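(* Let $\Pi$ be an infinite primitive Lie pseudogroup. With the left action $\rhd$ of $\mathcal U_\Pi=U(\mathfrak g_\Pi)$ on $\mathcal F_\Pi$ and the right coaction $\blacktriangledown:\mathcal U_\Pi\to\mathcal U_\Pi\otimes\mathcal F_\Pi$ described in the context, $\mathcal U_\Pi$ and $\mathcal F_\Pi$ form a matched pair of Hopf algebras, and their bicrossed product $\mathcal F_\Pi\bowtie\mathcal U_\Pi$ is canonically isomorphic to the Hopf algebra $\mathcal H_\Pi^{\mathrm{cop}}$ (the Hopf algebra $\mathcal H_\Pi$ with opposite coproduct).
   Context: **Pseudogroups.** $\Pi$ is one of the infinite primitive Lie–Cartan pseudogroups of local $C^\infty$-diffeomorphisms of $\mathbb R^m$: either *flat* (containing all translations), namely the pseudogroup of all local diffeomorphisms, the volume preserving, conformal volume preserving (linear isotropy group $\mathbb R^+\times SL$), symplectic or conformal symplectic (linear isotropy group $\mathbb R^+\times Sp$) pseudogroup; or the *contact* pseudogroup on $\mathbb R^{2n+1}$. $\mathrm{Diff}_\Pi$ is the group of globally defined diffeomorphisms of type $\Pi$. **Factorization.** $\mathrm{Diff}_\Pi=G_\Pi\cdot N_\Pi$, $G_\Pi\cap N_\Pi=\{e\}$, where: - flat case: $G_\Pi$ is the group of affine transformations of $\mathbb R^m$ lying in $\mathrm{Diff}_\Pi$; $N_\Pi=\{\psi\in\mathrm{Diff}_\Pi:\psi(0)=0,\ \psi'(0)=\mathrm{Id}\}$; - contact case: $\mathrm{Diff}_\Pi$ is the group of orientation preserving contact diffeomorphisms $\phi$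 of $\mathbb R^{2n+1}$, i.e. $\phi^*\alpha=f\alpha$ with $f>0$, for $\alpha=-dx^0+\frac12\sum_{i=1}^n(x^idx^{n+i}-x^{n+i}dx^i)$. Identify $\mathbb R^{2n+1}$ with the Heisenberg group $H_n$ with law $x*y=(x^0+y^0+\beta(x',y'),x'+y')$, $x'=(x^1,\dots,x^{2n})$, $\beta(x',y')=\frac12\sum_{i=1}^n(x^iy^{n+i}-x^{n+i}y^i)$. $G_\Pi\cong H_n\rtimes CSp(n,\mathbb R)$ is generated by the left translations $L_a(x)=a*x$, the maps $S_A(x)=(x^0,Ax')$, $A\in Sp(n,\mathbb R)$ (linear maps of $\mathbb R^{2n}$ preserving $\beta$), and $\mu_t(x)=(t^2x^0,tx')$, $t>0$. $N_\Pi$ is the subgroup of $\psi\in\mathrm{Diff}_\Pi$ with $\psi(0)=0$ and such that $\psi_{*0}$ induces the identity on $(T_0\mathbb R^{2n+1}/\mathcal D_0)\oplus\mathcal D_0$, $\mathcal D=\ker\alpha$. For $\varphi\in G_\Pi$, $\psi\in N_\Pi$ write $\psi\circ\varphi=(\psi\rhd\varphi)\circ(\psi\lhd\varphi)$ with $\psi\rhd\varphi\in G_\Pi$, $\psi\lhd\varphi\in N_\Pi$. $\mathrm{Diff}_\Pi$ acts on $G_\Pi\cong\mathrm{Diff}_\Pi/N_\Pi$ from the left, $\phi$ acting by $\tilde\phi$. **The Hopf algebra $\mathcal H_\Pi$.** $\mathcal A_\Pi=C^\infty(G_\Pi)\rtimes\mathrm{Diff}_\Pi$ is spanned by $fU_\phi^*$,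 with $f_1U_{\phi_1}^*\cdot f_2U_{\phi_2}^*=f_1(f_2\circ\tilde\phi_1)U_{\phi_2\phi_1}^*$; on $C^\infty(G_\Pi)$, $U_\phi^*\xi=\xi\circ\tilde\phi$, $U_\phi=(U^*_\phi)^{-1}$. Fix a basis $X_1,\dots,X_d$ of the Lie algebra $\mathfrak g_\Pi$ of $G_\Pi$ (left-invariant vector fields), acting on $\mathcal A_\Pi$ by $X(fU_\phi^* )=X(f)U_\phi^*$; write $U_\phi^*X_iU_\phi=\sum_j\Gamma_i^j(\phi)X_j$ and $\Delta_i^j(fU_\phi^* )=(\mathbf\Gamma(\phi)^{-1})_i^jfU_\phi^*$, $\mathbf\Gamma=(\Gamma_i^j)$. $\mathcal H_\Pi$ is the algebra of operators on $\mathcal A_\Pi$ generated by all $X_k,\Delta_i^j$, with the unique Hopf algebra structure whose coproduct satisfies $h(ab)=\sum h_{(1)}(a)h_{(2)}(b)$. **$\mathcal F_\Pi$.** Let $\Gamma^j_{i,k_1\ldots k_r}(\phi)=X_{k_r}\cdots X_{k_1}(\Gamma_i^j(\phi))$. $\mathcal F_\Pi$ is the algebra of functions on $N_\Pi$ generated by $\eta^j_{i,k_1\ldots k_r}(\psi)=\Gamma^j_{i,k_1\ldots k_r}(\psi)(e)$; it is a Hopf algebra with $\Delta f(\psi_1,\psi_2)=f(\psi_1\circ\psi_2)$, $Sf(\psi)=f(\psi^{-1})$, $\varepsilon(f)=f(e)$. **Action and coaction.** $\mathcal U_\Pi$ acts on $\mathcal F_\Pi$ by $(X\rhd f)(\psi)=\frac{d}{dt}|_{t=0}f(\psi\lhd\exp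 tX)$, $X\in\mathfrak g_\Pi$. For the PBW basis $X_I=X_1^{i_1}\cdots X_d^{i_d}$ of $\mathcal U_\Pi$ write $U_\psi X_IU_\psi^*=\sum_J\beta_I^J(\psi)X_J$ ($\psi\in N_\Pi$), $\beta_I^J(\psi)\in C^\infty(G_\Pi)$, and put $\blacktriangledown(X_I)=\sum_JX_J\otimes\beta_I^J(\cdot)(e)$; write $\blacktriangledown u=u_{\langle0\rangle}\otimes u_{\langle1\rangle}$. **Matched pairs.** Hopf algebras $\mathcal U,\mathcal F$ form a matched pair if $\mathcal F$ is a left $\mathcal U$-module algebra, $\mathcal U$ is a right $\mathcal F$-comodule coalgebra, and for $u,v\in\mathcal U$, $f\in\mathcal F$: $\epsilon(u\rhd f)=\epsilon(u)\epsilon(f)$; $\Delta(u\rhd f)=u_{(1)\langle0\rangle}\rhd f_{(1)}\otimes u_{(1)\langle1\rangle}(u_{(2)}\rhd f_{(2)})$; $\blacktriangledown(1)=1\otimes1$; $\blacktriangledown(uv)=u_{(1)\langle0\rangle}v_{\langle0\rangle}\otimes u_{(1)\langle1\rangle}(u_{(2)}\rhd v_{\langle1\rangle})$; $u_{(2)\langle0\rangle}\otimes(u_{(1)}\rhd f)u_{(2)\langle1\rangle}=u_{(1)\langle0\rangle}\otimes u_{(1)\langle1\rangle}(u_{(2)}\rhd f)$. The bicrossed product $\mathcal F\bowtie\mathcal U$ is $\mathcal F\otimes\mathcal U$ with product $(f\bowtie u)(g\bowtie v)=f(u_{(1)}\rhd g)\bowtie u_{(2)}v$, coproduct $\Delta(f\bowtie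 u)=f_{(1)}\bowtie u_{(1)\langle0\rangle}\otimes f_{(2)}u_{(1)\langle1\rangle}\bowtie u_{(2)}$, and antipode $S(f\bowtie u)=(1\bowtie S(u_{\langle0\rangle}))(S(fu_{\langle1\rangle})\bowtie1)$. ''Canonically'' refers to the correspondence sending $X\in\mathfrak g_\Pi\subset\mathcal H_\Pi$ to $1\bowtie X$, and a multiplication operator $fU_\phi^*\mapsto h(\phi)fU_\phi^*$ in the subalgebra of $\mathcal H_\Pi$ generated by the iterated commutators of the $\Delta_i^j$ with the $X_k$ to the function $\psi\mapsto h(\psi)(e)$ in $\mathcal F_\Pi$. *)

(* Defs.v *)
(** Conventions.  Scalars are real: functions on the Lie group and on the
    nilpotent group are real valued, and all Hopf algebras are over [R].
    Points of R^m are column vectors and 'd f x v is the Frechet differential of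
    [f] at [x] applied to [v]. *)
From HB Require Import structures.
From mathcomp Require Import all_boot all_order all_algebra.
From mathcomp Require Import all_classical all_reals all_analysis.

Set Implicit Arguments.
Unset Strict Implicit.
Unset Printing Implicit Defensive.

Import Order.TTheory GRing.Theory Num.Theory.
Import numFieldNormedType.Exports.

Local Open Scope classical_set_scope.
Local Open Scope quotient_scope.
Local Open Scope ring_scope.

Section Endo.
Variables (R : comNzRingType) (V : lmodType R).

Record Endo := MkEndo { efun :> V -> V ; efunP : `[< linear efun >] }.
HB.instance Definition _ := [isSub for efun].
HB.instance Definition _ := [Choice of Endo by <:].

Fact endo_submod :
  GRing.subsemimod_closed (V := V -> V : Type) (fun f : V -> V => `[< linear f >]).
Proof.
have E (f : V -> V) : (f \in (fun f : V -> V => `[< linear f >])) = `[< linear f >].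
  by [].
split; first split.
- by rewrite E; apply/asboolP => a x y /=; rewrite scaler0 addr0.
- move=> f g; rewrite !E => /asboolP hf /asboolP hg; apply/asboolP => a x y.
  have e u : (f + g) u = f u + g u by [].
  by rewrite !e hf hg scalerDr addrACA.
- move=> c f; rewrite !E => /asboolP hf; apply/asboolP => a x y.
  have e u : (c *: f) u = c *: f u by [].
  by rewrite !e hf scalerDr !scalerA (mulrC c a).
Qed.

HB.instance Definition _ :=
  GRing.SubChoice_isSubLmodule.Build R (V -> V) _ Endo endo_submod.

Lemma EndoE (f g : Endo) : f =1 g -> f = g.
Proof. by move=> e; apply/val_inj/funext. Qed.

Lemma Endo_linear (f : Endo) : linear f.
Proof. by have /asboolP := efunP f. Qed.

Fact endo1_subproof : `[< linear (id : V -> V) >]. Proof. exact/asboolP. Qed.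
Fact endoM_subproof (f g : Endo) : `[< linear (f \o g) >].
Proof. by apply/asboolP => a x y /=; rewrite !Endo_linear. Qed.

Definition endo1 := MkEndo endo1_subproof.
Definition endoM f g := MkEndo (endoM_subproof f g).

Lemma endoDE (f g : Endo) x : (f + g) x = f x + g x. Proof. by []. Qed.
Lemma endoZE a (f : Endo) x : (a *: f) x = a *: f x. Proof. by []. Qed.

Let mA : associative endoM. Proof. by move=> f g h; exact: EndoE. Qed.
Let m1l : left_id endo1 endoM. Proof. by move=> f; exact: EndoE. Qed.
Let m1r : right_id endo1 endoM. Proof. by move=> f; exact: EndoE. Qed.
Let mDl : left_distributive endoM +%R.
Proof. by move=> f g h; exact: EndoE. Qed.
Let mDr : right_distributive endoM +%R.
Proof.
move=> f g h; apply: EndoE => x; have := Endo_linear f 1 (g x) (h x).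
by rewrite !scale1r.
Qed.

HB.instance Definition _ :=
  GRing.Zmodule_isPzRing.Build Endo mA m1l m1r mDl mDr.

Lemma endo_mulE (f g : Endo) x : (f * g) x = f (g x). Proof. by []. Qed.

Lemma endo_scaleAl a (f g : Endo) : a *: (f * g) = a *: f * g.
Proof. exact: EndoE. Qed.

Lemma endo_scaleAr a (f g : Endo) : a *: (f * g) = f * (a *: g).
Proof.
apply: EndoE => x; rewrite !(endoZE, endo_mulE).
have := Endo_linear f a (g x) 0; rewrite !addr0 => ->.
have := Endo_linear f 1 0 0; rewrite !scale1r addr0 => e.
suff -> : f 0 = 0 by rewrite addr0.
by apply: (addrI (f 0)); rewrite -e addr0.
Qed.

End Endo.

Section Generated.
Variables (R : comNzRingType) (A : algType R) (S : set A).

Definition is_subalgebra (Q : set A) : Prop :=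
  [/\ Q 1, forall x y, Q x -> Q y -> Q (x + y), forall a x, Q x -> Q (a *: x)
    & forall x y, Q x -> Q y -> Q (x * y)].

Definition galg_set : set A :=
  [set x | forall Q, is_subalgebra Q -> S `<=` Q -> Q x].

Record galg := MkGalg { galgv :> A ; galgP : `[< galg_set galgv >] }.
HB.instance Definition _ := [isSub for galgv].
HB.instance Definition _ := [Choice of galg by <:].

Fact galg_subalg : GRing.subsemialg_closed (fun x => `[< galg_set x >]).
Proof.
have E x : (x \in (fun x => `[< galg_set x >])) = `[< galg_set x >] by [].
have h1 : galg_set 1 by move=> Q [].
have hZ a x : galg_set x -> galg_set (a *: x).
  by move=> hx Q hQ SQ; have [_ _ h _] := hQ; apply: h; exact: hx.
split; rewrite ?E; first exact/asboolP.
- split; first by rewrite E; apply/asboolP; rewrite -(scale0r 1); exact: hZ.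
  move=> x y; rewrite !E => /asboolP hx /asboolP hy; apply/asboolP => Q hQ SQ.
  by have [_ h _ _] := hQ; apply: h; [exact: hx|exact: hy].
- by move=> a x; rewrite !E => /asboolP hx; apply/asboolP; exact: hZ.
- move=> x y; rewrite !E => /asboolP hx /asboolP hy; apply/asboolP => Q hQ SQ.
  by have [_ _ _ h] := hQ; apply: h; [exact: hx|exact: hy].
Qed.

HB.instance Definition _ :=
  GRing.SubChoice_isSubAlgebra.Build R A _ galg galg_subalg.

End Generated.

Section Tensor.
Variables (R : comNzRingType) (A B : lmodType R).

Definition bilinear_map (W : lmodType R) (b : A -> B -> W) : Prop :=
  (forall y, linear (b^~ y)) /\ (forall x, linear (b x)).

Definition teval (W : lmodType R) (b : A -> B -> W) (s : seq (A * B)) : W :=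
  \sum_(p <- s) b p.1 p.2.

(* A (x) B is the quotient of formal sums of pairs by the relation "identified
   by every bilinear map". *)
Definition tensor_eq (s t : seq (A * B)) : bool :=
  `[< forall (W : lmodType R) (b : A -> B -> W), bilinear_map b ->
        teval b s = teval b t >].

Fact tensor_eq_refl : reflexive tensor_eq.
Proof. by move=> s; apply/asboolP. Qed.
Fact tensor_eq_sym : symmetric tensor_eq.
Proof.
by move=> s t; apply/asboolP/asboolP => h W b hb; rewrite (h _ _ hb).
Qed.
Fact tensor_eq_trans : transitive tensor_eq.
Proof.
move=> t s u /asboolP h1 /asboolP h2; apply/asboolP => W b hb.
by rewrite (h1 _ _ hb) (h2 _ _ hb).
Qed.
Definition tensor_equiv :=
  EquivRel tensor_eq tensor_eq_refl tensor_eq_sym tensor_eq_trans.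

Definition tensor := {eq_quot tensor_equiv}.
HB.instance Definition _ := Choice.on tensor.

Definition tclass (s : seq (A * B)) : tensor := \pi_({eq_quot tensor_equiv}) s.

(* The linear map induced by [b]; meaningful when [b] is bilinear, see
   [sweedlerE]. *)
Definition sweedler (W : lmodType R) (t : tensor) (b : A -> B -> W) : W :=
  teval b (repr (t : {eq_quot tensor_equiv})).

Definition tpure (x : A) (y : B) : tensor := tclass [:: (x, y)].

Lemma sweedlerE (W : lmodType R) (b : A -> B -> W) s : bilinear_map b ->
  sweedler (tclass s) b = teval b s.
Proof.
move=> hb; rewrite /sweedler /tclass.
have : tensor_eq (repr (\pi_({eq_quot tensor_equiv}) s)) s.
  by have /eqmodP := reprK (\pi_({eq_quot tensor_equiv}) s).
by move=> /asboolP/(_ W b hb).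
Qed.

Lemma tpure_bilinear_eval (W : lmodType R) (b : A -> B -> W) x y :
  bilinear_map b -> sweedler (tpure x y) b = b x y.
Proof. by move=> hb; rewrite sweedlerE// /teval big_seq1. Qed.

Lemma tensorP (t u : tensor) :
  (forall (W : lmodType R) (b : A -> B -> W), bilinear_map b ->
    sweedler t b = sweedler u b) -> t = u.
Proof.
move=> h; rewrite -[t]reprK -[u]reprK; apply/eqmodP; apply/asboolP => W b hb.
exact: h.
Qed.

Definition tzero : tensor := tclass [::].
Definition tadd (t u : tensor) : tensor :=
  tclass (repr (t : {eq_quot tensor_equiv}) ++ repr (u : {eq_quot tensor_equiv})).
Definition tscale (a : R) (t : tensor) : tensor :=
  tclass [seq (a *: p.1, p.2) | p <- repr (t : {eq_quot tensor_equiv})].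

Section ev.
Variables (W : lmodType R) (b : A -> B -> W).
Hypothesis hb : bilinear_map b.
Lemma sw0 : sweedler tzero b = 0. Proof. by rewrite sweedlerE// /teval big_nil. Qed.
Lemma swD t u : sweedler (tadd t u) b = sweedler t b + sweedler u b.
Proof. by rewrite sweedlerE// /teval big_cat. Qed.
Lemma swZ a t : sweedler (tscale a t) b = a *: sweedler t b.
Proof.
rewrite sweedlerE// /teval big_map scaler_sumr; apply: eq_bigr => p _ /=.
have bl := hb.1 p.2; have b0 : b 0 p.2 = 0.
  have := bl 1 0 0; rewrite !scale1r addr0 => /(congr1 (fun x => x - b 0 p.2)).
  by rewrite subrr addrK.
by have := bl a p.1 0; rewrite b0 !addr0.
Qed.
End ev.

Let taddA : associative tadd.
Proof. by move=> t u v; apply: tensorP => W b hb; rewrite !swD// addrA. Qed.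
Let taddC : commutative tadd.
Proof. by move=> t u; apply: tensorP => W b hb; rewrite !swD// addrC. Qed.
Let tadd0 : left_id tzero tadd.
Proof. by move=> t; apply: tensorP => W b hb; rewrite swD// sw0// add0r. Qed.
Let taddN : left_inverse tzero (tscale (- 1)) tadd.
Proof.
by move=> t; apply: tensorP => W b hb; rewrite swD// swZ// sw0// scaleN1r addNr.
Qed.

HB.instance Definition _ := GRing.isZmodule.Build tensor taddA taddC tadd0 taddN.

Let tscaleA a c (t : tensor) : tscale a (tscale c t) = tscale (a * c) t.
Proof. by apply: tensorP => W b hb; rewrite !swZ// scalerA. Qed.
Let tscale1 : left_id 1 tscale.
Proof. by move=> t; apply: tensorP => W b hb; rewrite swZ// scale1r. Qed.
Let tscaleDr : right_distributive tscale +%R.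
Proof.
by move=> a t u; apply: tensorP => W b hb; rewrite !(swZ, swD)// scalerDr.
Qed.
Let tscaleDl t : {morph tscale^~ t : a c / a + c}.
Proof.
by move=> a c; apply: tensorP => W b hb; rewrite !(swZ, swD)// scalerDl.
Qed.

HB.instance Definition _ :=
  GRing.Zmodule_isLmodule.Build R tensor tscaleA tscale1 tscaleDr tscaleDl.

End Tensor.


Inductive uterm (K T : Type) : Type :=
| UGen of T
| UScal of K
| UAdd of uterm K T & uterm K T
| UMul of uterm K T & uterm K T.

HB.instance Definition _ K T := gen_eqMixin (uterm K T).
HB.instance Definition _ K T := gen_choiceMixin (uterm K T).

Section Enveloping.
Variables (R : comNzRingType) (E : algType R) (L : set E).

(* [L] is a Lie subalgebra of [E] for the commutator bracket, and [envelop L] is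
   its universal enveloping algebra: noncommutative polynomials in the elements
   of [L], two of them being identified when every Lie morphism from [L] to an
   associative unital algebra gives them the same value. *)
Definition lie_morphism (B : algType R) (j : L -> B) : Prop :=
  (forall a (x y z : L), val z = a *: val x + val y -> j z = a *: j x + j y) /\
  (forall x y z : L, val z = val x * val y - val y * val x ->
     j z = j x * j y - j y * j x).

Fixpoint ueval (B : algType R) (j : L -> B) (t : uterm R L) : B :=
  match t with
  | UGen x => j x
  | UScal a => a%:A
  | UAdd s t => ueval j s + ueval j t
  | UMul s t => ueval j s * ueval j t
  end.

Definition env_eq (s t : uterm R L) : bool :=
  `[< forall (B : algType R) (j : L -> B), lie_morphism j ->
        ueval j s = ueval j t >].

Fact env_eq_refl : reflexive env_eq.
Proof. by move=> s; apply/asboolP. Qed.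
Fact env_eq_sym : symmetric env_eq.
Proof.
by move=> s t; apply/asboolP/asboolP => h B j hj; rewrite (h _ _ hj).
Qed.
Fact env_eq_trans : transitive env_eq.
Proof.
move=> t s u /asboolP h1 /asboolP h2; apply/asboolP => B j hj.
by rewrite (h1 _ _ hj) (h2 _ _ hj).
Qed.
Definition env_equiv := EquivRel env_eq env_eq_refl env_eq_sym env_eq_trans.

Definition envelop := {eq_quot env_equiv}.
HB.instance Definition _ := Choice.on envelop.

Definition uclass (t : uterm R L) : envelop := \pi_({eq_quot env_equiv}) t.
Definition urepr (u : envelop) : uterm R L := repr (u : {eq_quot env_equiv}).

Lemma urepr_eval (B : algType R) (j : L -> B) t : lie_morphism j ->
  ueval j (urepr (uclass t)) = ueval j t.
Proof.
move=> hj; have : env_eq (urepr (uclass t)) t.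
  by have /eqmodP := reprK (\pi_({eq_quot env_equiv}) t).
by move=> /asboolP/(_ B j hj).
Qed.

Lemma envelopP (u v : envelop) :
  (forall (B : algType R) (j : L -> B), lie_morphism j ->
     ueval j (urepr u) = ueval j (urepr v)) -> u = v.
Proof.
move=> h; rewrite -[u]reprK -[v]reprK; apply/eqmodP; apply/asboolP => B j hj.
exact: h.
Qed.

Definition uzero := uclass (UScal L 0).
Definition uone := uclass (UScal L 1).
Definition uadd (u v : envelop) := uclass (UAdd (urepr u) (urepr v)).
Definition umul (u v : envelop) := uclass (UMul (urepr u) (urepr v)).
Definition uscale (a : R) (u : envelop) :=
  uclass (UMul (UScal L a) (urepr u)).
Definition uopp (u : envelop) := uscale (- 1) u.

Definition ugen (x : L) : envelop := uclass (UGen R x).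

Section ev.
Variables (B : algType R) (j : L -> B).
Hypothesis hj : lie_morphism j.
Local Notation ev u := (ueval j (urepr u)).
Lemma ev0 : ev uzero = 0. Proof. by rewrite urepr_eval//= scale0r. Qed.
Lemma ev1 : ev uone = 1. Proof. by rewrite urepr_eval//= scale1r. Qed.
Lemma evD u v : ev (uadd u v) = ev u + ev v. Proof. by rewrite urepr_eval. Qed.
Lemma evM u v : ev (umul u v) = ev u * ev v. Proof. by rewrite urepr_eval. Qed.
Lemma evZ a u : ev (uscale a u) = a *: ev u.
Proof. by rewrite urepr_eval//= -scalerAl mul1r. Qed.
Lemma evN u : ev (uopp u) = - ev u. Proof. by rewrite evZ scaleN1r. Qed.
End ev.
Let evE := (ev0, ev1, evD, evM, evZ, evN).

Let uaddA : associative uadd.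
Proof. by move=> u v w; apply: envelopP => B j hj; rewrite !evE// addrA. Qed.
Let uaddC : commutative uadd.
Proof. by move=> u v; apply: envelopP => B j hj; rewrite !evE// addrC. Qed.
Let uadd0 : left_id uzero uadd.
Proof. by move=> u; apply: envelopP => B j hj; rewrite !evE// add0r. Qed.
Let uaddN : left_inverse uzero uopp uadd.
Proof. by move=> u; apply: envelopP => B j hj; rewrite !evE// addNr. Qed.
HB.instance Definition _ := GRing.isZmodule.Build envelop uaddA uaddC uadd0 uaddN.

Let umulA : associative umul.
Proof. by move=> u v w; apply: envelopP => B j hj; rewrite !evE// mulrA. Qed.
Let umul1l : left_id uone umul.
Proof. by move=> u; apply: envelopP => B j hj; rewrite !evE// mul1r. Qed.
Let umul1r : right_id uone umul.
Proof. by move=> u; apply: envelopP => B j hj; rewrite !evE// mulr1. Qed.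
Let umulDl : left_distributive umul uadd.
Proof. by move=> u v w; apply: envelopP => B j hj; rewrite !evE// mulrDl. Qed.
Let umulDr : right_distributive umul uadd.
Proof. by move=> u v w; apply: envelopP => B j hj; rewrite !evE// mulrDr. Qed.
Let lie0 : lie_morphism (fun _ : L => 0 : R^o).
Proof. by split=> *; rewrite ?scaler0 ?mulr0 ?subr0 ?addr0. Qed.
Let uone_neq0 : uone != 0.
Proof.
apply/eqP => /(congr1 (fun u => ueval (fun _ : L => 0 : R^o) (urepr u))).
by rewrite !evE// => /eqP; rewrite oner_eq0.
Qed.
HB.instance Definition _ :=
  GRing.Zmodule_isNzRing.Build envelop umulA umul1l umul1r umulDl umulDr uone_neq0.

Let uscaleA a c (u : envelop) : uscale a (uscale c u) = uscale (a * c) u.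
Proof. by apply: envelopP => B j hj; rewrite !evE// scalerA. Qed.
Let uscale1 : left_id 1 uscale.
Proof. by move=> u; apply: envelopP => B j hj; rewrite !evE// scale1r. Qed.
Let uscaleDr : right_distributive uscale +%R.
Proof. by move=> a u v; apply: envelopP => B j hj; rewrite !evE// scalerDr. Qed.
Let uscaleDl u : {morph uscale^~ u : a c / a + c}.
Proof. by move=> a c; apply: envelopP => B j hj; rewrite !evE// scalerDl. Qed.
HB.instance Definition _ :=
  GRing.Zmodule_isLmodule.Build R envelop uscaleA uscale1 uscaleDr uscaleDl.

Let uscaleAl a (u v : envelop) : a *: (u * v) = a *: u * v.
Proof. by apply: envelopP => B j hj; rewrite !evE// scalerAl. Qed.
HB.instance Definition _ := GRing.Lmodule_isLalgebra.Build R envelop uscaleAl.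
Let uscaleAr a (u v : envelop) : a *: (u * v) = u * (a *: v).
Proof. by apply: envelopP => B j hj; rewrite !evE// scalerAr. Qed.
HB.instance Definition _ := GRing.Lalgebra_isAlgebra.Build R envelop uscaleAr.

Lemma ugen_lie : lie_morphism ugen.
Proof.
split=> [a x y z e|x y z e]; apply: envelopP => B j hj.
  rewrite (_ : urepr _ = urepr (uclass (UGen R z)))// urepr_eval//=.
  rewrite (evD hj) (evZ hj) !(urepr_eval _ hj) /=; exact: hj.1.
rewrite (evD hj) (evN hj) !(evM hj) !(urepr_eval _ hj) /=; exact: hj.2.
Qed.

End Enveloping.


Reserved Notation "x \ox y" (at level 40, left associativity).
Reserved Notation "\sw_ ( x , y <- t ) E"
  (at level 41, E at level 41, x name, y name, t at level 50,
   format "'[' \sw_ ( x ,  y  <-  t ) '/  '  E ']'").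

Notation "x \ox y" := (tpure x y) : ring_scope.
Notation "\sw_ ( x , y <- t ) E" := (sweedler t (fun x y => E)) : ring_scope.

Section Hopf.
Variable R : comNzRingType.

(* [\sw_(x, y <- t) E] is Sweedler notation: the value at [t] of the linear map
   induced by the bilinear map (x, y) |-> E. *)
Record hopf_ops (H : lmodType R) := HopfOps {
  hmul : H -> H -> H ;
  hone : H ;
  hcomul : H -> tensor H H ;
  hcounit : H -> R ;
  hanti : H -> H }.

Record is_hopf (H : lmodType R) (h : hopf_ops H) : Prop := IsHopf {
  hopf_mul_bilinear : bilinear_map (hmul h) ;
  hopf_mulA : associative (hmul h) ;
  hopf_mul1 : left_id (hone h) (hmul h) ;
  hopf_mulr1 : right_id (hone h) (hmul h) ;
  hopf_comul_linear : linear (hcomul h) ;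
  hopf_counit_linear : linear (hcounit h : H -> R^o) ;
  hopf_anti_linear : linear (hanti h) ;
  hopf_comulA : forall x,
    \sw_(a, b <- hcomul h x) (hcomul h a \ox b) =
    \sw_(a, b <- hcomul h x) \sw_(c, e <- hcomul h b) ((a \ox c) \ox e) ;
  hopf_counitl : forall x, \sw_(a, b <- hcomul h x) (hcounit h a *: b) = x ;
  hopf_counitr : forall x, \sw_(a, b <- hcomul h x) (hcounit h b *: a) = x ;
  hopf_comulM : forall x y, hcomul h (hmul h x y) =
    \sw_(a, b <- hcomul h x) \sw_(c, e <- hcomul h y) (hmul h a c \ox hmul h b e) ;
  hopf_comul1 : hcomul h (hone h) = hone h \ox hone h ;
  hopf_counitM : {morph hcounit h : x y / hmul h x y >-> x * y} ;
  hopf_counit1 : hcounit h (hone h) = 1 ;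
  hopf_antil : forall x,
    \sw_(a, b <- hcomul h x) hmul h (hanti h a) b = hcounit h x *: hone h ;
  hopf_antir : forall x,
    \sw_(a, b <- hcomul h x) hmul h a (hanti h b) = hcounit h x *: hone h }.

Definition hopf_on_algebra (A : algType R) (h : hopf_ops A) : Prop :=
  [/\ is_hopf h, hmul h = *%R & hone h = 1].

(* The antipode of the co-opposite Hopf algebra is the inverse of the antipode. *)
Definition hopf_cop (H : lmodType R) (h : hopf_ops H) : hopf_ops H :=
  {| hmul := hmul h ;
     hone := hone h ;
     hcomul := fun x => \sw_(a, b <- hcomul h x) (b \ox a) ;
     hcounit := hcounit h ;
     hanti := fun x => xget 0 [set y | hanti h y = x] |}.

Record hopf_iso (H K : lmodType R) (h : hopf_ops H) (k : hopf_ops K)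
    (phi : H -> K) : Prop := HopfIso {
  hiso_linear : linear phi ;
  hiso_bij : bijective phi ;
  hiso_mul : forall x y, phi (hmul h x y) = hmul k (phi x) (phi y) ;
  hiso_one : phi (hone h) = hone k ;
  hiso_comul : forall x,
    hcomul k (phi x) = \sw_(a, b <- hcomul h x) (phi a \ox phi b) ;
  hiso_counit : forall x, hcounit k (phi x) = hcounit h x ;
  hiso_anti : forall x, phi (hanti h x) = hanti k (phi x) }.

Section Matched.
Variables (U F : lmodType R) (u : hopf_ops U) (f : hopf_ops F).
Variables (act : U -> F -> F) (coact : U -> tensor U F).
Local Notation "x \U* y" := (hmul u x y) (at level 40, left associativity).
Local Notation "x \F* y" := (hmul f x y) (at level 40, left associativity).
Local Notation "x |> y" := (act x y) (at level 38, right associativity).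

Record module_algebra : Prop := ModuleAlgebra {
  ma_bilinear : bilinear_map act ;
  ma_one : forall a, hone u |> a = a ;
  ma_mul : forall x y a, (x \U* y) |> a = x |> (y |> a) ;
  ma_prod : forall x a b,
    x |> (a \F* b) = \sw_(x1, x2 <- hcomul u x) ((x1 |> a) \F* (x2 |> b)) ;
  ma_unit : forall x, x |> hone f = hcounit u x *: hone f }.

Record comodule_coalgebra : Prop := ComoduleCoalgebra {
  cc_linear : linear coact ;
  cc_coassoc : forall x,
    \sw_(x0, x1 <- coact x) (coact x0 \ox x1) =
    \sw_(x0, x1 <- coact x) \sw_(a, b <- hcomul f x1) ((x0 \ox a) \ox b) ;
  cc_counit : forall x, \sw_(x0, x1 <- coact x) (hcounit f x1 *: x0) = x ;
  cc_comul : forall x,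
    \sw_(x0, x1 <- coact x) (hcomul u x0 \ox x1) =
    \sw_(x1, x2 <- hcomul u x) \sw_(a0, a1 <- coact x1) \sw_(b0, b1 <- coact x2)
      ((a0 \ox b0) \ox (a1 \F* b1)) ;
  cc_coun : forall x,
    \sw_(x0, x1 <- coact x) (hcounit u x0 *: x1) = hcounit u x *: hone f }.

Record matched_pair : Prop := MatchedPair {
  mp_hopf_U : is_hopf u ;
  mp_hopf_F : is_hopf f ;
  mp_module_algebra : module_algebra ;
  mp_comodule_coalgebra : comodule_coalgebra ;
  mp_counit : forall x a, hcounit f (x |> a) = hcounit u x * hcounit f a ;
  mp_comul : forall x a,
    hcomul f (x |> a) =
    \sw_(x1, x2 <- hcomul u x) \sw_(y0, y1 <- coact x1) \sw_(a1, a2 <- hcomul f a)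
      ((y0 |> a1) \ox (y1 \F* (x2 |> a2))) ;
  mp_coact1 : coact (hone u) = hone u \ox hone f ;
  mp_coactM : forall x y,
    coact (x \U* y) =
    \sw_(x1, x2 <- hcomul u x) \sw_(z0, z1 <- coact x1) \sw_(y0, y1 <- coact y)
      ((z0 \U* y0) \ox (z1 \F* (x2 |> y1))) ;
  mp_compat : forall x a,
    \sw_(x1, x2 <- hcomul u x) \sw_(y0, y1 <- coact x2)
      (y0 \ox ((x1 |> a) \F* y1)) =
    \sw_(x1, x2 <- hcomul u x) \sw_(y0, y1 <- coact x1)
      (y0 \ox (y1 \F* (x2 |> a))) }.

Definition bicrossed_mul (s t : tensor F U) : tensor F U :=
  \sw_(a, x <- s) \sw_(b, y <- t) \sw_(x1, x2 <- hcomul u x)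
    ((a \F* (x1 |> b)) \ox (x2 \U* y)).

Definition bicrossed : hopf_ops (tensor F U) :=
  {| hmul := bicrossed_mul ;
     hone := hone f \ox hone u ;
     hcomul := fun s =>
       \sw_(a, x <- s) \sw_(a1, a2 <- hcomul f a) \sw_(x1, x2 <- hcomul u x)
       \sw_(y0, y1 <- coact x1) ((a1 \ox y0) \ox ((a2 \F* y1) \ox x2)) ;
     hcounit := fun s =>
       \sw_(a, x <- s) (hcounit f a * hcounit u x : R^o) ;
     hanti := fun s =>
       \sw_(a, x <- s) \sw_(x0, x1 <- coact x)
         bicrossed_mul (hone f \ox hanti u x0) (hanti f (a \F* x1) \ox hone u) |}.

End Matched.
End Hopf.


Section Smooth.
Variables (R : realType) (V W : normedModType R).

(* f is of class C^k when it is differentiable and all its directional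
   derivatives are of class C^(k-1). *)
Fixpoint Ck (k : nat) (f : V -> W) : Prop :=
  if k is k'.+1 then
    (forall x, differentiable f x) /\
    (forall v, Ck k' (fun x => 'd f x v))
  else continuous f.

Definition smooth (f : V -> W) : Prop := forall k, Ck k f.

Lemma CkS k f : Ck k.+1 f -> Ck k f.
Proof.
elim: k f => [|k IH] f [df Df] /=.
  by move=> x; apply: differentiable_continuous.
by split=> // v; apply: IH.
Qed.

Lemma Ck_cst k (a : W) : Ck k (fun=> a).
Proof.
elim: k a => [|k IH] a /=; first by move=> x; apply: cst_continuous.
split=> [x|v]; first exact: differentiable_cst.
suff -> : (fun x => 'd (fun=> a) x v) = fun=> 0 by [].
by apply/funext => x; rewrite (_ : (fun=> a) = cst a)// diff_cst.
Qed.

Lemma Ck_add k f g : Ck k f -> Ck k g -> Ck k (f + g).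
Proof.
elim: k f g => [|k IH] f g /=.
  by move=> cf cg x; apply: continuousD; [exact: cf|exact: cg].
move=> [df Df] [dg Dg]; split=> [x|v]; first exact: differentiableD.
have -> : (fun x => 'd (f + g) x v) = (fun x => 'd f x v) + (fun x => 'd g x v).
  by apply/funext => x; rewrite diffD.
exact: IH.
Qed.

Lemma Ck_sum k n (F : 'I_n -> V -> W) :
  (forall i, Ck k (F i)) -> Ck k (\sum_i F i).
Proof.
move=> h; apply: (big_ind (Ck k)) => //; first exact: Ck_cst.
by move=> f g; apply: Ck_add.
Qed.

End Smooth.

Section SmoothOps.
Variables (R : realType) (V : normedModType R).

Lemma diff_compE (U W : normedModType R) (f : U -> W) (g : V -> U) x v :
  differentiable g x -> differentiable f (g x) ->
  'd (f \o g) x v = 'd f (g x) ('d g x v).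
Proof. by move=> dg df; rewrite diff_comp. Qed.

Lemma diff_idE (x v : V) : 'd (id : V -> V) x v = v.
Proof. by rewrite diff_val. Qed.

Lemma smooth_diff (W : normedModType R) (f : V -> W) x :
  smooth f -> differentiable f x.
Proof. by move=> /(_ 1) []. Qed.

Lemma Ck_lin (W W' : normedModType R) (l : {linear W -> W'}) k (f : V -> W) :
  continuous l -> Ck k f -> Ck k (l \o f).
Proof.
move=> cl; elim: k f => [|k IH] f /=.
  by move=> cf x; apply: continuous_comp; [exact: cf|exact: cl].
move=> [df Df]; split=> [x|v].
  by apply: differentiable_comp => //; apply: linear_differentiable.
have -> : (fun x => 'd (l \o f) x v) = l \o (fun x => 'd f x v).
  apply/funext => x; rewrite diff_comp//; last exact: linear_differentiable.
  by rewrite /= diff_lin.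
exact: IH.
Qed.

Section scale.
Variable W : normedModType R.

Let scl (p : R * W) : W := p.1 *: p.2.

Let scl_bilinear : bilinear_for
    (GRing.Scale.Law.clone _ _ *:%R _) (GRing.Scale.Law.clone _ _ *:%R _)
    (fun (a : R) (w : W) => a *: w).
Proof.
split=> [u'|u] a x y /=; first by rewrite scalerDl scalerA.
by rewrite scalerDr !scalerA mulrC.
Qed.

Let sclB : {bilinear R -> W -> W} :=
  HB.pack (fun (a : R) (w : W) => a *: w)
    (bilinear_isBilinear.Build R R W W _ _ _ scl_bilinear).

Let scl_cont : continuous (fun p : R * W => sclB p.1 p.2).
Proof. exact: scale_continuous. Qed.

Lemma Ck_scale k (c : V -> R) (h : V -> W) :
  Ck k c -> Ck k h -> Ck k (fun x => c x *: h x).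
Proof.
elim: k c h => [|k IH] c h /=.
  by move=> cc ch x; apply: cvgZ; [exact: cc|exact: ch].
move=> Cc Ch; have [dc Dc] := Cc; have [dh Dh] := Ch.
have E : (fun x => c x *: h x)
    = (fun p : R * W => sclB p.1 p.2) \o (fun x => (c x, h x)) by [].
have dp x : differentiable (fun x => (c x, h x)) x by exact: differentiable_pair.
have db p : differentiable (fun p : R * W => sclB p.1 p.2) p.
  exact: differentiable_bilin.
split=> [x|v]; first by rewrite E; apply: differentiable_comp.
have -> : (fun x => 'd (fun x => c x *: h x) x v) =
   (fun x => c x *: 'd h x v) + (fun x => 'd c x v *: h x).
  apply/funext => x; rewrite E diff_comp//=.
  have /(congr1 (fun l => l ('d (fun x => (c x, h x)) x v))) :=
    diff_bilin (c x, h x) scl_cont.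
  by rewrite diff_pair.
apply: Ck_add; apply: IH => //; exact: CkS.
Qed.

End scale.

Lemma Ck_mul k (f g : V -> R) : Ck k f -> Ck k g -> Ck k (f * g).
Proof. exact: Ck_scale. Qed.

Lemma smooth_cst (W : normedModType R) (a : W) : smooth (fun _ : V => a).
Proof. by move=> k; apply: Ck_cst. Qed.

Lemma smooth_add (W : normedModType R) (f g : V -> W) :
  smooth f -> smooth g -> smooth (f + g).
Proof. by move=> hf hg k; apply: Ck_add. Qed.

Lemma smooth_mul (f g : V -> R) : smooth f -> smooth g -> smooth (f * g).
Proof. by move=> hf hg k; apply: Ck_mul. Qed.

End SmoothOps.

Section SmoothMaps.
Variables (R : realType) (m : nat).
Notation V := 'cV[R]_m.

Lemma Ck_id k : Ck k (id : V -> V).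
Proof.
case: k => [|k] /=; first by move=> x; exact: cvg_id.
split=> [x|v]; first exact: (@ex_diff _ _ _ _ _ _ _ (is_diff_id x)).
have -> : (fun x : V => 'd id x v) = fun=> v.
  by apply/funext => x; exact: diff_idE.
exact: Ck_cst.
Qed.

Lemma colvE (u : V) : u = \sum_i u i 0 *: delta_mx i 0.
Proof. by rewrite {1}[u]matrix_sum_delta; apply: eq_bigr => i _; rewrite big_ord1. Qed.

Let coord (i : 'I_m) (u : V) : R := u i 0.
Let coord_lin i : linear (coord i).
Proof. by move=> a u v; rewrite /coord !mxE. Qed.
Let coordL i : {linear V -> R} :=
  HB.pack (coord i) (GRing.isLinear.Build _ _ _ _ _ (coord_lin i)).

Lemma Ck_comp (W : normedModType R) k (f : V -> W) (g : V -> V) :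
  Ck k f -> Ck k g -> Ck k (f \o g).
Proof.
elim: k f g => [|k IH] f g /=.
  by move=> cf cg x; apply: continuous_comp; [exact: cg|exact: cf].
move=> Cf Cg; have [df Df] := Cf; have [dg Dg] := Cg.
split=> [x|v]; first exact: differentiable_comp.
have -> : (fun x => 'd (f \o g) x v) =
    \sum_i (fun x => coord i ('d g x v) *: ('d f (g x) (delta_mx i 0))).
  apply/funext => x. 
  rewrite fct_sumE.
  transitivity ('d f (g x) ('d g x v)).
    exact: (diff_compE v (dg x) (df (g x))).
  transitivity ('d f (g x) (\sum_i ('d g x v) i 0 *: delta_mx i 0)).
    by rewrite -colvE.
  by rewrite linear_sum; apply: eq_bigr => i _; rewrite linearZ.
apply: Ck_sum => i; apply: Ck_scale.
  apply: (@Ck_lin _ _ _ _ (coordL i)) => //.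
  exact: coord_continuous.
have -> : (fun x => 'd f (g x) (delta_mx i 0)) =
  (fun y => 'd f y (delta_mx i 0)) \o g by [].
apply: IH => //; exact: CkS.
Qed.

Lemma smooth_id : smooth (id : V -> V).
Proof. by move=> k; apply: Ck_id. Qed.

Lemma smooth_comp (W : normedModType R) (f : V -> W) (g : V -> V) :
  smooth f -> smooth g -> smooth (f \o g).
Proof. by move=> hf hg k; apply: Ck_comp. Qed.

End SmoothMaps.


(* [primitive m] lists the infinite primitive pseudogroups on R^m; the bounds on
   the dimension exclude the cases where the pseudogroup is of finite type.
   Conformal means: up to a positive constant. *)
Inductive primitive : nat -> Type :=
| General m of (0 < m)%N : primitive m
| Volume m of (1 < m)%N : primitive m
| ConformalVolume m of (1 < m)%N : primitive m
| Symplectic n of (0 < n)%N : primitive (n + n)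
| ConformalSymplectic n of (0 < n)%N : primitive (n + n)
| Contact n of (0 < n)%N : primitive (1 + (n + n)).

Section Forms.
Variable R : realType.

Definition omega n (v w : 'cV[R]_(n + n)) : R :=
  \sum_(i < n) (v (lshift n i) 0 * w (rshift n i) 0
                - v (rshift n i) 0 * w (lshift n i) 0).

Definition beta n (v w : 'cV[R]_(n + n)) : R := 2^-1 * omega v w.

(* alpha x v is the value at the point x and the tangent vector v of
   - dx^0 + 1/2 sum_i (x^i dx^(n+i) - x^(n+i) dx^i). *)
Definition alpha n (x v : 'cV[R]_(1 + (n + n))) : R :=
  - usubmx v 0 0 + beta (dsubmx x) (dsubmx v).

Definition jac m (phi : 'cV[R]_m -> 'cV[R]_m) (x : 'cV[R]_m) : 'M[R]_m :=
  \matrix_(i, j) 'd phi x (delta_mx j 0) i 0.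

Definition diffeo m (phi : 'cV[R]_m -> 'cV[R]_m) : Prop :=
  smooth phi /\ exists psi, [/\ smooth psi, cancel phi psi & cancel psi phi].

Definition preserves m (P : primitive m) : ('cV[R]_m -> 'cV[R]_m) -> Prop :=
  match P in primitive m return ('cV[R]_m -> 'cV[R]_m) -> Prop with
  | General _ _ => fun=> True
  | Volume _ _ => fun phi => forall x, \det (jac phi x) = 1
  | ConformalVolume _ _ => fun phi =>
      exists2 c : R, 0 < c & forall x, \det (jac phi x) = c
  | Symplectic n _ => fun phi =>
      forall x v w, omega ('d phi x v) ('d phi x w) = omega v w
  | ConformalSymplectic n _ => fun phi =>
      exists2 c : R, 0 < c &
        forall x v w, omega ('d phi x v) ('d phi x w) = c * omega v w
  | Contact n _ => fun phi =>
      exists2 f : 'cV[R]_(1 + (n + n)) -> R, forall x, 0 < f x &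
        forall x v, alpha (phi x) ('d phi x v) = f x * alpha x v
  end.

End Forms.

Section Closure.
Variables (R : realType) (m : nat).
Notation V := 'cV[R]_m.
Implicit Types (phi psi : V -> V).

Lemma diff_compD phi psi x v : smooth phi -> smooth psi ->
  'd (phi \o psi) x v = 'd phi (psi x) ('d psi x v).
Proof.
move=> hphi hpsi.
exact: (diff_compE v (smooth_diff x hpsi) (smooth_diff (psi x) hphi)).
Qed.

Lemma diff_cancel phi psi x v : smooth phi -> smooth psi -> cancel psi phi ->
  'd phi (psi x) ('d psi x v) = v.
Proof.
move=> hphi hpsi K; transitivity ('d (phi \o psi) x v).
  by symmetry; exact: diff_compD.
have -> : phi \o psi = id by apply/funext => y /=; rewrite K.
exact: diff_idE.
Qed.

Lemma jac_mul phi x v : jac phi x *m v = 'd phi x v.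
Proof.
apply/colP => i; transitivity (('d phi x (\sum_j v j 0 *: delta_mx j 0)) i 0).
  rewrite linear_sum summxE mxE; apply: eq_bigr => j _.
  by rewrite linearZ !mxE mulrC.
by rewrite -colvE.
Qed.

Lemma jac_comp phi psi x : smooth phi -> smooth psi ->
  jac (phi \o psi) x = jac phi (psi x) *m jac psi x.
Proof.
move=> hphi hpsi; apply/matrixP => i j; rewrite [LHS]mxE [RHS]mxE.
rewrite (diff_compD _ _ hphi hpsi) -jac_mul mxE; apply: eq_bigr => k _.
congr (_ * _); symmetry; rewrite /jac.
exact: (mxE _ (fun i j => 'd psi x (delta_mx j 0) i 0)).
Qed.

Lemma jac_id x : jac (id : V -> V) x = 1%:M.
Proof.
apply/matrixP => i j; rewrite !mxE (_ : 'd id x _ = delta_mx j 0) ?mxE.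
  by rewrite andbT.
exact: diff_idE.
Qed.

Lemma det_jac_cancel phi psi x : smooth phi -> smooth psi -> cancel psi phi ->
  \det (jac phi (psi x)) * \det (jac psi x) = 1.
Proof.
move=> hphi hpsi K; rewrite -det_mulmx -(jac_comp x hphi hpsi).
have -> : phi \o psi = id by apply/funext => y /=; rewrite K.
by rewrite jac_id det1.
Qed.

Lemma diffeo_id : diffeo (id : V -> V).
Proof. by split; [exact: smooth_id|exists id; split => //; exact: smooth_id]. Qed.

Lemma diffeo_comp phi psi : diffeo phi -> diffeo psi -> diffeo (phi \o psi).
Proof.
move=> [h1 [phi' [h1' K1 K1']]] [h2 [psi' [h2' K2 K2']]]; split.
  exact: smooth_comp.
exists (psi' \o phi'); split; first exact: smooth_comp.
  by move=> x /=; rewrite K1 K2.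
by move=> x /=; rewrite K2' K1'.
Qed.

End Closure.

Section Preserves.
Variable R : realType.

Lemma preserves_id m (P : primitive m) : preserves (R:=R) P id.
Proof.
have dE k (x v : 'cV[R]_k) : 'd id x v = v by exact: diff_idE.
case: P => //= {}m hm.
- by move=> x; rewrite jac_id det1.
- by exists 1 => // x; rewrite jac_id det1.
- by move=> x v w; rewrite dE dE.
- by exists 1 => // x v w; rewrite dE dE mul1r.
- by exists (fun=> 1) => // x v; rewrite dE mul1r.
Qed.

Lemma preserves_comp m (P : primitive m) (phi psi : 'cV[R]_m -> 'cV[R]_m) :
  smooth phi -> smooth psi ->
  preserves P phi -> preserves P psi -> preserves P (phi \o psi).
Proof.
case: P phi psi => n hn phi psi hphi hpsi; rewrite /preserves.
- by [].
- move=> h1 h2 x; rewrite (jac_comp x hphi hpsi) det_mulmx.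
  exact: etrans (f_equal2 *%R (h1 (psi x)) (h2 x)) (mulr1 1).
- move=> [c c0 h1] [c' c0' h2]; exists (c * c'); first exact: mulr_gt0.
  move=> x; rewrite (jac_comp x hphi hpsi) det_mulmx.
  exact: (f_equal2 *%R (h1 (psi x)) (h2 x)).
- move=> h1 h2 x v w.
  have e := f_equal2 (@omega R n) (diff_compD x v hphi hpsi)
                                   (diff_compD x w hphi hpsi).
  exact: etrans e (etrans (h1 _ _ _) (h2 _ _ _)).
- move=> [c c0 h1] [c' c0' h2]; exists (c * c'); first exact: mulr_gt0.
  move=> x v w; have e := f_equal2 (@omega R n) (diff_compD x v hphi hpsi)
                                                (diff_compD x w hphi hpsi).
  apply: (etrans e); rewrite -mulrA.
  exact: etrans (h1 _ _ _) (congr1 _ (h2 _ _ _)).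
- move=> [f f0 h1] [g g0 h2]; exists (fun x => f (psi x) * g x).
    by move=> x; exact: mulr_gt0.
  move=> x v; have e := f_equal (alpha (phi (psi x))) (diff_compD x v hphi hpsi).
  apply: (etrans e); rewrite -mulrA.
  exact: etrans (h1 _ _) (congr1 _ (h2 _ _)).
Qed.

Lemma preserves_inv m (P : primitive m) (phi psi : 'cV[R]_m -> 'cV[R]_m) :
  smooth phi -> smooth psi -> cancel psi phi ->
  preserves P phi -> preserves P psi.
Proof.
have aux (a b c : R) : a = c -> a * b = 1 -> b = c^-1.
  move=> -> e; have c0 : c != 0.
    by apply/eqP => c0; move/eqP: e; rewrite c0 mul0r eq_sym oner_eq0.
  by apply: (mulfI c0); rewrite e divff.
case: P phi psi => n hn phi psi hphi hpsi K; rewrite /preserves.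
- by [].
- move=> h1 x; apply: (etrans _ (@invr1 R)).
  exact: aux (h1 (psi x)) (det_jac_cancel x hphi hpsi K).
- move=> [c c0 h1]; exists c^-1; first by rewrite invr_gt0.
  by move=> x; exact: aux (h1 (psi x)) (det_jac_cancel x hphi hpsi K).
- move=> h1 x v w; apply: (etrans (esym (h1 (psi x) _ _))).
  exact: (f_equal2 (@omega R n) (diff_cancel x v hphi hpsi K)
                                 (diff_cancel x w hphi hpsi K)).
- move=> [c c0 h1]; exists c^-1; first by rewrite invr_gt0.
  move=> x v w; apply: (mulfI (lt0r_neq0 c0)); rewrite (mulVKf (lt0r_neq0 c0)).
  apply: (etrans (esym (h1 (psi x) _ _))).
  exact: (f_equal2 (@omega R n) (diff_cancel x v hphi hpsi K)
                                 (diff_cancel x w hphi hpsi K)).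
- move=> [f f0 h1]; exists (fun x => (f (psi x))^-1).
    by move=> x; rewrite invr_gt0.
  move=> x v; apply: (mulfI (lt0r_neq0 (f0 (psi x)))).
  rewrite (mulVKf (lt0r_neq0 (f0 (psi x)))).
  apply: (etrans (esym (h1 (psi x) _))).
  exact: (f_equal2 (@alpha R n) (K x) (diff_cancel x v hphi hpsi K)).
Qed.

End Preserves.

Section DiffGroup.
Variables (R : realType) (m : nat) (P : primitive m).
Notation V := 'cV[R]_m.

Record Diff := MkDiff {
  dmap :> V -> V ;
  dmapP : `[< diffeo dmap /\ preserves P dmap >] }.

HB.instance Definition _ := [isSub for dmap].
HB.instance Definition _ := [Choice of Diff by <:].

Implicit Types phi psi : Diff.

Lemma Diff_smooth phi : smooth phi.
Proof. by have /asboolP [[]] := dmapP phi. Qed.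

Lemma Diff_inv_ex phi : exists psi : V -> V,
  [/\ smooth psi, cancel phi psi & cancel psi phi].
Proof. by have /asboolP [[]] := dmapP phi. Qed.

Definition dinvmap phi : V -> V := sval (cid (Diff_inv_ex phi)).

Lemma dinvmapP phi :
  [/\ smooth (dinvmap phi), cancel phi (dinvmap phi) & cancel (dinvmap phi) phi].
Proof. by rewrite /dinvmap; case: cid. Qed.

Fact did_subproof : `[< diffeo (id : V -> V) /\ preserves (R := R) P id >].
Proof. by apply/asboolP; split; [exact: diffeo_id|exact: preserves_id]. Qed.

Fact dcomp_subproof phi psi :
  `[< diffeo (phi \o psi) /\ preserves P (phi \o psi) >].
Proof.
have /asboolP [h1 h2] := dmapP phi; have /asboolP [h3 h4] := dmapP psi.
apply/asboolP; split; first exact: diffeo_comp.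
by apply: preserves_comp => //; exact: Diff_smooth.
Qed.

Fact dinv_subproof phi : `[< diffeo (dinvmap phi) /\ preserves P (dinvmap phi) >].
Proof.
have [h K K'] := dinvmapP phi; have /asboolP [h1 h2] := dmapP phi.
apply/asboolP; split; last exact: (preserves_inv (Diff_smooth phi)).
by split=> //; exists phi; split => //; exact: Diff_smooth.
Qed.

Definition did := MkDiff did_subproof.
Definition dcomp phi psi := MkDiff (dcomp_subproof phi psi).
Definition dinv phi := MkDiff (dinv_subproof phi).

Lemma DiffE phi psi : phi =1 psi -> phi = psi.
Proof. by move=> e; apply/val_inj/funext. Qed.

Let dcompA : associative dcomp. Proof. by move=> a b c; exact: DiffE. Qed.
Let dcomp1l : left_id did dcomp. Proof. by move=> a; exact: DiffE. Qed.
Let dcomp1r : right_id did dcomp. Proof. by move=> a; exact: DiffE. Qed.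
Let dcompVl : left_inverse did dinv dcomp.
Proof. by move=> a; apply: DiffE => x /=; have [_ ->] := dinvmapP a. Qed.
Let dcompVr : right_inverse did dinv dcomp.
Proof. by move=> a; apply: DiffE => x /=; have [_ _ ->] := dinvmapP a. Qed.

HB.instance Definition _ :=
  isGroup.Build Diff dcompA dcomp1l dcomp1r dcompVl dcompVr.

End DiffGroup.


Section Subgroups.
Variable gT : groupType.
Implicit Types H S : set gT.

Definition is_subgroup H : Prop :=
  [/\ H 1%g, forall x y, H x -> H y -> H (x * y)%g
    & forall x, H x -> H (x^-1)%g].

Definition generated S : set gT :=
  [set x | forall H, is_subgroup H -> S `<=` H -> H x].

Lemma generated_subgroup S : is_subgroup (generated S).
Proof.
split; first by move=> H [].
- by move=> x y hx hy H hH SH; have [_ hM _] := hH; apply: hM; [exact: hx|exact: hy].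
- by move=> x hx H hH SH; have [_ _ hV] := hH; apply: hV; exact: hx.
Qed.

Lemma subgroup_closed H : is_subgroup H -> group_closed (fun x => x \in H).
Proof.
move=> [h1 hM hV]; split; first by rewrite unfold_in inE.
move=> x y; rewrite !unfold_in !inE => hx hy.
by apply: hM => //; exact: hV.
Qed.

End Subgroups.

Section GN.
Variable R : realType.

(* The law of the Heisenberg group. *)
Definition hlaw n (x y : 'cV[R]_(1 + (n + n))) : 'cV[R]_(1 + (n + n)) :=
  col_mx (usubmx x + usubmx y + (beta (dsubmx x) (dsubmx y))%:M)
         (dsubmx x + dsubmx y).

Definition affine_maps m (P : primitive m) : set (Diff R P) :=
  [set phi | exists (A : 'M[R]_m) (b : 'cV[R]_m), forall x, phi x = A *m x + b].

Definition contact_gens n (hn : (0 < n)%N) : set (Diff R (Contact hn)) :=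
  [set phi : Diff R (Contact hn) |
    [\/ exists a, forall x, phi x = hlaw a x,
        exists2 A : 'M[R]_(n + n),
          forall v w, beta (A *m v) (A *m w) = beta v w &
          forall x, phi x = col_mx (usubmx x) (A *m dsubmx x)
      | exists2 t : R, 0 < t &
          forall x, phi x = col_mx (t ^+ 2 *: usubmx x) (t *: dsubmx x)]].

Definition Gset m (P : primitive m) : set (Diff R P) :=
  match P with
  | Contact n hn => generated (@contact_gens n hn)
  | Q => @affine_maps _ Q
  end.

Definition flat_unipotent m (P : primitive m) : set (Diff R P) :=
  [set psi : Diff R P | psi 0 = 0 /\ forall v, 'd psi 0 v = v].

Definition contact_unipotent n (hn : (0 < n)%N) : set (Diff R (Contact hn)) :=
  [set psi : Diff R (Contact hn) |
    [/\ psi 0 = 0,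
        forall v, alpha 0 v = 0 -> 'd psi 0 v = v
      & forall v, alpha 0 ('d psi 0 v) = alpha 0 v]].

Definition Nset m (P : primitive m) : set (Diff R P) :=
  match P with
  | Contact n hn => @contact_unipotent n hn
  | Q => @flat_unipotent _ Q
  end.

Lemma affine_subgroup m (P : primitive m) : is_subgroup (affine_maps (P:=P)).
Proof.
split; first by exists 1%:M, 0 => x; rewrite mul1mx addr0.
- move=> f g [A [b fE]] [B [c gE]]; exists (A *m B), (A *m c + b) => x.
  by rewrite /= fE gE mulmxDr mulmxA addrA.
- move=> f [A [b fE]].
  have K x : f ((f^-1)%g x) = x by have [_ _] := dinvmapP f; exact.
  have K' x : (f^-1)%g (f x) = x by have [_ k _] := dinvmapP f; exact: k.
  pose c := (f^-1)%g 0.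
  have cE : A *m c = - b by apply/eqP; rewrite -subr_eq0 opprK -fE K.
  pose B : 'M[R]_m := \matrix_(i, j) ((f^-1)%g (delta_mx j 0) - c) i 0.
  have AB : A *m B = 1%:M.
    apply/matrixP => i j; transitivity ((A *m ((f^-1)%g (delta_mx j 0) - c)) i 0).
      by rewrite !mxE; apply: eq_bigr => k _; rewrite !mxE.
    have -> : A *m ((f^-1)%g (delta_mx j 0) - c) = delta_mx j 0.
      by rewrite mulmxBr cE opprK -fE K.
    by rewrite !mxE andbT.
  exists B, c => x; have BA := mulmx1C AB.
  have := fE ((f^-1)%g x); rewrite K => e.
  have cB : c = - (B *m b) by rewrite -mulmxN -cE mulmxA BA mul1mx.
  by symmetry; rewrite {1}e cB mulmxDr mulmxA BA mul1mx addrK.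
Qed.

Lemma Gset_subgroup m (P : primitive m) : is_subgroup (Gset (P:=P)).
Proof.
case: P => *; by [exact: affine_subgroup | exact: generated_subgroup].
Qed.

Section unipotent.
Variables (m : nat) (P : primitive m).
Implicit Types f g : Diff R P.

Lemma Ddiff1 v : 'd (1%g : Diff R P) 0 v = v.
Proof. exact: diff_idE. Qed.

Lemma DdiffM f g v : g 0 = 0 ->
  'd ((f * g)%g : Diff R P) 0 v = 'd f 0 ('d g 0 v).
Proof.
move=> g0; have e := diff_compD 0 v (Diff_smooth f) (Diff_smooth g).
exact: (etrans e (f_equal (fun y => 'd f y ('d g 0 v)) g0)).
Qed.

Lemma DfixV f : f 0 = 0 -> (f^-1)%g 0 = 0.
Proof.
move=> f0; have [_ k _] := dinvmapP f.
exact: etrans (congr1 (f^-1)%g (esym f0)) (k 0).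
Qed.

Lemma DdiffV f v : f 0 = 0 -> 'd f 0 ('d ((f^-1)%g : Diff R _) 0 v) = v.
Proof.
move=> f0; apply: (etrans (esym (DdiffM f v (DfixV f0)))).
rewrite mulgV; exact: Ddiff1.
Qed.

End unipotent.

Lemma flat_unipotent_subgroup m (P : primitive m) :
  is_subgroup (flat_unipotent (P:=P)).
Proof.
split; first by split=> // v; exact: Ddiff1.
- move=> f g [f0 fv] [g0 gv]; split; first by rewrite /= g0 f0.
  by move=> v; exact: (etrans (DdiffM f v g0) (etrans (fv ('d g 0 v)) (gv v))).
- move=> f [f0 fv]; split; first exact: DfixV.
  by move=> v; exact: (etrans (esym (fv ('d ((f^-1)%g : Diff R _) 0 v))) (DdiffV v f0)).
Qed.

Lemma contact_unipotent_subgroup n (hn : (0 < n)%N) :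
  is_subgroup (contact_unipotent (hn:=hn)).
Proof.
split; first by split=> // v => [_|]; [exact: Ddiff1|exact: (congr1 (alpha 0) (Ddiff1 _ v))].
- move=> f g [f0 fv fa] [g0 gv ga]; split; first by rewrite /= g0 f0.
    move=> v v0; have e := f_equal ('d f 0) (gv v v0).
    exact: (etrans (DdiffM f v g0) (etrans e (fv v v0))).
  move=> v; apply: (etrans (f_equal (alpha 0) (DdiffM f v g0))).
  exact: (etrans (fa ('d g 0 v)) (ga v)).
- move=> f [f0 fv fa].
  have ga v : alpha 0 ('d ((f^-1)%g : Diff R _) 0 v) = alpha 0 v.
    exact: (etrans (esym (fa ('d ((f^-1)%g : Diff R _) 0 v))) (f_equal (alpha 0) (DdiffV v f0))).
  split=> [|v v0|]; [exact: DfixV| |exact: ga].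
  exact: (etrans (esym (fv ('d ((f^-1)%g : Diff R _) 0 v) (etrans (ga v) v0))) (DdiffV v f0)).
Qed.

Lemma Nset_subgroup m (P : primitive m) : is_subgroup (Nset (P:=P)).
Proof.
case: P => *;
  by [exact: flat_unipotent_subgroup | exact: contact_unipotent_subgroup].
Qed.

End GN.


Section FunAlgebra.
Variables (T : pointedType) (K : realType).
Fact fct_scaleAl (a : K) (f g : T -> K) : a *: (f * g) = a *: f * g.
Proof. by apply/funext => x; exact: mulrA. Qed.
HB.instance Definition _ :=
  @GRing.Lmodule_isLalgebra.Build K (T -> K) fct_scaleAl.
Fact fct_scaleAr (a : K) (f g : T -> K) : a *: (f * g) = f * (a *: g).
Proof. by apply/funext => x; exact: mulrCA. Qed.
HB.instance Definition _ :=
  @GRing.Lalgebra_isAlgebra.Build K (T -> K) fct_scaleAr.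
End FunAlgebra.

Section GNTypes.
Variables (R : realType) (m : nat) (P : primitive m).

Record GPi := MkG { gval :> Diff R P ; gvalP : gval \in Gset (R:=R) (P:=P) }.
HB.instance Definition _ := [isSub for gval].
HB.instance Definition _ := [Choice of GPi by <:].
HB.instance Definition _ := SubChoice_isSubGroup.Build (Diff R P) _ GPi
  (subgroup_closed (@Gset_subgroup R m P)).
HB.instance Definition _ := isPointed.Build GPi 1%g.

Record NPi := MkN { nval :> Diff R P ; nvalP : nval \in Nset (R:=R) (P:=P) }.
HB.instance Definition _ := [isSub for nval].
HB.instance Definition _ := [Choice of NPi by <:].
HB.instance Definition _ := SubChoice_isSubGroup.Build (Diff R P) _ NPi
  (subgroup_closed (@Nset_subgroup R m P)).
HB.instance Definition _ := isPointed.Build NPi 1%g.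

(* The two factors of phi = g o nu in Diff = G . N; the factorization exists and
   is unique. *)
Definition Gpart (phi : Diff R P) : GPi :=
  xget 1%g [set g : GPi | exists nu : NPi, phi = (gval g * nval nu)%g].
Definition Npart (phi : Diff R P) : NPi :=
  xget 1%g [set nu : NPi | exists g : GPi, phi = (gval g * nval nu)%g].

(* Left action of Diff on G = Diff / N. *)
Definition tilde (phi : Diff R P) (g : GPi) : GPi := Gpart (phi * gval g)%g.

(* psi <| g, defined by psi o g = (psi |> g) o (psi <| g). *)
Definition lact (psi : NPi) (g : GPi) : NPi := Npart (nval psi * gval g)%g.

(* Elements of G are affine maps, also in the contact case.  The coordinates
   (g 0, linear part of g) embed G as a submanifold of a vector space, and a
   function is smooth on G when it is locally the restriction of a smooth function
   of these coordinates (which cut-off functions allow to take defined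
   everywhere). *)
Definition jet (g : GPi) : 'cV[R]_m * 'M[R]_m :=
  (g 0, \matrix_(i, j) (g (delta_mx j 0) - g 0) i 0).

Definition smoothG (f : GPi -> R) : Prop :=
  forall g, exists2 F : 'cV[R]_m * 'M[R]_m -> R, smooth F &
    \forall w \near jet g, forall h : GPi, jet h = w -> f h = F w.

Record Cinf := MkCinf { cfun :> GPi -> R ; cfunP : `[< smoothG cfun >] }.
HB.instance Definition _ := [isSub for cfun].
HB.instance Definition _ := [Choice of Cinf by <:].

Fact smoothG_subalg :
  GRing.subsemialg_closed (A := GPi -> R : Type) (fun f : GPi -> R => `[< smoothG f >]).
Proof.
have cst (a : R) : smoothG (fun=> a).
  by move=> g; exists (fun=> a); [exact: smooth_cst|near=> w].
have dD f1 f2 : smoothG f1 -> smoothG f2 -> smoothG (f1 + f2).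
  move=> h1 h2 g; have [F1 s1 e1] := h1 g; have [F2 s2 e2] := h2 g.
  exists (F1 + F2); first exact: smooth_add.
  near=> w => h hw; rewrite /GRing.add /=; congr (_ + _).
    by move: h hw; near: w.
  by move: h hw; near: w.
have dM f1 f2 : smoothG f1 -> smoothG f2 -> smoothG (f1 * f2).
  move=> h1 h2 g; have [F1 s1 e1] := h1 g; have [F2 s2 e2] := h2 g.
  exists (F1 * F2); first exact: smooth_mul.
  near=> w => h hw; rewrite /GRing.mul /=; congr (_ * _).
    by move: h hw; near: w.
  by move: h hw; near: w.
split; rewrite ?unfold_in; first by apply/asboolP; exact: cst.
- split; first by rewrite unfold_in; apply/asboolP; exact: cst.
  by move=> u v; rewrite !unfold_in => /asboolP hu /asboolP hv; apply/asboolP; exact: dD.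
- move=> a u; rewrite !unfold_in => /asboolP hu; apply/asboolP.
  exact: (dM (fun=> a) u (cst a) hu).
- by move=> u v; rewrite !unfold_in => /asboolP hu /asboolP hv; apply/asboolP; exact: dM.
Unshelve. all: by end_near.
Qed.

HB.instance Definition _ :=
  GRing.SubChoice_isSubAlgebra.Build R (GPi -> R) _ Cinf smoothG_subalg.
HB.instance Definition _ :=
  GRing.SubNzRing_isSubComNzRing.Build (GPi -> R) _ Cinf.

End GNTypes.


Section Operators.
Variables (R : realType) (m : nat) (P : primitive m).
Local Notation C := (Cinf R P).
Local Notation G := (GPi R P).
Local Notation N := (NPi R P).
Local Notation D := (Diff R P).

Definition OpG : Type := Endo C.
HB.instance Definition _ := GRing.PzRing.on OpG.
HB.instance Definition _ := GRing.Lmodule.on OpG.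
Fact OpG_neq0 : (1 : OpG) != 0.
Proof.
apply/eqP => /(congr1 (fun f : OpG => f 1)) e.
by have := oner_neq0 C; rewrite (e : 1 = 0 :> C) eqxx.
Qed.
HB.instance Definition _ := GRing.PzSemiRing_isNonZero.Build OpG OpG_neq0.
HB.instance Definition _ :=
  GRing.Lmodule_isLalgebra.Build R OpG (@endo_scaleAl R C).
HB.instance Definition _ :=
  GRing.Lalgebra_isAlgebra.Build R OpG (@endo_scaleAr R C).

(* U_phi^* xi = xi o tilde phi, which is again smooth; U_phi = pull (phi^-1). *)
Definition pull (phi : D) (xi : C) : C := insubd 0 (xi \o tilde phi).

(* Left-invariant vector fields: derivations of C^oo(G) that commute with left
   translations. *)
Definition lieG : set OpG :=
  [set X | (forall f g : C, X (f * g) = X f * g + f * X g) /\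
     forall (h : G) (f f' : C), (forall g, f' g = f (h * g)%g) ->
       forall g, X f' g = X f (h * g)%g].

(* t |-> exp (t X): the one-parameter subgroup with velocity X. *)
Definition expG (X : OpG) : R -> G :=
  xget (fun=> 1%g) [set gam |
    (forall s t, gam (s + t) = (gam s * gam t)%g) /\
    forall (f : C) (g : G),
      is_derive (0 : R) 1 (fun t => f (g * gam t)%g : R) (X f g)].

Definition mulG (f : C) : OpG.
Proof.
apply: (@MkEndo _ _ (fun g : C => f * g)).
by apply/asboolP => a x y; rewrite mulrDr scalerAr.
Defined.

(* The function [a] with finite support stands for sum_phi (a phi) U_phi^*. *)
Definition finite_support (a : D -> C) : Prop :=
  finite_set [set phi | a phi != 0].

Record crossed := MkCrossed {
  coef :> D -> C ;
  coefP : `[< finite_support coef >] }.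
HB.instance Definition _ := [isSub for coef].
HB.instance Definition _ := [Choice of crossed by <:].

Fact crossed_submod : GRing.subsemimod_closed (V := D -> C : Type)
  (fun a => `[< finite_support a >]).
Proof.
have E (a : D -> C) : (a \in (fun a => `[< finite_support a >]))
   = `[< finite_support a >] by [].
split; first split.
- rewrite E; apply/asboolP; apply: sub_finite_set (finite_set0 D) => phi.
  by rewrite /= eqxx.
- move=> a b; rewrite !E => /asboolP ha /asboolP hb; apply/asboolP.
  have hab : finite_set ([set phi | a phi != 0] `|` [set phi | b phi != 0]).
    by rewrite finite_setU.
  apply: sub_finite_set hab => phi /=; have [a0|] := eqVneq (a phi) 0; last by left.
  have [b0|] := eqVneq (b phi) 0; last by right.
  by rewrite /GRing.add /= a0 b0 addr0 eqxx.
- move=> c a; rewrite !E => /asboolP ha; apply/asboolP.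
  apply: sub_finite_set ha => phi /=; apply: contraNneq => a0.
  by rewrite /GRing.scale /= a0 scaler0.
Qed.
HB.instance Definition _ :=
  GRing.SubChoice_isSubLmodule.Build R (D -> C) _ crossed crossed_submod.

Lemma crossed_finite (a : crossed) : finite_set [set phi | a phi != 0].
Proof. by have /asboolP := coefP a. Qed.

Lemma pull0 phi : pull phi 0 = 0.
Proof.
apply: val_inj; rewrite /pull val_insubd; case: ifP => // _.
Qed.

Fact cmul_subproof (a b : crossed) : `[< finite_support (fun chi : D =>
  \sum_(phi \in [set: D]) (a phi * pull phi (b (chi * phi^-1)%g))) >].
Proof.
apply/asboolP.
have fin := finite_image2 (fun phi psi : D => (psi * phi)%g)
  (crossed_finite a) (crossed_finite b).
apply: sub_finite_set fin => chi /= nz.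
apply: contrapT => h; move/eqP: nz; apply; apply: fsbig1 => phi _.
have [->|a0] := eqVneq (a phi) 0; first by rewrite mul0r.
have [->|b0] := eqVneq (b (chi * phi^-1)%g) 0; first by rewrite pull0 mulr0.
exfalso; apply: h; exists phi => //; exists (chi * phi^-1)%g => //.
by rewrite -mulgA mulVg mulg1.
Qed.

(* f1 U_phi1^* . f2 U_phi2^* = f1 (f2 o tilde phi1) U_(phi2 phi1)^*: the
   coefficient at chi collects phi = phi1 and chi phi^-1 = phi2. *)
Definition cmul (a b : crossed) : crossed := MkCrossed (cmul_subproof a b).

Fact monom_subproof (f : C) (phi : D) :
  `[< finite_support (fun chi : D => if chi == phi then f else 0) >].
Proof.
apply/asboolP; apply: sub_finite_set (finite_set1 phi) => chi /=.
by case: ifP => [/eqP ->//|_]; rewrite eqxx.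
Qed.

Definition monom (f : C) (phi : D) : crossed := MkCrossed (monom_subproof f phi).

Definition OpA : Type := Endo crossed.
HB.instance Definition _ := GRing.PzRing.on OpA.
HB.instance Definition _ := GRing.Lmodule.on OpA.
Fact OpA_neq0 : (1 : OpA) != 0.
Proof.
apply/eqP => /(congr1 (fun h : OpA => h (monom 1 1%g) 1%g)) /= e.
have := oner_neq0 C; rewrite -[X in X != _]/(if true then 1 else 0 : C).
by rewrite -(eqxx (1%g : D)) (e : _ = 0 :> C) eqxx.
Qed.
HB.instance Definition _ := GRing.PzSemiRing_isNonZero.Build OpA OpA_neq0.
HB.instance Definition _ :=
  GRing.Lmodule_isLalgebra.Build R OpA (@endo_scaleAl R crossed).
HB.instance Definition _ :=
  GRing.Lalgebra_isAlgebra.Build R OpA (@endo_scaleAr R crossed).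

Lemma OpG0 (T : OpG) : T 0 = 0.
Proof.
have := Endo_linear T 1 0 0; rewrite !scale1r addr0 => e.
by apply: (addrI (T 0)); rewrite -e addr0.
Qed.

Fact diag_finite (T : D -> OpG) (a : crossed) :
  `[< finite_support (fun phi => T phi (a phi)) >].
Proof.
apply/asboolP; apply: sub_finite_set (crossed_finite a) => phi /=.
by apply: contraNneq => ->; rewrite OpG0.
Qed.

Fact diag_linear (T : D -> OpG) :
  `[< linear (fun a => MkCrossed (diag_finite T a)) >].
Proof.
apply/asboolP => c a b; apply: val_inj; apply/funext => phi /=.
exact: (Endo_linear (T phi) c (a phi) (b phi)).
Qed.

Definition diag (T : D -> OpG) : OpA := MkEndo (diag_linear T).

Definition vfield (X : OpG) : OpA := diag (fun=> X).
(* f U_phi^* |-> h(phi) f U_phi^*. *)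
Definition multop (h : D -> C) : OpA := diag (fun phi => mulG (h phi)).

End Operators.


Section HopfPi.
Variables (R : realType) (m : nat) (P : primitive m) (d : nat).
Local Notation C := (Cinf R P).
Local Notation G := (GPi R P).
Local Notation N := (NPi R P).
Local Notation D := (Diff R P).
Local Notation g_Pi := (@lieG R m P).

Definition UPi := envelop g_Pi.
HB.instance Definition _ := GRing.Algebra.on UPi.

Variable X : 'I_d -> g_Pi.

Definition is_basis : Prop :=
  (forall c : 'I_d -> R, \sum_k c k *: val (X k) = 0 -> forall k, c k = 0) /\
  (forall Y : g_Pi, exists c : 'I_d -> R, val Y = \sum_k c k *: val (X k)).

(* The matrix with U_phi^* X_i U_phi = sum_j Gamma_i^j(phi) X_j; row i, column j.
   It exists and is unique since the X_k form a frame of TG, and it is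
   invertible. *)
Definition Gam (phi : D) : 'M[C]_d :=
  xget 0 [set M : 'M[C]_d | forall i (xi : C),
    pull phi (val (X i) (pull (phi^-1)%g xi)) = \sum_j M i j * val (X j) xi].

Definition Gaminv (phi : D) : 'M[C]_d :=
  xget 0 [set M : 'M[C]_d | M *m Gam phi = 1%:M /\ Gam phi *m M = 1%:M].

Definition Delta (i j : 'I_d) : OpA R P := multop (fun phi => Gaminv phi i j).

Definition HPi := galg ([set T : OpA R P |
  (exists k, T = vfield (val (X k))) \/ (exists i j, T = Delta i j)]).
HB.instance Definition _ := GRing.Algebra.on HPi.

(* X_(k_r) ... X_(k_1) Gamma_i^j(psi) at the unit e, for ks = [:: k_1; ...; k_r]. *)
Definition eta (i j : 'I_d) (ks : seq 'I_d) : N -> R :=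
  fun psi => foldl (fun f k => val (X k) f) (Gam (nval psi) i j) ks 1%g.

Definition FPi := @galg R (N -> R : Type)
  [set f | exists i j ks, f = eta i j ks].
HB.instance Definition _ := GRing.Algebra.on FPi.

Definition opmonom (I : {ffun 'I_d -> nat}) : OpG R P :=
  \prod_(k < d) (val (X k) : OpG R P) ^+ I k.
Definition pbw (I : {ffun 'I_d -> nat}) : UPi :=
  \prod_(k < d) (ugen (X k) : UPi) ^+ I k.

(* Each of the following five conditions has at most one solution, given the
   (co)module and Hopf algebra axioms: U is generated by g and spanned by the
   PBW monomials, and elements of F (x) F and H (x) H are determined by the
   functions on N x N, resp. the bilinear operators, that they define. *)
Definition hopf_UPi (hU : hopf_ops UPi) : Prop :=
  hopf_on_algebra hU /\
  forall Y : g_Pi,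
    [/\ hcomul hU (ugen Y) = ugen Y \ox 1 + 1 \ox ugen Y,
        hcounit hU (ugen Y) = 0 & hanti hU (ugen Y) = - (ugen Y : UPi)].

Definition hopf_FPi (hF : hopf_ops FPi) : Prop :=
  [/\ hopf_on_algebra hF,
      forall (f : FPi) (psi1 psi2 : N),
        \sw_(a, b <- hcomul hF f)
          (galgv a psi1 * galgv b psi2 : R^o) = galgv f (psi1 * psi2)%g,
      forall f : FPi, hcounit hF f = galgv f 1%g
    & forall (f : FPi) (psi : N), galgv (hanti hF f) psi = galgv f (psi^-1)%g].

Definition hopf_HPi (hH : hopf_ops HPi) : Prop :=
  hopf_on_algebra hH /\
  forall (h : HPi) (a b : crossed R P),
    galgv h (cmul a b) =
    \sw_(h1, h2 <- hcomul hH h) cmul (galgv h1 a) (galgv h2 b).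

Definition action_spec (act : UPi -> FPi -> FPi) : Prop :=
  forall (Y : g_Pi) (f : FPi) (psi : N),
    is_derive (0 : R) 1 (fun t : R => galgv f (lact psi (expG (val Y) t)) : R)
      (galgv (act (ugen Y) f) psi).

(* [bt J] is beta_I^J, for J in the finite set [s]; U_psi and U_psi^* are
   [pull psi^-1] and [pull psi]. *)
Definition coaction_spec (coact : UPi -> tensor UPi FPi) : Prop :=
  forall I, exists (s : seq {ffun 'I_d -> nat})
      (bt : {ffun 'I_d -> nat} -> N -> C) (b : {ffun 'I_d -> nat} -> FPi),
    [/\ uniq s,
        forall (psi : N) (xi : C),
          pull (nval psi^-1)%g (opmonom I (pull (nval psi) xi)) =
          \sum_(J <- s) bt J psi * opmonom J xi,
        forall J psi, galgv (b J) psi = bt J psi 1%g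
      & coact (pbw I) = \sum_(J <- s) pbw J \ox b J].

Definition iterated_commutators : set (OpA R P) :=
  [set T | exists i j (ks : seq 'I_d),
     T = foldl (fun S k => vfield (val (X k)) * S - S * vfield (val (X k)))
           (Delta i j) ks].

Definition canonical_map (Phi : tensor FPi UPi -> HPi) : Prop :=
  (forall Y : g_Pi, galgv (Phi (1 \ox ugen Y)) = vfield (val Y)) /\
  (forall h : D -> C, galg_set iterated_commutators (multop h) ->
     exists f : FPi, (forall psi : N, galgv f psi = h (nval psi) 1%g) /\
       galgv (Phi (f \ox 1)) = multop h).

End HopfPi.

(* Main.v *)
(** A diffeomorphism of type Pi acts on G = Diff / N by [tilde phi], whose jet
    is a smooth function of the jet; hence functions and left-invariant vector
    fields on G can be pulled back, and the matrices Gam satisfy the cocycle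
    identity Gam(f h) = pull h (Gam f) Gam(h).  For psi in N the matrix Gam(psi)(e) is
    unipotent, so the entries of its inverse are again in F.

    An element f of F extends to the functions hat f (phi) : g |-> f(Npart(phi g)),
    in terms of which u |> f and the coaction read
       hat (u |> f) (phi) = u (hat f (phi)),
       u o pull phi = sum hat u<1> (phi) . pull phi o u<0>.
    The tensor products are separated by point evaluations on F and, by the
    Poincare-Birkhoff-Witt theorem, by the functionals u |-> (u xi)(e) on U; every
    coalgebra identity becomes, on these functionals, associativity of an
    operation on the index set, and every matched pair axiom a Leibniz rule.

    f (x) u |-> hat f . u is an injective algebra morphism from the bicrossed
    product to diagonal operators on the crossed product, with image H.  The
    antipode of the co-opposite structure is S'(f (x) u) = Theta(S u) (S f)^, where
    Theta u is u conjugated by the pull-back along phi; that S' is inverse to the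
    antipode of the bicrossed product follows from antimultiplicativity. *)
Require Import Defs.
From HB Require Import structures.
From mathcomp Require Import all_boot all_order all_algebra.
From mathcomp Require Import all_classical all_reals all_analysis.
From mathcomp Require Import ring lra zify.

Set Implicit Arguments.
Unset Strict Implicit.
Unset Printing Implicit Defensive.

Import Order.TTheory GRing.Theory Num.Theory.
Import numFieldNormedType.Exports.

Local Open Scope classical_set_scope.
Local Open Scope quotient_scope.
Local Open Scope ring_scope.

(** G is only a set of affine maps, smoothness on it means being locally a smooth function of the
    jet, and [lieG] is defined algebraically, by derivations. So tangent vectors, flows and the
    frame property of the [X k] must be produced. Hadamard's lemma shows that a derivation at a
    point is determined by its values on the jet coordinates, and the exponential of such a velocity
    stays in G because the functions cutting out G all satisfy one linear differential equation
    along it. The contact pseudogroup is the delicate case: the first jet of phi o g is in general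
    not that of an element of G, and the action on G is found only after d(phi^* alpha) = d(f alpha)
    has been used on the contact planes. The index 4 of unipotence, hence the four-term geometric
    sums, comes from extending the action to all pairs (vector, matrix): two steps kill the base
    component, two more the linear part. Coproducts, antipodes and the coaction are obtained as
    existence statements by induction on generators. The induction differentiates along G, which is
    why it works with [hat] on all of Diff; the chosen tensors are then handled only through their
    defining identities. *)

(** * Differential calculus in finite frames *)

(** Stands for finite dimension: the chain rule for C^k maps consumes continuous coordinates and a
    reconstruction formula, and one proof then serves scalars, column vectors and jets. *)
Record frame (R : realType) (V : normedModType R) := Frame {
  fidx : finType ;
  fco : fidx -> {linear V -> R} ;
  fe : fidx -> V ;
  fco_cont : forall k, continuous (fco k) ;
  frameE : forall w, w = \sum_k fco k w *: fe k }.

Section FrameCalculus.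
Variables (R : realType) (V : normedModType R) (B : frame V).
Local Notation co := (fco (f := B)).
Local Notation e := (fe (f := B)).

Lemma diff_frame (W : normedModType R) (f : V -> W) x v :
  'd f x v = \sum_k co k v *: 'd f x (e k).
Proof.
by rewrite {1}(frameE B v) linear_sum; apply: eq_bigr => k _; rewrite linearZ.
Qed.

Lemma Ck_fsum (U W : normedModType R) (K : finType) k (F : K -> U -> W) :
  (forall i, Ck k (F i)) -> Ck k (fun x => \sum_i F i x).
Proof.
move=> h; rewrite (_ : (fun x => _) = \sum_i F i); last first.
  by apply/funext => x; rewrite fct_sumE.
by apply: (big_ind (Ck k)) => //; [exact: Ck_cst|move=> ? ?; exact: Ck_add].
Qed.

(** Expanding ['d g x v] in the frame turns the derivative of the composite into a finite sum of
    products, to which the induction hypothesis for the lower order applies. *)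
Lemma Ck_comp_frame (U W : normedModType R) k (f : V -> W) (g : U -> V) :
  Ck k f -> Ck k g -> Ck k (f \o g).
Proof.
elim: k f g => [|k IH] f g /=.
  by move=> cf cg x; apply: continuous_comp; [exact: cg|exact: cf].
move=> Cf Cg; have [df Df] := Cf; have [dg Dg] := Cg.
split=> [x|v]; first exact: differentiable_comp.
have -> : (fun x => 'd (f \o g) x v) =
    (fun x => \sum_i co i ('d g x v) *: ('d f (g x) (e i))).
  by apply/funext => x; rewrite (diff_compE v (dg x) (df (g x))) diff_frame.
apply: Ck_fsum => i; apply: Ck_scale.
  by apply: (@Ck_lin _ _ _ _ (co i)) => //; exact: fco_cont.
have -> : (fun x => 'd f (g x) (e i)) = (fun y => 'd f y (e i)) \o g by [].
by apply: IH => //; exact: CkS.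
Qed.

Lemma Ck_frame (U : normedModType R) k (g : U -> V) :
  (forall i, Ck k (fun x => co i (g x))) -> Ck k g.
Proof.
move=> h; rewrite (_ : g = fun x => \sum_i co i (g x) *: e i).
  by apply: Ck_fsum => i; apply: Ck_scale => //; exact: Ck_cst.
by apply/funext => x; rewrite -frameE.
Qed.

Lemma Ck_idg (U : normedModType R) k : Ck k (id : U -> U).
Proof.
case: k => [|k] /=; first by move=> x; exact: cvg_id.
split=> [x|v]; first exact: (@ex_diff _ _ _ _ _ _ _ (is_diff_id x)).
rewrite (_ : (fun x : U => 'd id x v) = fun=> v); first exact: Ck_cst.
by apply/funext => x; exact: diff_idE.
Qed.

Lemma Ck_co k i : Ck k (co i : V -> R).
Proof. exact: (@Ck_lin _ _ _ _ (co i) k id (@fco_cont _ _ B i) (@Ck_idg _ k)). Qed.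

Lemma Ck_diff (U W : normedModType R) k (f : V -> W) (g h : U -> V) :
  Ck k.+1 f -> Ck k g -> Ck k h -> Ck k (fun x => 'd f (g x) (h x)).
Proof.
move=> Cf Cg Ch; rewrite (_ : (fun x => _) =
  fun x => \sum_i co i (h x) *: 'd f (g x) (e i)); last first.
  by apply/funext => x; rewrite diff_frame.
apply: Ck_fsum => i; apply: Ck_scale.
  by apply: (@Ck_lin _ _ _ _ (co i)) => //; exact: fco_cont.
by apply: (@Ck_comp_frame _ _ _ (fun y => 'd f y (e i))) => //; case: Cf => _; apply.
Qed.

End FrameCalculus.

Section SmoothAlgebra.
Variables (R : realType) (V : normedModType R).
Implicit Types f g : V -> R.

Lemma Ck_opp (W : normedModType R) k (f : V -> W) : Ck k f -> Ck k (fun x => - f x).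
Proof.
move=> h; rewrite (_ : (fun x => _) = fun x => (-1 : R) *: f x).
  by apply: Ck_scale => //; exact: Ck_cst.
by apply/funext => x; rewrite scaleN1r.
Qed.

(** The derivative of 1/f is -f'/f^2, again built from 1/f, so the induction on the order closes. *)
Lemma Ck_inv k f : (forall x, f x != 0) -> Ck k f -> Ck k (fun x => (f x)^-1).
Proof.
move=> f0; elim: k => [|k IH] /=.
  by move=> cf x; apply: cvgV => //; exact: cf.
move=> Cf; have [df Df] := Cf; split=> [x|v]; first exact: differentiableV.
rewrite (_ : (fun x => _) = fun x => ((f x)^-1 * (f x)^-1) *: - 'd f x v).
  apply: Ck_scale; last by apply: Ck_opp; exact: Df.
  by apply: Ck_mul; apply: IH; exact: CkS.
apply/funext => x; rewrite diffV//=.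
by rewrite /GRing.scale /= -expr2 exprVn mulrN mulNr.
Qed.

Lemma smooth_inv f : (forall x, f x != 0) -> smooth f ->
  smooth (fun x => (f x)^-1).
Proof. by move=> f0 sf k; exact: Ck_inv. Qed.

Lemma smooth_opp (W : normedModType R) (f : V -> W) :
  smooth f -> smooth (fun x => - f x).
Proof. by move=> sf k; exact: Ck_opp. Qed.

Lemma smooth_prod (K : finType) (P : pred K) (F : K -> V -> R) :
  (forall i, smooth (F i)) -> smooth (fun x => \prod_(i | P i) F i x).
Proof.
move=> h; rewrite (_ : (fun x => _) = \prod_(i | P i) F i).
  apply: (big_ind (fun f : V -> R => smooth f)) => //; first by move=> k; exact: (@Ck_cst _ _ _ k (1 : R)).
  by move=> ? ? ? ?; exact: smooth_mul.
by apply/funext => x; elim/big_rec2: _ => // i y1 y2 _ ->.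
Qed.

Lemma smooth_sum (W : normedModType R) (K : finType) (F : K -> V -> W) :
  (forall i, smooth (F i)) -> smooth (fun x => \sum_i F i x).
Proof. by move=> h k; apply: Ck_fsum => i; exact: h. Qed.

End SmoothAlgebra.

(** * Flat functions *)

Section Bump.
Variable R : realType.

(* x^-n e^(-1/x), extended by 0 to x <= 0. *)
Definition flat (n : nat) (x : R) : R :=
  if 0 < x then x^-1 ^+ n * expR (- x^-1) else 0.

Lemma flat_ge0 n x : 0 <= flat n x.
Proof.
rewrite /flat; case: ifP => // x0.
by rewrite mulr_ge0 ?expR_ge0// exprn_ge0// invr_ge0 ltW.
Qed.

Lemma flat_gt0 n x : 0 < x -> 0 < flat n x.
Proof. by move=> x0; rewrite /flat x0 mulr_gt0 ?expR_gt0// exprn_gt0// invr_gt0. Qed.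

Lemma flat_le0 n x : x <= 0 -> flat n x = 0.
Proof. by move=> x0; rewrite /flat ltNge x0. Qed.

Lemma flat_mulX n x : flat n.+1 x * x = flat n x.
Proof.
rewrite /flat; case: ifP => x0; last by rewrite mul0r.
by rewrite exprSr -!mulrA (mulrCA x^-1) mulVf ?mulr1// gt_eqF.
Qed.

(** With y = 1/x this is y <= n e^(y/n) raised to the n-th power. Together with [flat_mulX] it makes
    every [flat n] vanish at least linearly at 0. *)
Lemma flat_bounded n x : flat n x <= n%:R ^+ n.
Proof.
rewrite /flat; case: ifP => x0; last by rewrite exprn_ge0.
set y := x^-1; have y0 : 0 <= y by rewrite invr_ge0 ltW.
rewrite expRN ler_pdivrMr ?expR_gt0//.
case: n => [|n]; first by rewrite !expr0 mul1r -[leLHS]expR0 ler_expR.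
have -> : expR y = expR (y / n.+1%:R) ^+ n.+1.
  by rewrite -expRM_natl mulrCA mulfV ?mulr1.
rewrite -exprMn; apply: lerXn2r; rewrite ?nnegrE//.
rewrite mulrC -ler_pdivrMr//.
by apply: le_trans (expR_ge1Dx _); rewrite lerDr.
Qed.

(** The index n is there to make the family stable under differentiation; one induction on the order
    then gives smoothness of all its members. *)
Lemma is_derive_flat n x :
  is_derive x (1 : R) (flat n) (flat n.+2 x - n%:R * flat n.+1 x).
Proof.
have [x0|x0|->] := ltgtP x 0.
- rewrite !flat_le0 ?ltW// mulr0 subr0.
  apply: (@near_eq_is_derive _ _ _ (cst 0)) => //.
  near=> y; rewrite flat_le0// ltW//; near: y; exact: lt_nbhsl.
- pose g (y : R) := y^-1 ^+ n * expR (- y^-1).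
  have xn : x != 0 by rewrite gt_eqF.
  apply: (@near_eq_is_derive _ _ _ g) => //.
    near=> y; rewrite /flat ifT//; near: y; exact: lt_nbhsr.
  have dV : is_derive x (1 : R) (fun y : R => y^-1) (- x ^- 2).
    by have := is_deriveV xn (is_derive_id x 1); rewrite scaler1.
  have dE : is_derive x (1 : R) (fun y : R => expR (- y^-1)) (expR (- x^-1) * x ^- 2).
    have dN := is_deriveN dV; rewrite opprK in dN.
    exact: (@is_derive1_comp _ expR (fun y : R => - y^-1)).
  have := is_deriveM (is_deriveX n dV) dE.
  have -> : (fun y : R => y^-1) ^+ n * (fun y : R => expR (- y^-1)) = g.
    by apply/funext => y; rewrite /g /= mulrfctE exprfctE.
  move=> h; apply: (@is_derive_eq _ _ _ _ _ _ _ _ h).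
  rewrite /flat x0 /GRing.scale /= -exprVn exprfctE {h}/g {g}.
  by case: n => [|n]; rewrite /= ?mul0r ?expr0 ?exprS; ring.
- have bd k y : `|flat k.+1 y| <= k.+2%:R ^+ k.+2 * `|y|.
    by rewrite -flat_mulX normrM ler_wpM2r// ger0_norm ?flat_ge0// flat_bounded.
  rewrite !flat_le0// mulr0 subr0.
  (* By [flat_mulX] the difference quotient of [flat n] at 0 is [flat n.+1], whose limit 0 is the
     claimed derivative. *)
  apply/is_derive1_caratheodory; exists (flat n.+1); split.
  + by move=> z; rewrite subr0 (flat_le0 _ (lexx 0)) subr0 flat_mulX.
  + suff h : flat n.+1 @ (0 : R) --> (0 : R).
      by move: h; rewrite -[X in _ --> X](flat_le0 n.+1 (lexx 0)).
    apply/cvgr0Pnorm_lt => eps e0.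
    pose C : R := n.+2%:R ^+ n.+2.
    have C0 : 0 < C by rewrite exprn_gt0.
    near=> y; apply: le_lt_trans (bd n y) _.
    rewrite mulrC -ltr_pdivlMr//; near: y; exact: (@nbhs0_lt R R^o _ (divr_gt0 e0 C0)).
  + by rewrite flat_le0.
Unshelve. all: by end_near.
Qed.

Lemma diff_is_derive (W : normedModType R) (f : R -> W) (x v : R) df :
  is_derive x 1 f df -> differentiable f x /\ 'd f x v = v *: df.
Proof.
move=> h; have d : differentiable f x by apply/derivable1_diffP.
by split=> //; rewrite diff1E// derive1E derive_val.
Qed.

Lemma smooth_flat n : smooth (flat n : R -> R).
Proof.
move=> k; elim: k n => [|k IH] n.
  move=> x; have [d _] := diff_is_derive 1 (is_derive_flat n x).
  exact: differentiable_continuous.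
split=> [x|v]; first by have [] := diff_is_derive 1 (is_derive_flat n x).
rewrite (_ : (fun x => _) =
    fun x => v *: (flat n.+2 x + (- n%:R) *: flat n.+1 x)).
  apply: Ck_scale; first exact: Ck_cst.
  by apply: Ck_add => //; apply: Ck_scale => //; exact: Ck_cst.
apply/funext => x; have [_ ->] := diff_is_derive v (is_derive_flat n x).
by congr (_ *: (_ + _)); rewrite -mulNr.
Qed.

Definition frameR : frame R^o.
Proof.
apply: (@Frame R R^o unit (fun=> (idfun : {linear R^o -> R})) (fun=> 1)).
- by move=> _ x; exact: cvg_id.
- by move=> w; rewrite big_const cardT enumT unlock /= addr0 /GRing.scale /= mulr1.
Defined.

Lemma smooth_flat_comp (V : normedModType R) n (f : V -> R) :
  smooth f -> smooth (fun x => flat n (f x)).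
Proof.
by move=> sf k; apply: (@Ck_comp_frame _ _ frameR _ _ k (flat n) f) => //; exact: smooth_flat.
Qed.

(* 1/q is replaced near q = 0 by q / (q^2 + a bump). *)
Lemma local_inverse (V : normedModType R) (q : V -> R) w0 : smooth q -> q w0 != 0 ->
  exists2 r : V -> R, smooth r & \forall w \near w0, q w * r w = 1.
Proof.
move=> sq q0; pose eps := q w0 ^+ 2 / 2.
have e0 : 0 < eps by rewrite divr_gt0// exprn_even_gt0.
pose den w := q w * q w + flat 0 (eps - q w * q w).
have sd : smooth den.
  apply: smooth_add; first exact: smooth_mul.
  apply: smooth_flat_comp; apply: smooth_add; first exact: smooth_cst.
  by apply: smooth_opp; exact: smooth_mul.
have d0 w : den w != 0.
  rewrite gt_eqF// /den; have [->|qw] := eqVneq (q w) 0.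
    by rewrite mul0r add0r subr0 flat_gt0.
  by rewrite ltr_pwDl ?flat_ge0// -expr2 exprn_even_gt0.
exists (fun w => q w * (den w)^-1).
  by apply: smooth_mul => //; exact: smooth_inv.
have cq : (fun w => q w * q w) @ w0 --> q w0 * q w0.
  by have := smooth_mul sq sq 0; apply.
near=> w.
have : eps < q w * q w.
  near: w; apply: (cvgr_gt _ cq).
  by rewrite /eps -expr2 ltr_pdivrMr// ltr_pMr ?ltr1n// exprn_even_gt0.
move=> ew; rewrite mulrA.
have dE : den w = q w * q w by rewrite /den flat_le0 ?addr0// subr_le0 ltW.
by rewrite -dE mulfV.
Unshelve. all: by end_near.
Qed.

End Bump.

(** * Hadamard's lemma *)

Section Hadamard.
Variable R : realType.

Lemma antiderivative (f : R -> R) : continuous f ->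
  exists P : R -> R, forall x : R, 0 <= x <= 1 -> is_derive x (1 : R) P (f x).
Proof.
move=> cf.
(* The lower limit -1 and integrability up to 2 put 0 and 1 in the interior, where the fundamental
   theorem gives two-sided derivatives. *)
pose P x := (\int[lebesgue_measure]_(t in [set` Interval (BLeft (-1 : R)) (BRight x)]) f t)%R.
exists P => x /andP[x0 x1].
have int : lebesgue_measure.-integrable [set` Interval (BLeft (-1 : R)) (BRight (2 : R))] (EFin \o f).
  apply: continuous_compact_integrable; first exact: segment_compact.
  by apply: continuous_subspaceT.
have x2 : x < 2 by apply: le_lt_trans x1 _; rewrite ltr1n.
have ax : -1 < x.
  by apply: lt_le_trans x0; rewrite oppr_lt0.
have [d e] := @continuous_FTC1_closed R f (-1) x 2 x2 int ax (cf x).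
have dP : derivable P x (1 : R) := d.
have eP : derive1 P x = f x := e.
by apply: (DeriveDef dP); rewrite derive1E in eP.
Qed.

(** The integral over [0, 1], encoded by a chosen antiderivative: additivity is then immediate and
    bounds follow from the mean value theorem. For continuous [f] the choice is a true
    antiderivative. *)
Definition int01 (f : R -> R) : R :=
  let P := xget (fun=> 0) [set P : R -> R |
    forall x : R, 0 <= x <= 1 -> is_derive x (1 : R) P (f x)] in P 1 - P 0.

Lemma is_derive_MVT (f df : R -> R) (a b : R) : a < b ->
  (forall x : R, a <= x <= b -> is_derive x (1 : R) f (df x)) ->
  exists2 c, a < c < b & f b - f a = df c * (b - a).
Proof.
move=> ab h; have [||c hc e] := @MVT R f df a b ab.
- by move=> x /[!in_itv] /= /andP[? ?]; apply: h; rewrite !ltW.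
- apply: continuous_in_subspaceT => x; rewrite inE /= in_itv /= => hx.
  apply: differentiable_continuous; apply/derivable1_diffP.
  by have := h x hx; case.
- by exists c => //; move: hc; rewrite in_itv.
Qed.

Lemma int01P (f P : R -> R) :
  (forall x : R, 0 <= x <= 1 -> is_derive x (1 : R) P (f x)) -> int01 f = P 1 - P 0.
Proof.
move=> hP; rewrite /int01; set S := (X in xget _ X); set Q := xget _ S.
have hQ (x : R) : 0 <= x <= 1 -> is_derive x (1 : R) Q (f x).
  by move: x; apply: (@xgetPex _ (fun=> 0) S); exists P.
have h (x : R) : 0 <= x <= 1 -> is_derive x (1 : R) (P - Q) 0.
  by move=> hx; rewrite -(subrr (f x)); apply: is_deriveB; [exact: hP|exact: hQ].
have [c _ /eqP] := is_derive_MVT (ltr01) h.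
rewrite mul0r subr_eq0 => /eqP e.
have : (P - Q) 1 - (P - Q) 0 = 0 by rewrite e subrr.
have E x : (P - Q) x = P x - Q x by [].
by rewrite !E => /eqP; lra.
Qed.

Lemma int01D (f g : R -> R) : continuous f -> continuous g ->
  int01 (fun x => f x + g x) = int01 f + int01 g.
Proof.
move=> /antiderivative[P hP] /antiderivative[Q hQ].
have hPQ (x : R) : 0 <= x <= 1 -> is_derive x (1 : R) (P + Q) (f x + g x).
  by move=> hx; apply: is_deriveD; [exact: hP|exact: hQ].
rewrite (int01P hP) (int01P hQ) (int01P hPQ).
have E x : (P + Q) x = P x + Q x by [].
by rewrite !E; ring.
Qed.

Lemma int01Z a (f : R -> R) : continuous f -> int01 (fun x => a * f x) = a * int01 f.
Proof.
move=> /antiderivative[P hP]; have hZ (x : R) : 0 <= x <= 1 -> is_derive x (1 : R) (a *: P) (a * f x).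
  by move=> hx; apply: is_deriveZ; exact: hP.
by rewrite (int01P hP) (int01P hZ) mulrBr.
Qed.

Lemma int01_bound (f : R -> R) M : continuous f ->
  (forall x : R, 0 <= x <= 1 -> `|f x| <= M) -> `|int01 f| <= M.
Proof.
move=> /antiderivative[P hP] hM; rewrite (int01P hP).
have [c /andP[c0 c1] ->] := is_derive_MVT ltr01 hP.
by rewrite subr0 mulr1 hM// !ltW.
Qed.

Lemma diff_eps (V W : normedModType R) (f : V -> W) (L : {linear V -> W}) x :
  continuous L ->
  (forall eps : R, 0 < eps ->
    \forall h \near (0 : V), `|f (h + x) - f x - L h| <= eps * `|h|) ->
  differentiable f x /\ 'd f x = L :> (V -> W).
Proof.
move=> cL h.
have E : f \o shift x = cst (f x) + L +o_ (0 : V) id.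
  apply/eqaddoP => eps e0; near=> y.
  rewrite (_ : (_ - _) y = f (y + x) - f x - L y); last first.
    by rewrite -[LHS]/(f (y + x) - (f x + L y)) opprD addrA.
  by near: y; exact: h.
have D := diff_unique cL E; split => //.
by apply/diff_locallyP; rewrite D.
Unshelve. all: by end_near.
Qed.

Lemma is_derive_curve (V W : normedModType R) (F : V -> W) (c : R -> V) (s : R) c' :
  differentiable F (c s) -> is_derive s (1 : R) c c' ->
  is_derive s (1 : R) (F \o c) ('d F (c s) c').
Proof.
move=> dF hc; have dc : differentiable c s by apply/derivable1_diffP; case: hc.
have dFc : differentiable (F \o c) s by exact: differentiable_comp.
apply: DeriveDef; first by apply/derivable1_diffP.
rewrite deriveE// (diff_compE (1 : R) dc dF).
by case: (diff_is_derive (1 : R) hc) => _ ->; rewrite scale1r.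
Qed.

Lemma is_derive_line (V : normedModType R) (p u : V) (s : R) :
  is_derive s (1 : R) (fun s => p + s *: u) u.
Proof.
have [d E] := is_diff_scalel s u.
have h : is_derive s (1 : R) (fun s : R => s *: u) u.
  apply: DeriveDef; first exact/derivable1_diffP.
  by rewrite deriveE// E scale1r.
by have := is_deriveD (is_derive_cst p s (1 : R)) h; rewrite add0r.
Qed.

Section Path.
Variables (V : normedModType R) (B : frame V) (w0 : V).
Local Notation co := (fco (f := B)).
Local Notation e := (fe (f := B)).

Let path (w : V) (t : R) : V := w0 + t *: (w - w0).

Let path_cont w : continuous (path w).
Proof. by move=> t; apply: cvgD; [exact: cvg_cst|apply: cvgZr_tmp; exact: cvg_id]. Qed.

(** The weight t^j is there because each differentiation in [w] under the integral sign brings out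
    one more factor t. *)
Definition path_mean (j : nat) (H : V -> R) (w : V) : R :=
  int01 (fun t => t ^+ j * H (path w t)).

Let mean_cont j H w : continuous H -> continuous (fun t : R => t ^+ j * H (path w t)).
Proof.
move=> cH t; apply: cvgM; first exact: exprn_continuous.
by apply: (continuous_comp (f := path w) (g := H)); [exact: path_cont|exact: cH].
Qed.

(** Compactness of the parameter interval makes the continuity of [g] uniform along the segment. *)
Lemma unif_path (g : V -> R) (w : V) eps : continuous g -> 0 < eps ->
  \forall y \near (0 : V), forall t : R, 0 <= t <= 1 ->
    `|g (path w t + y) - g (path w t)| < eps.
Proof.
move=> cg e0.
have /compact_near_coveringP K : compact `[0 : R, 1]%classic := @segment_compact _ _ _.
have := K V (nbhs (0 : V)) (fun y t => `|g (path w t + y) - g (path w t)| < eps).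
move=> /(_ _ _) h; near=> y => t t01.
have : `[0, 1]%classic t by rewrite /= in_itv.
move: t {t01}; near: y; apply: h => t _.
have c1 : {for (t, 0 : V), continuous (fun p : R * V => path w p.1 + p.2)}.
  apply: cvgD; last exact: cvg_snd.
  by apply: continuous_comp; [exact: cvg_fst|exact: path_cont].
have c2 : (fun p : R * V => g (path w p.1 + p.2) - g (path w p.1)) @ (t, 0 : V) --> 0.
  rewrite -[X in _ --> X](subrr (g (path w t))); apply: cvgB.
    rewrite -[X in g X]addr0.
    by apply: (continuous_comp c1); exact: cg.
  have c3 : {for (t, 0 : V), continuous (fun p : R * V => path w p.1)}.
    by apply: continuous_comp; [exact: cvg_fst|exact: path_cont].
  by apply: (continuous_comp c3); exact: cg.
have /cvgr0Pnorm_lt /(_ eps e0) [[A1 A2] [hA1 hA2] sub] := c2.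
by exists (A1, A2) => // -[y1 y2] hy; exact: (sub (y1, y2) hy).
Unshelve. all: by end_near.
Qed.

Lemma path_mean_linear j (H : V -> R) w : Ck 1 H ->
  linear (fun v => path_mean j (fun y => 'd H y v) w : R).
Proof.
move=> [dH CH] a u v; rewrite /path_mean.
have c1 := mean_cont (j := j) (w := w) (CH u).
have c2 := mean_cont (j := j) (w := w) (CH v).
rewrite /GRing.scale /= -int01Z// -int01D//; last first.
  by move=> t; apply: cvgM; [exact: cvg_cst|exact: c1].
by congr int01; apply/funext => t; rewrite linearP /GRing.scale /=; ring.
Qed.

Lemma co_bounded : exists2 M : R, 0 < M & forall k v, `|co k v| <= M * `|v|.
Proof.
suff h : \forall r \near +oo, forall k v, `|co k v| <= r * `|v|.
  have [M M0 hM] := pinfty_ex_gt0 h; by exists M.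
apply: filter_forall => k; apply/linear_boundedP.
apply: continuous_linear_bounded; exact: fco_cont.
Qed.

(** Differentiation under the integral sign. The mean value theorem replaces the increment of [H] by
    a differential at a nearby point, and uniform continuity of the partial derivatives along the
    path bounds the error. *)
Lemma path_mean_diff j (H : V -> R) w : Ck 1 H ->
  differentiable (path_mean j H) w /\
  forall v, 'd (path_mean j H) w v = path_mean j.+1 (fun y => 'd H y v) w.
Proof.
move=> CH; have [dH cH] := CH.
pose L : {linear V -> R} := HB.pack (fun v => path_mean j.+1 (fun y => 'd H y v) w)
  (GRing.isLinear.Build _ _ _ _ _ (path_mean_linear j.+1 w CH)).
have LE v : L v = path_mean j.+1 (fun y => 'd H y v) w by [].
suff [D E] : differentiable (path_mean j H) w /\ 'd (path_mean j H) w = L :> (V -> R).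
  by split=> // v; rewrite E.
have cL : continuous L.
  rewrite (_ : (L : V -> R) = fun v => \sum_k co k v *: L (e k)).
    apply: (@Ck_fsum _ _ _ _ 0) => k; apply: (@Ck_scale _ _ _ 0).
      exact: (@Ck_co _ _ B 0).
    exact: (@Ck_cst _ _ _ 0).
  by apply/funext => v; rewrite {1}(frameE B v) linear_sum; apply: eq_bigr => k _; rewrite linearZ.
apply: diff_eps => // eps e0.
have cHc : continuous H by move=> x; exact: differentiable_continuous.
have [M M0 hM] := co_bounded.
(* [M] bounds each coordinate of a vector by M times its norm. The successor of the number of frame
   vectors absorbs the sum over the frame and is positive even for an empty one. *)
pose eps' := eps / (M * #|fidx B|.+1%:R).
have e'0 : 0 < eps' by rewrite divr_gt0// mulr_gt0.
have : \forall y \near (0 : V), forall k (t : R), 0 <= t <= 1 ->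
    `|'d H (path w t + y) (e k) - 'd H (path w t) (e k)| < eps'.
  by apply: filter_forall => k; apply: (unif_path w (cH (e k)) e'0).
move=> /nbhs_norm0P [del /= del0 hdel].
near=> h.
have hd : `|h| < del by near: h; exact: nbhs0_lt.
rewrite /path_mean.
have c1 := mean_cont (j := j) (w := h + w) cHc.
have c2 := mean_cont (j := j) (w := w) cHc.
have c3 := mean_cont (j := j.+1) (w := w) (cH h).
have c4 : continuous (fun t : R => (-1) * (t ^+ j * H (path w t))).
  by move=> t; apply: cvgM; [exact: cvg_cst|exact: c2].
have c5 : continuous (fun t : R => (-1) * (t ^+ j.+1 * 'd H (path w t) h)).
  by move=> t; apply: cvgM; [exact: cvg_cst|exact: c3].
have c6 : continuous (fun t : R => t ^+ j * H (path (h + w) t) + (-1) * (t ^+ j * H (path w t))).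
  by move=> t; apply: cvgD; [exact: c1|exact: c4].
have -> : int01 (fun t => t ^+ j * H (path (h + w) t)) - int01 (fun t => t ^+ j * H (path w t))
   - int01 (fun t => t ^+ j.+1 * 'd H (path w t) h) =
   int01 (fun t => t ^+ j * H (path (h + w) t) + (-1) * (t ^+ j * H (path w t))
     + (-1) * (t ^+ j.+1 * 'd H (path w t) h)).
  by rewrite int01D// int01D// int01Z// int01Z//; ring.
apply: int01_bound.
  by move=> t; apply: cvgD; [exact: c6|exact: c5].
move=> t /andP[t0 t1].
have t01 : 0 <= t <= 1 by rewrite t0.
have tj : `|t ^+ j| <= 1 by rewrite normrX ger0_norm// exprn_ile1.
have E : path (h + w) t = path w t + (1 : R) *: (t *: h).
  by rewrite /path scale1r -!addrA -scalerDr (addrC (w - w0)).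
have pc : continuous (fun s : R => path w t + s *: (t *: h)).
  by move=> s; apply: cvgD; [exact: cvg_cst|apply: cvgZr_tmp; exact: cvg_id].
have [||c ] := @MVT_segment R (fun s => H (path w t + s *: (t *: h)))
  (fun s => 'd H (path w t + s *: (t *: h)) (t *: h)) 0 1 ler01.
- move=> s _; apply: (@is_derive_curve _ _ H (fun s => path w t + s *: (t *: h))) => //.
  exact: is_derive_line.
- apply: continuous_subspaceT => s.
  exact: (continuous_comp (pc s) (cHc _)).
rewrite in_itv /= => /andP[c0 c1'].
rewrite -E scale0r addr0 subr0 mulr1; set q := path w t + c *: (t *: h) => mv.
have -> : t ^+ j * H (path (h + w) t) + -1 * (t ^+ j * H (path w t)) +
    -1 * (t ^+ j.+1 * 'd H (path w t) h) =
    t ^+ j * \sum_k co k (t *: h) * ('d H q (e k) - 'd H (path w t) (e k)).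
  transitivity (t ^+ j * ('d H q (t *: h) - 'd H (path w t) (t *: h))).
    have lz : 'd H (path w t) (t *: h) = t * 'd H (path w t) h by rewrite linearZ.
    by rewrite -mv lz exprSr; ring.
  rewrite (diff_frame B H q) (diff_frame B H (path w t)) -sumrB; congr (_ * _).
  by apply: eq_bigr => k _; rewrite -scalerBr.
rewrite normrM; apply: le_trans (ler_piMl _ tj) _ => //.
apply: le_trans (ler_norm_sum _ _ _) _.
have th : `|t *: h| <= `|h| by rewrite normrZ ler_piMl// ger0_norm.
apply: (@le_trans _ _ (\sum_(k : fidx B) (M * `|h|) * eps')).
  apply: ler_sum => k _; rewrite normrM ler_pM//.
    by apply: le_trans (hM _ _) _; rewrite ler_pM2l.
  apply/ltW/hdel => //=; rewrite normrZ ger0_norm//.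
  by apply: le_lt_trans hd; apply: le_trans th; rewrite ler_piMl.
rewrite sumr_const -mulr_natr /eps'.
have K0 : (0 : R) < #|fidx B|.+1%:R by [].
have -> : M * `|h| * (eps / (M * #|fidx B|.+1%:R)) * #|fidx B|%:R
   = (eps * `|h|) * (#|fidx B|%:R / #|fidx B|.+1%:R).
  by field; rewrite ?gt_eqF.
rewrite ler_piMr ?mulr_ge0 ?(ltW e0)// ler_pdivrMr// mul1r ler_nat.
exact: leqnSn.
Unshelve. all: by end_near.
Qed.

Lemma path_mean_Ck k j (H : V -> R) : Ck k.+1 H -> Ck k (path_mean j H).
Proof.
elim: k j H => [|k IH] j H CH.
  by move=> w; apply: differentiable_continuous; have [] := path_mean_diff j w CH.
have C1 : Ck 1 H by elim: k.+1 CH {IH} => // n IHn /CkS.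
split=> [w|v]; first by have [] := path_mean_diff j w C1.
rewrite (_ : (fun x => _) = path_mean j.+1 (fun y => 'd H y v)).
  by apply: IH; case: CH => _; apply.
by apply/funext => w; have [_ ->] := path_mean_diff j w C1.
Qed.

(** Integrate the derivative of t |-> F(w0 + t (w - w0)) and expand it in the frame: the coefficient
    functions are the means of the partial derivatives along the segment. *)
Lemma hadamard (F : V -> R) : smooth F ->
  exists Fk : fidx B -> V -> R, [/\ forall k, smooth (Fk k),
    forall w, F w = F w0 + \sum_k co k (w - w0) * Fk k w
    & forall k, Fk k w0 = 'd F w0 (e k)].
Proof.
move=> sF; exists (fun k => path_mean 0 (fun y => 'd F y (e k))).
have dF x : differentiable F x := smooth_diff x sF.
have sdF k : smooth (fun y => 'd F y (e k)).
  by move=> n; have [_] := sF n.+1; apply.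
have cdF k : continuous (fun y => 'd F y (e k)) := sdF k 0.
split.
- by move=> k n; apply: path_mean_Ck; exact: sdF.
- move=> w.
  have h (t : R) : 0 <= t <= 1 -> is_derive t (1 : R) (fun t => F (path w t))
      (\sum_k co k (w - w0) * 'd F (path w t) (e k)).
    move=> _; have := is_derive_curve (dF (path w t)) (is_derive_line w0 (w - w0) t).
    by rewrite (diff_frame B).
  have := int01P h.
  rewrite /path scale1r scale0r addr0 (addrC w0) subrK => E.
  apply/eqP; rewrite addrC -subr_eq -E; apply/eqP.
  rewrite /path_mean.
  have S (s : seq (fidx B)) : continuous (fun t => \sum_(k <- s) co k (w - w0) * 'd F (path w t) (e k)) /\
    int01 (fun t => \sum_(k <- s) co k (w - w0) * 'd F (path w t) (e k)) =
    \sum_(k <- s) co k (w - w0) * int01 (fun t => t ^+ 0 * 'd F (path w t) (e k)).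
    elim: s => [|k s [IHc IH]].
      rewrite big_nil (_ : (fun t => _) = fun=> 0 * 0); last first.
        by apply/funext => t; rewrite big_nil mul0r.
      by split; [move=> t; exact: cvg_cst|rewrite int01Z ?mul0r// => t; exact: cvg_cst].
    have c1 : continuous (fun t => co k (w - w0) * 'd F (path w t) (e k)).
      move=> t; apply: cvgM; first exact: cvg_cst.
      have pt : {for t, continuous (path w)} by exact: path_cont.
      exact: (continuous_comp pt (cdF k (path w t))).
    rewrite big_cons (_ : (fun t => \sum_(k0 <- k :: s) _) = fun t =>
       co k (w - w0) * 'd F (path w t) (e k) +
       \sum_(k <- s) co k (w - w0) * 'd F (path w t) (e k)); last first.
      by apply/funext => t; rewrite big_cons.
    split; first by move=> t; apply: cvgD; [exact: c1|exact: IHc].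
    rewrite int01D// IH; congr (_ + _).
    have c2 := mean_cont (j := 0) (w := w) (cdF k).
    rewrite -int01Z//.
    by congr int01; apply/funext => t; rewrite expr0 mul1r.
  by have [_ ->] := S (index_enum _).
- move=> k; rewrite /path_mean.
  have h (t : R) : 0 <= t <= 1 -> is_derive t (1 : R)
     (fun t => 0 + t *: ('d F w0 (e k) : R)) (t ^+ 0 * 'd F (path w0 t) (e k)).
    move=> _; rewrite /path subrr scaler0 addr0 expr0 mul1r; exact: is_derive_line.
  by rewrite (int01P h) !add0r scale1r scale0r subr0.
Qed.
End Path.
End Hadamard.

(** * The matrix exponential *)

Section MatrixExp.
Variable R : realType.

(** A growth condition that termwise differentiation preserves and that makes the power series
    converge everywhere. *)
Definition exp_type (c : R ^nat) := exists C K : R,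
  [/\ 0 <= C, 0 <= K & forall k, `|c k| <= C * (K ^+ k / k`!%:R)].

Lemma exp_type_cvg c x : exp_type c -> cvgn (pseries c x).
Proof.
move=> [C [K [C0 K0 h]]]; apply: normed_cvg.
apply: (@series_le_cvg _ _ (fun k => C * exp_coeff (K * `|x|) k)).
- by move=> k; exact: normr_ge0.
- by move=> k; rewrite mulr_ge0// exp_coeff_ge0// mulr_ge0.
- move=> k; rewrite /exp_coeff /= normrM normrX exprMn.
  rewrite mulrAC mulrA ler_wpM2r ?exprn_ge0//.
- rewrite (_ : series _ = fun n => C * series (exp_coeff (K * `|x|)) n).
    by apply: is_cvgMl_tmp; exact: is_cvg_series_exp_coeff.
  by apply/funext => n; rewrite /series /= mulr_sumr.
Qed.

Lemma exp_type_diffs c : exp_type c -> exp_type (pseries_diffs c).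
Proof.
move=> [C [K [C0 K0 h]]]; exists (C * K), K; split=> // [|k]; first exact: mulr_ge0.
rewrite /pseries_diffs normrM ger0_norm//.
apply: (@le_trans _ _ (k.+1%:R * (C * (K ^+ k.+1 / (k.+1)`!%:R)))).
  by rewrite ler_wpM2l.
rewrite factS natrM exprS le_eqVlt; apply/orP; left; apply/eqP.
have k1 : k.+1%:R != 0 :> R by rewrite pnatr_eq0.
have k2 : k`!%:R != 0 :> R by rewrite pnatr_eq0 -lt0n fact_gt0.
move: (k.+1%:R : R) (k`!%:R : R) k1 k2 => a b a0 b0.
by field; rewrite ?a0 ?b0.
Qed.

Lemma exp_type_derive c x : exp_type c ->
  is_derive x (1 : R) (fun y : R => limn (pseries c y))
    (limn (pseries (pseries_diffs c) x)).
Proof.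
move=> h; have h1 := exp_type_diffs h; have h2 := exp_type_diffs h1.
apply: (@pseries_snd_diffs _ _ (`|x| + 1)); try exact: exp_type_cvg.
by rewrite [ltRHS]ger0_norm ?addr_ge0// ltrDl.
Qed.

Lemma cvg_fsum (K : finType) (f : K -> R ^nat) (a : K -> R) :
  (forall l, f l @ \oo --> a l) -> (fun k => \sum_l f l k) @ \oo --> \sum_l a l.
Proof.
move=> h; elim: (index_enum K) => [|l s IH].
  rewrite big_nil (_ : (fun k => _) = fun=> 0); first exact: cvg_cst.
  by apply/funext => k; rewrite big_nil.
rewrite big_cons (_ : (fun k => _) = fun k => f l k + \sum_(l <- s) f l k).
  by apply: cvgD => //; exact: h.
by apply/funext => k; rewrite big_cons.
Qed.

Lemma lim_pseries_sum n (a : 'I_n -> R) (c : 'I_n -> R ^nat) x :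
  (forall l, exp_type (c l)) ->
  limn (pseries (fun k => \sum_l a l * c l k) x) = \sum_l a l * limn (pseries (c l) x).
Proof.
move=> h; apply/cvg_lim => //.
rewrite (_ : pseries _ x = fun N => \sum_l a l * pseries (c l) x N).
  by apply: cvg_fsum => l; apply: cvgMl_tmp; exact: exp_type_cvg.
apply/funext => N; rewrite /pseries /series /=.
under [RHS]eq_bigr do rewrite mulr_sumr.
rewrite exchange_big /=; apply: eq_bigr => k _.
by rewrite mulr_suml; apply: eq_bigr => l _; rewrite mulrA.
Qed.

Variables (n : nat) (M : 'M[R]_n.+1).

Definition expmx (t : R) : 'M[R]_n.+1 :=
  \matrix_(i, j) limn (pseries (fun k => (M ^+ k) i j / k`!%:R) t).

Lemma expmx_type i j : exp_type (fun k => (M ^+ k) i j / k`!%:R).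
Proof.
(* This sum dominates every column sum of absolute values, whence |(M ^+ k) i j| <= K^k by
   induction. *)
pose K := \sum_i \sum_j `|M i j|.
have K0 : 0 <= K by apply: sumr_ge0 => *; apply: sumr_ge0.
exists 1, K; split=> // k; rewrite mul1r normrM normfV [`|k`!%:R|]ger0_norm//.
rewrite ler_wpM2r// ?invr_ge0//.
elim: k i j => [|k IH] i j.
  by rewrite expr0 expr0 mxE; case: (_ == _); rewrite ?normr1 ?normr0.
rewrite exprSr mxE; apply: le_trans (ler_norm_sum _ _ _) _.
apply: (@le_trans _ _ (\sum_l K ^+ k * `|M l j|)).
  by apply: ler_sum => l _; rewrite normrM ler_wpM2r.
rewrite -mulr_sumr exprSr ler_wpM2l ?exprn_ge0//.
by apply: ler_sum => l _; rewrite (bigD1 j)//= lerDl sumr_ge0.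
Qed.

Let diffsE i j : pseries_diffs (fun k => (M ^+ k) i j / k`!%:R) =
  fun k => (M ^+ k.+1) i j / k`!%:R.
Proof.
apply/funext => k; rewrite /pseries_diffs factS natrM.
have k1 : k.+1%:R != 0 :> R by rewrite pnatr_eq0.
have k2 : k`!%:R != 0 :> R by rewrite pnatr_eq0 -lt0n fact_gt0.
move: (k.+1%:R : R) (k`!%:R : R) k1 k2 => a b a0 b0.
by field; rewrite ?a0 ?b0.
Qed.

Lemma is_derive_expmxl i j t :
  is_derive t (1 : R) (fun t => expmx t i j) ((M * expmx t) i j).
Proof.
have -> : (M * expmx t) i j =
    \sum_l M i l * limn (pseries (fun k => (M ^+ k) l j / k`!%:R) t).
  by rewrite mxE; apply: eq_bigr => l _; rewrite [expmx t l j]mxE.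
rewrite -(lim_pseries_sum _ _ (c := fun l k => (M ^+ k) l j / k`!%:R)); last first.
  by move=> l; exact: expmx_type.
rewrite (_ : (fun k => _) = pseries_diffs (fun k => (M ^+ k) i j / k`!%:R)).
  rewrite (_ : (fun t => _) = fun t => limn (pseries (fun k => (M ^+ k) i j / k`!%:R) t)).
    exact: exp_type_derive (expmx_type i j).
  by apply/funext => s; rewrite mxE.
rewrite diffsE; apply/funext => k; rewrite exprS mxE mulr_suml.
by apply: eq_bigr => l _; rewrite mulrA.
Qed.

Lemma is_derive_expmxr i j t :
  is_derive t (1 : R) (fun t => expmx t i j) ((expmx t * M) i j).
Proof.
have -> : (expmx t * M) i j =
    \sum_l M l j * limn (pseries (fun k => (M ^+ k) i l / k`!%:R) t).
  by rewrite mxE; apply: eq_bigr => l _; rewrite [expmx t i l]mxE mulrC.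
rewrite -(lim_pseries_sum _ _ (c := fun l k => (M ^+ k) i l / k`!%:R)); last first.
  by move=> l; exact: expmx_type.
rewrite (_ : (fun k => _) = pseries_diffs (fun k => (M ^+ k) i j / k`!%:R)).
  rewrite (_ : (fun t => _) = fun t => limn (pseries (fun k => (M ^+ k) i j / k`!%:R) t)).
    exact: exp_type_derive (expmx_type i j).
  by apply/funext => s; rewrite mxE.
rewrite diffsE; apply/funext => k; rewrite exprSr mxE mulr_suml.
by apply: eq_bigr => l _; rewrite mulrA [M l j * _]mulrC.
Qed.

Lemma expmx0 : expmx 0 = 1.
Proof.
apply/matrixP => i j; rewrite mxE.
apply/cvg_lim => //; apply: cvg_near_cst; near=> N.
have : (0 < N)%N by near: N; exact: nbhs_infty_gt.
move: (N) => [//|N'] _; rewrite /pseries /series /= big_nat_recl//= big1 => [|k _].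
  by rewrite expr0 expr0 fact0 divr1 mulr1 addr0.
by rewrite expr0n mulr0.
Unshelve. all: by end_near.
Qed.

(** The left side has zero derivative in u: [M] comes out on the right of one exponential and on the
    left of the other, with opposite signs. At u = 0 it is the right side. *)
Lemma expmx_shift s u : expmx (s + u) * expmx (- u) = expmx s.
Proof.
have sh (i j : 'I_n.+1) (y : R) : is_derive y (1 : R) (fun u => expmx (s + u) i j)
    ((expmx (s + y) * M) i j).
  have l : is_derive y (1 : R) (fun u : R => s + u) 1.
    by have := is_deriveD (is_derive_cst s y (1 : R)) (is_derive_id y (1 : R)); rewrite add0r.
  by have := is_derive1_comp (is_derive_expmxr i j (s + y)) l; rewrite mulr1.
have ng (i j : 'I_n.+1) (y : R) : is_derive y (1 : R) (fun u => expmx (- u) i j)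
    (- (M * expmx (- y)) i j).
  have l : is_derive y (1 : R) (fun u : R => - u) (- 1) by exact: is_deriveN (is_derive_id y (1 : R)).
  by have := is_derive1_comp (is_derive_expmxl i j (- y)) l; rewrite mulrN1.
apply/matrixP => i j.
have h (x : R) : is_derive x (1 : R) (fun u => (expmx (s + u) * expmx (- u)) i j) 0.
  have D l := is_deriveM (sh i l x) (ng l j x).
  have := is_derive_sum D.
  rewrite (_ : \sum_(l < n.+1) _ = (fun u => (expmx (s + u) * expmx (- u)) i j)); last first.
    by apply/funext => y; rewrite fct_sumE mxE.
  rewrite (_ : \sum_(l < n.+1) _ = (expmx (s + x) * M * expmx (- x)) i j
      - (expmx (s + x) * (M * expmx (- x))) i j).
    by rewrite mulrA subrr.
  rewrite !mxE -sumrB; apply: eq_bigr => l _.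
  by rewrite /GRing.scale /= mulrN addrC [X in X - _]mulrC.
have := is_derive_0_is_cst u 0 h.
by rewrite addr0 oppr0 expmx0 mulr1.
Qed.

Lemma expmxD s t : expmx (s + t) = expmx s * expmx t.
Proof.
have inv u : expmx u * expmx (- u) = 1 by rewrite -{1}[u]add0r expmx_shift expmx0.
have inv' : expmx (- t) * expmx t = 1 by rewrite -{2}[t]opprK inv.
by rewrite -(expmx_shift s t) -mulrA inv' mulr1.
Qed.

End MatrixExp.

(** * Symmetry of second derivatives *)

Section Schwarz.
Variables (R : realType) (V : normedModType R) (F : V -> R).
Hypothesis CF : Ck 2 F.

(** The mean value theorem twice: along u for the increment of [F] in the direction v, then along v
    for the derivative in the direction u. *)
Let mixed_quotient x u v (h : R) : 0 < h ->
  exists s t : R, [/\ 0 <= s <= h, 0 <= t <= h &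
    F (x + h *: u + h *: v) - F (x + h *: u) - F (x + h *: v) + F x =
    h * (h * 'd (fun y => 'd F y u) (x + s *: u + t *: v) v)].
Proof.
move=> h0; have [dF CdF] := CF; have [dG _] := CdF u.
have D (p : V) (s : R) (w : V) :
    is_derive s (1 : R) (fun s => F (p + s *: w)) ('d F (p + s *: w) w).
  exact: (is_derive_curve (dF _) (is_derive_line p w s)).
pose p (s : R) := F (x + h *: v + s *: u) - F (x + s *: u).
have dp (s : R) : 0 <= s <= h -> is_derive s (1 : R) p
    ('d F (x + h *: v + s *: u) u - 'd F (x + s *: u) u).
  by move=> _; exact: is_deriveB.
have [s /andP[s0 sh] e1] := is_derive_MVT h0 dp.
pose q (t : R) := 'd F (x + s *: u + t *: v) u.
have dq (t : R) : 0 <= t <= h -> is_derive t (1 : R) q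
    ('d (fun y => 'd F y u) (x + s *: u + t *: v) v).
  by move=> _; exact: (is_derive_curve (dG _) (is_derive_line (x + s *: u) v t)).
have [t /andP[t0 th] e2] := is_derive_MVT h0 dq.
exists s, t; split; rewrite ?ltW//.
move: e1 e2; rewrite /p /q !scale0r !addr0 !subr0 (addrAC x (h *: v)) (addrAC x (h *: v)).
move=> e1 e2; have -> X : h * (h * X) = X * h * h by ring.
by rewrite -e2 -e1; ring.
Qed.

(** The second difference is symmetric in u and v, so [mixed_quotient] equates the two mixed
    derivatives at points arbitrarily close to x; continuity then equates them at x. *)
Lemma schwarz x u v :
  'd (fun y => 'd F y u) x v = 'd (fun y => 'd F y v) x u.
Proof.
have [dF CdF] := CF.
have cH a b : continuous (fun y => 'd (fun y => 'd F y a) y b).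
  by have [_] := CdF a; apply.
apply: contrapT => /eqP ne.
set a := 'd _ x v in ne; set b := 'd _ x u in ne.
pose eps := `|a - b| / 2.
have e0 : 0 < eps by rewrite divr_gt0// normr_gt0 subr_eq0.
have near_val c d : exists2 del : R, 0 < del & forall y : V, `|y| < del ->
    `|'d (fun y => 'd F y c) x d - 'd (fun y => 'd F y c) (x + y) d| < eps.
  have /cvgrPdist_lt /(_ eps e0) := cH c d x.
  move=> /nbhs0P /nbhs_norm0P [del /= d0 hd]; by exists del.
have [d1 d10 h1] := near_val u v; have [d2 d20 h2] := near_val v u.
pose del := Num.min d1 d2; pose N := `|u| + `|v| + 1.
have N0 : 0 < N by rewrite ltr_wpDl// addr_ge0.
pose h := del / N.
have h0 : 0 < h by rewrite divr_gt0// lt_min d10.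
have small (s t : R) : 0 <= s <= h -> 0 <= t <= h -> `|s *: u + t *: v| < del.
  move=> /andP[s0 sh] /andP[t0 th]; apply: le_lt_trans (ler_normD _ _) _.
  rewrite !normrZ !ger0_norm//.
  have -> : del = h * N by rewrite /h divfK// gt_eqF.
  apply: (@le_lt_trans _ _ (h * `|u| + h * `|v|)).
    by rewrite lerD// ler_wpM2r.
  by rewrite -mulrDr ltr_pM2l// ltrDl.
have [s1 [t1 [hs1 ht1 e1]]] := mixed_quotient x u v h0.
have [s2 [t2 [hs2 ht2 e2]]] := mixed_quotient x v u h0.
have E : 'd (fun y => 'd F y u) (x + (s1 *: u + t1 *: v)) v =
    'd (fun y => 'd F y v) (x + (t2 *: u + s2 *: v)) u.
  apply: (mulfI (lt0r_neq0 h0)); apply: (mulfI (lt0r_neq0 h0)).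
  rewrite addrA -e1 (addrC (t2 *: u)) addrA -e2.
  by rewrite (addrAC x (h *: v)); ring.
have i1 : `|s1 *: u + t1 *: v| < d1.
  by apply: lt_le_trans (small _ _ hs1 ht1) _; rewrite ge_min lexx.
have i2 : `|t2 *: u + s2 *: v| < d2.
  by apply: lt_le_trans (small _ _ ht2 hs2) _; rewrite ge_min lexx orbT.
move: i1 i2 => /h1 i1 /h2 i2.
have : `|a - b| < eps + eps.
  rewrite -[a - b](subrKA ('d (fun y => 'd F y u) (x + (s1 *: u + t1 *: v)) v)).
  apply: le_lt_trans (ler_normD _ _) _; apply: ltrD => //.
  by rewrite E distrC.
by rewrite /eps -splitr ltxx.
Qed.

End Schwarz.

(** * Jets as codes of affine maps *)

Section Jets.
Variables (R : realType) (m : nat).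
Notation V := 'cV[R]_m.
Notation E := ('cV[R]_m * 'M[R]_m)%type.

Fact cvco_linear i : linear (fun u : V => u i 0 : R).
Proof. by move=> a u v; rewrite !mxE. Qed.
Definition cvco i : {linear V -> R} :=
  HB.pack (fun u : V => u i 0 : R) (GRing.isLinear.Build _ _ _ _ _ (cvco_linear i)).

Definition frameV : frame V.
Proof.
apply: (@Frame R V 'I_m cvco (fun i => delta_mx i 0)).
- by move=> i; exact: coord_continuous.
- by move=> w; rewrite {1}(colvE w).
Defined.

Definition jidx := ('I_m + 'I_m * 'I_m)%type.
Definition jcof (k : jidx) (w : E) : R :=
  match k with inl i => w.1 i 0 | inr p => w.2 p.1 p.2 end.
Fact jcof_linear k : linear (jcof k).
Proof. by move=> a u v; case: k => [i|p] /=; rewrite !mxE. Qed.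
Definition jco k : {linear E -> R} :=
  HB.pack (jcof k) (GRing.isLinear.Build _ _ _ _ _ (jcof_linear k)).
Definition je (k : jidx) : E :=
  match k with inl i => (delta_mx i 0, 0) | inr p => (0, delta_mx p.1 p.2) end.

Definition frameJ : frame E.
Proof.
apply: (@Frame R E jidx jco je).
- move=> [i|p] x /=.
  + apply: (continuous_comp (g := fun u : V => u i 0)); first exact: cvg_fst.
    exact: coord_continuous.
  + apply: (continuous_comp (g := fun u : 'M[R]_m => u p.1 p.2)); first exact: cvg_snd.
    exact: coord_continuous.
- move=> [u A]; rewrite big_sumType.
  have h (I : finType) (F : I -> V) (F' : I -> 'M[R]_m) :
      \sum_i ((F i, F' i) : E) = (\sum_i F i, \sum_i F' i).
    by elim/big_rec3: _ => // i y1 y2 y3 _ ->.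
  rewrite [X in _ = X + _](h _ (fun i => u i 0 *: delta_mx i 0) (fun i => u i 0 *: 0)).
  rewrite [X in _ = _ + X](h _ (fun p => A p.1 p.2 *: 0) (fun p => A p.1 p.2 *: delta_mx p.1 p.2)).
  rewrite -[RHS]/((_ + _, _ + _) : E) -colvE.
  rewrite [X in (_ + X, _)]big1 ?[X in (_, X + _)]big1 => [|p _|i _]; rewrite ?scaler0//.
  rewrite addr0 add0r; congr pair.
  by rewrite {1}[A]matrix_sum_delta pair_big.
Defined.

Lemma smooth_jets (U : normedModType R) (f : U -> E) :
  (forall i, smooth (fun x => (f x).1 i 0)) ->
  (forall i j, smooth (fun x => (f x).2 i j)) -> smooth f.
Proof.
by move=> h1 h2 k; apply: (@Ck_frame _ _ frameJ) => -[i|[i j]] /=; [exact: h1|exact: h2].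
Qed.

Lemma smooth_jco k : smooth (jco k : E -> R).
Proof. by move=> n; exact: (@Ck_co _ _ frameJ n k). Qed.

Lemma smooth_fst i : smooth (fun w : E => w.1 i 0).
Proof. exact: (smooth_jco (inl i)). Qed.

Lemma smooth_snd i j : smooth (fun w : E => w.2 i j).
Proof. exact: (smooth_jco (inr (i, j))). Qed.

Lemma smooth_compJ (U W : normedModType R) (f : E -> W) (g : U -> E) :
  smooth f -> smooth g -> smooth (f \o g).
Proof. by move=> sf sg k; apply: (@Ck_comp_frame _ _ frameJ). Qed.

Lemma smooth_compV (U W : normedModType R) (f : V -> W) (g : U -> V) :
  smooth f -> smooth g -> smooth (f \o g).
Proof. by move=> sf sg k; apply: (@Ck_comp_frame _ _ frameV). Qed.

(* Composition of affine maps x |-> A x + b, coded by the pairs (b, A). *)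
Definition aff (w w' : E) : E := (w.1 + w.2 *m w'.1, w.2 *m w'.2).
Definition aff1 : E := (0, 1%:M).
Definition aeval (w : E) (x : V) : V := w.2 *m x + w.1.

Lemma aff1r : right_id aff1 aff.
Proof. by move=> [b A]; rewrite /aff /= mulmx0 mulmx1 addr0. Qed.

Lemma aeval_aff w w' x : aeval (aff w w') x = aeval w (aeval w' x).
Proof. by rewrite /aeval /= mulmxDr mulmxA -addrA (addrC w.1). Qed.

Lemma smooth_aff (U : normedModType R) (f g : U -> E) :
  smooth f -> smooth g -> smooth (fun x => aff (f x) (g x)).
Proof.
move=> sf sg; apply: smooth_jets => i.
  rewrite (_ : (fun x => _) = (fun x => (f x).1 i 0) +
    (fun x => \sum_k ((fun x => (f x).2 i k) * (fun x => (g x).1 k 0)) x)); last first.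
    by apply/funext => x; rewrite /= !mxE.
  apply: smooth_add; first by apply: (smooth_compJ (smooth_fst i) sf).
  apply: smooth_sum => k; apply: smooth_mul.
    exact: (smooth_compJ (smooth_snd i k) sf).
  exact: (smooth_compJ (smooth_fst k) sg).
move=> j; rewrite (_ : (fun x => _) =
  (fun x => \sum_k ((fun x => (f x).2 i k) * (fun x => (g x).2 k j)) x)); last first.
  by apply/funext => x; rewrite /= !mxE.
apply: smooth_sum => k; apply: smooth_mul.
  exact: (smooth_compJ (smooth_snd i k) sf).
exact: (smooth_compJ (smooth_snd k j) sg).
Qed.

Lemma smooth_aeval (w : E) : smooth (aeval w).
Proof.
move=> k; apply: (@Ck_frame _ _ frameV) => i /=.
have -> : (fun x : V => (aeval w x) i 0) =
    (fun x : V => \sum_l w.2 i l *: (x l 0 : R)) + (fun=> w.1 i 0).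
  by apply/funext => x; rewrite !mxE.
apply: Ck_add; last exact: Ck_cst.
apply: Ck_fsum => l; apply: Ck_scale; first exact: Ck_cst.
exact: (@Ck_co _ _ frameV k l).
Qed.

Lemma diff_aeval (w : E) x v : 'd (aeval w) x v = w.2 *m v.
Proof.
have d : differentiable (aeval w) x by exact: smooth_diff (smooth_aeval w).
have h := is_derive_curve (F := aeval w) (c := fun t : R => x + t *: v) (s := 0).
rewrite scale0r addr0 in h.
have /= h1 := h _ d (is_derive_line x v 0).
have h2 : is_derive (0 : R) (1 : R) (aeval w \o (fun t : R => x + t *: v)) (w.2 *m v).
  rewrite (_ : _ \o _ = fun t : R => aeval w x + t *: (w.2 *m v)); first exact: is_derive_line.
  by apply/funext => t; rewrite /aeval /= mulmxDr -scalemxAr addrAC.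
by rewrite -(@derive_val _ _ _ _ _ _ _ h1) (@derive_val _ _ _ _ _ _ _ h2).
Qed.

End Jets.

(** * Affine maps that rescale the invariant of the pseudogroup *)

Section ScalingDef.
Variable R : realType.

(* w multiplies the invariant (volume, symplectic or contact form) of the
   pseudogroup by the constant c. *)
Definition scales m (P : primitive m) : 'cV[R]_m * 'M[R]_m -> R -> Prop :=
  match P in primitive m return 'cV[R]_m * 'M[R]_m -> R -> Prop with
  | General _ _ => fun w c => c = 1
  | Volume _ _ => fun w c => \det w.2 = 1 /\ c = 1
  | ConformalVolume _ _ => fun w c => \det w.2 = c
  | Symplectic n _ => fun w c =>
      (forall u v, omega (w.2 *m u) (w.2 *m v) = omega u v) /\ c = 1
  | ConformalSymplectic n _ => fun w c =>
      forall u v, omega (w.2 *m u) (w.2 *m v) = c * omega u v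
  | Contact n _ => fun w c =>
      forall x v, alpha (aeval w x) (w.2 *m v) = c * alpha x v
  end.

Lemma jac_aeval m (w : 'cV[R]_m * 'M[R]_m) x : jac (aeval w) x = w.2.
Proof.
apply/matrixP => i j; rewrite mxE diff_aeval mxE (bigD1 j)//= big1 ?mxE ?eqxx ?mulr1 ?addr0//.
by move=> k kj; rewrite mxE (negbTE kj) mulr0.
Qed.

Lemma scales_preserves m (P : primitive m) w c : 0 < c -> scales P w c ->
  preserves P (aeval w).
Proof.
case: P w => n hn w c0 /=.
- by [].
- by move=> [h _] x; rewrite jac_aeval.
- by move=> h; exists c => // x; rewrite jac_aeval.
- by move=> [h _] x u v; rewrite !diff_aeval.
- by move=> h; exists c => // x u v; rewrite !diff_aeval.
- by move=> h; exists (fun=> c) => // x v; rewrite diff_aeval.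
Qed.

End ScalingDef.

Section AffineGroup.
Variables (R : realType) (m : nat) (P : primitive m).
Notation V := 'cV[R]_m.
Notation E := ('cV[R]_m * 'M[R]_m)%type.
Notation D := (Diff R P).

Definition affinv (w : E) : E := (- (invmx w.2 *m w.1), invmx w.2).

Lemma affinvl w : w.2 \in unitmx -> aff (affinv w) w = aff1 R m.
Proof. by move=> h; rewrite /aff /affinv /= addNr mulVmx. Qed.

Lemma affinvr w : w.2 \in unitmx -> aff w (affinv w) = aff1 R m.
Proof. by move=> h; rewrite /aff /affinv /= mulmxN mulmxA mulmxV// mul1mx subrr. Qed.

Lemma aeval1 x : aeval (aff1 R m) x = x.
Proof. by rewrite /aeval mul1mx addr0. Qed.

Lemma mkDiff (w : E) c : w.2 \in unitmx -> 0 < c -> scales P w c ->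
  exists phi : D, forall x, phi x = aeval w x.
Proof.
move=> wU c0 sw.
have h : `[< diffeo (aeval w) /\ preserves P (aeval w) >].
  apply/asboolP; split; last exact: scales_preserves sw.
  split; first exact: smooth_aeval.
  exists (aeval (affinv w)); split; first exact: smooth_aeval.
    by move=> x; rewrite -aeval_aff affinvl// aeval1.
  by move=> x; rewrite -aeval_aff affinvr// aeval1.
by exists (MkDiff h).
Qed.

Lemma jet_affine (g : GPi R P) (w : E) : (forall x, g x = aeval w x) -> jet g = w.
Proof.
move=> h; case: w h => b A h; rewrite /jet h /aeval /= mulmx0 add0r; congr pair.
by apply/matrixP => i j; rewrite mxE !h /aeval /= addrK -colE mxE.
Qed.

End AffineGroup.

(** * The forms omega and beta *)

Section FlatOmega.
Variables (R : realType) (n : nat).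
Local Notation W := 'cV[R]_(n + n).

Lemma omega_linl (a : R) (u u' v : W) : omega (a *: u + u') v = a * omega u v + omega u' v.
Proof.
rewrite /omega mulr_sumr -big_split; apply: eq_bigr => i _ /=; rewrite !mxE; ring.
Qed.

Lemma omega_anti (u v : W) : omega u v = - omega v u.
Proof. by rewrite /omega -sumrN; apply: eq_bigr => i _; ring. Qed.

Lemma omega_linr (a : R) (u v v' : W) : omega u (a *: v + v') = a * omega u v + omega u v'.
Proof. by rewrite omega_anti omega_linl opprD -mulrN -!omega_anti. Qed.

Lemma omega0l v : omega (0 : W) v = 0 :> R.
Proof. by rewrite /omega big1// => i _; rewrite !mxE !mul0r subrr. Qed.

Lemma omega0r v : omega v (0 : W) = 0 :> R.
Proof. by rewrite omega_anti omega0l oppr0. Qed.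

Lemma omega_nondeg (v : W) : (forall u, omega u v = 0 :> R) -> v = 0.
Proof.
move=> h; apply/colP => k; rewrite mxE -[k]fintype.splitK; case: (fintype.split k) => i /=.
  have := h (delta_mx (rshift n i) 0); rewrite /omega (bigD1 i)//= big1.
    rewrite !mxE !eqxx eq_lrshift /= mul0r mul1r sub0r addr0 => /eqP.
    by rewrite oppr_eq0 => /eqP.
  move=> j ji; rewrite !mxE eq_lrshift (inj_eq (@rshift_inj _ _)) (negbTE ji) /=.
  by rewrite !mul0r subrr.
have := h (delta_mx (lshift n i) 0); rewrite /omega (bigD1 i)//= big1.
  by rewrite !mxE !eqxx eq_rlshift /= mul0r mul1r subr0 addr0.
move=> j ji; rewrite !mxE eq_rlshift (inj_eq (@lshift_inj _ _)) (negbTE ji) /=.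
by rewrite !mul0r subrr.
Qed.

Lemma beta_nondeg (v : W) : (forall u, beta u v = 0 :> R) -> v = 0.
Proof.
move=> h; apply: omega_nondeg => u; have := h u; rewrite /beta => /eqP.
by rewrite mulf_eq0 invr_eq0 pnatr_eq0 /= => /eqP.
Qed.

Lemma beta_linl (a : R) (u u' v : W) : beta (a *: u + u') v = a * beta u v + beta u' v.
Proof. by rewrite /beta omega_linl; ring. Qed.

Lemma beta_linr (a : R) (u v v' : W) : beta u (a *: v + v') = a * beta u v + beta u v'.
Proof. by rewrite /beta omega_linr; ring. Qed.

Lemma beta0l v : beta (0 : W) v = 0 :> R.
Proof. by rewrite /beta omega0l mulr0. Qed.

Lemma beta0r v : beta v (0 : W) = 0 :> R.
Proof. by rewrite /beta omega0r mulr0. Qed.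

Lemma beta_anti (u v : W) : beta u v = - beta v u.
Proof. by rewrite /beta omega_anti mulrN. Qed.

End FlatOmega.

(** * The contact group as the affine maps that rescale alpha *)

Section ContactAffine.
Variables (R : realType) (n : nat).
Local Notation W := 'cV[R]_(n + n).
Local Notation V := 'cV[R]_(1 + (n + n)).
Local Notation M := 'M[R]_(1 + (n + n)).
Local Notation E := (V * M)%type.

Lemma inj_unitmx k (A : 'M[R]_k) : (forall v : 'cV_k, A *m v = 0 -> v = 0) -> A \in unitmx.
Proof.
move=> h; rewrite -unitmx_tr -row_free_unit -kermx_eq0.
apply/eqP/row_matrixP => i; rewrite row0.
have : row i (kermx A^T) *m A^T = 0 by apply/sub_kermxP; exact: row_sub.
set r := row i _ => rA.
have /h r0 : A *m r^T = 0 by apply: trmx_inj; rewrite trmx_mul trmxK trmx0.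
by rewrite -[r]trmxK r0 trmx0.
Qed.

Lemma linear_matrix k (f : 'cV[R]_k -> 'cV[R]_k) : linear f ->
  exists A : 'M[R]_k, forall v, A *m v = f v.
Proof.
move=> lf; pose F : {linear 'cV[R]_k -> 'cV[R]_k} :=
  HB.pack f (GRing.isLinear.Build _ _ _ _ _ lf).
exists (\matrix_(i, j) f (delta_mx j 0) i 0) => v.
apply/colP => i; rewrite -[f]/(F : _ -> _) {2}(colvE v) linear_sum summxE mxE.
by apply: eq_bigr => j _; rewrite linearZ !mxE mulrC.
Qed.

Lemma dn0 : dsubmx (0 : V) = 0.
Proof. by apply/matrixP => i j; rewrite !mxE. Qed.

Definition up (x : V) : R := usubmx x 0 0.

Lemma up_linear a u v : up (a *: u + v) = a * up u + up v.
Proof. by rewrite /up !mxE. Qed.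

Lemma dn_linear a (u v : V) : dsubmx (a *: u + v) = a *: dsubmx u + dsubmx v.
Proof. by apply/matrixP => i j; rewrite !mxE. Qed.

Lemma colP2 (u v : V) : up u = up v -> dsubmx u = dsubmx v -> u = v.
Proof.
move=> e1 e2; rewrite -[u]vsubmxK -[v]vsubmxK e2; congr col_mx.
by apply/matrixP => i j; rewrite !ord1.
Qed.

Lemma up_col (a : R) (u : W) : up (col_mx a%:M u) = a.
Proof. by rewrite /up col_mxKu mxE eqxx. Qed.

Lemma alphaE (x v : V) : alpha x v = - up v + beta (dsubmx x) (dsubmx v).
Proof. by []. Qed.

Lemma alpha_linear x a (u v : V) : alpha x (a *: u + v) = a * alpha x u + alpha x v.
Proof. by rewrite !alphaE up_linear dn_linear beta_linr; ring. Qed.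

Lemma alpha0r x : alpha x (0 : V) = 0.
Proof. by rewrite alphaE dn0 beta0r /up !mxE oppr0 addr0. Qed.

Definition e0 : V := col_mx 1%:M 0.

Lemma alpha_e0 x : alpha x e0 = -1 :> R.
Proof. by rewrite alphaE up_col col_mxKd beta0r addr0. Qed.

Variable hn : (0 < n)%N.

Section Scale.
Variables (w : E) (c : R).
Hypotheses (c0 : 0 < c) (sw : scales (Contact hn) w c).

(** For v in the kernel, alpha x v = 0 at every point x: x = 0 kills the vertical coordinate, and
    varying x kills the others by nondegeneracy of [beta]. *)
Lemma contact_unit : w.2 \in unitmx.
Proof.
apply: inj_unitmx => v wv.
have h (x : V) : alpha x v = 0.
  have := sw x v; rewrite wv alpha0r => /esym/eqP.
  by rewrite mulf_eq0 gt_eqF// => /eqP.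
have v0 : up v = 0.
  have := h 0; rewrite alphaE dn0 beta0l addr0.
  by move/eqP; rewrite oppr_eq0 => /eqP.
apply: colP2; first by rewrite v0 /up !mxE.
rewrite [RHS]dn0.
apply: beta_nondeg => u; have := h (col_mx 0 u).
by rewrite alphaE v0 oppr0 add0r col_mxKd.
Qed.

(** Subtract the scaling identities at the base points [u] and 0: all that remains is the dependence
    of alpha on the base point, which is [beta]. *)
Lemma contact_scale_beta (u v : V) :
  beta (dsubmx (w.2 *m u)) (dsubmx (w.2 *m v)) = c * beta (dsubmx u) (dsubmx v).
Proof.
have h1 := sw u v; have h2 := sw 0 v.
move: h1 h2; rewrite !alphaE /aeval mulmx0 add0r -[w.2 *m u]scale1r.
rewrite dn_linear beta_linl scale1r mul1r.
rewrite dn0.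
by rewrite beta0l addr0 => h1 h2; apply/eqP; move/eqP: h1; lra.
Qed.

(** Since alpha is -1 on [e0] everywhere, it takes the value -c on [w.2 *m e0] at every point.
    Dependence on the point enters only through [beta], so nondegeneracy kills the horizontal
    part. *)
Lemma contact_scale_e0 : w.2 *m e0 = c *: e0.
Proof.
have wU := contact_unit.
have h (y : V) : - up (w.2 *m e0) + beta (dsubmx y) (dsubmx (w.2 *m e0)) = - c.
  have := sw (invmx w.2 *m (y - w.1)) e0.
  by rewrite alpha_e0 mulrN1 alphaE /aeval mulKVmx// subrK.
have u0 : up (w.2 *m e0) = c.
  have := h 0; rewrite dn0.
  by rewrite beta0l addr0 => /oppr_inj.
apply: colP2; first by rewrite u0 -[c *: e0]addr0 up_linear up_col mulr1 /up !mxE addr0.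
have -> : dsubmx (c *: e0) = 0 by rewrite linearZ /= col_mxKd scaler0.
apply: beta_nondeg => u; have := h (col_mx 0 u); rewrite u0 col_mxKd.
by rewrite -[RHS]addr0 => /addrI.
Qed.

Lemma contact_scale_horizontal (v : V) : up v = 0 ->
  up (w.2 *m v) = beta (dsubmx w.1) (dsubmx (w.2 *m v)).
Proof.
move=> v0; have := sw 0 v; rewrite !alphaE v0 /aeval mulmx0 add0r.
rewrite dn0.
by rewrite beta0l oppr0 addr0 mulr0 addrC => /eqP; rewrite subr_eq0 => /eqP.
Qed.

End Scale.

Definition contact_affine : set (Diff R (Contact hn)) :=
  [set phi | exists w c, [/\ 0 < c, forall x, phi x = aeval w x & scales (Contact hn) w c]].

Lemma contact_affine_subgroup : is_subgroup contact_affine.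
Proof.
split.
- exists (aff1 R _), 1; split=> // [x|x v]; first by rewrite aeval1.
  by rewrite aeval1 mul1mx mul1r.
- move=> f g [w [c [c0 fw sw]]] [w' [c' [c0' gw sw']]].
  exists (aff w w'), (c * c'); split; first exact: mulr_gt0.
    by move=> x; rewrite aeval_aff -gw -fw.
  by move=> x v; rewrite aeval_aff -mulmxA; have := sw (aeval w' x) (w'.2 *m v) => ->; rewrite -mulrA; congr (_ * _); exact: sw'.
- move=> f [w [c [c0 fw sw]]].
  have wU := contact_unit c0 sw.
  exists (affinv w), c^-1; split; first by rewrite invr_gt0.
    move=> x; have [_ K _] := dinvmapP f.
    rewrite -[x in LHS]aeval1 -(affinvr wU) aeval_aff -fw; exact: K.
  move=> x v; apply: (mulfI (lt0r_neq0 c0)); rewrite mulVKf ?gt_eqF//.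
  have := sw (aeval (affinv w) x) (invmx w.2 *m v) => /= <-.
  by rewrite -aeval_aff affinvr// aeval1 mulmxA mulmxV// mul1mx.
Qed.

Lemma contact_mk (b : V) (L : V -> V) c : linear L -> 0 < c ->
  (forall x v, alpha (L x + b) (L v) = c * alpha x v) ->
  exists phi : Diff R (Contact hn), (forall x, phi x = L x + b) /\ contact_affine phi.
Proof.
move=> lL c0 h; have [A AE] := linear_matrix lL.
have sw : scales (Contact hn) (b, A) c by move=> x v; rewrite /aeval /= !AE h.
have [phi phiE] := mkDiff (contact_unit c0 sw) c0 sw.
exists phi; split; first by move=> x; rewrite phiE /aeval /= AE.
by exists (b, A), c.
Qed.

Lemma dnD (u v : V) : dsubmx (u + v) = dsubmx u + dsubmx v.
Proof. by rewrite -{1}[u]scale1r dn_linear scale1r. Qed.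

Lemma upD (u v : V) : up (u + v) = up u + up v.
Proof. by rewrite -{1}[u]scale1r up_linear mul1r. Qed.

Lemma dnZe0 k : dsubmx (k *: e0) = 0.
Proof. by rewrite -[k *: e0]addr0 dn_linear col_mxKd scaler0 dn0 addr0. Qed.

Lemma upZe0 k : up (k *: e0) = k.
Proof. by rewrite -[k *: e0]addr0 up_linear up_col mulr1 /up !mxE addr0. Qed.

Lemma hlawE (a x : V) :
  hlaw a x = (x + beta (dsubmx a) (dsubmx x) *: e0) + a.
Proof.
apply: colP2; last by rewrite col_mxKd !dnD dnZe0 addr0 addrC.
rewrite !upD upZe0 /up col_mxKu !mxE eqxx mulr1n; ring.
Qed.

Let trans_linear (a : V) :
  linear (fun x : V => x + beta (dsubmx a) (dsubmx x) *: e0).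
Proof.
move=> k u v; rewrite dn_linear beta_linr scalerDl -scalerA scalerDr.
by rewrite addrACA.
Qed.

Let trans_scale (a x v : V) :
  alpha ((x + beta (dsubmx a) (dsubmx x) *: e0) + a)
    (v + beta (dsubmx a) (dsubmx v) *: e0) = 1 * alpha x v.
Proof.
rewrite !alphaE !(upD, dnD) !(upZe0, dnZe0) !addr0.
by rewrite -[dsubmx x]scale1r beta_linl scale1r; ring.
Qed.

Let sym_linear (A : 'M[R]_(n + n)) : linear (fun x : V => col_mx (usubmx x) (A *m dsubmx x)).
Proof.
move=> k u v; rewrite dn_linear mulmxDr -scalemxAr linearP /=.
by rewrite scale_col_mx add_col_mx.
Qed.

Let dil_linear (t : R) : linear (fun x : V => col_mx (t ^+ 2 *: usubmx x) (t *: dsubmx x)).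
Proof.
move=> k u v; rewrite dn_linear linearP /= !scalerDr !scalerA.
by rewrite scale_col_mx add_col_mx !scalerA (mulrC k) (mulrC k).
Qed.

Let sym_scale (A : 'M[R]_(n + n)) : (forall v w, beta (A *m v) (A *m w) = beta v w) ->
  forall x v : V, alpha (col_mx (usubmx x) (A *m dsubmx x) + 0)
   (col_mx (usubmx v) (A *m dsubmx v)) = 1 * alpha x v.
Proof. by move=> h x v; rewrite addr0 !alphaE !col_mxKd h /up col_mxKu mul1r. Qed.

Let dil_scale (t : R) (x v : V) :
  alpha (col_mx (t ^+ 2 *: usubmx x) (t *: dsubmx x) + 0)
   (col_mx (t ^+ 2 *: usubmx v) (t *: dsubmx v)) = t ^+ 2 * alpha x v.
Proof.
rewrite addr0 !alphaE !col_mxKd /up col_mxKu mxE.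
rewrite -[t *: dsubmx x]addr0 beta_linl beta0l -[t *: dsubmx v]addr0 beta_linr beta0r.
ring.
Qed.

(** Each generator is affine and rescales alpha by a constant: 1 for translations and symplectic
    maps, t^2 for dilations. *)
Lemma generated_affine : generated (@contact_gens R n hn) `<=` contact_affine.
Proof.
move=> phi; apply; first exact: contact_affine_subgroup.
have ext (f : Diff R (Contact hn)) (L : V -> V) b c : linear L -> 0 < c ->
    (forall x v, alpha (L x + b) (L v) = c * alpha x v) ->
    (forall x, f x = L x + b) -> contact_affine f.
  move=> lL c0 h fL; have [g [gE]] := contact_mk lL c0 h.
  by rewrite (_ : g = f)//; apply: DiffE => x; rewrite gE fL.
move=> f /= [[a h]|[A hA h]|[t t0 h]].
- by apply: (ext f _ a 1 (trans_linear a)) => // x; rewrite h hlawE.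
- apply: (ext f _ 0 1 (sym_linear A)) => // [|x]; first exact: sym_scale.
  by rewrite h addr0.
- apply: (ext f _ 0 (t ^+ 2) (dil_linear t)) => // [|x]; first exact: exprn_gt0.
  by rewrite h addr0.
Qed.

(** [w] is the dilation with t = sqrt c, followed by the symplectic map A = B / t, followed by the
    left translation by [w.1]. The matrix B multiplies [beta] by c, which dictates t. *)
Lemma affine_generated : contact_affine `<=` generated (@contact_gens R n hn).
Proof.
move=> phi [w [c [c0 phiE sw]]].
have e1 := contact_scale_e0 c0 sw.
have hor := contact_scale_horizontal sw.
have hb := contact_scale_beta sw.
pose t := Num.sqrt c.
have t0 : 0 < t by rewrite sqrtr_gt0.
have t2 : t ^+ 2 = c by rewrite sqr_sqrtr// ltW.
pose B : 'M[R]_(n + n) := drsubmx w.2.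
(* As [w.2] maps [e0] to a multiple of itself, its lower left block is zero and B alone gives the
   last coordinates. *)
have BE (v : V) : dsubmx (w.2 *m v) = B *m dsubmx v.
  have dl0 : dlsubmx w.2 = 0.
    have := congr1 dsubmx e1; rewrite dnZe0 -{1}[w.2]submxK mul_block_col col_mxKd.
    by rewrite mulmx1 mulmx0 addr0.
  rewrite -{1}[w.2]submxK -{1}[v]vsubmxK mul_block_col col_mxKd.
  by rewrite dl0 mul0mx add0r.
pose A := t^-1 *: B.
have AB u v : beta (A *m u) (A *m v) = beta u v.
  have := hb (col_mx 0 u) (col_mx 0 v); rewrite !BE !col_mxKd => e.
  rewrite -!scalemxAl -[_ *: (B *m u)]addr0 -[_ *: (B *m v)]addr0.
  rewrite beta_linl beta_linr beta0l beta0r !addr0 e -t2.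
  by field; rewrite gt_eqF.
have [f1 [f1E _]] := contact_mk (trans_linear w.1) ltr01 (trans_scale w.1).
have [f2 [f2E _]] := contact_mk (sym_linear A) ltr01 (sym_scale AB).
have [f3 [f3E _]] := contact_mk (dil_linear t) (exprn_gt0 2 t0) (dil_scale t).
have -> : phi = (f1 * (f2 * f3))%g.
  apply: DiffE => x; rewrite phiE /aeval -[RHS]/(f1 (f2 (f3 x))) f1E; congr (_ + _).
  rewrite f2E f3E !addr0 !col_mxKd !col_mxKu.
  have AtB : A *m (t *: dsubmx x) = B *m dsubmx x.
    by rewrite -scalemxAr -scalemxAl scalerA mulfV ?scale1r ?gt_eqF.
  have u0 : up (col_mx 0 (dsubmx x)) = 0 by rewrite /up col_mxKu mxE.
  have xE : x = up x *: e0 + col_mx 0 (dsubmx x).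
    by apply: colP2; rewrite ?upD ?dnD ?upZe0 ?dnZe0 ?col_mxKd ?u0 ?add0r ?addr0.
  apply: colP2; last by rewrite dnD dnZe0 addr0 BE col_mxKd AtB.
  rewrite {1}xE mulmxDr -scalemxAr e1 scalerA !upD !upZe0 hor// BE col_mxKd AtB.
  by rewrite [up (col_mx _ _)]/up col_mxKu mxE t2 mulrC.
have [_ gM _] := generated_subgroup (@contact_gens R n hn).
apply: (gM); last apply: (gM).
- by move=> H _; apply; apply: Or31; exists w.1 => x; rewrite f1E hlawE.
- by move=> H _; apply; apply: Or32; exists A => // x; rewrite f2E addr0.
- by move=> H _; apply; apply: Or33; exists t => // x; rewrite f3E addr0.
Qed.

End ContactAffine.

(** * Contact maps are conformal on the contact planes *)

Section ContactConformal.
Variables (R : realType) (n : nat).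
Local Notation V := 'cV[R]_(1 + (n + n)).

Lemma diff_cvco k (U : normedModType R) (F : U -> 'cV[R]_k) i y v : differentiable F y ->
  'd (fun z => F z i 0 : R) y v = ('d F y v) i 0.
Proof.
move=> dF; have cl : continuous (cvco R i : 'cV[R]_k -> R) by exact: coord_continuous.
have := diff_compE v dF (@linear_differentiable R _ _ (cvco R i) (F y) cl).
by rewrite (diff_lin _ cl).
Qed.

Lemma is_derive_cvco k (c : R -> 'cV[R]_k) (t : R) c' i :
  is_derive t (1 : R) c c' -> is_derive t (1 : R) (fun t => c t i 0 : R) (c' i 0).
Proof.
move=> hc; have cl : continuous (cvco R i : 'cV[R]_k -> R) by exact: coord_continuous.
have := is_derive_curve (@linear_differentiable R _ _ (cvco R i) (c t) cl) hc.
by rewrite (diff_lin _ cl).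
Qed.

Lemma is_derive_alpha (c e : R -> V) (t : R) c' e' :
  is_derive t (1 : R) c c' -> is_derive t (1 : R) e e' ->
  is_derive t (1 : R) (fun t => alpha (c t) (e t))
    (alpha (c t) e' + beta (dsubmx c') (dsubmx (e t))).
Proof.
move=> hc he.
have Dc i := is_derive_cvco (rshift 1 i) hc.
have De i := is_derive_cvco (rshift 1 i) he.
have D (i : 'I_n) := is_deriveB (is_deriveM (Dc (lshift n i)) (De (rshift n i)))
   (is_deriveM (Dc (rshift n i)) (De (lshift n i))).
have := is_deriveD (is_deriveN (is_derive_cvco (lshift (n + n) 0) he))
   (is_deriveZ 2^-1 (is_derive_sum D)).
rewrite (_ : - _ + _ = (fun t => alpha (c t) (e t))); last first.
  apply/funext => s; rewrite /alpha /beta /omega -[LHS]/(- _ + _) !mxE; congr (- _ + _).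
  rewrite -[LHS]/(_ * _) fct_sumE; congr (_ * _).
  by apply: eq_bigr => i _; rewrite !mxE.
rewrite (_ : - _ + _ = alpha (c t) e' + beta (dsubmx c') (dsubmx (e t)))//.
rewrite /alpha /beta /omega !mxE -addrA -mulrDr -big_split; congr (- _ + _ * _).
by apply: eq_bigr => i _; rewrite !mxE /GRing.scale /=; ring.
Qed.

Variables (phi : V -> V) (f : V -> R).
Hypothesis sphi : smooth phi.
Hypothesis fphi : forall x v, alpha (phi x) ('d phi x v) = f x * alpha x v.

Let second x u v : 'd (fun y => 'd phi y v) x u = 'd (fun y => 'd phi y u) x v.
Proof.
have [dphi _] := sphi 2.
have d2 w : differentiable (fun y => 'd phi y w) x by have [_ /(_ w) []] := sphi 2.
suff h i : ('d (fun y => 'd phi y v) x u) i 0 = ('d (fun y => 'd phi y u) x v) i 0.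
  by apply/matrixP => i j; rewrite ord1.
have C2 : Ck 2 (fun y => phi y i 0 : R).
  apply: (@Ck_lin _ _ _ _ (cvco R i) 2 phi); first exact: coord_continuous.
  exact: sphi.
have E w : (fun y => 'd (fun y => phi y i 0 : R) y w) = (fun y => ('d phi y w) i 0).
  by apply/funext => y; exact: diff_cvco.
have := schwarz C2 x v u; rewrite (E u) (E v) => e.
exact: etrans (esym (diff_cvco i u (d2 v))) (etrans e (diff_cvco i v (d2 u))).
Qed.

Let dtheta x u v : is_derive (0 : R) (1 : R)
  (fun t => alpha (phi (x + t *: u)) ('d phi (x + t *: u) v))
  (alpha (phi x) ('d (fun y => 'd phi y v) x u) +
   beta (dsubmx ('d phi x u)) (dsubmx ('d phi x v))).
Proof.
have [dphi _] := sphi 2.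
have d2 w y : differentiable (fun y => 'd phi y w) y by have [_ /(_ w) []] := sphi 2.
have E0 : x + (0 : R) *: u = x by rewrite scale0r addr0.
have l := is_derive_line x u 0.
have h1 : is_derive (0 : R) (1 : R) (fun t : R => phi (x + t *: u)) ('d phi x u).
  by have := is_derive_curve (dphi (x + (0 : R) *: u)) l; rewrite E0.
have h2 : is_derive (0 : R) (1 : R) (fun t : R => 'd phi (x + t *: u) v)
    ('d (fun y => 'd phi y v) x u).
  by have := is_derive_curve (d2 v (x + (0 : R) *: u)) l; rewrite E0.
have h3 := is_derive_alpha h1 h2.
by rewrite E0 in h3.
Qed.

(** This is d(phi^* alpha) = d(f alpha) on ker alpha, where df ^ alpha vanishes. The exterior
    derivative is taken by differentiating alpha(phi)(dphi v) along u and antisymmetrizing; the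
    second differentials of phi cancel by symmetry. *)
Lemma contact_conformal x u v : alpha x u = 0 -> alpha x v = 0 ->
  beta (dsubmx ('d phi x u)) (dsubmx ('d phi x v)) = f x * beta (dsubmx u) (dsubmx v).
Proof.
have main a b : alpha x b = 0 -> alpha (phi x) ('d (fun y => 'd phi y b) x a) +
   beta (dsubmx ('d phi x a)) (dsubmx ('d phi x b)) = f x * beta (dsubmx a) (dsubmx b).
  move=> b0; have h := dtheta x a b.
  (* No regularity of [f] is given; evaluating at [e0], where alpha is -1, expresses it through
     [phi] and makes it differentiable along lines. *)
  have fE t : f (x + t *: a) = - alpha (phi (x + t *: a)) ('d phi (x + t *: a) (e0 R n)).
    by rewrite fphi alpha_e0 mulrN1 opprK.
  have hf := is_deriveN (dtheta x a (e0 R n)).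
  have ht := is_deriveZ (beta (dsubmx a) (dsubmx b)) (is_derive_id (0 : R) (1 : R)).
  have := is_deriveM hf ht => {hf ht}.
  have -> : (- (fun t : R => alpha (phi (x + t *: a)) ('d phi (x + t *: a) (e0 R n))))
       * (beta (dsubmx a) (dsubmx b) *: id) =
     (fun t => alpha (phi (x + t *: a)) ('d phi (x + t *: a) b)).
    apply/funext => t; rewrite fphi -[LHS]/(- _ * (_ * t)) -fE.
    rewrite (_ : alpha (x + t *: a) b = alpha x b + t * beta (dsubmx a) (dsubmx b)).
      by rewrite b0 add0r (mulrC t).
    by rewrite !alphaE (addrC x) dn_linear beta_linl addrA addrAC.
  move=> h'; rewrite -(@derive_val _ _ _ _ _ _ _ h) (@derive_val _ _ _ _ _ _ _ h').
  have E0 : x + (0 : R) *: a = x by rewrite scale0r addr0.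
  set B := beta (dsubmx a) (dsubmx b).
  pose K := - (alpha (phi x) ('d (fun y => 'd phi y (e0 R n)) x a)
      + beta (dsubmx ('d phi x a)) (dsubmx ('d phi x (e0 R n)))).
  transitivity (f (x + (0 : R) *: a) * (B * 1) + (B * 0) * K); first by rewrite fE.
  by rewrite E0 mulr1 mulr0 mul0r addr0.
move=> u0 v0; have h1 := main u v v0; have h2 := main v u u0.
have s1 := congr1 (alpha (phi x)) (second x u v).
have a1 := beta_anti (dsubmx v) (dsubmx u).
have a2 := beta_anti (dsubmx ('d phi x v)) (dsubmx ('d phi x u)).
rewrite a1 a2 in h2; rewrite s1 in h1.
move: h1 h2; move: (alpha _ _) (beta _ _) (beta _ _) (f x) => p q r s.
lra.
Qed.

End ContactConformal.

(** * Elements of G through their jets *)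

Section Factorization.
Variables (R : realType) (m : nat) (P : primitive m).
Local Notation V := 'cV[R]_m.
Local Notation E := ('cV[R]_m * 'M[R]_m)%type.
Local Notation D := (Diff R P).
Local Notation G := (GPi R P).

Lemma Diff_preserves (phi : D) : preserves P phi.
Proof. by have /asboolP[] := dmapP phi. Qed.

Lemma Diff_jac_unit (phi : D) x : jac phi x \in unitmx.
Proof.
have [s K K'] := dinvmapP phi.
rewrite unitmxE unitfE; apply/eqP => d0.
have e := @det_jac_cancel R m (dinvmap phi) phi x s (Diff_smooth phi) K.
have e' := etrans (esym e) (congr1 (fun z => \det (jac (dinvmap phi) (phi x)) * z) d0).
by have := etrans e' (mulr0 _) => /eqP; rewrite oner_eq0.
Qed.

Lemma G_scales (g : G) : exists2 c, 0 < c &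
  (forall x, g x = aeval (jet g) x) /\ scales P (jet g) c.
Proof.
suff [w [c [c0 gw sw]]] : exists w c, [/\ 0 < c, forall x, g x = aeval w x & scales P w c].
  by exists c; rewrite // (jet_affine gw).
have := gvalP g; rewrite inE.
have pres := Diff_preserves (gval g).
move: (gval g) pres => f pres.
have flat_case : affine_maps f -> exists w, f = aeval w :> (V -> V).
  by move=> [A [b h]]; exists (b, A); apply/funext => x; rewrite h.
case: P f pres flat_case => n hn f pres fc.
- by move=> /fc[w fw]; exists w, 1; split=> // x; rewrite fw.
- move=> /fc[w fw]; exists w, 1; split=> // [x|]; first by rewrite fw.
  by have := pres 0; rewrite fw jac_aeval.
- move=> /fc[w fw]; have [c c0 h] := pres; exists w, c; split=> // [x|]; first by rewrite fw.
  by have := h 0; rewrite fw jac_aeval.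
- move=> /fc[w fw]; exists w, 1; split=> // [x|]; first by rewrite fw.
  by split=> // u v; have := pres 0 u v; rewrite fw !diff_aeval.
- move=> /fc[w fw]; have [c c0 h] := pres; exists w, c; split=> // [x|]; first by rewrite fw.
  by move=> u v; have := h 0 u v; rewrite fw !diff_aeval.
- by move=> /generated_affine.
Qed.

Lemma jetE (g : G) x : g x = aeval (jet g) x.
Proof. by have [c _ []] := G_scales g. Qed.

Lemma jet_inj : injective (@jet R m P).
Proof.
move=> g h e; apply: val_inj; apply: DiffE => x.
exact: etrans (jetE g x) (etrans (congr1 (fun w => aeval w x) e) (esym (jetE h x))).
Qed.

Lemma jetM (g h : G) : jet (g * h)%g = aff (jet g) (jet h).
Proof.
apply: jet_affine => x; rewrite aeval_aff -!jetE.
by [].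
Qed.

Lemma jet1 : jet (1%g : G) = aff1 R m.
Proof. by apply: jet_affine => x; rewrite aeval1. Qed.

Lemma jet_unit (g : G) : (jet g).2 \in unitmx.
Proof.
have := jetM g g^-1%g; rewrite mulgV jet1 => /(congr1 snd) /= /esym e.
by case/mulmx1_unit: e.
Qed.

Lemma scales_G (w : E) c : w.2 \in unitmx -> 0 < c -> scales P w c ->
  exists g : G, jet g = w.
Proof.
move=> wU c0 sw; have [phi phiE] := mkDiff wU c0 sw.
suff h : phi \in Gset (R := R) (P := P).
  by exists (MkG h); apply: jet_affine.
rewrite inE; clear wU; case: P w sw phi phiE => n hn w sw phi phiE;
  try by exists w.2, w.1.
by apply: affine_generated; exists w, c.
Qed.

Lemma scales_mul (w w' : E) c c' : scales P w c -> scales P w' c' ->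
  scales P (aff w w') (c * c').
Proof.
case: P w w' => n hn w w' /=.
- by move=> -> ->; rewrite mulr1.
- by move=> [h1 ->] [h2 ->]; rewrite det_mulmx h1 h2 mulr1.
- by move=> <- <-; rewrite det_mulmx.
- move=> [h1 ->] [h2 ->]; split=> [u v|]; last by rewrite mulr1.
  by rewrite -!mulmxA h1 h2.
- by move=> h1 h2 u v; rewrite -!mulmxA h1 h2 mulrA.
- by move=> h1 h2 x v; rewrite aeval_aff -mulmxA h1 h2 mulrA.
Qed.

Lemma smooth_dcoord (phi : V -> V) v i : smooth phi -> smooth (fun y => ('d phi y v) i 0 : R).
Proof.
move=> s k; apply: (@Ck_lin _ _ _ _ (cvco R i) k (fun y => 'd phi y v)).
  exact: coord_continuous.
by case: (s k.+1) => _; apply.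
Qed.

Lemma smooth_base : smooth (fun w : E => w.1).
Proof. by move=> k; apply: (@Ck_frame _ _ (frameV R m)) => i; exact: smooth_fst. Qed.

Lemma smooth_jacM (phi : V -> V) j i : smooth phi ->
  smooth (fun w : E => ('d phi (w.1) (col j w.2)) i 0 : R).
Proof.
move=> s; rewrite (_ : (fun w => _) = fun w : E => \sum_k
   ((fun w : E => w.2 k j) * (fun w : E => ('d phi (w.1) (delta_mx k 0)) i 0)) w).
  apply: smooth_sum => k; apply: smooth_mul; first exact: smooth_snd.
  exact: (smooth_compV (smooth_dcoord (delta_mx k 0) i s) smooth_base).
apply/funext => w.
apply: etrans (congr1 (fun u : V => u i 0) (diff_frame (frameV R m) phi (w.1) (col j w.2))) _.
rewrite summxE.
apply: eq_bigr => k _; rewrite [LHS]mxE; congr (_ * _).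
exact: (mxE _ (fun i _ => w.2 i j)).
Qed.

Lemma smooth_base_comp (phi : V -> V) i : smooth phi -> smooth (fun w : E => phi w.1 i 0 : R).
Proof.
move=> s; have s' : smooth (fun y => phi y i 0 : R).
  by move=> k; apply: (@Ck_lin _ _ _ _ (cvco R i) k phi); [exact: coord_continuous|exact: s].
exact: (smooth_compV s' smooth_base).
Qed.

Lemma diff_G (g : G) x v : 'd g x v = (jet g).2 *m v.
Proof.
have -> : (g : V -> V) = aeval (jet g) by apply/funext => y; exact: jetE.
exact: diff_aeval.
Qed.

Lemma diff_factor (phi nu : D) (g g' : G) v :
  (phi * gval g = gval g' * nu)%g ->
  'd phi (g 0) ((jet g).2 *m v) = (jet g').2 *m 'd nu 0 v.
Proof.
move=> e.
have e1 := diff_compD 0 v (Diff_smooth phi) (Diff_smooth g).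
have e2 := diff_compD 0 v (Diff_smooth g') (Diff_smooth nu).
have := congr1 (fun f : D => 'd f 0 v) e => e3.
have e4 := etrans (esym e1) (etrans e3 e2).
exact: etrans (congr1 ('d phi (g 0)) (esym (diff_G g 0 v))) (etrans e4 (diff_G g' (nu 0) _)).
Qed.

(** Origin of the nilpotency index: two applications kill the base component, two more the matrix
    that is left. *)
Lemma nil4 (T : E -> E) : (forall u, (T (T u)).1 = 0) -> (forall a, T (T (0, a)) = 0) ->
  forall u, T (T (T (T u))) = 0.
Proof.
by move=> h1 h2 u; rewrite [T (T u)]surjective_pairing h1 h2.
Qed.

End Factorization.

(** * The action of Diff on G, extended to all jets *)

Section TildeAmbient.
Variable R : realType.

(** Asks for a map on the whole ambient vector space, where differential calculus is available, that
    restricts to the action on G. The last clause is the source of unipotence for N. *)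
Definition tilde_spec m (P : primitive m) (phi : Diff R P)
    (Phi : 'cV[R]_m * 'M[R]_m -> 'cV[R]_m * 'M[R]_m) : Prop :=
  [/\ smooth Phi,
      forall g : GPi R P, exists2 g' : GPi R P, jet g' = Phi (jet g) &
        exists nu : NPi R P, (phi * gval g = gval g' * nval nu)%g
    & Nset phi -> forall u, iter 4 (fun v => 'd Phi (aff1 R m) v - v) u = 0].

Lemma matrix_of_linear m (L : {linear 'cV[R]_m -> 'cV[R]_m}) (A : 'M[R]_m) v :
  (\matrix_(i, j) (L (col j A)) i 0) *m v = L (A *m v).
Proof.
have -> : A *m v = \sum_j v j 0 *: col j A.
  by apply/colP => i; rewrite summxE mxE; apply: eq_bigr => j _; rewrite !mxE mulrC.
rewrite linear_sum; apply/colP => i; rewrite summxE mxE; apply: eq_bigr => j _.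
by rewrite linearZ !mxE mulrC.
Qed.

Section Lines.
Variable m : nat.
Local Notation V := 'cV[R]_m.
Local Notation E := ('cV[R]_m * 'M[R]_m)%type.

Lemma diff_line (Phi : E -> E) u u' : smooth Phi ->
  (forall t : R, Phi (aff1 R m + t *: u) = aff1 R m + t *: u') ->
  'd Phi (aff1 R m) u = u'.
Proof.
move=> sP h.
have E0 : aff1 R m + (0 : R) *: u = aff1 R m by rewrite scale0r addr0.
have h1 : is_derive (0 : R) (1 : R) (fun t : R => Phi (aff1 R m + t *: u)) ('d Phi (aff1 R m) u).
  by have := is_derive_curve (smooth_diff _ sP) (is_derive_line (aff1 R m) u 0); rewrite E0.
have h2 := is_derive_line (aff1 R m) u' 0.
rewrite (_ : (fun t : R => _) = (fun t : R => aff1 R m + t *: u')) in h1; last exact/funext.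
by rewrite -(@derive_val _ _ _ _ _ _ _ h1) (@derive_val _ _ _ _ _ _ _ h2).
Qed.

Lemma diff_base (Phi : E -> E) (phi : V -> V) u : smooth Phi -> smooth phi ->
  (forall w, (Phi w).1 = phi w.1) ->
  ('d Phi (aff1 R m) u).1 = 'd phi 0 u.1.
Proof.
move=> sP sp h.
have E0 : aff1 R m + (0 : R) *: u = aff1 R m by rewrite scale0r addr0.
have h1 : is_derive (0 : R) (1 : R) (fun t : R => Phi (aff1 R m + t *: u)) ('d Phi (aff1 R m) u).
  by have := is_derive_curve (smooth_diff _ sP) (is_derive_line (aff1 R m) u 0); rewrite E0.
have F0 : 0 + (0 : R) *: u.1 = 0 by rewrite scale0r addr0.
have h2 : is_derive (0 : R) (1 : R) (fun t : R => phi (0 + t *: u.1)) ('d phi 0 u.1).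
  by have := is_derive_curve (smooth_diff _ sp) (is_derive_line 0 u.1 0); rewrite F0.
apply/colP => i; have h3 := is_derive_cvco i h2.
have ck : continuous (jco R (inl i) : E -> R) := @fco_cont _ _ (frameJ R m) (inl i).
have := is_derive_curve (@linear_differentiable R _ _ (jco R (inl i)) (Phi (aff1 R m + (0 : R) *: u)) ck) h1.
rewrite (diff_lin _ ck) => h4.
have e4 := @derive_val _ _ _ _ _ _ _ h4.
have e3 := @derive_val _ _ _ _ _ _ _ h3.
have FE : jco R (inl i) \o (fun t : R => Phi (aff1 R m + t *: u)) =
    (fun t : R => phi (0 + t *: u.1) i 0).
  by apply/funext => t /=; rewrite h.
exact: etrans (esym e4) (etrans (congr1 (fun f : R -> R => derive f (0 : R) (1 : R)) FE) e3).
Qed.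
End Lines.

Section Flat.
Variables (m : nat) (P : primitive m).
Local Notation E := ('cV[R]_m * 'M[R]_m)%type.
Hypothesis HN : Nset (R := R) (P := P) = flat_unipotent (P := P).
Hypothesis HS : forall (phi : Diff R P) b x, exists2 c, 0 < c & scales P (b, jac phi x) c.

(** The extension is the first prolongation (b, A) |-> (phi b, phi'(b) A): then g' has the same
    1-jet at 0 as phi o g, which says exactly that the remaining factor lies in N. *)
Lemma flat_tilde (phi : Diff R P) : exists Phi, tilde_spec phi Phi.
Proof.
pose Phi (w : E) : E := (phi w.1, \matrix_(i, j) ('d phi (w.1) (col j w.2)) i 0).
have PhiM w v : (Phi w).2 *m v = 'd phi (w.1) (w.2 *m v) by exact: matrix_of_linear.
have PhiJ w : (Phi w).2 = jac phi w.1 *m w.2.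
  apply/matrixP => i j; have := PhiM w (delta_mx j 0); rewrite -jac_mul mulmxA.
  by move/colP/(_ i); rewrite -!colE !mxE.
have sP : smooth Phi.
  apply: smooth_jets => [i|i j] /=.
    exact: smooth_base_comp (Diff_smooth phi).
  rewrite (_ : (fun w => _) = fun w : E => ('d phi (w.1) (col j w.2)) i 0).
    exact: smooth_jacM (Diff_smooth phi).
  by apply/funext => w; rewrite mxE.
exists Phi; split => //.
- move=> g; have [c c0 [gE sg]] := G_scales g.
  have [c' c0' sp] := HS phi (phi (g 0) - jac phi (g 0) *m (jet g).1) (g 0).
  have U : (Phi (jet g)).2 \in unitmx.
    by rewrite PhiJ unitmx_mul Diff_jac_unit jet_unit.
  have S : scales P (Phi (jet g)) (c' * c).
    have <- : aff (phi (g 0) - jac phi (g 0) *m (jet g).1, jac phi (g 0)) (jet g) = Phi (jet g).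
      exact: (f_equal2 pair (subrK _ _) (esym (PhiJ (jet g)))).
    exact: scales_mul.
  have [g' g'E] := scales_G U (mulr_gt0 c0' c0) S; exists g' => //.
  pose nu := ((gval g')^-1 * (phi * gval g))%g.
  have fac : (phi * gval g = gval g' * nu)%g by rewrite /nu mulgA mulgV mul1g.
  suff hn : nu \in Nset (R := R) (P := P) by exists (MkN hn).
  rewrite inE HN; split.
    have e0 : phi (g 0) = g' (nu 0) := congr1 (fun f : Diff R P => dmap f (0 : 'cV[R]_m)) fac.
    have e1 : g' 0 = phi (g 0) := congr1 (fun w : E => w.1) g'E.
    have [_ K _] := dinvmapP (gval g').
    by rewrite -[nu 0]K -e0 -e1 K.
  move=> v; have e := diff_factor v fac.
  have e2 := PhiM (jet g) v; rewrite -g'E in e2.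
  have e3 : (jet g').2 *m v = (jet g').2 *m 'd nu 0 v := etrans e2 e.
  by have := congr1 (mulmx (invmx (jet g').2)) e3; rewrite !mulKmx ?jet_unit.
- rewrite HN => -[p0 pv] u.
  have db w : ('d Phi (aff1 R m) w).1 = w.1.
    exact: etrans (diff_base w sP (Diff_smooth phi) (fun _ => erefl)) (pv w.1).
  have d0 a : 'd Phi (aff1 R m) (0, a) = (0, a).
    apply: diff_line => // t; apply: (f_equal2 pair).
      by rewrite /= scaler0 addr0 p0.
    apply/matrixP => i j; rewrite mxE /= scaler0 addr0 pv.
    exact: mxE.
  have T0 a : 'd Phi (aff1 R m) (0, a) - (0, a) = 0 by rewrite d0 subrr.
  apply: (@nil4 R m (fun v => 'd Phi (aff1 R m) v - v)) => [w|a]; last first.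
    by rewrite T0 linear0 subrr.
  rewrite -[LHS]/(('d Phi (aff1 R m) _).1 - _) db subrr.
  by [].
Qed.

End Flat.

Section ContactTilde.
Variables (n : nat) (hn : (0 < n)%N).
Local Notation W := 'cV[R]_(n + n).
Local Notation V := 'cV[R]_(1 + (n + n)).
Local Notation E := (V * 'M[R]_(1 + (n + n)))%type.
Local Notation P := (Contact hn).
Local Notation e0 := (e0 R n).

Lemma mulmx_ext k (A B : 'M[R]_k) : (forall v : 'cV_k, A *m v = B *m v) -> A = B.
Proof.
move=> h; apply/matrixP => i j; have := h (delta_mx j 0).
by move/colP/(_ i); rewrite -!colE !mxE.
Qed.

(** The projection along [e0] onto the contact plane at the origin. *)
Definition hz (v : V) : V := v - up v *: e0.

Lemma hz_linear : linear hz.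
Proof.
move=> a u v; rewrite /hz up_linear scalerBr scalerA scalerDl opprD.
by rewrite addrACA.
Qed.

Lemma upZ a (v : V) : up (a *: v) = a * up v.
Proof. by rewrite /up !mxE. Qed.

Lemma up_e0 : up e0 = 1. Proof. exact: up_col. Qed.

Lemma up_hz v : up (hz v) = 0.
Proof. by rewrite /hz -scaleNr upD upZe0 subrr. Qed.

Lemma dn_hz v : dsubmx (hz v) = dsubmx v.
Proof. by rewrite /hz -scaleNr dnD dnZe0 addr0. Qed.

Lemma hzK v : hz v + up v *: e0 = v. Proof. exact: subrK. Qed.

Variable phi : Diff R P.

(** The image of [e0] under the linear part of g'. On G the second summand vanishes, since [w.2]
    maps [e0] to a multiple of itself; off G it makes the differential at the unit unipotent on the
    whole ambient space. *)
Let K (w : E) : V := (- alpha (phi w.1) ('d phi (w.1) (w.2 *m e0))) *: e0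
  + hz (w.2 *m e0).

(** The differential of phi o g at 0 is kept on the contact plane only. It cannot be kept on [e0],
    because elements of G preserve that direction and general contact maps do not. *)
Let L (w : E) (v : V) : V := 'd phi (w.1) (w.2 *m hz v) + up v *: K w.

Let L_linear w : linear (L w).
Proof.
move=> a u v; rewrite /L hz_linear mulmxDr -scalemxAr up_linear.
move: (K w) (w.2 *m hz u) (w.2 *m hz v) => k x y.
have -> : 'd phi (w.1) (a *: x + y) = a *: 'd phi (w.1) x + 'd phi (w.1) y by exact: linearP.
by rewrite scalerDr scalerDl !scalerA addrACA.
Qed.

Let Phi (w : E) : E := (phi w.1, \matrix_(i, j) (L w (delta_mx j 0)) i 0).

Let PhiM w v : (Phi w).2 *m v = L w v.
Proof.
pose F : {linear V -> V} := HB.pack (L w) (GRing.isLinear.Build _ _ _ _ _ (L_linear w)).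
have h := matrix_of_linear F 1%:M v; rewrite mul1mx in h.
apply: (etrans _ h); congr (_ *m v).
by apply/matrixP => i j; rewrite [LHS]mxE [RHS]mxE col1.
Qed.

Lemma smooth_jacMv (v : V) i : smooth (fun w : E => ('d phi (w.1) (w.2 *m v)) i 0 : R).
Proof.
have h := fun j => smooth_mul (@smooth_cst R E R (v j 0)) (smooth_jacM j i (Diff_smooth phi)).
have := smooth_sum h; congr smooth; apply/funext => w.
apply: etrans _ (congr1 (fun u : V => u i 0) (matrix_of_linear ('d phi (w.1)) w.2 v)).
rewrite [RHS]mxE; apply: eq_bigr => j _.
by rewrite [X in _ = X * _]mxE; exact: mulrC.
Qed.

Lemma smooth_appl (v : V) i : smooth (fun w : E => (w.2 *m v) i 0 : R).
Proof.
have h := fun j => smooth_mul (@smooth_cst R E R (v j 0)) (@smooth_snd R _ i j).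
have := smooth_sum h; congr smooth; apply/funext => w.
by rewrite mxE; apply: eq_bigr => j _; rewrite mulrC.
Qed.

Lemma smooth_alpha (U : normedModType R) (f g : U -> V) :
  (forall i, smooth (fun x => f x i 0 : R)) -> (forall i, smooth (fun x => g x i 0 : R)) ->
  smooth (fun x => alpha (f x) (g x)).
Proof.
move=> sf sg.
rewrite (_ : (fun x => _) = (fun x => - g x (lshift _ 0) 0) + (fun=> 2^-1) *
  (fun x => \sum_i ((fun x => f x (rshift 1 (lshift n i)) 0) * (fun x => g x (rshift 1 (rshift n i)) 0)
    + (fun x => - ((fun x => f x (rshift 1 (rshift n i)) 0) * (fun x => g x (rshift 1 (lshift n i)) 0)) x)) x)).
  apply: smooth_add; first exact: smooth_opp (sg _).
  apply: smooth_mul; first by move=> k; exact: Ck_cst.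
  apply: smooth_sum => i; apply: smooth_add; first exact: smooth_mul.
  by apply: smooth_opp; exact: smooth_mul.
apply/funext => x; rewrite /alpha /beta /omega mxE; congr (_ + _ * _).
by apply: eq_bigr => i _; rewrite !mxE.
Qed.

Let smooth_Phi : smooth Phi.
Proof.
apply: smooth_jets => [i|i j] /=; first exact: smooth_base_comp (Diff_smooth phi).
set v := delta_mx j 0 : V.
have sK : smooth (fun w : E => K w i 0 : R).
  rewrite (_ : (fun w => _) = (fun w : E => - alpha (phi w.1) ('d phi (w.1) (w.2 *m e0))) * (fun=> e0 i 0)
     + ((fun w : E => (w.2 *m e0) i 0) + (fun w : E => - ((fun w : E => (w.2 *m e0) (lshift _ 0) 0) * (fun=> e0 i 0)) w))).
    apply: smooth_add.
      apply: smooth_mul; last by move=> k; exact: Ck_cst.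
      apply: smooth_opp; apply: smooth_alpha => k; last exact: smooth_jacMv.
      exact: smooth_base_comp (Diff_smooth phi).
    apply: smooth_add; first exact: smooth_appl.
    by apply: smooth_opp; apply: smooth_mul; [exact: smooth_appl|by move=> k; exact: Ck_cst].
  apply/funext => w; rewrite /K mxE; congr (_ + _); first by rewrite mxE.
  by rewrite /hz mxE; congr (_ + _); rewrite mxE; congr (- _); rewrite mxE /up mxE.
have sE := smooth_add (smooth_jacMv (hz v) i) (smooth_mul (@smooth_cst R E R (up v)) sK).
move: sE; congr smooth; apply/funext => w.
by rewrite [RHS]mxE /L [RHS]mxE; congr (_ + _); rewrite [RHS]mxE.
Qed.

(** Horizontal vectors are scaled correctly because [phi] is conformal on contact planes, and [e0]
    by the choice of [K]. *)
Let Phi_scale (w : E) f c : 0 < c -> scales P w c ->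
  (forall x v, alpha (phi x) ('d phi x v) = f x * alpha x v) ->
  scales P (Phi w) (f w.1 * c).
Proof.
move=> c0 sg fE; pose b := w.1.
have hor v : up v = 0 -> alpha b (w.2 *m v) = 0.
  move=> v0; have := sg 0 v; rewrite /aeval mulmx0 add0r => ->.
  by rewrite alphaE v0 dn0 beta0l oppr0 addr0 mulr0.
have ae0 : alpha b (w.2 *m e0) = - c.
  have := sg 0 e0; rewrite /aeval mulmx0 add0r => ->.
  by rewrite alpha_e0 mulrN1.
have KE : K w = (f b * c) *: e0.
  have we0 := contact_scale_e0 c0 sg.
  rewrite /K fE ae0 mulrN opprK; rewrite (_ : hz _ = 0) ?addr0//.
  by rewrite we0 /hz upZe0 subrr.
have LE v : L w v = 'd phi b (w.2 *m hz v) + (up v * (f b * c)) *: e0.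
  by rewrite /L KE scalerA.
have hor2 v : alpha (phi b) ('d phi b (w.2 *m hz v)) = 0.
  by rewrite fE hor ?mulr0// up_hz.
have dnL v : dsubmx (L w v) = dsubmx ('d phi b (w.2 *m hz v)).
  by rewrite LE dnD dnZe0 addr0.
move=> x v; rewrite /aeval !PhiM.
have -> : alpha (L w x + (Phi w).1) (L w v) = alpha (phi b) (L w v) + beta (dsubmx (L w x)) (dsubmx (L w v)).
  rewrite !alphaE dnD -[dsubmx (L w x)]scale1r beta_linl scale1r mul1r.
  by rewrite -[(Phi w).1]/(phi b); ring.
rewrite !dnL (contact_conformal (Diff_smooth phi) fE) ?hor ?up_hz//.
rewrite (contact_scale_beta sg) !dn_hz LE.
rewrite [_ + _ *: e0]addrC alpha_linear hor2 alpha_e0 alphaE; ring.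
Qed.

Lemma contact_tilde : exists Phi, tilde_spec phi Phi.
Proof.
exists Phi; split => //.
- move=> g; have [f f0 fE] := Diff_preserves phi.
  have [c c0 [gE sg]] := G_scales g.
  have S := Phi_scale c0 sg fE.
  have s0 : 0 < f (jet g).1 * c by rewrite mulr_gt0.
  have [g' g'E] := scales_G (contact_unit s0 S) s0 S; exists g' => //.
  pose nu := ((gval g')^-1 * (phi * gval g))%g.
  have fac : (phi * gval g = gval g' * nu)%g by rewrite /nu mulgA mulgV mul1g.
  suff hn' : nu \in Nset (R := R) (P := P) by exists (MkN hn').
  have e (v : V) : L (jet g) v = (jet g').2 *m v by rewrite g'E PhiM.
  have d (v : V) : (jet g').2 *m 'd nu 0 v = 'd phi (g 0) ((jet g).2 *m v).
    by rewrite -(diff_factor v fac).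
  rewrite inE; split.
  + have e0 : phi (g 0) = g' (nu 0) := congr1 (fun f : Diff R P => dmap f (0 : V)) fac.
    have e1 : g' 0 = phi (g 0) := congr1 (fun w : E => w.1) g'E.
    have [_ K' _] := dinvmapP (gval g').
    by rewrite -[nu 0]K' -e0 -e1 K'.
  + move=> v v0.
    have uv : up v = 0 by move: v0; rewrite alphaE dn0 beta0l addr0 => /eqP; rewrite oppr_eq0 => /eqP.
    have hv : hz v = v by rewrite /hz uv scale0r subr0.
    have := e v; rewrite /L uv scale0r addr0 hv => e'.
    have := congr1 (mulmx (invmx (jet g').2)) (etrans (d v) e').
    by rewrite !mulKmx ?jet_unit.
  (* Both phi o g and g' rescale alpha at 0 by the same factor, so [nu] leaves it unchanged. *)
  + move=> v; apply: (mulfI (lt0r_neq0 s0)).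
    have h1 := S 0 ('d nu 0 v).
    have h2 : aeval (Phi (jet g)) 0 = phi (g 0) by rewrite /aeval mulmx0 add0r.
    rewrite h2 -g'E in h1.
    have h3 := congr1 (alpha (phi (g 0))) (d v).
    have h4 := fE (g 0) ((jet g).2 *m v).
    have h5 := sg 0 v; rewrite /aeval mulmx0 add0r in h5.
    have h6 := congr1 (fun z => f (g 0) * z) h5.
    rewrite -[RHS]mulrA; apply: etrans (esym h1) _.
    exact: etrans h3 (etrans h4 h6).
- move=> [p0 pk pa] u.
  pose Lp := ('d phi 0 : {linear V -> V}).
  have Lk v : alpha 0 v = 0 -> Lp v = v by exact: pk.
  have a_up v : alpha 0 v = - up v by rewrite alphaE dn0 beta0l addr0.
  (* The differential of phi at 0 preserves alpha, so Lp v - v lies in the contact plane, where Lp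
     is the identity. *)
  have L2 v : Lp (Lp v - v) = Lp v - v.
    apply: Lk; have := alpha_linear 0 (-1) v (Lp v).
    by rewrite scaleN1r addrC mulN1r => ->; rewrite pa addNr.
  have db w : ('d Phi (aff1 R _) w).1 = Lp w.1.
    exact: (diff_base w smooth_Phi (Diff_smooth phi) (fun _ => erefl)).
  have Llin (a : 'M[R]_(1 + (n + n))) : linear (fun v : V => Lp (a *m hz v) + up v *: (a *m e0)).
    move=> k x y; rewrite hz_linear mulmxDr -scalemxAr linearP up_linear /=.
    by rewrite scalerDr scalerDl !scalerA addrACA.
  have d0 (a : 'M[R]_(1 + (n + n))) : exists2 a' : 'M[R]_(1 + (n + n)),
      'd Phi (aff1 R _) (0, a) = (0, a') &
      forall v, (a' - a) *m v = Lp (a *m hz v) - a *m hz v.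
    have [a' a'E] := linear_matrix (Llin a).
    exists a'; last first.
      move=> v; have av : a *m v = a *m hz v + up v *: (a *m e0).
        by rewrite -{1}(hzK v) mulmxDr -scalemxAr.
      by rewrite mulmxBl a'E av opprD addrACA subrr addr0.
    apply: diff_line => // t; apply: (f_equal2 pair).
      by rewrite /= scaler0 addr0 p0.
    apply: mulmx_ext => v; apply: etrans (PhiM _ v) _.
    have E0 : (aff1 R _ + t *: ((0, a) : E)).1 = 0 :> V by rewrite /= scaler0 addr0.
    have E2 (x : V) : (aff1 R _ + t *: ((0, a) : E)).2 *m x = x + t *: (a *m x).
      by rewrite /= mulmxDl mul1mx -scalemxAl.
    rewrite /L E2.
    have Lh x : up x = 0 -> Lp x = x by move=> x0; rewrite Lk// a_up x0 oppr0.
    have -> : K (aff1 R _ + t *: ((0, a) : E)) = e0 + t *: (a *m e0).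
      rewrite /K E2 E0 p0.
      have -> : alpha 0 ('d phi 0 (e0 + t *: (a *m e0))) = alpha 0 (e0 + t *: (a *m e0)) by exact: pa.
      by rewrite a_up opprK /hz upD upZ up_e0 addrC subrK.
    have -> : 'd phi (((aff1 R _ + t *: ((0, a) : E)).1)) = Lp :> (V -> V) by rewrite E0.
    rewrite linearD linearZ /= Lh ?up_hz//.
    rewrite [RHS]mulmxDl mul1mx -scalemxAl a'E.
    rewrite scalerDr [LHS]addrACA hzK; congr (_ + _).
    by rewrite scalerDr !scalerA (mulrC t).
  have T0 (a : 'M[R]_(1 + (n + n))) : exists2 a' : 'M[R]_(1 + (n + n)),
      'd Phi (aff1 R _) (0, a) - (0, a) = (0, a') & forall v, a' *m v = Lp (a *m hz v) - a *m hz v.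
    have [a' h1 h2] := d0 a; exists (a' - a) => //.
    by rewrite h1; apply: (f_equal2 pair) => //=; rewrite subrr.
  apply: (@nil4 R _ (fun v => 'd Phi (aff1 R _) v - v)) => [w|a]; last first.
    have [a1 -> h1] := T0 a; have [a2 -> h2] := T0 a1.
    apply: (f_equal2 pair) => //; apply: mulmx_ext => v.
    rewrite h2 mul0mx h1.
    by rewrite L2 subrr.
  have T1 x : ('d Phi (aff1 R _) x - x).1 = Lp x.1 - x.1 by rewrite -db.
  by rewrite T1 T1 L2 subrr.
Qed.

End ContactTilde.
End TildeAmbient.

(** * The factorization Diff = G N and pull-backs *)

Section Tilde.
Variables (R : realType) (m : nat) (P : primitive m).
Local Notation V := 'cV[R]_m.
Local Notation E := ('cV[R]_m * 'M[R]_m)%type.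
Local Notation D := (Diff R P).
Local Notation G := (GPi R P).
Local Notation N := (NPi R P).
Local Notation C := (Cinf R P).

Lemma tilde_ex (phi : D) : exists Phi, tilde_spec phi Phi.
Proof.
case: P phi => n hn phi; last exact: contact_tilde.
all: apply: flat_tilde => // f b x; have := Diff_preserves f => /=.
- by exists 1.
- by move=> h; exists 1.
- by case=> c c0 h; exists c.
- by move=> h; exists 1 => //; split=> // u v; rewrite !jac_mul.
- by case=> c c0 h; exists c => // u v; rewrite !jac_mul.
Qed.

(** In the flat case the jet is read off from the value and the differential at 0. In the contact
    case the differential is known on the contact plane; on [e0] it is multiplication by the scale,
    which preservation of alpha forces to be 1. *)
Lemma GN_trivial (g : G) : Nset (gval g) -> g = 1%g.
Proof.
move=> gN; apply: jet_inj; rewrite jet1.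
have flat : flat_unipotent (gval g) -> jet g = aff1 R m.
  move=> [g0 gv]; apply: (f_equal2 pair); first exact: g0.
  by apply: mulmx_ext => v; rewrite mul1mx; exact: etrans (esym (diff_G g 0 v)) (gv v).
move: gN flat; case: P g => n hn g gN; try exact.
move=> _; have [g0 gk ga] := gN.
have [c c0 [gE sg]] := G_scales g.
apply: (f_equal2 pair); first exact: g0.
apply: mulmx_ext => v; rewrite mul1mx.
have h v' : alpha 0 v' = 0 -> (jet g).2 *m v' = v'.
  by move=> v0; exact: etrans (esym (diff_G g 0 v')) (gk v' v0).
have a_up v' : alpha 0 v' = - up v' :> R by rewrite alphaE dn0 beta0l addr0.
have e1 := contact_scale_e0 c0 sg.
have c1 : c = 1.
  have := ga (e0 R n); rewrite (_ : 'd _ _ _ = c *: e0 R n).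
    by rewrite !a_up upZ up_e0 mulr1 => /oppr_inj.
  by rewrite -e1; exact: diff_G.
rewrite -(hzK v) mulmxDr -scalemxAr e1 c1 scale1r h//.
by rewrite a_up up_hz oppr0.
Qed.

Lemma factor_ex (phi : D) : exists (g : G) (nu : N), phi = (gval g * nval nu)%g.
Proof.
have [Phi [_ h _]] := tilde_ex phi; have [g _ [nu e]] := h 1%g.
by exists g, nu; rewrite -e mulg1.
Qed.

Lemma factor_uniq (g g' : G) (nu nu' : N) :
  (gval g * nval nu = gval g' * nval nu')%g -> g = g' /\ nu = nu'.
Proof.
move=> e.
have e2 : gval (g'^-1 * g)%g = nval (nu' * nu^-1)%g.
  rewrite -[LHS]/((gval g')^-1 * gval g)%g -[RHS]/(nval nu' * (nval nu)^-1)%g.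
  by rewrite -[nval nu'](mulKg (gval g')) -e !mulgA mulgK.
have g1 : (g'^-1 * g)%g = 1%g.
  apply: GN_trivial; rewrite e2; have := nvalP (nu' * nu^-1)%g; rewrite inE; exact.
have gg : g = g' by apply/eqP; rewrite -(inj_eq (mulgI g'^-1%g)) g1 mulVg.
split=> //; apply: val_inj; apply: (mulgI (gval g)); rewrite /= e gg.
by [].
Qed.

Lemma GpartE (g : G) (nu : N) : Gpart (gval g * nval nu)%g = g.
Proof.
rewrite /Gpart; case: xgetP => [g' -> [nu' e]|/(_ g) []]; last by exists nu.
by case: (factor_uniq e).
Qed.

Lemma NpartE (g : G) (nu : N) : Npart (gval g * nval nu)%g = nu.
Proof.
rewrite /Npart; case: xgetP => [nu' -> [g' e]|/(_ nu) []]; last by exists g.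
by case: (factor_uniq e).
Qed.

Lemma GNpart (phi : D) : (gval (Gpart phi) * nval (Npart phi))%g = phi.
Proof. by have [g [nu ->]] := factor_ex phi; rewrite GpartE NpartE. Qed.

Lemma tilde_factor (phi : D) (g : G) :
  (phi * gval g = gval (tilde phi g) * nval (Npart (phi * gval g)))%g.
Proof. by rewrite GNpart. Qed.

Lemma tildeM (f h : D) (g : G) : tilde (f * h)%g g = tilde f (tilde h g).
Proof.
rewrite {1}/tilde -mulgA (tilde_factor h) mulgA (tilde_factor f) -mulgA.
exact: (GpartE _ (_ * _)%g).
Qed.

Lemma tilde_G (h g : G) : tilde (gval h) g = (h * g)%g.
Proof. by have := GpartE (h * g)%g 1%g; rewrite mulg1. Qed.

Lemma tilde_id (g : G) : tilde 1%g g = g.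
Proof. by rewrite (tilde_G 1%g) mul1g. Qed.

(** N is the stabilizer of the unit in Diff / N. Evaluation at the unit therefore absorbs pull-backs
    by elements of N, which turns identities between functions on G into identities on N. *)
Lemma tilde_N1 (psi : N) : tilde (nval psi) 1%g = 1%g.
Proof. by rewrite /tilde mulg1 -[nval psi]mul1g (GpartE 1%g). Qed.

Lemma jet_tilde (phi : D) : exists Phi : E -> E, [/\ smooth Phi,
  forall g : G, jet (tilde phi g) = Phi (jet g)
  & Nset phi -> forall u, iter 4 (fun v => 'd Phi (aff1 R m) v - v) u = 0].
Proof.
have [Phi [sP h n]] := tilde_ex phi; exists Phi; split => // g.
by have [g' <- [nu e]] := h g; rewrite /tilde e GpartE.
Qed.

Lemma smoothG_tilde (phi : D) (xi : C) : smoothG (xi \o tilde phi).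
Proof.
have [Phi [sP hP _]] := jet_tilde phi.
have /asboolP sxi := cfunP xi.
move=> g; have [F sF eF] := sxi (tilde phi g).
exists (F \o Phi); first exact: smooth_compJ.
have cP : Phi @ jet g --> jet (tilde phi g) by rewrite hP; exact: (sP 0).
have ev : \forall w \near jet g, forall h : G, jet h = Phi w -> xi h = F (Phi w) := cP _ eF.
near=> w => h hh; have hw : forall h : G, jet h = Phi w -> xi h = F (Phi w) by near: w.
by apply: hw; rewrite hP hh.
Unshelve. all: by end_near.
Qed.

(** The composite is smooth, so the default value of [insubd] in [pull] is never taken. *)
Lemma pullE (phi : D) (xi : C) g : pull phi xi g = xi (tilde phi g).
Proof.
have h : `[< smoothG (xi \o tilde phi) >] by apply/asboolP; exact: smoothG_tilde.
by rewrite /pull -[LHS]/(\val (insubd 0 _) g) insubdK.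
Qed.

Lemma Cext (x y : C) : (forall g, x g = y g) -> x = y.
Proof. by move=> h; apply/val_inj/funext. Qed.

Lemma CD (x y : C) g : (x + y) g = x g + y g. Proof. by []. Qed.
Lemma CZ a (x : C) g : (a *: x) g = a * x g. Proof. by []. Qed.
Lemma CM (x y : C) g : (x * y) g = x g * y g. Proof. by []. Qed.
Lemma C1 g : (1 : C) g = 1. Proof. by []. Qed.
Lemma C0 g : (0 : C) g = 0. Proof. by []. Qed.

Lemma Csum (I : Type) (s : seq I) (Q : pred I) (F : I -> C) g :
  (\sum_(i <- s | Q i) F i) g = \sum_(i <- s | Q i) F i g.
Proof. by elim/big_rec2: _ => // i y x _ <-; rewrite CD. Qed.

Lemma pullM (f h : D) (xi : C) : pull (f * h)%g xi = pull h (pull f xi).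
Proof. by apply: Cext => g; rewrite !pullE tildeM. Qed.

Lemma pull1 (xi : C) : pull 1%g xi = xi.
Proof. by apply: Cext => g; rewrite pullE tilde_id. Qed.

Lemma pullK (f : D) (xi : C) : pull f (pull f^-1%g xi) = xi.
Proof. by rewrite -pullM mulVg pull1. Qed.

Lemma pullVK (f : D) (xi : C) : pull f^-1%g (pull f xi) = xi.
Proof. by rewrite -pullM mulgV pull1. Qed.

Lemma pull_linear (f : D) : linear (pull f).
Proof. by move=> a x y; apply: Cext => g; rewrite !(CD, CZ, pullE). Qed.

Lemma pull_mul (f : D) (x y : C) : pull f (x * y) = pull f x * pull f y.
Proof. by apply: Cext => g; rewrite !(CM, pullE). Qed.

Lemma pull_one (f : D) : pull f 1 = 1.
Proof. by apply: Cext => g; rewrite !(C1, pullE). Qed.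

End Tilde.

(** * Bump functions and curves in a frame *)

Section FrameMore.
Variables (R : realType) (V : normedModType R) (B : frame V).
Local Notation co := (fco (f := B)).
Local Notation e := (fe (f := B)).

Lemma bump_ex (w0 : V) (U : set V) : nbhs w0 U ->
  exists chi : V -> R, [/\ smooth chi, 0 < chi w0 & forall w, chi w != 0 -> U w].
Proof.
move=> /nbhs_ballP [del /= d0 hd].
(* Coordinates of [w - w0] smaller than r = del / S keep [w] within distance del of [w0]; the added
   1 makes S positive. *)
pose S := \sum_k `|e k| + 1.
have S0 : 0 < S by rewrite ltr_wpDl// sumr_ge0.
pose r := del / S.
have r0 : 0 < r by rewrite divr_gt0.
pose q (w : V) := \sum_k ((fun w => co k w - co k w0) * (fun w => co k w - co k w0)) w.
have sq : smooth q.
  have s1 k : smooth (fun w : V => co k w - co k w0 : R).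
    by apply: smooth_add; move=> n; [exact: Ck_co|exact: Ck_cst].
  by apply: smooth_sum => k; apply: smooth_mul.
exists (fun w => flat 0 (r ^+ 2 - q w)); split.
- apply: smooth_flat_comp; apply: smooth_add; first by move=> k; exact: Ck_cst.
  exact: smooth_opp.
- rewrite flat_gt0// subr_gt0 /q big1 ?exprn_gt0// => k _.
  by rewrite /GRing.mul /= subrr mulr0.
- move=> w /eqP cw; apply: hd; rewrite -ball_normE /=.
  have qr : q w < r ^+ 2.
    by rewrite ltNge; apply/negP => h; apply: cw; rewrite flat_le0// subr_le0.
  have ck k : `|co k w - co k w0| < r.
    rewrite -(ltr_pXn2r (n := 2))// ?nnegrE ?(ltW r0)// real_normK ?num_real//.
    apply: le_lt_trans qr; rewrite /q (bigD1 k)//= lerDl sumr_ge0// => i _.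
    by rewrite -expr2 sqr_ge0.
  rewrite distrC (frameE B (w - w0)).
  apply: le_lt_trans (ler_norm_sum _ _ _) _.
  apply: (@le_lt_trans _ _ (\sum_k r * `|e k|)).
    apply: ler_sum => k _; rewrite normrZ ler_wpM2r// linearB /=; exact/ltW/ck.
  rewrite -mulr_sumr (_ : del = r * S) ?ltr_pM2l ?ltrDl//.
  by rewrite /r divfK// gt_eqF.
Qed.

Lemma is_derive_fsum (W : normedModType R) (I : finType) (h : I -> R -> W) (x : R) dh :
  (forall i, is_derive x (1 : R) (h i) (dh i)) ->
  is_derive x (1 : R) (fun t => \sum_i h i t) (\sum_i dh i).
Proof.
move=> H; elim: (index_enum I) => [|i s IH].
  rewrite big_nil (_ : (fun t => _) = fun=> 0); first exact: is_derive_cst.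
  by apply/funext => t; rewrite big_nil.
rewrite big_cons (_ : (fun t => _) = h i + fun t => \sum_(i <- s) h i t).
  exact: is_deriveD.
by apply/funext => t; rewrite big_cons.
Qed.

Lemma is_derive_scalel (W : normedModType R) (f : R -> R) (x f' : R) (v : W) :
  is_derive x (1 : R) f f' -> is_derive x (1 : R) (fun t => f t *: v) (f' *: v).
Proof.
move=> hf; have [d E] := is_diff_scalel (f x) v.
by have := is_derive_curve d hf; rewrite E.
Qed.

Lemma is_derive_frame (c : R -> V) (x : R) c' :
  (forall k, is_derive x (1 : R) (fun t => co k (c t) : R) (co k c')) ->
  is_derive x (1 : R) c c'.
Proof.
move=> h; rewrite (frameE B c') (_ : c = fun t => \sum_k co k (c t) *: e k).
  by apply: is_derive_fsum => k; exact: is_derive_scalel.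
by apply/funext => t; rewrite -frameE.
Qed.

End FrameMore.

Section SmoothDet.
Variables (R : realType) (U : normedModType R).

Lemma smooth_det n (f : U -> 'M[R]_n) : (forall i j, smooth (fun x => f x i j : R)) ->
  smooth (fun x => \det (f x) : R).
Proof.
move=> h; rewrite /determinant; apply: smooth_sum => s.
apply: smooth_mul; first by move=> k; exact: Ck_cst.
by apply: smooth_prod => i; exact: h.
Qed.

End SmoothDet.

(** * Derivations at a point of G *)

Section PointDerivations.
Variables (R : realType) (m : nat) (P : primitive m).
Local Notation V := 'cV[R]_m.
Local Notation E := ('cV[R]_m * 'M[R]_m)%type.
Local Notation G := (GPi R P).
Local Notation C := (Cinf R P).
Local Notation one := (aff1 R m).

Lemma smoothG_jet (F : E -> R) : smooth F -> `[< smoothG (fun g : G => F (jet g)) >].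
Proof.
move=> sF; apply/asboolP => g; exists F => //.
by near=> w => h ->.
Unshelve. all: by end_near.
Qed.

Definition onG (F : E -> R) (sF : smooth F) : C := MkCinf (smoothG_jet sF).

Definition cc (k : jidx m) : C := onG (smooth_jco R k).

Lemma C_local (xi : C) (g : G) : exists2 F : E -> R, smooth F &
  \forall w \near jet g, forall h : G, jet h = w -> xi h = F w.
Proof. by have /asboolP := cfunP xi; apply. Qed.

Record point_derivation (g : G) (dl : C -> R) : Prop := PointDerivation {
  pd_linear : forall a x y, dl (a *: x + y) = a * dl x + dl y ;
  pd_leibniz : forall x y, dl (x * y) = dl x * y g + x g * dl y }.

Section At.
Variables (g : G) (dl : C -> R).
Hypothesis pd : point_derivation g dl.

Lemma pdD (x y : C) : dl (x + y) = dl x + dl y.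
Proof. by have := pd_linear pd 1 x y; rewrite scale1r mul1r. Qed.

Lemma pd0 : dl 0 = 0.
Proof. by have := pdD 0 0; rewrite addr0 => /eqP; rewrite -subr_eq0 opprD addrA subrr sub0r oppr_eq0 => /eqP. Qed.

Lemma pdZ a (x : C) : dl (a *: x) = a * dl x.
Proof. by have := pd_linear pd a x 0; rewrite addr0 pd0 addr0. Qed.

Lemma pd1 : dl 1 = 0.
Proof.
have := pd_leibniz pd 1 1; rewrite mulr1 C1 mul1r mulr1 => /eqP.
by rewrite -subr_eq0 opprD addrA subrr sub0r oppr_eq0 => /eqP.
Qed.

Lemma pdsum (I : Type) (s : seq I) (F : I -> C) : dl (\sum_(i <- s) F i) = \sum_(i <- s) dl (F i).
Proof.
by elim: s => [|i s IH]; rewrite ?big_nil ?pd0// !big_cons pdD IH.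
Qed.

(** Multiply by a bump function supported where [xi] vanishes: the product is 0, and the Leibniz
    rule leaves a nonzero multiple of [dl xi]. *)
Lemma pd_local (xi : C) : (\forall w \near jet g, forall h : G, jet h = w -> xi h = 0) -> dl xi = 0.
Proof.
move=> h; have [chi [sc c0 hc]] := bump_ex (frameJ R m) h.
have := pd_leibniz pd (onG sc) xi.
rewrite (_ : onG sc * xi = 0).
  have -> : xi g = 0 by apply: (nbhs_singleton h).
  rewrite pd0 mulr0 add0r => /esym/eqP; rewrite mulf_eq0 => /orP[|/eqP//].
  by rewrite -[onG sc g]/(chi (jet g)) gt_eqF.
apply: Cext => h'; rewrite CM C0 -[onG sc h']/(chi (jet h')).
have [->|/hc/(_ h' erefl) ->] := eqVneq (chi (jet h')) 0; first by rewrite mul0r.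
by rewrite mulr0.
Qed.

Definition velocity : E := \sum_k dl (cc k) *: je R k.

(** Hadamard's lemma writes [xi] near g as a constant plus products of centred coordinates with
    smooth functions; on these the Leibniz rule keeps only the values of [dl] on the coordinates. *)
Lemma pd_chain (xi : C) (F : E -> R) : smooth F ->
  (\forall w \near jet g, forall h : G, jet h = w -> xi h = F w) ->
  dl xi = 'd F (jet g) velocity.
Proof.
move=> sF hF; have [Fk [sFk FE Fk0]] := hadamard (frameJ R m) (jet g) sF.
have -> : dl xi = dl (onG sF).
  apply/eqP; rewrite -subr_eq0 -[- dl _]mulN1r -pdZ -pdD; apply/eqP/pd_local.
  near=> w => h hh; rewrite CD CZ mulN1r.
  have hw : forall h : G, jet h = w -> xi h = F w by near: w.
  by rewrite hw// -[onG sF h]/(F (jet h)) hh subrr.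
pose c k : R := jco R k (jet g).
have -> : onG sF = F (jet g) *: 1 + \sum_k (cc k - c k *: 1) * onG (sFk k).
  apply: Cext => h; rewrite CD CZ C1 mulr1 Csum -[onG sF h]/(F (jet h)) FE; congr (_ + _).
  apply: eq_bigr => k _; rewrite CM; congr (_ * _); rewrite linearB /=.
  by rewrite -[RHS]/(jcof k (jet h) - c k * 1) mulr1.
rewrite pdD pdZ pd1 mulr0 add0r pdsum (linear_sum ('d F (jet g))).
apply: eq_bigr => k _; rewrite (pd_leibniz pd).
rewrite (_ : (cc k - _) g = 0); last by rewrite -[LHS]/(c k - c k * 1) mulr1 subrr.
rewrite mul0r addr0 -[onG _ g]/(Fk k (jet g)) Fk0 -scaleNr pdD pdZ pd1 mulr0 addr0.
by rewrite linearZ.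
Unshelve. all: by end_near.
Qed.

End At.

Lemma velocity_co g dl k : point_derivation g dl -> jco R k (velocity dl) = dl (cc k).
Proof.
move=> pd; rewrite (pd_chain pd (F := jco R k) (xi := cc k) (smooth_jco R k)); last first.
  by near=> w => h <-.
rewrite diff_lin//; exact: (@fco_cont _ _ (frameJ R m) k).
Unshelve. all: by end_near.
Qed.

(** Tangency to G at the unit, stated by annihilation of the functions vanishing on G: this needs no
    charts of G. *)
Definition tangent (xi : E) : Prop := forall p : E -> R, smooth p ->
  (forall h : G, p (jet h) = 0) -> 'd p one xi = 0.

Lemma velocity_tangent dl : point_derivation 1%g dl -> tangent (velocity dl).
Proof.
move=> pd p sp hp; rewrite -(@jet1 R m P) -(pd_chain pd (xi := 0) sp); first exact: pd0 pd.
by near=> w => h <-; rewrite hp.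
Unshelve. all: by end_near.
Qed.

End PointDerivations.

(** * Semi-invariants of G *)

Section SemiInvariants.
Variables (R : realType) (m : nat) (P : primitive m).
Local Notation V := 'cV[R]_m.
Local Notation E := ('cV[R]_m * 'M[R]_m)%type.
Local Notation one := (aff1 R m).

Lemma smooth_mulmxv (v : V) i : smooth (fun w : E => (w.2 *m v) i 0 : R).
Proof.
have h := fun j => smooth_mul (@smooth_cst R E R (v j 0)) (@smooth_snd R _ i j).
have := smooth_sum h; congr smooth; apply/funext => w.
by rewrite mxE; apply: eq_bigr => j _; rewrite mulrC.
Qed.

Lemma smooth_det2 : smooth (fun w : E => \det w.2 : R).
Proof. by apply: smooth_det => i j; exact: smooth_snd. Qed.

End SemiInvariants.

Lemma smooth_omega (R : realType) (n : nat) (U : normedModType R) (f g : U -> 'cV[R]_(n + n)) :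
  (forall i, smooth (fun x => f x i 0 : R)) -> (forall i, smooth (fun x => g x i 0 : R)) ->
  smooth (fun x => omega (f x) (g x)).
Proof.
move=> sf sg; rewrite /omega; apply: smooth_sum => i; apply: smooth_add.
  exact: smooth_mul.
by apply: smooth_opp; exact: smooth_mul.
Qed.

Lemma omega_neq0 (R : realType) (n : nat) : (0 < n)%N ->
  exists u v : 'cV[R]_(n + n), omega u v != 0.
Proof.
move=> n0; apply: contrapT => h.
have i0 : 'I_(n + n) := lshift n (Ordinal n0).
have : delta_mx i0 0 = 0 :> 'cV[R]_(n + n).
  apply: omega_nondeg => u; apply: contrapT => /eqP ne.
  by apply: h; exists u, (delta_mx i0 0).
move=> /colP/(_ i0); rewrite !mxE !eqxx => /eqP.
by rewrite oner_eq0.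
Qed.

Section SemiInvariants2.
Variables (R : realType) (m : nat) (P : primitive m).
Local Notation V := 'cV[R]_m.
Local Notation E := ('cV[R]_m * 'M[R]_m)%type.
Local Notation one := (aff1 R m).

(* G is cut out of the affine maps by functions p_i that each of its elements
   multiplies by the same constant. *)
Lemma semi_invariants : exists (I : Type) (p : I -> E -> R) (i0 : I) (strict : Prop),
  [/\ forall i, smooth (p i), p i0 one != 0,
      forall (g : E) c, scales P g c -> (strict -> c = 1) /\
        forall i h, p i (aff g h) = c * p i h
    & forall w c, (strict -> c = 1) -> (forall i, p i w = c * p i one) -> scales P w c].
Proof.
case: P => n hn.
(* [strict] records whether the constant is forced to be 1. Here no equation cuts out G among the
   invertible affine maps, so the constant function 1 serves. *)
- exists unit, (fun _ _ => 1), tt, True; split => //=.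
  + by move=> _; exact: smooth_cst.
  + by move=> g c ->; split=> // _ _; rewrite mul1r.
  + by move=> w c h _; exact: h.
- exists unit, (fun _ w => \det w.2), tt, True; split => //=.
  + by move=> _; exact: smooth_det2.
  + by rewrite det1 oner_neq0.
  + by move=> g c [h ->]; split=> // _ h'; rewrite det_mulmx h.
  + by move=> w c /(_ I) -> h; split=> //; rewrite (h tt) det1 mulr1.
- exists unit, (fun _ w => \det w.2), tt, False; split => //=.
  + by move=> _; exact: smooth_det2.
  + by rewrite det1 oner_neq0.
  + by move=> g c h; split=> // _ h'; rewrite det_mulmx h.
  + by move=> w c _ h; rewrite (h tt) det1 mulr1.
- have [u0 [v0 uv0]] := omega_neq0 R hn.
  exists ('cV[R]_(n + n) * 'cV[R]_(n + n))%type, (fun uv w => omega (w.2 *m uv.1) (w.2 *m uv.2)),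
    (u0, v0), True; split => //=.
  + by move=> uv; apply: smooth_omega => i; exact: smooth_mulmxv.
  + by rewrite !mul1mx.
  + by move=> g c [h ->]; split=> // uv h'; rewrite -!mulmxA h mul1r.
  + by move=> w c /(_ I) -> h; split=> // u v; rewrite (h (u, v)) !mul1mx mul1r.
- have [u0 [v0 uv0]] := omega_neq0 R hn.
  exists ('cV[R]_(n + n) * 'cV[R]_(n + n))%type, (fun uv w => omega (w.2 *m uv.1) (w.2 *m uv.2)),
    (u0, v0), False; split => //=.
  + by move=> uv; apply: smooth_omega => i; exact: smooth_mulmxv.
  + by rewrite !mul1mx.
  + by move=> g c h; split=> // uv h'; rewrite -!mulmxA h.
  + by move=> w c _ h u v; rewrite (h (u, v)) !mul1mx.
- exists ('cV[R]_(1 + (n + n)) * 'cV[R]_(1 + (n + n)))%type,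
    (fun xv w => alpha (aeval w xv.1) (w.2 *m xv.2)), (0, e0 R n), False; split => //=.
  + move=> xv; apply: smooth_alpha => i; last exact: smooth_mulmxv.
    have := smooth_add (@smooth_mulmxv R _ xv.1 i) (@smooth_fst R _ i).
    by congr smooth; apply/funext => w; rewrite /aeval [RHS]mxE.
  + by rewrite mul1mx aeval1 alpha_e0 oppr_eq0 oner_neq0.
  + by move=> g c h; split=> // xv h'; rewrite aeval_aff -mulmxA; exact: h.
  + by move=> w c _ h x v; rewrite (h (x, v)) aeval1 mul1mx.
Qed.

End SemiInvariants2.

(** * One-parameter subgroups of G *)

Section OneParameter.
Variables (R : realType) (m : nat) (P : primitive m).
Local Notation V := 'cV[R]_m.
Local Notation E := ('cV[R]_m * 'M[R]_m)%type.
Local Notation G := (GPi R P).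
Local Notation one := (aff1 R m).

(* Left translation by w on tangent vectors of the affine group. *)
Definition ltrans (w u : E) : E := (w.2 *m u.1, w.2 *m u.2).

Section Exp.
Variable xi : E.

(** The affine map (b, A) is coded by the matrix with rows (1, 0) and (b, A), so that composition
    becomes the matrix product; a velocity has zero first row. *)
Let M : 'M[R]_(1 + m) := block_mx 0 0 xi.1 xi.2.
Let X (t : R) : 'M[R]_(1 + m) := @expmx R m M t.

Definition aexp (t : R) : E := (dlsubmx (X t), drsubmx (X t)).

Let X_top (i : 'I_1) j t : X t (lshift m i) j = (1%:M : 'M[R]_(1 + m)) (lshift m i) j.
Proof.
have h (x : R) : is_derive x (1 : R) (fun t => X t (lshift m i) j : R) 0.
  have := @is_derive_expmxl R m M (lshift m i) j x.
  rewrite (_ : (M * expmx M x) (lshift m i) j = 0)//.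
  rewrite mxE big1// => l _; rewrite /M -[l]fintype.splitK.
  by case: (fintype.split l) => k /=; rewrite ?block_mxEul ?block_mxEur mxE mul0r.
by have -> := is_derive_0_is_cst t 0 h; rewrite /X expmx0.
Qed.

Let X_block t : X t = block_mx 1%:M 0 (aexp t).1 (aexp t).2.
Proof.
rewrite -[LHS]submxK; congr block_mx.
  apply/matrixP => i j; rewrite [LHS]mxE [LHS]mxE X_top !mxE.
  by rewrite (inj_eq (@lshift_inj _ _)).
apply/matrixP => i j; rewrite [LHS]mxE [LHS]mxE X_top !mxE.
by rewrite eq_lrshift.
Qed.

Lemma aexpD s t : aexp (s + t) = aff (aexp s) (aexp t).
Proof.
have e : X (s + t) = X s *m X t := expmxD M s t.
rewrite /aexp e (X_block s) (X_block t) mulmx_block.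
rewrite block_mxKdl block_mxKdr mulmx1 mulmx0 add0r.
by rewrite -!X_block.
Qed.

Lemma aexp0 : aexp 0 = one.
Proof.
rewrite /aexp /X expmx0; apply: (f_equal2 pair); apply/matrixP => i j; rewrite !mxE.
  by rewrite -[rshift 1 i == lshift m j]/(_ == _) eq_rlshift.
by rewrite -[rshift 1 i == rshift 1 j]/(_ == _) eq_rshift.
Qed.

Lemma aexp_unit t : (aexp t).2 \in unitmx.
Proof.
have := aexpD t (- t); rewrite subrr aexp0 => /(congr1 snd) /= /esym e.
by case/mulmx1_unit: e.
Qed.

Lemma aexp_derive t : is_derive t (1 : R) aexp (ltrans (aexp t) xi).
Proof.
apply: (@is_derive_frame _ _ (frameJ R m)) => k.
have XM : X t *m M = block_mx 0 0 ((aexp t).2 *m xi.1) ((aexp t).2 *m xi.2).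
  by rewrite X_block mulmx_block !mulmx0 !mul0mx ?mul1mx !add0r ?addr0.
case: k => [i|[i j]].
  have e : (X t *m M) (rshift 1 i) (lshift m (0 : 'I_1)) = ((aexp t).2 *m xi.1) i 0.
    by rewrite XM block_mxEdl.
  have := @is_derive_expmxr R m M (rshift 1 i) (lshift m (0 : 'I_1)) t.
  rewrite [X in is_derive _ _ _ X](e : _ = _).
  by congr is_derive; apply/funext => s; rewrite /= !mxE.
have e : (X t *m M) (rshift 1 i) (rshift 1 j) = ((aexp t).2 *m xi.2) i j.
  by rewrite XM block_mxEdr.
have := @is_derive_expmxr R m M (rshift 1 i) (rshift 1 j) t.
rewrite [X in is_derive _ _ _ X](e : _ = _).
by congr is_derive; apply/funext => s; rewrite /= !mxE.
Qed.

End Exp.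

Lemma ltrans1 u : ltrans one u = u.
Proof. by case: u => a b; rewrite /ltrans /= !mul1mx. Qed.

(** By semi-invariance certain combinations of the [p i] vanish on G. As [xi] annihilates their
    differentials, all [p i] satisfy the same equation p' = lam p along the exponential curve; they
    are multiplied by exp(lam t), which is what membership in G requires. *)
Lemma tangent_aexp (xi : E) : tangent P xi -> forall t, exists g : G, jet g = aexp xi t.
Proof.
move=> txi t.
have [I [p [i0 [strict [sp p0 hG hS]]]]] := semi_invariants R P.
pose lam := 'd (p i0) one xi / p i0 one.
have d1 (r : E -> R) : smooth r -> is_derive (0 : R) (1 : R) (fun s => r (aexp xi s)) ('d r one xi).
  move=> sr; have := is_derive_curve (smooth_diff _ sr) (aexp_derive xi 0).
  by rewrite aexp0 ltrans1.
have Gp (g : G) : exists c, (strict -> c = 1) /\ forall i h, p i (aff (jet g) h) = c * p i h.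
  by have [c c0 [_ sg]] := G_scales g; exists c; exact: hG.
have dp i s : is_derive s (1 : R) (fun t => p i (aexp xi t)) (lam * p i (aexp xi s)).
  pose r (w : E) := p i (aff w (aexp xi s)).
  have sr : smooth r.
    by apply: (smooth_compJ (sp i)); apply: smooth_aff => //; [move=> k; exact: Ck_idg|by move=> k; exact: Ck_cst].
  have e : 'd r one xi = lam * p i (aexp xi s).
    (* Vanishes on G: an element of G multiplies [r] and [p i0] by the same constant, relative to
       their values at [one]. *)
    pose q := r * (fun=> p i0 one) + (fun w => - (p i0 * (fun=> p i (aexp xi s))) w).
    have s1 : smooth (r * (fun=> p i0 one)) by apply: smooth_mul => //; by move=> k; exact: Ck_cst.
    have s2 : smooth (p i0 * (fun=> p i (aexp xi s))) by apply: smooth_mul => //; by move=> k; exact: Ck_cst.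
    have sq : smooth q by apply: smooth_add => //; exact: smooth_opp.
    have q0 : 'd q one xi = 0.
      apply: txi => // g; have [c [_ hc]] := Gp g.
      rewrite -[LHS]/(p i (aff (jet g) (aexp xi s)) * p i0 one
        - p i0 (jet g) * p i (aexp xi s)).
      have hc0 : p i0 (jet g) = c * p i0 one by rewrite -hc aff1r.
      by rewrite hc hc0; ring.
    have h1 := d1 q sq; rewrite q0 in h1.
    have h2 := is_deriveB (is_deriveM (d1 r sr) (is_derive_cst (p i0 one) 0 (1 : R)))
      (is_deriveM (d1 _ (sp i0)) (is_derive_cst (p i (aexp xi s)) 0 (1 : R))).
    have := etrans (esym (@derive_val _ _ _ _ _ _ _ h2)) (@derive_val _ _ _ _ _ _ _ h1).
    rewrite !scaler0 !add0r => /subr0_eq e1.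
    apply: (mulfI p0); apply: etrans e1 _.
    by rewrite /lam /GRing.scale /=; field.
  have := d1 r sr; rewrite e /r => h.
  have sh : is_derive s (1 : R) (fun t : R => t - s) 1.
    by have := is_deriveB (is_derive_id s (1 : R)) (is_derive_cst s s (1 : R)); rewrite subr0.
  rewrite -(subrr s) in h; have := @is_derive1_comp R (fun s' => p i (aff (aexp xi s') (aexp xi s))) (fun t => t - s) s _ _ h sh; rewrite mulr1.
  congr is_derive; apply/funext => y /=.
  by rewrite -aexpD subrK.
have pE i s : p i (aexp xi s) = expR (lam * s) * p i one.
  have h (x : R) : is_derive x (1 : R) (fun t => expR (- (lam * t)) * p i (aexp xi t)) 0.
    have dl : is_derive x (1 : R) (fun t : R => - (lam * t)) (- lam).
      have := is_deriveN (is_deriveZ lam (is_derive_id x (1 : R))).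
      by rewrite /GRing.scale /= mulr1.
    have de := @is_derive1_comp R expR (fun t => - (lam * t)) x _ _ (is_derive_expR _) dl.
    have := is_deriveM de (dp i x); rewrite (_ : _ *: _ + _ *: _ = 0) //.
    by rewrite /GRing.scale /=; ring.
  have := is_derive_0_is_cst s 0 h; rewrite mulr0 oppr0 expR0 mul1r aexp0 => <-.
  by rewrite mulrA -expRD subrr expR0 mul1r.
have [g gE] : exists g : G, jet g = aexp xi t.
  apply: (@scales_G _ _ _ _ (expR (lam * t))); [exact: aexp_unit|exact: expR_gt0|].
  apply: hS => // st.
  (* When the constant is forced to be 1, the function [p i0] minus its value at [one] vanishes on
     G, so tangency gives lam = 0. *)
  have l0 : lam = 0.
    pose q := p i0 + (fun=> - p i0 one).
    have sq : smooth q by apply: smooth_add => //; by move=> k; exact: Ck_cst.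
    have q0 : 'd q one xi = 0.
      apply: txi => // g; have [c [/(_ st) -> hc]] := Gp g.
      have hc0 : p i0 (jet g) = 1 * p i0 one by rewrite -hc aff1r.
      by rewrite -[LHS]/(p i0 (jet g) - p i0 one) hc0 mul1r subrr.
    have h1 := d1 q sq; rewrite q0 in h1.
    have h2 := is_deriveD (d1 _ (sp i0)) (is_derive_cst (- p i0 one) 0 (1 : R)).
    have := etrans (esym (@derive_val _ _ _ _ _ _ _ h2)) (@derive_val _ _ _ _ _ _ _ h1).
    by rewrite addr0 /lam => ->; rewrite mul0r.
  by rewrite l0 mul0r expR0.
by exists g.
Qed.

End OneParameter.

(** * Left-invariant vector fields from velocities *)

Section LieAlgebra.
Variables (R : realType) (m : nat) (P : primitive m).
Local Notation V := 'cV[R]_m.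
Local Notation E := ('cV[R]_m * 'M[R]_m)%type.
Local Notation D := (Diff R P).
Local Notation G := (GPi R P).
Local Notation C := (Cinf R P).
Local Notation one := (aff1 R m).

(** One representative [F] serves at all points of G near g. This is what makes the derivative along
    a flow, computed pointwise from [F], a smooth function again. *)
Lemma C_local_near (xi : C) (g : G) : exists2 F : E -> R, smooth F &
  \forall w \near jet g, forall h : G, jet h = w ->
    \forall w' \near w, forall h' : G, jet h' = w' -> xi h' = F w'.
Proof.
have [F sF hF] := C_local xi g; exists F => //.
have := nbhs_interior hF; apply: filterS => w hw h _.
exact: hw.
Qed.

Lemma smooth_ltrans (xi : E) : smooth (fun w => ltrans w xi).
Proof.
apply: smooth_jets => [i|i j] /=; first exact: smooth_mulmxv.
have := smooth_mulmxv (R := R) (col j xi.2) i; congr smooth; apply/funext => w.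
by rewrite mxE [RHS]mxE; apply: eq_bigr => l _; rewrite [X in _ * X = _]mxE.
Qed.

Lemma smooth_diffl (F : E -> R) (xi : E) : smooth F ->
  smooth (fun w => 'd F w (ltrans w xi)).
Proof.
move=> sF k; apply: (@Ck_diff _ _ (frameJ R m) _ _ k F id (fun w => ltrans w xi)).
- exact: sF.
- exact: Ck_idg.
- exact: smooth_ltrans.
Qed.

Section Field.
Variables (xi : E) (gam : R -> G).
Hypothesis gamE : forall t, jet (gam t) = aexp xi t.

Lemma gam_derive (f : C) (g : G) (F : E -> R) : smooth F ->
  (\forall w \near jet g, forall h : G, jet h = w -> f h = F w) ->
  is_derive (0 : R) (1 : R) (fun t => f (g * gam t)%g : R) ('d F (jet g) (ltrans (jet g) xi)).
Proof.
move=> sF hF.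
pose c t := aff (jet g) (aexp xi t).
have c0 : c 0 = jet g by rewrite /c aexp0 aff1r.
have dc : is_derive (0 : R) (1 : R) c (ltrans (jet g) xi).
  have sa : smooth (aff (jet g)).
    by apply: smooth_aff; [move=> k; exact: Ck_cst|move=> k; exact: Ck_idg].
  have := is_derive_curve (smooth_diff _ sa) (aexp_derive xi 0).
  rewrite aexp0 ltrans1; congr is_derive.
  have h (t : R) : aff (jet g) (one + t *: xi) = jet g + t *: ltrans (jet g) xi.
    apply: (f_equal2 pair) => /=.
      by rewrite add0r -scalemxAr.
    by rewrite mulmxDr mulmx1 -scalemxAr.
  have h1 : is_derive (0 : R) (1 : R) (fun t : R => aff (jet g) (one + t *: xi)) ('d (aff (jet g)) one xi).
    have E0 : one + (0 : R) *: xi = one by rewrite scale0r addr0.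
    by have := is_derive_curve (smooth_diff _ sa) (is_derive_line one xi 0); rewrite E0.
  have h2 := is_derive_line (jet g) (ltrans (jet g) xi) 0.
  rewrite (_ : (fun t : R => _) = (fun t : R => jet g + t *: ltrans (jet g) xi)) in h1; last exact/funext.
  exact: etrans (esym (@derive_val _ _ _ _ _ _ _ h1)) (@derive_val _ _ _ _ _ _ _ h2).
have dF : differentiable F (c 0) by exact: smooth_diff sF.
have := is_derive_curve dF dc; rewrite c0 => h.
apply: near_eq_is_derive h.
have cc : c @ (0 : R) --> jet g.
  rewrite -c0; apply: differentiable_continuous; apply/derivable1_diffP.
  by case: dc.
have ev : \forall t \near (0 : R), forall h : G, jet h = c t -> f h = F (c t) := cc _ hF.
near=> t; have ht : forall h : G, jet h = c t -> f h = F (c t) by near: t.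
by rewrite ht// jetM gamE.
Unshelve. all: by end_near.
Qed.

Let vff (f : C) (g : G) : R := derive (fun t => f (g * gam t)%g : R) (0 : R) (1 : R).

Let vffE (f : C) (g : G) (F : E -> R) : smooth F ->
  (\forall w \near jet g, forall h : G, jet h = w -> f h = F w) ->
  vff f g = 'd F (jet g) (ltrans (jet g) xi).
Proof. by move=> sF hF; have h := gam_derive sF hF; rewrite /vff derive_val. Qed.

Let vff_smooth f : `[< smoothG (vff f) >].
Proof.
apply/asboolP => g; have [F sF hF] := C_local_near f g.
exists (fun w => 'd F w (ltrans w xi)); first exact: smooth_diffl.
near=> w => h hw; rewrite -hw; apply: vffE => //; rewrite hw.
suff : forall h : G, jet h = w -> \forall w' \near w, forall h' : G, jet h' = w' -> f h' = F w'.
  by apply; exact: hw.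
by near: w.
Unshelve. all: by end_near.
Qed.

Let vfC (f : C) : C := MkCinf (vff_smooth f).

Let gam_is_derive (f : C) (g : G) : is_derive (0 : R) (1 : R) (fun t => f (g * gam t)%g : R) (vfC f g).
Proof.
have [F sF hF] := C_local f g.
by have h := gam_derive sF hF; rewrite -[vfC f g]/(vff f g) (vffE sF hF).
Qed.

Let vf_linear : linear vfC.
Proof.
move=> a x y; apply: Cext => g.
have h1 := gam_is_derive (a *: x + y) g.
have h2 := is_deriveD (is_deriveZ a (gam_is_derive x g)) (gam_is_derive y g).
exact: etrans (esym (@derive_val _ _ _ _ _ _ _ h1)) (@derive_val _ _ _ _ _ _ _ h2).
Qed.

Definition vfield_of : OpG R P := MkEndo (introT (asboolP _) vf_linear).

Lemma vfield_of_derive (f : C) (g : G) :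
  is_derive (0 : R) (1 : R) (fun t => f (g * gam t)%g : R) (vfield_of f g).
Proof. exact: gam_is_derive. Qed.

Lemma vfield_of_lie : lieG vfield_of.
Proof.
split=> [f g|h f f' ff' g].
  apply: Cext => x.
  have h1 := gam_is_derive (f * g) x.
  have h2 := is_deriveM (gam_is_derive f x) (gam_is_derive g x).
  have := etrans (esym (@derive_val _ _ _ _ _ _ _ h1)) (@derive_val _ _ _ _ _ _ _ h2).
  have g0 : gam 0 = 1%g by apply: jet_inj; rewrite gamE aexp0 jet1.
  rewrite g0 mulg1 CD !CM => ->.
  by rewrite addrC [_ * g x]mulrC.
have h1 := gam_is_derive f' g.
have h2 := gam_is_derive f (h * g)%g.
rewrite (_ : (fun t => f' _) = fun t => f (h * g * gam t)%g) in h1.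
  exact: etrans (esym (@derive_val _ _ _ _ _ _ _ h1)) (@derive_val _ _ _ _ _ _ _ h2).
by apply/funext => t; rewrite ff' mulgA.
Qed.

End Field.

End LieAlgebra.

(** * The Lie algebra of G and its exponential map *)

Section LieFacts.
Variables (R : realType) (m : nat) (P : primitive m).
Local Notation V := 'cV[R]_m.
Local Notation E := ('cV[R]_m * 'M[R]_m)%type.
Local Notation D := (Diff R P).
Local Notation G := (GPi R P).
Local Notation C := (Cinf R P).
Local Notation one := (aff1 R m).
Local Notation lie := (@lieG R m P).

Lemma OpGD (S T : OpG R P) f : (S + T) f = S f + T f. Proof. by []. Qed.
Lemma OpGZ a (S : OpG R P) f : (a *: S) f = a *: S f. Proof. by []. Qed.
Lemma OpGM (S T : OpG R P) f : (S * T) f = S (T f). Proof. by []. Qed.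

Lemma OpGsum (I : Type) (s : seq I) (F : I -> OpG R P) f :
  (\sum_(i <- s) F i) f = \sum_(i <- s) F i f.
Proof. by elim: s => [|i s IH]; rewrite ?big_nil// !big_cons OpGD IH. Qed.

Lemma lie_pd (Y : OpG R P) g : lie Y -> point_derivation g (fun f => Y f g).
Proof.
move=> [hM _]; split=> [a x y|x y].
  by rewrite (Endo_linear Y) CD CZ.
by rewrite hM.
Qed.

Lemma lie_left (Y : OpG R P) h f g : lie Y -> Y (pull (gval h) f) g = Y f (h * g)%g.
Proof. by move=> [_ hL]; apply: hL => x; rewrite pullE tilde_G. Qed.

Lemma lie_ext (Y Z : OpG R P) : lie Y -> lie Z -> (forall f, Y f 1%g = Z f 1%g) -> Y = Z.
Proof.
move=> hY hZ h; apply: EndoE => f; apply: Cext => g.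
by rewrite -[g]mulg1 -!lie_left.
Qed.

(** The velocity of a point derivation is tangent, so its exponential stays in G; differentiating
    along right translations by this subgroup gives a left-invariant field with the prescribed value
    at the unit. *)
Lemma pd_flow (dl : C -> R) : point_derivation 1%g dl -> exists (Z : OpG R P) (gam : R -> G),
  [/\ lie Z, forall f, Z f 1%g = dl f,
    forall s t, gam (s + t) = (gam s * gam t)%g
  & forall (f : C) (g : G), is_derive (0 : R) (1 : R) (fun t => f (g * gam t)%g : R) (Z f g)].
Proof.
move=> pd; have tx := velocity_tangent pd.
have [gam gamE] := choice (tangent_aexp tx).
exists (vfield_of gamE), gam; split.
- exact: vfield_of_lie.
- move=> f; have [F sF hF] := C_local f 1%g.
  rewrite (pd_chain pd sF hF).
  have h1 := vfield_of_derive gamE f 1%g.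
  have h2 := gam_derive gamE sF hF; rewrite jet1 ltrans1 in h2.
  rewrite jet1.
  exact: etrans (esym (@derive_val _ _ _ _ _ _ _ h1)) (@derive_val _ _ _ _ _ _ _ h2).
- by move=> s t; apply: jet_inj; rewrite jetM !gamE aexpD.
- exact: vfield_of_derive.
Qed.

(** The choice made in [expG] has a solution: a left-invariant field is determined by its value at
    the unit, hence is the one that [pd_flow] integrates. *)
Lemma expG_spec (Y : OpG R P) : lie Y ->
  (forall s t, expG Y (s + t) = (expG Y s * expG Y t)%g) /\
  forall (f : C) (g : G), is_derive (0 : R) (1 : R) (fun t => f (g * expG Y t)%g : R) (Y f g).
Proof.
move=> hY; have [Z [gam [hZ ZY gM gD]]] := pd_flow (lie_pd 1%g hY).
have e : Y = Z by apply: lie_ext => // f; rewrite ZY.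
rewrite /expG; set S := (X in xget _ X).
suff : S (xget (fun=> 1%g) S) by [].
by apply: (@xgetPex _ (fun=> 1%g) S); exists gam; split => // f g; rewrite e.
Qed.

Lemma lie_linear_comb (I : Type) (s : seq I) (c : I -> R) (F : I -> lie) :
  lie (\sum_(k <- s) c k *: val (F k)).
Proof.
elim: s => [|k s [h1 h2]].
  rewrite big_nil; split=> [f g|h f f' _ g].
    by rewrite -[(0 : OpG R P) _]/(0 : C) mul0r mulr0 addr0.
  by [].
have [k1 k2] : lie (val (F k)) by have := valP (F k); rewrite inE.
rewrite big_cons; split=> [f g|h f f' ff g].
  by rewrite !OpGD !OpGZ h1 k1 mulrDl mulrDr -scalerAl -scalerAr scalerDr addrACA.
by rewrite !OpGD !OpGZ !CD !CZ (h2 _ _ _ ff) (k2 _ _ _ ff).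
Qed.

Lemma smooth_adj i j : smooth (fun w : E => (\adj w.2) i j : R).
Proof.
have s : smooth (fun w : E => (-1) ^+ (j + i) * \det (row' j (col' i w.2)) : R).
  apply: smooth_mul; first by move=> k; exact: Ck_cst.
  apply: smooth_det => a b.
  have := @smooth_snd R m (lift j a) (lift i b).
  by congr smooth; apply/funext => w; rewrite !mxE.
by move: s; congr smooth; apply/funext => w; rewrite mxE.
Qed.

Lemma inv_lin (g : G) : (jet g^-1%g).2 = invmx (jet g).2.
Proof.
have h : (jet g).2 *m (jet g^-1%g).2 = 1%:M.
  by have := jetM g g^-1%g; rewrite mulgV jet1 => /(congr1 snd) /= /esym.
by rewrite -[LHS](mulKmx (jet_unit g)) h mulmx1.
Qed.

Lemma smooth_inv_lin i l : smoothG (fun g : G => (jet g^-1%g).2 i l).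
Proof.
move=> g.
have d0 : \det (jet g).2 != 0 by have := jet_unit g; rewrite unitmxE unitfE.
(* The inverse of the determinant is not smooth on all matrices; near [jet g] it has a globally
   smooth representative. *)
have [r sr hr] := local_inverse (@smooth_det2 R m) d0.
exists (fun w => r w * (\adj w.2) i l).
  by apply: smooth_mul => //; exact: smooth_adj.
near=> w => h hw; rewrite inv_lin hw /invmx -hw jet_unit hw mxE; congr (_ * _).
have e : \det w.2 * r w = 1 by near: w.
have w0 : \det w.2 != 0 by have := jet_unit h; rewrite hw unitmxE unitfE.
by apply: (mulfI w0); rewrite e mulfV.
Unshelve. all: by end_near.
Qed.

Definition binv i l : C := MkCinf (introT (asboolP _) (@smooth_inv_lin i l)).

End LieFacts.

(** * Frames of TG and the matrices Gam *)

Section Basis.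
Variables (R : realType) (m : nat) (P : primitive m) (d : nat).
Local Notation V := 'cV[R]_m.
Local Notation E := ('cV[R]_m * 'M[R]_m)%type.
Local Notation D := (Diff R P).
Local Notation G := (GPi R P).
Local Notation N := (NPi R P).
Local Notation C := (Cinf R P).
Local Notation one := (aff1 R m).
Local Notation lie := (@lieG R m P).
Variables (X : 'I_d -> lie) (hX : is_basis X).
Local Notation XX i := (val (X i) : OpG R P).

Lemma X_lie i : lie (XX i). Proof. by have := valP (X i); rewrite inE. Qed.

Lemma X_span (Y : OpG R P) : lie Y -> exists c : 'I_d -> R, Y = \sum_k c k *: XX k.
Proof.
move=> hY; have yY : Y \in lie by rewrite inE.
by have [_ h] := hX; have [c e] := h (SigSub yY); exists c.
Qed.

Lemma X_indep (c : 'I_d -> R) : (forall f : C, \sum_k c k * XX k f 1%g = 0) -> forall k, c k = 0.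
Proof.
move=> h; have [hi _] := hX; apply: hi.
apply: (@lie_ext _ _ P); first exact: lie_linear_comb.
  by have := lie_linear_comb (P := P) [::] c X; rewrite big_nil.
move=> f; rewrite OpGsum Csum.
have E0 : (0 : OpG R P) f 1%g = 0 by [].
rewrite E0.
transitivity (\sum_k c k * XX k f 1%g).
  by apply: eq_bigr => k _; rewrite OpGZ CZ.
exact: h.
Qed.

Lemma X_indep_at (c : 'I_d -> R) (g : G) :
  (forall f : C, \sum_k c k * XX k f g = 0) -> forall k, c k = 0.
Proof.
move=> h; apply: X_indep => f; rewrite -[RHS](h (pull (gval g^-1%g) f)).
apply: eq_bigr => k _; rewrite (lie_left _ _ _ (X_lie k)) mulVg.
by [].
Qed.

(** The values of the X i on the jet coordinates form a matrix with independent rows, since by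
    [pd_chain] a derivation killing all coordinates is zero. A right inverse of it gives the dual
    basis. *)
Lemma dual_basis : exists L : 'I_d -> jidx m -> R,
  forall i j, \sum_k XX i (cc R P k) 1%g * L j k = (i == j)%:R.
Proof.
pose K := jidx m.
pose A : 'M[R]_(d, #|{: K}|) := \matrix_(i, k) XX i (cc R P (enum_val k)) 1%g.
have fA : row_free A.
  rewrite -kermx_eq0; apply/eqP/row_matrixP => i; rewrite row0.
  have : row i (kermx A) *m A = 0 by apply/sub_kermxP; exact: row_sub.
  set r := row i _ => rA; apply/rowP => k; rewrite [RHS]mxE.
  move: k; apply: (@X_indep (fun k => r 0 k)) => f.
  pose dl (f : C) := \sum_k r 0 k * XX k f 1%g.
  have pd : point_derivation 1%g dl.
    split=> [a x y|x y].
      rewrite /dl mulr_sumr -big_split; apply: eq_bigr => k _ /=.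
      by rewrite (Endo_linear (XX k)) CD CZ; ring.
    rewrite /dl mulr_sumr mulr_suml -big_split; apply: eq_bigr => k _ /=.
    by rewrite (pd_leibniz (lie_pd 1%g (X_lie k))); ring.
  have [F sF hF] := C_local f 1%g.
  rewrite -[LHS]/(dl f) (pd_chain pd sF hF) (_ : velocity dl = 0) ?linear0//.
  rewrite /velocity big1// => k _; rewrite (_ : dl (cc R P k) = 0) ?scale0r//.
  have /rowP/(_ (enum_rank k)) := rA; rewrite [LHS]mxE [RHS]mxE => e; rewrite -[RHS]e.
  by apply: eq_bigr => l _; rewrite [A l _]mxE enum_rankK.
have /row_freeP [B AB] := fA.
exists (fun j k => B (enum_rank k) j) => i j.
have /matrixP/(_ i j) := AB; rewrite [LHS]mxE [RHS]mxE => <-.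
rewrite (reindex _ (onW_bij _ (@enum_val_bij _))) /=.
by apply: eq_bigr => k _; rewrite [A i _]mxE enum_valK.
Qed.

Definition dualX : 'I_d -> jidx m -> R := sval (cid dual_basis).

Lemma dualXP i j : \sum_k XX i (cc R P k) 1%g * dualX j k = (i == j)%:R.
Proof. by rewrite /dualX; case: cid. Qed.

Lemma pd_coords (dl : C -> R) : point_derivation 1%g dl ->
  forall f, dl f = \sum_j (\sum_k dl (cc R P k) * dualX j k) * XX j f 1%g.
Proof.
move=> pd; have [Z [_ [hZ Zdl _ _]]] := pd_flow pd.
have [c Zc] := X_span hZ.
have dlE f : dl f = \sum_j c j * XX j f 1%g.
  by rewrite -Zdl Zc OpGsum Csum; apply: eq_bigr => j _; rewrite OpGZ CZ.
move=> f; rewrite dlE; apply: eq_bigr => j _; congr (_ * _).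
transitivity (\sum_k \sum_i c i * (XX i (cc R P k) 1%g * dualX j k)).
  rewrite exchange_big /= (bigD1 j)//= -mulr_sumr dualXP eqxx mulr1 big1 ?addr0//.
  by move=> i ij; rewrite -mulr_sumr dualXP (negbTE ij) mulr0.
by apply: eq_bigr => k _; rewrite dlE mulr_suml; apply: eq_bigr => i _; rewrite mulrA.
Qed.

Section GamEx.
Variables (phi : D) (i : 'I_d).

Let DD (f : C) : C := pull phi (XX i (pull (phi^-1)%g f)).

Let DD_linear a x y : DD (a *: x + y) = a *: DD x + DD y.
Proof. by rewrite /DD pull_linear (Endo_linear (XX i)) pull_linear. Qed.

Let DD_leibniz x y : DD (x * y) = DD x * y + x * DD y.
Proof.
have [hM _] := X_lie i.
rewrite /DD pull_mul hM -[pull phi (_ + _)]/(pull phi (_ + _)).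
have -> (a b : C) : pull phi (a + b) = pull phi a + pull phi b.
  by have := pull_linear phi 1 a b; rewrite !scale1r.
by rewrite !pull_mul !pullK.
Qed.

Let dl (g : G) (f : C) : R := DD (pull (gval g^-1%g) f) g.

Let dl_pd g : point_derivation 1%g (dl g).
Proof.
split=> [a x y|x y]; first by rewrite /dl pull_linear DD_linear CD CZ.
rewrite /dl pull_mul DD_leibniz CD !CM !pullE !tilde_G mulVg.
by [].
Qed.

(** The values on jet coordinates of the derivation [DD] translated from g to the unit, written out
    so as to be visibly smooth in g; constants drop out because [DD] kills them. *)
Let entry (k : jidx m) : C :=
  match k with
  | inl a => \sum_l binv R P a l * DD (cc R P (inl l))
  | inr ab => \sum_l binv R P ab.1 l * DD (cc R P (inr (l, ab.2)))
  end.

Let DD0 : DD 0 = 0.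
Proof. by have := DD_linear (-1) 0 0; rewrite !scaleN1r oppr0 addr0 addNr. Qed.

Let DD1 : DD 1 = 0.
Proof.
have := DD_leibniz 1 1; rewrite !mulr1 mul1r => /eqP.
by rewrite -subr_eq0 opprD addrA subrr sub0r oppr_eq0 => /eqP.
Qed.

Let DDcomb (a0 : R) (I : finType) (c : I -> R) (F : I -> C) :
  DD (a0 *: 1 + \sum_l c l *: F l) = \sum_l c l *: DD (F l).
Proof.
rewrite DD_linear DD1 scaler0 add0r.
elim: (index_enum I) => [|l s IH]; first by rewrite !big_nil DD0.
by rewrite !big_cons DD_linear IH.
Qed.

Let entryE g k : dl g (cc R P k) = entry k g.
Proof.
have J (h : G) : jet (g^-1 * h)%g = aff (jet g^-1%g) (jet h) by rewrite jetM.
case: k => [a|[a b]]; rewrite /dl /entry Csum.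
  have -> : pull (gval g^-1%g) (cc R P (inl a)) = (jet g^-1%g).1 a 0 *: 1
     + \sum_l (jet g^-1%g).2 a l *: cc R P (inl l).
    apply: Cext => h; rewrite pullE tilde_G CD CZ C1 mulr1 Csum.
    by rewrite -[LHS]/(jcof (inl a) (jet (g^-1 * h)%g)) J /= !mxE.
  by rewrite DDcomb Csum; apply: eq_bigr => l _; rewrite CZ CM.
have -> : pull (gval g^-1%g) (cc R P (inr (a, b))) = (0 : R) *: 1
   + \sum_l (jet g^-1%g).2 a l *: cc R P (inr (l, b)).
  apply: Cext => h; rewrite pullE tilde_G scale0r add0r Csum.
  by rewrite -[LHS]/(jcof (inr (a, b)) (jet (g^-1 * h)%g)) J /= !mxE.
by rewrite DDcomb Csum; apply: eq_bigr => l _; rewrite CZ CM.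
Qed.

(** Conjugated by [phi], the field X i is still a derivation. At each g, moved to the unit, it is a
    combination of the X j whose coefficients are its values on coordinates, and these depend
    smoothly on g. *)
Lemma Gam_row_ex : exists M : 'I_d -> C, forall xi : C,
  pull phi (XX i (pull (phi^-1)%g xi)) = \sum_j M j * XX j xi.
Proof.
exists (fun j => \sum_k dualX j k *: entry k) => xi; apply: Cext => g.
have -> : pull phi (XX i (pull (phi^-1)%g xi)) g = dl g (pull (gval g) xi).
  by rewrite /dl -pullM mulgV pull1.
rewrite (pd_coords (dl_pd g)) Csum; apply: eq_bigr => j _.
rewrite CM (lie_left _ _ _ (X_lie j)) mulg1 Csum; congr (_ * _).
by apply: eq_bigr => k _; rewrite entryE CZ mulrC.
Qed.

End GamEx.

Lemma GamP (phi : D) i (xi : C) :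
  pull phi (XX i (pull (phi^-1)%g xi)) = \sum_j Gam X phi i j * XX j xi.
Proof.
have [F hF] := choice (Gam_row_ex phi).
rewrite /Gam; set S := (X in xget _ X).
suff : S (xget 0 S) by apply.
apply: (@xgetPex _ 0 S); exists (\matrix_(i, j) F i j) => k f.
by rewrite hF; apply: eq_bigr => j _; rewrite mxE.
Qed.

Lemma XC_indep (c c' : 'I_d -> C) :
  (forall f : C, \sum_k c k * XX k f = \sum_k c' k * XX k f) -> forall k, c k = c' k.
Proof.
move=> h k; apply: Cext => g; apply/eqP; rewrite -subr_eq0; apply/eqP.
move: k; apply: (@X_indep_at (fun k => c k g - c' k g) g) => f.
have := congr1 (fun x : C => x g) (h f); rewrite /= !Csum => e.
transitivity (\sum_k c k g * XX k f g - \sum_k c' k g * XX k f g).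
  by rewrite -sumrB; apply: eq_bigr => k _; rewrite mulrBl.
by rewrite [X in X - _](e : _ = _) subrr.
Qed.

Lemma Gam_uniq (phi : D) (M : 'M[C]_d) :
  (forall i (xi : C), pull phi (XX i (pull (phi^-1)%g xi)) = \sum_j M i j * XX j xi) ->
  M = Gam X phi.
Proof.
move=> h; apply/matrixP => i; apply: XC_indep => f.
by rewrite -h GamP.
Qed.

End Basis.

(** * Unipotence of Gam at the unit *)

Section Unipotent.
Variables (R : realType) (m : nat) (P : primitive m) (d : nat).
Local Notation E := ('cV[R]_m * 'M[R]_m)%type.
Local Notation D := (Diff R P).
Local Notation G := (GPi R P).
Local Notation N := (NPi R P).
Local Notation C := (Cinf R P).
Local Notation one := (aff1 R m).
Local Notation lie := (@lieG R m P).
Variables (X : 'I_d -> lie) (hX : is_basis X).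
Local Notation XX i := (val (X i) : OpG R P).

Definition Gam_unit (psi : N) : 'M[R]_d := \matrix_(i, j) Gam X (nval psi) i j 1%g.

Let vel i : E := velocity (fun f : C => XX i f 1%g).

Let vel_indep (c : 'I_d -> R) : \sum_k c k *: vel k = 0 -> forall k, c k = 0.
Proof.
move=> h; apply: (X_indep hX) => f.
have [F sF hF] := C_local f 1%g.
transitivity ('d F (jet (1%g : G)) (\sum_k c k *: vel k)); last by rewrite h linear0.
rewrite linear_sum; apply: eq_bigr => k _.
by rewrite (pd_chain (lie_pd 1%g (X_lie X k)) sF hF) linearZ.
Qed.

(* Gam(psi) at the unit is the matrix of the differential at the unit of the
   action of psi^-1 on G. *)
Lemma Gam_unit_unipotent (psi : N) : (Gam_unit psi - 1) ^+ 4 = 0.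
Proof.
have [Phi [sP hP nP]] := jet_tilde (nval psi)^-1%g.
have {}nP : forall u, iter 4 (fun v => 'd Phi one v - v) u = 0.
  by apply: nP; have := nvalP (psi^-1)%g; rewrite inE.
pose T (u : E) : E := 'd Phi one u - u.
have TL : linear T by move=> a u v; rewrite /T linearP scalerBr opprD addrACA.
pose TT : {linear E -> E} := HB.pack T (GRing.isLinear.Build _ _ _ _ _ TL).
(* [Gam_unit psi - 1] is the matrix of [T] on the velocities of the X i, so its powers follow the
   iterates of [T]. *)
have step i : \sum_j (Gam_unit psi - 1) i j *: vel j = T (vel i).
  transitivity ((\sum_j Gam_unit psi i j *: vel j) - vel i).
    rewrite (eq_bigr (fun j => Gam_unit psi i j *: vel j - (i == j)%:R *: vel j)).
      rewrite sumrB; congr (_ - _); rewrite (bigD1 i)//= eqxx scale1r big1 ?addr0//.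
      by move=> j ij; rewrite eq_sym (negbTE ij) scale0r.
    by move=> j _; rewrite !mxE -scalerBl.
  rewrite /T; congr (_ - _).
  rewrite (frameE (frameJ R m) (\sum_j _)) (frameE (frameJ R m) ('d Phi one (vel i))).
  apply: eq_bigr => k _; congr (_ *: _).
  have e1 : XX i (pull (nval psi)^-1%g (cc R P k)) 1%g = \sum_j Gam_unit psi i j * XX j (cc R P k) 1%g.
    have := congr1 (fun x : C => x 1%g) (GamP hX (nval psi) i (cc R P k)).
    rewrite pullE tilde_N1 Csum => ->.
    by apply: eq_bigr => j _; rewrite mxE.
  have sk : smooth (jco R k \o Phi) by apply: (smooth_compJ _ sP); exact: smooth_jco.
  have e2 : XX i (pull (nval psi)^-1%g (cc R P k)) 1%g = 'd (jco R k \o Phi) one (vel i).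
    rewrite (pd_chain (lie_pd 1%g (X_lie X i)) sk) ?jet1//.
    by near=> w => h hh; rewrite pullE -hh -[LHS]/(jco R k (jet (tilde _ h))) hP.
  have ck : continuous (jco R k : E -> R) := @fco_cont _ _ (frameJ R m) k.
  have e3 : 'd (jco R k \o Phi) one (vel i) = jco R k ('d Phi one (vel i)).
    have e := diff_compE (vel i) (smooth_diff one sP) (@linear_differentiable R _ _ (jco R k) (Phi one) ck).
    exact: etrans e (congr1 (fun l : E -> R => l ('d Phi one (vel i))) (diff_lin (Phi one) ck)).
  rewrite -[RHS]e3 -e2 e1 -[LHS]/(jco R k _) linear_sum; apply: eq_bigr => j _.
  by rewrite linearZ; congr (_ * _); exact: velocity_co (lie_pd 1%g (X_lie X j)).
have pow n i : \sum_j ((Gam_unit psi - 1) ^+ n) i j *: vel j = iter n T (vel i).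
  elim: n i => [|n IH] i.
    rewrite expr0 (bigD1 i)//= mxE eqxx scale1r big1 ?addr0// => j ij.
    by rewrite mxE eq_sym (negbTE ij) scale0r.
  rewrite exprSr.
  transitivity (\sum_l ((Gam_unit psi - 1) ^+ n) i l *: T (vel l)).
    under [RHS]eq_bigr do rewrite -step scaler_sumr.
    rewrite exchange_big; apply: eq_bigr => j _ /=.
    by rewrite mxE scaler_suml; apply: eq_bigr => l _; rewrite scalerA.
  rewrite iterS -IH -[T (\sum_j _)]/(TT _) linear_sum.
  by apply: eq_bigr => l _; rewrite linearZ.
apply/matrixP => i j; rewrite [RHS]mxE; move: j; apply: vel_indep.
by rewrite pow nP.
Unshelve. all: by end_near.
Qed.

End Unipotent.

(** * Linear maps and Sweedler sums *)

Section RawLinear.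
Variables (R : comNzRingType) (A B : lmodType R) (f : A -> B).
Hypothesis lf : linear f.

Lemma rlinD x y : f (x + y) = f x + f y.
Proof. by have := lf 1 x y; rewrite !scale1r. Qed.

Lemma rlin0 : f 0 = 0.
Proof. by apply: (addrI (f 0)); rewrite -rlinD !addr0. Qed.

Lemma rlinZ a x : f (a *: x) = a *: f x.
Proof. by have := lf a x 0; rewrite rlin0 !addr0. Qed.

Lemma rlinN x : f (- x) = - f x.
Proof. by rewrite -scaleN1r rlinZ scaleN1r. Qed.

Lemma rlin_sum (I : Type) (s : seq I) (F : I -> A) :
  f (\sum_(i <- s) F i) = \sum_(i <- s) f (F i).
Proof. by elim: s => [|i s IH]; rewrite ?big_nil ?rlin0// !big_cons rlinD IH. Qed.

End RawLinear.

Section TensorTheory.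
Variables (R : comNzRingType) (A B : lmodType R).
Implicit Types t : tensor A B.

Lemma swE (W : lmodType R) t (b : A -> B -> W) :
  sweedler t b = \sum_(p <- repr (t : {eq_quot tensor_equiv A B})) b p.1 p.2.
Proof. by []. Qed.

Lemma eq_sw (W : lmodType R) t (b b' : A -> B -> W) :
  (forall x y, b x y = b' x y) -> sweedler t b = sweedler t b'.
Proof. by move=> h; rewrite !swE; apply: eq_bigr => p _; exact: h. Qed.

Lemma sw_comp (W W' : lmodType R) (f : W -> W') t (b : A -> B -> W) : linear f ->
  f (sweedler t b) = sweedler t (fun x y => f (b x y)).
Proof. by move=> lf; rewrite !swE rlin_sum. Qed.

Lemma sw_addf (W : lmodType R) t (b b' : A -> B -> W) :
  sweedler t (fun x y => b x y + b' x y) = sweedler t b + sweedler t b'.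
Proof. by rewrite !swE big_split. Qed.

Lemma sw_scalef (W : lmodType R) a t (b : A -> B -> W) :
  sweedler t (fun x y => a *: b x y) = a *: sweedler t b.
Proof. by rewrite !swE scaler_sumr. Qed.

Lemma sw_linear (W : lmodType R) (b : A -> B -> W) : bilinear_map b ->
  linear (fun t => sweedler t b).
Proof. by move=> hb a t u; rewrite -(swZ hb) -(swD hb). Qed.

Lemma tpure_bilinear : bilinear_map (@tpure R A B).
Proof.
split=> [y a u v|x a u v]; apply: tensorP => W b hb;
  rewrite (sw_linear hb) !(tpure_bilinear_eval _ _ hb).
- exact: (hb.1 y a u v).
- exact: (hb.2 x a u v).
Qed.

Lemma tensor_sum t : t = \sum_(p <- repr (t : {eq_quot tensor_equiv A B})) p.1 \ox p.2.
Proof.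
apply: tensorP => W b hb; rewrite (rlin_sum (sw_linear hb)) swE.
by apply: eq_bigr => p _; rewrite (tpure_bilinear_eval _ _ hb).
Qed.

Lemma tensor_ind (Q : tensor A B -> Prop) : (forall x y, Q (x \ox y)) ->
  (forall t u, Q t -> Q u -> Q (t + u)) -> forall t, Q t.
Proof.
move=> hp hD t; rewrite (tensor_sum t); elim: (repr _) => [|p s IH].
  rewrite big_nil (_ : 0 = 0 \ox 0 :> tensor A B)//.
  by rewrite (rlin0 (tpure_bilinear.2 0)).
by rewrite big_cons; apply: hD.
Qed.

End TensorTheory.

(** * Separating families of functionals *)

Section Separation.
Variable R : fieldType.

Definition separating (I : Type) (A : lmodType R) (l : I -> A -> R) : Prop :=
  (forall i, linear (l i : A -> R^o)) /\ forall a, (forall i, l i a = 0) -> a = 0.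

Lemma sep_eq (I : Type) (A : lmodType R) (l : I -> A -> R) a b : separating l ->
  (forall i, l i a = l i b) -> a = b.
Proof.
move=> [ll ls] h; apply/eqP; rewrite -subr_eq0; apply/eqP/ls => i.
by rewrite (rlinD (ll i)) (rlinN (ll i)) h subrr.
Qed.

Definition tev (A B : lmodType R) (l : A -> R) (m : B -> R) (t : tensor A B) : R :=
  sweedler t (fun x y => l x * m y : R^o).

Lemma tev_bilinear (A B : lmodType R) (l : A -> R) (m : B -> R) :
  linear (l : A -> R^o) -> linear (m : B -> R^o) ->
  bilinear_map (fun x y => l x * m y : R^o).
Proof.
move=> ll lm; split=> [y a u v|x a u v].
  by rewrite ll mulrDl; congr (_ + _); exact: esym (mulrA _ _ _).
by rewrite lm mulrDr; congr (_ + _); exact: mulrCA.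
Qed.

Lemma tev_pure (A B : lmodType R) (l : A -> R) (m : B -> R) x y :
  linear (l : A -> R^o) -> linear (m : B -> R^o) -> tev l m (x \ox y) = l x * m y.
Proof. by move=> ll lm; exact: (tpure_bilinear_eval _ _ (tev_bilinear ll lm)). Qed.

Lemma tev_linear (A B : lmodType R) (l : A -> R) (m : B -> R) :
  linear (l : A -> R^o) -> linear (m : B -> R^o) -> linear (tev l m : _ -> R^o).
Proof. by move=> ll lm; exact: sw_linear (tev_bilinear ll lm). Qed.

(** Induction on the number of pure tensors. If [l i] does not kill [q.1], the equations for this i
    and all j express [q.2] through the other second factors, and substitution removes one term. *)
Lemma tensor_separating (I J : Type) (A B : lmodType R) (l : I -> A -> R) (m : J -> B -> R) :
  separating l -> separating m ->
  separating (fun ij : I * J => tev (l ij.1) (m ij.2)).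
Proof.
move=> [ll sl] sm; have lm := sm.1; split=> [[i j]|t]; first exact: tev_linear.
rewrite (tensor_sum t); move: (repr _) => s h.
have {}h i j : tev (l i) (m j) (\sum_(p <- s) p.1 \ox p.2) = 0 by exact: h (i, j).
have pb := @tpure_bilinear R A B.
have [n] := ubnP (size s); elim: n s h => // n IH s h hs.
have [z|] := pselect (forall i (p : A * B), p \in s -> l i p.1 = 0).
  rewrite big_seq big1// => p ps; rewrite (sl p.1) => [|i]; last exact: z.
  exact: rlin0 (pb.1 p.2).
move=> /existsNP[i /existsNP[q /not_implyP[qs /eqP lq]]].
pose r (p : A * B) := l i p.1 / l i q.1.
have eq : \sum_(p <- s) p.1 \ox p.2 = q.1 \ox q.2 + \sum_(p <- rem q s) p.1 \ox p.2.
  by rewrite (perm_big _ (perm_to_rem qs)) big_cons.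
have q2 : q.2 = - \sum_(p <- rem q s) r p *: p.2.
  apply: (sep_eq sm) => j; have := h i j.
  rewrite eq (rlinD (tev_linear (ll i) (lm j))) tev_pure// (rlin_sum (tev_linear (ll i) (lm j))).
  move=> /eqP; rewrite addr_eq0 => /eqP e.
  rewrite (rlinN (lm j)) (rlin_sum (lm j)); apply: (mulfI lq); rewrite e mulrN mulr_sumr.
  congr (- _); apply: eq_bigr => p _; rewrite (rlinZ (lm j)) tev_pure//.
  by rewrite /r -[_ *: _]/(_ * _) mulrA mulrCA divff// mulr1.
have e2 : \sum_(p <- s) p.1 \ox p.2 =
    \sum_(p <- [seq (p.1 - r p *: q.1, p.2) | p <- rem q s]) p.1 \ox p.2.
  rewrite eq big_map {1}q2 (rlinN (pb.2 _)) (rlin_sum (pb.2 _)) -sumrN -big_split /=.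
  apply: eq_bigr => p _; rewrite (rlinD (pb.1 _)) (rlinN (pb.1 _)) (rlinZ (pb.1 _)).
  by rewrite (rlinZ (pb.2 _)) addrC.
rewrite e2; apply: IH => [i' j'|]; first by rewrite -e2; exact: h.
rewrite size_map size_rem//; case: (s) qs hs => //= *; lia.
Qed.

End Separation.

(** * Automatic proofs of linearity *)

Section LinearCombinators.
Variable R : comNzRingType.
Implicit Types A B Z W V : lmodType R.

Lemma lin_id A : linear (fun x : A => x). Proof. by []. Qed.

Lemma lin_comp A B W (g : B -> W) (f : A -> B) : linear g -> linear f ->
  linear (fun x => g (f x)).
Proof. by move=> lg lf a u v /=; rewrite lf lg. Qed.

Lemma lin_add A B (f g : A -> B) : linear f -> linear g -> linear (fun x => f x + g x).
Proof. by move=> lf lg a u v /=; rewrite lf lg scalerDr addrACA. Qed.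

Lemma lin_opp A B (f : A -> B) : linear f -> linear (fun x => - f x).
Proof. by move=> lf a u v /=; rewrite lf scalerN opprD. Qed.

Lemma lin_scale A B c (f : A -> B) : linear f -> linear (fun x => c *: f x).
Proof. by move=> lf a u v /=; rewrite lf scalerDr !scalerA mulrC. Qed.

Lemma lin_scalel A B (f : A -> R^o) (w : B) : linear f -> linear (fun x => f x *: w).
Proof. by move=> lf a u v /=; rewrite lf scalerDl -scalerA. Qed.

Lemma lin_mull A (E : algType R) (f : A -> E) c : linear f -> linear (fun x => f x * c).
Proof. by move=> lf a u v /=; rewrite lf mulrDl scalerAl. Qed.

Lemma lin_mulr A (E : algType R) (f : A -> E) c : linear f -> linear (fun x => c * f x).
Proof. by move=> lf a u v /=; rewrite lf mulrDr scalerAr. Qed.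

Lemma lin_bill A B Z W (b : B -> Z -> W) (f : A -> B) c : bilinear_map b -> linear f ->
  linear (fun x => b (f x) c).
Proof. by move=> hb lf a u v /=; rewrite lf (hb.1 c). Qed.

Lemma lin_bilr A B Z W (b : Z -> B -> W) (f : A -> B) c : bilinear_map b -> linear f ->
  linear (fun x => b c (f x)).
Proof. by move=> hb lf a u v /=; rewrite lf (hb.2 c). Qed.

Lemma lin_swt V A B W (t : V -> tensor A B) (b : A -> B -> W) : linear t -> bilinear_map b ->
  linear (fun x => sweedler (t x) b).
Proof. by move=> lt hb a u v /=; rewrite lt (sw_linear hb). Qed.

Lemma lin_swb V A B W (t : tensor A B) (b : V -> A -> B -> W) :
  (forall x y, linear (fun z => b z x y)) -> linear (fun z => sweedler t (b z)).
Proof.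
move=> h a u v /=; rewrite -sw_scalef -sw_addf; apply: eq_sw => x y; exact: h.
Qed.

End LinearCombinators.

Lemma mul_bilinear (R : comNzRingType) (E : algType R) :
  bilinear_map ( *%R : E -> E -> E).
Proof.
by split=> [y|x]; [exact: (lin_mull y (@lin_id R E))|exact: (lin_mulr x (@lin_id R E))].
Qed.

Ltac lin_triv :=
  match goal with |- GRing.linear_for _ (fun x => x) => move=> ? ? ?; reflexivity end.

Ltac lin_leaf := fail.

(* Proves linearity of an expression built by sums, products, tensors and
   Sweedler sums from the maps known to [lin_leaf]. *)
Ltac lin :=
  lazymatch goal with
  | |- bilinear_map _ => first [assumption | exact: tpure_bilinear | lin_leaf | split; intros ?; simpl; lin]
  | |- GRing.linear_for _ _ => first
    [ exact: lin_id | lin_triv | assumption | exact: tpure_bilinear | lin_leaf | lin_step ]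
  end
with lin_step := cbv beta;
  match goal with
  | |- GRing.linear_for _ (fun x => sweedler ?t (@?b x)) =>
      apply: lin_swb; intros ? ?; simpl; lin
  | |- GRing.linear_for _ (fun x => sweedler (@?t x) ?b) =>
      apply: (lin_swt (t := t) (b := b)); [lin | lin]
  | |- GRing.linear_for _ (fun x => @?f x + @?g x) => apply: (lin_add (f := f) (g := g)); lin
  | |- GRing.linear_for _ (fun x => - @?f x) => apply: (lin_opp (f := f)); lin
  | |- GRing.linear_for _ (fun x => ?c *: @?f x) => apply: (lin_scale c (f := f)); lin
  | |- GRing.linear_for _ (fun x => @?f x *: ?w) => apply: (lin_scalel w (f := f)); lin
  | |- GRing.linear_for _ (fun x => @?f x * ?c) => first [apply: lin_mull | apply: (lin_mull (f := f) c)]; lin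
  | |- GRing.linear_for _ (fun x => ?c * @?f x) => first [apply: lin_mulr | apply: (lin_mulr (f := f) c)]; lin
  | |- GRing.linear_for _ (fun x => ?b ?c (@?f x)) =>
      apply: (lin_bilr (b := b) (f := f) c); [first [assumption | exact: tpure_bilinear | lin_leaf] | lin]
  | |- GRing.linear_for _ (fun x => ?b (@?f x) ?c) =>
      apply: (lin_bill (b := b) (f := f) c); [first [assumption | exact: tpure_bilinear | lin_leaf] | lin]
  | |- GRing.linear_for _ (fun x => ?g (@?f x)) =>
      lazymatch f with (fun y => y) => fail | _ =>
        apply: (lin_comp (g := g) (f := f)); [solve [lin] | lin] end
  end.

(** * Universal property of the enveloping algebra *)

Section EnvelopTheory.
Variables (R : comNzRingType) (E : algType R) (L : set E).
Local Notation U := (envelop L).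

Lemma uclassK (u : U) : uclass (urepr u) = u. Proof. exact: reprK. Qed.

Lemma uclass_add s t : uclass (UAdd s t) = uclass s + uclass t :> U.
Proof.
by apply: envelopP => B j hj; rewrite urepr_eval//= (evD hj) !(urepr_eval _ hj).
Qed.

Lemma uclass_mul s t : uclass (UMul s t) = uclass s * uclass t :> U.
Proof.
by apply: envelopP => B j hj; rewrite urepr_eval//= (evM hj) !(urepr_eval _ hj).
Qed.

Lemma uclass_scal a : uclass (UScal L a) = a *: (1 : U).
Proof.
by apply: envelopP => B j hj; rewrite urepr_eval//= (evZ hj) (ev1 hj).
Qed.

Lemma envelop_ind (Q : U -> Prop) : (forall x, Q (ugen x)) -> Q 1 ->
  (forall a u v, Q u -> Q v -> Q (a *: u + v)) ->
  (forall u v, Q u -> Q v -> Q (u * v)) -> forall u, Q u.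
Proof.
move=> hg h1 hl hm u; have h0 : Q 0.
  by have := hl (- 1) _ _ h1 h1; rewrite scaleN1r addNr.
rewrite -(uclassK u); elim: (urepr u) => [x|a|s hs t ht|s hs t ht]; first exact: hg.
- by rewrite uclass_scal -[_ *: _]addr0; exact: hl.
- by rewrite uclass_add -[X in X + _]scale1r; exact: hl.
- by rewrite uclass_mul; exact: hm.
Qed.

Section Lift.
Variables (B : algType R) (j : L -> B).
Hypothesis hj : lie_morphism j.

Definition ulift (u : U) : B := ueval j (urepr u).

Lemma ulift_linear : linear ulift.
Proof. by move=> a u v; rewrite /ulift (evD hj) (evZ hj). Qed.

Lemma uliftM u v : ulift (u * v) = ulift u * ulift v. Proof. exact: (evM hj). Qed.

Lemma ulift1 : ulift 1 = 1. Proof. exact: (ev1 hj). Qed.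

Lemma ulift_gen x : ulift (ugen x) = j x. Proof. exact: (urepr_eval _ hj). Qed.

End Lift.

Lemma ugen_lin a (x y z : L) : val z = a *: val x + val y ->
  ugen z = a *: ugen x + ugen y :> U.
Proof. exact: (ugen_lie L).1. Qed.

Lemma ugen_bracket (x y z : L) : val z = val x * val y - val y * val x ->
  ugen z = ugen x * ugen y - ugen y * ugen x :> U.
Proof. exact: (ugen_lie L).2. Qed.

End EnvelopTheory.

Section AlgMorph.
Variables (R : comNzRingType) (A B : algType R) (f : A -> B).
Hypotheses (fM : {morph f : x y / x * y}) (f1 : f 1 = 1).

Lemma amorphX x n : f (x ^+ n) = f x ^+ n.
Proof. by elim: n => [|n IH]; rewrite ?expr0 ?exprS ?fM ?IH. Qed.

Lemma amorph_prod (I : Type) (s : seq I) (F : I -> A) :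
  f (\prod_(i <- s) F i) = \prod_(i <- s) f (F i).
Proof. by elim: s => [|i s IH]; rewrite ?big_nil ?big_cons ?fM ?IH. Qed.

End AlgMorph.

(** * U as differential operators on G *)

Section Rep.
Variables (R : realType) (m : nat) (P : primitive m).
Local Notation C := (Cinf R P).
Local Notation G := (GPi R P).
Local Notation D := (Diff R P).
Local Notation lie := (@lieG R m P).
Local Notation U := (UPi R P).

Lemma val_lie_morphism : lie_morphism (val : lie -> OpG R P).
Proof. by split=> [a x y z ->|x y z ->]. Qed.

Definition rep (u : U) : OpG R P := ulift (val : lie -> OpG R P) u.

Lemma rep_linear : linear rep. Proof. exact: ulift_linear val_lie_morphism. Qed.
Lemma repM (u v : U) : rep (u * v) = rep u * rep v.
Proof. exact: uliftM val_lie_morphism u v. Qed.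
Lemma rep1 : rep (1 : U) = 1. Proof. exact: ulift1 val_lie_morphism. Qed.
Lemma rep_gen (Y : lie) : rep (ugen Y : U) = val Y.
Proof. exact: ulift_gen val_lie_morphism Y. Qed.

Lemma UPi_ind (Q : U -> Prop) : (forall x : lie, Q (ugen x)) -> Q 1 ->
  (forall a u v, Q u -> Q v -> Q (a *: u + v)) ->
  (forall u v, Q u -> Q v -> Q (u * v)) -> forall u, Q u.
Proof. exact: envelop_ind. Qed.

Lemma rep_linear_at (xi : C) : linear (fun u : U => rep u xi).
Proof. by move=> a u v; rewrite rep_linear. Qed.

End Rep.

(** * Poincare-Birkhoff-Witt: ordered monomials span *)

Section OrderedMonomials.
Variables (d : nat).
Local Notation MI := {ffun 'I_d -> nat}.

Definition mincr (I : MI) (k : 'I_d) : MI := [ffun i => (I i + (i == k))%N].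
Definition mdecr (I : MI) (k : 'I_d) : MI := [ffun i => (I i - (i == k))%N].
Definition mdeg (I : MI) : nat := \sum_i I i.

Lemma mdeg_incr I k : mdeg (mincr I k) = (mdeg I).+1.
Proof.
rewrite /mdeg (eq_bigr (fun i => (I i + (i == k))%N)) => [|i _]; last by rewrite ffunE.
rewrite big_split /= -addn1; congr addn.
by rewrite (bigD1 k)//= eqxx big1// => i /negbTE ->.
Qed.

Lemma mdecrK (I : MI) k : (0 < I k)%N -> mincr (mdecr I k) k = I.
Proof.
move=> h; apply/ffunP => i; rewrite !ffunE.
by case: eqP => [->|_] /=; [rewrite subnK|rewrite subn0 addn0].
Qed.

Lemma mincrK (I : MI) k : mdecr (mincr I k) k = I.
Proof. by apply/ffunP => i; rewrite !ffunE addnK. Qed.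

Lemma mincrC (I : MI) j k : mincr (mincr I j) k = mincr (mincr I k) j.
Proof. by apply/ffunP => i; rewrite !ffunE addnAC. Qed.

Lemma mdeg0P I : mdeg I = 0%N -> I = [ffun=> 0%N].
Proof.
by move=> /eqP; rewrite sum_nat_eq0 => /forallP h; apply/ffunP => i; rewrite ffunE; apply/eqP/h.
Qed.

Lemma min_index (I : MI) : (0 < mdeg I)%N ->
  exists2 k, (0 < I k)%N & forall i : 'I_d, (i < k)%N -> I i = 0%N.
Proof.
move=> h; have [k0 hk0] : exists k, (0 < I k)%N.
  apply/existsP; apply: contraLR h => /existsPn h; rewrite -eqn0Ngt; apply/eqP/big1 => i _.
  by have := h i; rewrite -eqn0Ngt => /eqP.
case: (@arg_minnP _ k0 (fun k : 'I_d => 0 < I k)%N (fun k : 'I_d => val k) hk0) => k hk mk; exists k => // i ik.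
by apply/eqP; rewrite eqn0Ngt; apply/negP => /mk; rewrite leqNgt ik.
Qed.

Lemma ordered_monom_cons (A : pzRingType) (x : 'I_d -> A) (I : MI) (k : 'I_d) :
  (forall i : 'I_d, (i < k)%N -> I i = 0%N) ->
  x k * \prod_(i < d) x i ^+ I i = \prod_(i < d) x i ^+ mincr I k i.
Proof.
move=> h; have E F : \prod_(i < d) F i = \prod_(i <- enum 'I_d) F i :> A.
  by rewrite [index_enum _]unlock enumT.
have tr : transitive (fun i j : 'I_d => (i < j)%N) by move=> ? ? ?; apply: ltn_trans.
rewrite !E; have : sorted (fun i j : 'I_d => (i < j)%N) (enum 'I_d).
  by have := iota_ltn_sorted 0 d; rewrite -val_enum_ord sorted_map.
have : k \in enum 'I_d by rewrite mem_enum.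
elim: (enum 'I_d) => // a s IH; rewrite inE !big_cons /= (path_sortedE tr).
case: (eqVneq k a) => [<- _ /andP[/allP al _]|ka /= ks /andP[/allP al so]].
  rewrite ffunE eqxx addn1 exprS -!mulrA; congr (_ * (_ * _)).
  rewrite !big_seq; apply: eq_bigr => i /al ki; rewrite ffunE.
  by case: eqP ki => [->|_]; rewrite ?ltnn// addn0.
by rewrite ffunE h ?al// eq_sym (negbTE ka) !expr0 !mul1r; exact: IH.
Qed.

End OrderedMonomials.

Section PBW.
Variables (R : realType) (m : nat) (P : primitive m) (d : nat).
Local Notation C := (Cinf R P).
Local Notation G := (GPi R P).
Local Notation D := (Diff R P).
Local Notation lie := (@lieG R m P).
Local Notation U := (UPi R P).
Local Notation MI := {ffun 'I_d -> nat}.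
Variables (X : 'I_d -> lie) (hX : is_basis X).
Local Notation XX i := (val (X i) : OpG R P).
Local Notation ux k := (ugen (X k) : U).

Definition ucomb (s : seq (R * MI)) : U := \sum_(p <- s) p.1 *: pbw X p.2.

Definition filt (n : nat) (u : U) : Prop :=
  exists2 s, u = ucomb s & forall p, p \in s -> (mdeg p.2 <= n)%N.

Lemma filt_lin n a u v : filt n u -> filt n v -> filt n (a *: u + v).
Proof.
move=> [s -> hs] [t -> ht]; exists ([seq (a * p.1, p.2) | p <- s] ++ t).
  rewrite /ucomb big_cat big_map scaler_sumr; congr (_ + _); apply: eq_bigr => p _.
  by rewrite scalerA.
move=> p; rewrite mem_cat => /orP[/mapP[q qs ->]|]; [exact: (hs q qs)|exact: ht].
Qed.

Lemma filt0 n : filt n 0. Proof. by exists [::]; rewrite // /ucomb big_nil. Qed.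

Lemma filt_pbw (I : MI) : filt (mdeg I) (pbw X I).
Proof.
exists [:: (1, I)]; first by rewrite /ucomb big_seq1 scale1r.
by move=> p; rewrite inE => /eqP ->.
Qed.

Lemma filt_sum n (K : Type) (s : seq K) (c : K -> R) (F : K -> U) :
  (forall k, filt n (F k)) -> filt n (\sum_(k <- s) c k *: F k).
Proof.
by move=> h; elim: s => [|k s IH]; [rewrite big_nil; exact: filt0|rewrite big_cons; apply: filt_lin; [exact: h|exact: IH]].
Qed.

Lemma filt_leq n n' u : (n <= n')%N -> filt n u -> filt n' u.
Proof. by move=> nn [s -> hs]; exists s => // p /hs h; exact: leq_trans h nn. Qed.

Lemma filtD n u v : filt n u -> filt n v -> filt n (u + v).
Proof. by move=> hu hv; rewrite -[u]scale1r; exact: filt_lin. Qed.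

Lemma ugen_X_span (Y : lie) : exists c : 'I_d -> R, ugen Y = \sum_k c k *: ux k :> U.
Proof.
have [c hc] := X_span hX (set_mem (valP Y)); exists c.
have L (s : seq 'I_d) : exists2 Z : lie, val Z = \sum_(k <- s) c k *: XX k :> OpG R P &
    ugen Z = \sum_(k <- s) c k *: ux k :> U.
  elim: s => [|k s [Z hZ IH]].
    have l0 : lie 0 by have := lie_linear_comb [::] c X; rewrite big_nil.
    exists (SigSub (mem_set l0)); rewrite !big_nil//.
    by rewrite (@ugen_lin _ _ _ (- 1) (SigSub (mem_set l0)) (SigSub (mem_set l0)) (SigSub (mem_set l0)))
      ?scaleN1r ?addNr//= scaler0 addr0.
  have l := lie_linear_comb (k :: s) c X.
  exists (SigSub (mem_set l)) => //; rewrite [RHS]big_cons -IH; apply: ugen_lin.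
  by rewrite hZ /=; exact: big_cons.
have [Z hZ <-] := L (index_enum _); suff -> : Y = Z by [].
by apply: val_inj; rewrite hZ -hc.
Qed.

Lemma bracket_span j k : exists c : 'I_d -> R,
  ux k * ux j = ux j * ux k + \sum_i c i *: ux i.
Proof.
have lb : lie (XX k * XX j - XX j * XX k).
  have := X_lie X k; have := X_lie X j; move=> [dj lj] [dk lk].
  have sb (S T : OpG R P) f : (S - T) f = S f - T f by [].
  split=> [f g|h f f' e g].
    rewrite !sb !OpGM !dj !dk.
    rewrite !(rlinD (Endo_linear (XX k))) !(rlinD (Endo_linear (XX j))) !dj !dk.
    ring.
  have e1 := lk h _ _ (lj h _ _ e) g; have e2 := lj h _ _ (lk h _ _ e) g.
  have sc (x y : C) k' : (x - y) k' = x k' - y k' by [].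
  by rewrite !sb !OpGM !sc e1 e2.
have [c hc] := ugen_X_span (SigSub (mem_set lb)); exists c.
have e : ugen (SigSub (mem_set lb)) = ux k * ux j - ux j * ux k :> U by exact: ugen_bracket.
by rewrite -hc e addrCA subrr addr0.
Qed.

Lemma pbw_incr (I : MI) (k : 'I_d) : (forall i : 'I_d, (i < k)%N -> I i = 0%N) ->
  ux k * pbw X I = pbw X (mincr I k).
Proof. exact: ordered_monom_cons. Qed.

(** If k exceeds the smallest index j of the monomial, [ux k] is moved past [ux j]. The bracket is a
    combination of generators, so the correction has lower degree and the induction on the degree
    absorbs it. *)
Lemma pbw_mul n : forall (I : MI) (k : 'I_d), (mdeg I <= n)%N ->
  exists2 w, filt (mdeg I) w & ux k * pbw X I = pbw X (mincr I k) + w.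
Proof.
elim: n => [|n IH] I k hI.
  exists 0; first exact: filt0.
  rewrite addr0; apply: pbw_incr => i _.
  by rewrite (mdeg0P (I := I)) ?ffunE//; lia.
have [I0|Ip] := posnP (mdeg I); first by apply: IH; rewrite I0.
have [j Ij jmin] := min_index Ip.
have [kj|jk] := leqP k j.
  exists 0; first exact: filt0.
  by rewrite addr0; apply: pbw_incr => i ik; apply: jmin; exact: leq_trans ik kj.
have filtX i u (n' : nat) : (n' <= n)%N -> filt n' u -> filt n'.+1 (ux i * u).
  move=> n'n [s -> hs]; rewrite /ucomb mulr_sumr big_seq.
  have h p : p \in s -> filt n'.+1 (ux i * (p.1 *: pbw X p.2)).
    move=> /hs hp; rewrite -scalerAr -[_ *: _]addr0; apply: filt_lin; last exact: filt0.
    have [w hw ->] := IH p.2 i (leq_trans hp n'n).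
    apply: filtD; last by apply: filt_leq hw; rewrite ltnW.
    by apply: (filt_leq _ (filt_pbw _)); rewrite mdeg_incr.
  elim: (s) h => [|p t It] h; first by rewrite big_nil; exact: filt0.
  rewrite -big_seq big_cons; apply: filtD; first by apply: h; rewrite mem_head.
  by rewrite big_seq; apply: It => q qt; apply: h; rewrite inE qt orbT.
set I' := mdecr I j; have eI : mincr I' j = I by exact: mdecrK.
have dI : mdeg I = (mdeg I').+1 by rewrite -{1}eI mdeg_incr.
have I'min (i : 'I_d) : (i < j)%N -> I' i = 0%N by move=> ij; rewrite ffunE jmin.
have [c hc] := bracket_span j k.
have [w hw ew] := IH I' k ltac:(lia).
have -> : pbw X I = ux j * pbw X I' by rewrite pbw_incr// eI.
rewrite mulrA hc mulrDl -mulrA ew mulrDr.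
rewrite pbw_incr; last first.
  move=> i ij; rewrite ffunE I'min// add0n.
  by case: eqP => // ik; move: ij; rewrite ik; lia.
rewrite -addrA mincrC eI; eexists; last by [].
apply: filtD; first by rewrite dI; apply: filtX => //; lia.
rewrite mulr_suml; under eq_bigr do rewrite -scalerAl.
apply: filt_sum => i; rewrite dI; apply: filtX; [lia|exact: filt_pbw].
Qed.

Lemma ugen_filt (Y : lie) n u : filt n u -> filt n.+1 (ugen Y * u).
Proof.
move=> [s -> hs]; have [c ->] := ugen_X_span Y.
rewrite mulr_suml; under eq_bigr do rewrite -scalerAl.
apply: filt_sum => k; rewrite /ucomb mulr_sumr.
elim: s hs => [|p s IH] hs; first by rewrite big_nil; exact: filt0.
rewrite big_cons -scalerAr; apply: filt_lin; last first.
  by apply: IH => q qs; apply: hs; rewrite inE qs orbT.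
have [w hw ->] := pbw_mul k (leqnn (mdeg p.2)).
have hp : (mdeg p.2 <= n)%N by apply: hs; rewrite mem_head.
apply: filtD; last by apply: filt_leq hw; rewrite (leq_trans hp).
by apply: (filt_leq _ (filt_pbw _)); rewrite mdeg_incr ltnS.
Qed.

Lemma pbw_span_raw (u : U) : exists n, filt n u.
Proof.
(* Strengthened to left multiplication by u, so that the induction over u only ever multiplies by
   one generator. *)
suff h v : (exists n, filt n v) -> exists n, filt n (u * v).
  rewrite -[u]mulr1; apply: h; exists (mdeg ([ffun=> 0%N] : MI)).
  rewrite (_ : 1 = pbw X [ffun=> 0%N]); first exact: filt_pbw.
  by rewrite /pbw big1// => i _; rewrite ffunE.
elim/UPi_ind: u v => [Y|| a u1 u2 h1 h2|u1 u2 h1 h2] v hv.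
- by have [n hn] := hv; exists n.+1; exact: ugen_filt.
- by rewrite mul1r.
- have [n1 f1] := h1 _ hv; have [n2 f2] := h2 _ hv; exists (maxn n1 n2).
  rewrite mulrDl -scalerAl; apply: filt_lin; [apply: filt_leq f1|apply: filt_leq f2]; lia.
- by rewrite -mulrA; exact/h1/h2.
Qed.

Lemma pbw_span (u : U) : exists (s : seq MI) (c : MI -> R),
  uniq s /\ u = \sum_(I <- s) c I *: pbw X I.
Proof.
have [n [s -> _]] := pbw_span_raw u.
exists (undup [seq p.2 | p <- s]), (fun I => \sum_(p <- s | p.2 == I) p.1).
split; first exact: undup_uniq.
under [RHS]eq_bigr do rewrite scaler_suml big_mkcond /=.
rewrite exchange_big /ucomb !big_seq /=; apply: eq_bigr => p ps.
rewrite (bigD1_seq p.2) ?undup_uniq ?mem_undup ?map_f//= eqxx big1 ?addr0// => I.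
by rewrite eq_sym => /negbTE ->.
Qed.

End PBW.

(** * Poincare-Birkhoff-Witt: ordered monomials are separated by functions *)

Section Independence.
Variables (R : realType) (m : nat) (P : primitive m) (d : nat).
Local Notation C := (Cinf R P).
Local Notation G := (GPi R P).
Local Notation lie := (@lieG R m P).
Local Notation U := (UPi R P).
Local Notation MI := {ffun 'I_d -> nat}.
Variables (X : 'I_d -> lie) (hX : is_basis X).
Local Notation XX i := (val (X i) : OpG R P).

Lemma CB (x y : C) g : (x - y) g = x g - y g. Proof. by []. Qed.

(* Normal coordinates at the unit. *)
Definition ncoord (j : 'I_d) : C :=
  \sum_k dualX hX j k *: (cc R P k - cc R P k 1%g *: 1).

Lemma ncoord1 j : ncoord j 1%g = 0.
Proof.
rewrite Csum big1// => k _; rewrite CZ.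
by rewrite CB CZ C1 mulr1 subrr mulr0.
Qed.

Lemma X_ncoord i j : XX i (ncoord j) 1%g = (i == j)%:R.
Proof.
rewrite -(dualXP hX) (rlin_sum (Endo_linear (XX i))) Csum; apply: eq_bigr => k _.
rewrite (rlinZ (Endo_linear (XX i))) (rlinD (Endo_linear (XX i))) (rlinN (Endo_linear (XX i))).
have x1 : XX i 1 = 0 by apply: Cext => g; rewrite (pd1 (lie_pd g (X_lie X i))).
by rewrite (rlinZ (Endo_linear (XX i))) x1 scaler0 subr0 CZ mulrC.
Qed.

Definition cmonom (J : MI) : C := \prod_j ncoord j ^+ J j.

Lemma derivX (D : C -> C) (f : C) n : (forall x y, D (x * y) = D x * y + x * D y) -> D 1 = 0 ->
  D (f ^+ n) = n%:R *: (D f * f ^+ n.-1).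
Proof.
move=> dD d1; elim: n => [|n IH]; first by rewrite expr0 d1 scale0r.
rewrite exprS dD IH /=; case: n {IH} => [|n] /=.
  by rewrite expr0 !mulr1 scale0r mulr0 addr0 scale1r.
by rewrite -scalerAr mulrCA -exprS -[in RHS]addn1 natrD scalerDl scale1r addrC.
Qed.

Lemma deriv_cmonom (D : C -> C) (J : MI) : (forall x y, D (x * y) = D x * y + x * D y) -> D 1 = 0 ->
  D (cmonom J) = \sum_j (J j)%:R *: (cmonom (mdecr J j) * D (ncoord j)).
Proof.
move=> dD d1; have := index_enum_uniq 'I_d; rewrite /cmonom.
elim: (index_enum _) => [|k s IH] /=; first by rewrite !big_nil.
move=> /andP[ks us]; rewrite !big_cons dD (IH us) (derivX _ _ dD d1) ffunE eqxx subn1.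
congr (_ + _).
  rewrite -scalerAl; congr (_ *: _); rewrite mulrAC mulrC mulrA mulrAC; congr (_ * _).
  congr (_ * _); rewrite !big_seq; apply: eq_bigr => i si; rewrite ffunE.
  by case: eqP => [e|_]; [rewrite e (negbTE ks) in si|rewrite subn0].
rewrite mulr_sumr !big_seq; apply: eq_bigr => j js.
rewrite -scalerAr big_cons ffunE (_ : (k == j) = false) ?subn0 ?mulrA//.
by apply: contraNF ks => /eqP ->.
Qed.

Definition mcount (s : seq 'I_d) : MI := [ffun i => count_mem i s].

Lemma mdeg_mcount s : mdeg (mcount s) = size s.
Proof.
elim: s => [|k s IH]; first by rewrite /mdeg big1// => i _; rewrite ffunE.
rewrite (_ : mcount (k :: s) = mincr (mcount s) k) ?mdeg_incr ?IH//.
by apply/ffunP => i; rewrite !ffunE /= eq_sym addnC.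
Qed.

Definition mfact (J : MI) : R := \prod_i (J i)`!%:R.

Lemma mfact_incr J k : mfact (mincr J k) = (J k).+1%:R * mfact J.
Proof.
rewrite /mfact (bigD1 k)//= [in RHS](bigD1 k)//= ffunE eqxx addn1 factS natrM -!mulrA.
congr (_ * (_ * _)); apply: eq_bigr => i /negbTE ik; by rewrite ffunE ik addn0.
Qed.

(** At most [mdeg J] derivations meet a monomial vanishing to order [mdeg J] at the unit: the result
    survives only if every coordinate is differentiated as often as its exponent. The factor [g] is
    there for the induction, to carry the derivatives already taken. *)
Lemma opprod_cmonom (s : seq 'I_d) : forall (J : MI) (g : C), (size s <= mdeg J)%N ->
  (\prod_(k <- s) XX k : OpG R P) (cmonom J * g) 1%g =
  if mcount s == J then mfact J * g 1%g else 0.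
Proof.
elim/last_ind: s => [|s k IH] J g hs.
  rewrite big_nil -[LHS]/((cmonom J * g) 1%g) CM.
  have -> : cmonom J 1%g = \prod_j (ncoord j 1%g) ^+ J j.
    rewrite /cmonom; elim: (index_enum _) => [|j s IH]; first by rewrite !big_nil C1.
    rewrite !big_cons CM IH; congr (_ * _).
    by elim: (J j) => [|n In]; rewrite ?expr0 ?C1// !exprS CM In.
  case: eqP => [<-|nJ].
    by rewrite /mfact !big1 ?mul1r// => i _; rewrite ffunE// expr0.
  have [j Jj] : exists j, (0 < J j)%N.
    apply/existsP; apply: contra_notT nJ => /existsPn h; apply/ffunP => i; rewrite ffunE /=.
    by have := h i; rewrite -eqn0Ngt => /eqP ->.
  by rewrite (bigD1 j)//= ncoord1 expr0n eqn0Ngt Jj /= !mul0r.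
rewrite big_rcons OpGM; have [dX _] := X_lie X k.
have d1 : XX k 1 = 0 by apply: Cext => h; rewrite (pd1 (lie_pd h (X_lie X k))).
rewrite dX (deriv_cmonom J dX d1); move: hs; rewrite size_rcons => hs.
set T := (\prod_(k0 <- s) XX k0 : OpG R P).
rewrite (rlinD (Endo_linear T)) CD IH; last by lia.
rewrite (_ : (mcount s == J) = false) ?addr0; last first.
  by apply/negbTE/eqP => e; move: hs; rewrite -e mdeg_mcount ltnn.
rewrite mulr_suml (rlin_sum (Endo_linear T)) Csum (bigD1 k)//= big1 ?addr0 => [|j jk]; last first.
  rewrite -scalerAl (rlinZ (Endo_linear T)) CZ -mulrA.
  have [->|Jj] := posnP (J j); first by rewrite mul0r.
  rewrite IH; last by move: hs; rewrite -{1}(mdecrK Jj) mdeg_incr.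
  by rewrite CM X_ncoord (eq_sym k j) (negbTE jk) mul0r mulr0 if_same mulr0.
rewrite -scalerAl (rlinZ (Endo_linear T)) CZ -mulrA.
have -> : mcount (rcons s k) = mincr (mcount s) k.
  apply/ffunP => i; rewrite !ffunE -cats1 count_cat /= addn0; congr (_ + _)%N.
  by rewrite eq_sym.
have [Jk|Jk] := posnP (J k).
  rewrite Jk mul0r; case: eqP => // e; move: Jk; rewrite -e ffunE eqxx; lia.
rewrite IH; last by move: hs; rewrite -{1}(mdecrK Jk) mdeg_incr.
rewrite CM X_ncoord eqxx mul1r.
have -> : (mcount s == mdecr J k) = (mincr (mcount s) k == J).
  by apply/eqP/eqP => [->|<-]; rewrite ?mdecrK ?mincrK.
case: ifP => _; last by rewrite mulr0.
rewrite mulrA -[in RHS](mdecrK Jk) mfact_incr; congr (_%:R * _ * _).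
by rewrite ffunE eqxx subn1 prednK.
Qed.

Lemma rep_pbw I : rep (pbw X I) = opmonom X I.
Proof.
rewrite /pbw /opmonom (amorph_prod (@repM R m P) (@rep1 R m P)); apply: eq_bigr => k _.
by rewrite (amorphX (@repM R m P) (@rep1 R m P)) rep_gen.
Qed.

Lemma rep_pbw_cmonom (I J : MI) : (mdeg I <= mdeg J)%N ->
  rep (pbw X I) (cmonom J) 1%g = if I == J then mfact J else 0.
Proof.
move=> h; pose s := flatten [seq nseq (I i) i | i <- index_enum 'I_d].
have cs : mcount s = I.
  apply/ffunP => i; rewrite ffunE count_flatten -map_comp sumnE big_map.
  by rewrite (bigD1 i)//= count_nseq /= eqxx mul1n big1 ?addn0// => j ji; rewrite count_nseq /= (negbTE ji).
have os : opmonom X I = \prod_(k <- s) XX k.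
  rewrite /opmonom /s; elim: (index_enum _) => [|i t IH]; first by rewrite !big_nil.
  rewrite big_cons /= big_cat -IH; congr (_ * _).
  by elim: (I i) => [|n In]; rewrite ?expr0 ?big_nil// exprS In /= big_cons.
rewrite rep_pbw os -[cmonom J]mulr1 opprod_cmonom; last by rewrite -mdeg_mcount cs.
by rewrite cs C1 mulr1.
Qed.

Lemma mfact_neq0 J : mfact J != 0.
Proof. by apply/prodf_neq0 => i _; rewrite pnatr_eq0 -lt0n fact_gt0. Qed.

(** Test against [cmonom J] for a J of maximal degree among the nonzero coefficients: every other
    monomial gives 0 and what remains is c J times [mfact J]. *)
Lemma rep_separating : separating (fun (xi : C) (u : U) => rep u xi 1%g).
Proof.
split=> [xi a u v|u h]; first by rewrite rep_linear OpGD OpGZ.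
have [s [c [us eu]]] := pbw_span hX u.
rewrite eu big_seq big1// => I Is.
have [->|cI] := eqVneq (c I) 0; first by rewrite scale0r.
have hex : exists n, has (fun J => (c J != 0) && (mdeg J == n)) s.
  by exists (mdeg I); apply/hasP; exists I; rewrite ?cI /=.
have hb n : has (fun J => (c J != 0) && (mdeg J == n)) s -> (n <= \max_(J <- s) mdeg J)%N.
  move=> /hasP[J Js /andP[_ /eqP <-]]; exact: leq_bigmax_seq.
case: (ex_maxnP hex hb) => n /hasP[J Js /andP[cJ /eqP dJ]] hm.
have := h (cmonom J); rewrite eu (rlin_sum (rep_linear_at _)) Csum (bigD1_seq J)//=.
rewrite (rlinZ (rep_linear_at _)) CZ rep_pbw_cmonom// eqxx big_seq_cond big1 ?addr0 => [|K /andP[Ks KJ]].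
  by move=> /eqP; rewrite mulf_eq0 (negbTE cJ) (negbTE (mfact_neq0 J)).
rewrite (rlinZ (rep_linear_at _)) CZ.
have [->|cK] := eqVneq (c K) 0; first by rewrite mul0r.
rewrite rep_pbw_cmonom ?(negbTE KJ) ?mulr0// dJ; apply: hm; apply/hasP.
by exists K; rewrite ?cK /=.
Qed.

End Independence.

Section GalgInd.
Variables (R : comNzRingType) (A : algType R) (S : set A).

(** Minimality in [galg_set] concerns subsets of [A], not of the subtype; the predicate is therefore
    carried together with a proof of membership. *)
Lemma galg_ind (Q : galg S -> Prop) : Q 1 -> (forall x y, Q x -> Q y -> Q (x + y)) ->
  (forall a x, Q x -> Q (a *: x)) -> (forall x y, Q x -> Q y -> Q (x * y)) ->
  (forall x, S (galgv x) -> Q x) -> forall x, Q x.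
Proof.
move=> h1 hD hZ hM hS x.
have [p hp] : exists p : `[< galg_set S (galgv x) >], Q (MkGalg p).
  have /asboolP h := galgP x.
  apply: (h [set a | exists p : `[< galg_set S a >], Q (MkGalg p)]) => [|a Sa].
    split=> [|a b [p ha] [q hb]|c a [p ha]|a b [p ha] [q hb]].
    - by exists (galgP 1); rewrite (_ : MkGalg _ = 1)//; apply: val_inj.
    - by exists (galgP (MkGalg p + MkGalg q)); rewrite (_ : MkGalg _ = MkGalg p + MkGalg q);
        [exact: hD|exact: val_inj].
    - by exists (galgP (c *: MkGalg p)); rewrite (_ : MkGalg _ = c *: MkGalg p);
        [exact: hZ|exact: val_inj].
    - by exists (galgP (MkGalg p * MkGalg q)); rewrite (_ : MkGalg _ = MkGalg p * MkGalg q);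
        [exact: hM|exact: val_inj].
  have p : `[< galg_set S a >] by apply/asboolP => Q' _; apply.
  by exists p; exact: hS.
by rewrite (_ : x = MkGalg p)//; exact: val_inj.
Qed.

Lemma galg_gen (a : A) : S a -> exists x : galg S, galgv x = a.
Proof.
move=> Sa; have p : `[< galg_set S a >] by apply/asboolP => Q' _; apply.
by exists (MkGalg p).
Qed.

End GalgInd.

(** * Extending functions from N to Diff, and the action of U on F *)

Section Functions.
Variables (R : realType) (m : nat) (P : primitive m) (d : nat).
Local Notation C := (Cinf R P).
Local Notation G := (GPi R P).
Local Notation N := (NPi R P).
Local Notation D := (Diff R P).
Local Notation lie := (@lieG R m P).
Local Notation U := (UPi R P).
Variables (X : 'I_d -> lie) (hX : is_basis X).
Local Notation XX i := (val (X i) : OpG R P).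
Local Notation F := (FPi X).
Local Notation ux k := (ugen (X k) : U).

Lemma GamM (f h : D) i j :
  Gam X (f * h)%g i j = \sum_k pull h (Gam X f i k) * Gam X h k j.
Proof.
have -> // : Gam X (f * h)%g = \matrix_(i, j) \sum_k pull h (Gam X f i k) * Gam X h k j.
  apply: esym; apply: (Gam_uniq hX) => {}i xi.
  rewrite invgM !pullM (GamP hX) (rlin_sum (pull_linear h)).
  under eq_bigr do rewrite pull_mul (GamP hX) mulr_sumr.
  rewrite exchange_big; apply: eq_bigr => l _; rewrite [in RHS]mxE mulr_suml.
  by apply: eq_bigr => k _; rewrite mulrA.
by rewrite mxE.
Qed.

(** Elements of G act on G by left translations, with which the X i commute. *)
Lemma Gam_G (h : G) i j : Gam X (gval h) i j = (i == j)%:R.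
Proof.
have -> : Gam X (gval h) = 1%:M.
  apply: esym; apply: (Gam_uniq hX) => {}i xi.
  rewrite (bigD1 i)//= [X in X * _]mxE eqxx mul1r big1 ?addr0 => [|k ki]; last first.
    by rewrite [X in X * _]mxE eq_sym (negbTE ki) mul0r.
  apply: Cext => g; rewrite pullE tilde_G.
  have e : XX i (pull (gval h) (pull (gval h)^-1%g xi)) g = _ := lie_left _ _ _ (X_lie X i).
  by rewrite -e pullK.
by rewrite mxE.
Qed.

Lemma GamMG (f : D) (h : G) i j : Gam X (f * gval h)%g i j = pull (gval h) (Gam X f i j).
Proof.
rewrite GamM (bigD1 j)//= Gam_G eqxx mulr1 big1 ?addr0// => k kj.
by rewrite Gam_G (negbTE kj) mulr0.
Qed.

Lemma GamGM (f : D) (h : G) i j : Gam X (gval h * f)%g i j = Gam X f i j.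
Proof.
rewrite GamM (bigD1 i)//= Gam_G eqxx -[1%:R]/(1 : C) pull_one mul1r big1 ?addr0// => k ki.
by rewrite Gam_G eq_sym (negbTE ki) (rlin0 (pull_linear f)) mul0r.
Qed.

Lemma Gam_Npart (f : D) i j : Gam X (nval (Npart f)) i j = Gam X f i j.
Proof. by rewrite -[in RHS](GNpart f) GamGM. Qed.

Definition GamX (f : D) i j ks : C := foldl (fun x k => XX k x) (Gam X f i j) ks.

(** Left-invariant fields commute with translation by g, which moves the evaluation from the unit to
    g; the G-part of [f * gval g] does not change Gam. *)
Lemma GamX_eta (f : D) (g : G) i j ks : GamX f i j ks g = Defs.eta X i j ks (Npart (f * gval g)%g).
Proof.
rewrite /Defs.eta /GamX Gam_Npart GamMG.
have -> (x : C) : foldl (fun x k => XX k x) (pull (gval g) x) ks =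
    pull (gval g) (foldl (fun x k => XX k x) x ks).
  elim: ks x => //= k ks IH x; rewrite -IH; congr foldl; apply: Cext => h.
  by rewrite pullE tilde_G; apply: lie_left; exact: X_lie.
by rewrite pullE tilde_G mulg1.
Qed.

Lemma hat_ex (f : F) (phi : D) : exists x : C, forall g, x g = galgv f (Npart (phi * gval g)%g).
Proof.
elim/galg_ind: f => [|f f' [x hx] [y hy]|a f [x hx]|f f' [x hx] [y hy]|f [i [j [ks e]]]].
- by exists 1 => g; rewrite C1.
- by exists (x + y) => g; rewrite CD hx hy.
- by exists (a *: x) => g; rewrite CZ hx.
- by exists (x * y) => g; rewrite CM hx hy.
- by exists (GamX phi i j ks) => g; rewrite GamX_eta e.
Qed.

(* The function phi |-> h(phi) on Diff whose restriction to N, evaluated at the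
   unit, is [f]. *)
Definition hat (phi : D) (f : F) : C := sval (cid (hat_ex f phi)).

Lemma hatE (phi : D) (f : F) g : hat phi f g = galgv f (Npart (phi * gval g)%g).
Proof. exact: (svalP (cid (hat_ex f phi)) g). Qed.

Lemma hat_linear phi : linear (hat phi).
Proof. by move=> a f h; apply: Cext => g; rewrite CD CZ !hatE. Qed.
Lemma hatM phi f h : hat phi (f * h) = hat phi f * hat phi h.
Proof. by apply: Cext => g; rewrite CM !hatE. Qed.
Lemma hat1 phi : hat phi 1 = 1.
Proof. by apply: Cext => g; rewrite C1 !hatE. Qed.

Lemma Npart_nval (psi : N) : Npart (nval psi) = psi.
Proof. by have := NpartE (1 : G)%g psi; rewrite mul1g. Qed.

Lemma hat_unit (psi : N) (f : F) : hat (nval psi) f 1%g = galgv f psi.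
Proof. by rewrite hatE mulg1 Npart_nval. Qed.

Lemma hat_eq (f h : F) : (forall psi : N, hat (nval psi) f 1%g = hat (nval psi) h 1%g) -> f = h.
Proof.
by move=> e; apply: val_inj; apply/funext => psi; have := e psi; rewrite !hat_unit.
Qed.

(** A generator with its list of derivatives is replaced by two cases, an entry of Gam and one
    further derivative, so that constructions on F need only a cocycle rule and a derivation
    rule. *)
Lemma F_ind (Q : F -> Prop) : Q 1 -> (forall x y, Q x -> Q y -> Q (x + y)) ->
  (forall a x, Q x -> Q (a *: x)) -> (forall x y, Q x -> Q y -> Q (x * y)) ->
  (forall i j (e : F), (forall phi, hat phi e = Gam X phi i j) -> Q e) ->
  (forall k (x y : F), (forall phi, hat phi y = XX k (hat phi x)) -> Q x -> Q y) ->
  forall x, Q x.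
Proof.
move=> h1 hD hZ hM he hX'; apply: galg_ind => // f [i [j [ks e]]].
have hE (f' : F) ks' : galgv f' = Defs.eta X i j ks' -> forall phi, hat phi f' = GamX phi i j ks'.
  by move=> e' phi; apply: Cext => g; rewrite hatE e' GamX_eta.
elim/last_ind: ks f e => [|ks k IH] f e; first by apply: (he i j) => phi; rewrite (hE _ _ e).
have [f' e'] : exists f' : F, galgv f' = Defs.eta X i j ks by apply: galg_gen; exists i, j, ks.
apply: (hX' k f') => [phi|]; last exact: IH.
by rewrite (hE _ _ e) (hE _ _ e') /GamX -cats1 foldl_cat.
Qed.

Lemma rep_X k : rep (ux k) = XX k. Proof. exact: rep_gen. Qed.

Lemma act_ex_X k (f : F) : exists h : F, forall phi, hat phi h = XX k (hat phi f).
Proof.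
have [dX lX] := X_lie X k.
elim/galg_ind: f => [|f f' [x hx] [y hy]|a f [x hx]|f f' [x hx] [y hy]|f [i [j [ks e]]]].
- exists 0 => phi; rewrite hat1 (rlin0 (hat_linear phi)); apply: Cext => g.
  by rewrite C0 (pd1 (lie_pd g (X_lie X k))).
- by exists (x + y) => phi; rewrite !(rlinD (hat_linear phi)) hx hy (rlinD (Endo_linear _)).
- by exists (a *: x) => phi; rewrite !(rlinZ (hat_linear phi)) hx (rlinZ (Endo_linear _)).
- exists (x * f' + f * y) => phi.
  by rewrite (rlinD (hat_linear phi)) !hatM hx hy dX.
- have [h eh] : exists h : F, galgv h = Defs.eta X i j (rcons ks k).
    by apply: galg_gen; exists i, j, (rcons ks k).
  have E phi : hat phi f = GamX phi i j ks.
    by apply: Cext => g; rewrite hatE e GamX_eta.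
  by exists h => phi; rewrite E; apply: Cext => g; rewrite hatE eh -GamX_eta /GamX -cats1 foldl_cat.
Qed.

Lemma act_ex (u : U) : forall f : F, exists h : F, forall phi, hat phi h = rep u (hat phi f).
Proof.
elim/UPi_ind: u => [Y|| a u v hu hv|u v hu hv] f.
- have [c ->] := ugen_X_span hX Y.
  elim: (index_enum _) => [|k s [h eh]].
    exists 0 => phi; rewrite big_nil (rlin0 (hat_linear phi)) (rlin0 (rep_linear_at _)).
    by [].
  have [h' eh'] := act_ex_X k f; exists (c k *: h' + h) => phi.
  by rewrite big_cons hat_linear eh eh' (rep_linear_at (hat phi f)) rep_X.
- by exists f => phi; rewrite rep1.
- have [x hx] := hu f; have [y hy] := hv f; exists (a *: x + y) => phi.
  by rewrite hat_linear hx hy rep_linear OpGD OpGZ.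
- have [y hy] := hv f; have [x hx] := hu y; exists x => phi.
  by rewrite hx hy repM.
Qed.

Definition act (u : U) (f : F) : F := sval (cid (act_ex u f)).

Lemma hat_act phi u f : hat phi (act u f) = rep u (hat phi f).
Proof. exact: (svalP (cid (act_ex u f)) phi). Qed.

Lemma Gam_inv (phi : D) i j :
  \sum_k Gam X phi i k * pull phi (Gam X phi^-1%g k j) = (i == j)%:R.
Proof.
have e := GamM phi phi^-1%g i j; rewrite mulgV -[X in Gam _ X]/(gval (1%g : G)) Gam_G in e.
have := congr1 (pull phi) e; rewrite (rlin_sum (pull_linear phi)) => e'.
transitivity (pull phi (i == j)%:R); last first.
  by case: (i == j); [exact: pull_one|exact: rlin0 (pull_linear phi)].
rewrite e'; apply: eq_bigr => k _; rewrite pull_mul; congr (_ * _).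
by rewrite -pullM mulVg pull1.
Qed.

(** On N, at the unit, the inverse of a unipotent matrix is a finite geometric sum, hence polynomial
    in the generators. Invariance of Gam under G on both sides then gives the identity at every g
    and for every diffeomorphism. *)
Lemma gi_ex i j : exists b : F, forall phi, hat phi b = pull phi (Gam X phi^-1%g i j).
Proof.
have [e he] : exists e : 'I_d -> 'I_d -> F, forall i j phi, hat phi (e i j) = Gam X phi i j.
  have h i' j' : exists e : F, forall phi, hat phi e = Gam X phi i' j'.
    have [e ee] : exists e : F, galgv e = Defs.eta X i' j' [::].
      by apply: galg_gen; exists i', j', [::].
    by exists e => phi; apply: Cext => g; rewrite hatE ee -GamX_eta.
  by exists (fun i j => sval (cid (h i j))) => i' j' phi; exact: (svalP (cid (h i' j')) phi).
have pw n i' j' : exists b : F, forall psi : N, galgv b psi = ((1 - Gam_unit X psi) ^+ n) i' j'.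
  elim: n i' j' => [|n IH] i' j'.
    by exists ((i' == j')%:R *: 1) => psi; rewrite expr0 [RHS]mxE; exact: mulr1.
  have {IH}[b hb] : exists b : 'I_d -> F, forall k (psi : N),
      galgv (b k) psi = ((1 - Gam_unit X psi) ^+ n) i' k.
    exists (fun k => sval (cid (IH i' k))) => k; exact: (svalP (cid (IH i' k))).
  exists (\sum_k b k * ((k == j')%:R *: 1 - e k j')) => psi.
  rewrite exprSr [RHS]mxE -hat_unit (rlin_sum (hat_linear _)) Csum; apply: eq_bigr => k _.
  rewrite hatM CM hat_unit hb; congr (_ * _).
  rewrite (rlinD (hat_linear _)) (rlinN (hat_linear _)) (rlinZ (hat_linear _)) hat1 he.
  by rewrite CB CZ C1 mulr1 [RHS]mxE [X in _ = X + _]mxE [X in _ = _ + X]mxE [X in _ = _ - X]mxE.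
(* Four terms suffice because the fourth power of [1 - Gam_unit X psi] vanishes. *)
pose b : F := \sum_(n < 4) sval (cid (pw n i j)).
have bE (psi : N) : galgv b psi = Gam X (nval psi)^-1%g i j 1%g.
  pose Gi : 'M[R]_d := \matrix_(i, j) Gam X (nval psi)^-1%g i j 1%g.
  pose Sg := \sum_(n < 4) (1 - Gam_unit X psi) ^+ n.
  have h1 : Gam_unit X psi *m Gi = 1%:M.
    apply/matrixP => i' j'; rewrite [LHS]mxE [RHS]mxE.
    have := congr1 (fun x : C => x 1%g) (Gam_inv (nval psi) i' j'); rewrite Csum => h.
    have hd : ((i' == j')%:R : C) 1%g = (i' == j')%:R by case: (i' == j').
    rewrite -hd -h; apply: eq_bigr => k _; rewrite CM pullE tilde_N1.
    by congr (_ * _); rewrite mxE.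
  have h2 : Gam_unit X psi *m Sg = 1%:M.
    have := subrX1 (1 - Gam_unit X psi) 4.
    have -> : (1 - Gam_unit X psi) ^+ 4 = 0.
      by rewrite -opprB exprNn (Gam_unit_unipotent hX) mulr0.
    by rewrite addrAC subrr !add0r mulNr => /oppr_inj e1; exact: esym e1.
  have gE : Gam X (nval psi)^-1%g i j 1%g = Gi i j by rewrite mxE.
  rewrite gE; have <- : Sg i j = Gi i j.
    by rewrite -[Sg]mul1mx -(mulmx1C h1) -mulmxA h2 mulmx1.
  rewrite summxE -hat_unit (rlin_sum (hat_linear _)) Csum; apply: eq_bigr => n _.
  by rewrite hat_unit; exact: (svalP (cid (pw n i j))).
exists b => phi; apply: Cext => g; rewrite hatE bE pullE.
set nu := Npart _; have tf := tilde_factor phi g; rewrite -/nu in tf.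
have gvV (h : G) : gval (h^-1)%g = (gval h)^-1%g by [].
(* From phi g = g' nu one gets phi^-1 = g nu^-1 g'^-1: the left factor does not affect Gam, and the
   right one translates the point g' to the unit. *)
have -> : (phi^-1 = gval g * ((nval nu)^-1 * gval ((tilde phi g)^-1)))%g.
  have e1 : phi = (gval (tilde phi g) * nval nu * (gval g)^-1)%g by rewrite -tf mulgK.
  by rewrite gvV {1}e1 !invgM invgK.
have e2 := GamGM ((nval nu)^-1 * gval ((tilde phi g)^-1))%g g i j.
have e3 := GamMG (nval nu)^-1%g (tilde phi g)^-1%g i j.
have e4 := congr1 (fun x : C => x (tilde phi g)) (etrans e2 e3).
by rewrite e4 pullE tilde_G mulVg.
Qed.

End Functions.

Lemma eq_swr (R : comNzRingType) (A B : lmodType R) (t : tensor A B) (b b' : A -> B -> R^o) :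
  (forall x y, b x y = b' x y) -> sweedler t b = sweedler t b' :> R.
Proof. exact: eq_sw. Qed.

Lemma sw_swap (R : comNzRingType) (A B A' B' W : lmodType R) (t : tensor A B) (t' : tensor A' B')
    (b : A -> B -> A' -> B' -> W) :
  \sw_(x, y <- t) \sw_(z, w <- t') b x y z w = \sw_(z, w <- t') \sw_(x, y <- t) b x y z w.
Proof. by rewrite !swE exchange_big. Qed.

Lemma sw_mull (R : comNzRingType) (A B : lmodType R) (E : algType R) (t : tensor A B)
  (b : A -> B -> E) c : c * sweedler t b = \sw_(x, y <- t) (c * b x y).
Proof. exact: sw_comp (lin_mulr c (@lin_id R E)). Qed.

Lemma sw_mulr (R : comNzRingType) (A B : lmodType R) (E : algType R) (t : tensor A B)
  (b : A -> B -> E) c : sweedler t b * c = \sw_(x, y <- t) (b x y * c).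
Proof. exact: (sw_comp t b (lin_mull c (@lin_id R E))). Qed.

(** * Coalgebras determined by functionals *)

Section EvalCoalgebra.
Variables (R : fieldType) (A : lmodType R) (I : Type) (l : I -> A -> R).
Variables (op : I -> I -> I) (e : I) (Dl : A -> tensor A A).
Hypotheses (sl : separating l) (opA : associative op) (op1 : left_id e op) (op1r : right_id e op).
Hypothesis (DlE : forall i j x, tev (l i) (l j) (Dl x) = l (op i j) x).
Let ll i : linear (l i : A -> R^o). Proof. exact: sl.1. Qed.

Lemma eval_comul_linear : linear Dl.
Proof.
move=> a x y; apply: (sep_eq (tensor_separating sl sl)) => -[i j] /=.
by rewrite (tev_linear (ll i) (ll j)) !DlE (ll (op i j)).
Qed.

Lemma eval_comulA x : \sw_(a, b <- Dl x) (Dl a \ox b) =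
  \sw_(a, b <- Dl x) \sw_(c, g <- Dl b) ((a \ox c) \ox g).
Proof.
apply: (sep_eq (tensor_separating (tensor_separating sl sl) sl)) => -[[i j] k] /=.
have l2 := tev_linear (ll i) (ll j); have l3 := tev_linear l2 (ll k).
transitivity (l (op (op i j) k) x).
  rewrite (sw_comp _ _ l3) -DlE [RHS]/tev; apply: eq_swr => a b.
  by rewrite tev_pure// DlE.
rewrite -opA -DlE (sw_comp _ _ l3) [LHS]/tev; apply: eq_swr => a b.
rewrite (sw_comp _ _ l3) -DlE [X in l i a * X]/tev -[_ * _]/(_ * _ : R^o) sw_mull; apply: eq_swr => c g.
by rewrite !tev_pure// mulrA.
Qed.

Lemma eval_counitl x : \sw_(a, b <- Dl x) (l e a *: b) = x.
Proof.
apply: (sep_eq sl) => i; rewrite (sw_comp _ _ (ll i)) -[i in RHS]op1 -DlE [RHS]/tev.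
by apply: eq_swr => a b; exact: rlinZ (ll i) _ _.
Qed.

Lemma eval_counitr x : \sw_(a, b <- Dl x) (l e b *: a) = x.
Proof.
apply: (sep_eq sl) => i; rewrite (sw_comp _ _ (ll i)) -[i in RHS]op1r -DlE [RHS]/tev.
apply: eq_swr => a b; rewrite [RHS]mulrC; exact: rlinZ (ll i) _ _.
Qed.

End EvalCoalgebra.

Section OppositeAlgebra.
Variables (R : comNzRingType) (A : algType R).
(** The antipode of U reverses products; with values in the opposite algebra it comes from the
    universal property. *)
Definition opalg : Type := A.
HB.instance Definition _ := GRing.Lmodule.on opalg.
Let omul (x y : opalg) : opalg := (y : A) * (x : A).
Let omulA : associative omul. Proof. by move=> x y z; rewrite /omul mulrA. Qed.
Let omul1 : left_id (1 : A) omul. Proof. by move=> x; rewrite /omul mulr1. Qed.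
Let omul1r : right_id (1 : A) omul. Proof. by move=> x; rewrite /omul mul1r. Qed.
Let omulDl : left_distributive omul +%R. Proof. by move=> x y z; exact: mulrDr. Qed.
Let omulDr : right_distributive omul +%R. Proof. by move=> x y z; exact: mulrDl. Qed.
Let o10 : (1 : A) != 0. Proof. exact: oner_neq0. Qed.
HB.instance Definition _ :=
  GRing.Zmodule_isNzRing.Build opalg omulA omul1 omul1r omulDl omulDr o10.
Let oscaleAl a (x y : opalg) : a *: (x * y) = (a *: x : opalg) * y.
Proof. exact: (@scalerAr R A a y x). Qed.
HB.instance Definition _ := GRing.Lmodule_isLalgebra.Build R opalg oscaleAl.
Let oscaleAr a (x y : opalg) : a *: (x * y) = x * (a *: y : opalg).
Proof. exact: (@scalerAl R A a y x). Qed.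
HB.instance Definition _ := GRing.Lalgebra_isAlgebra.Build R opalg oscaleAr.
End OppositeAlgebra.

(** * The Hopf algebra U *)

Section HopfU.
Variables (R : realType) (m : nat) (P : primitive m) (d : nat).
Local Notation C := (Cinf R P).
Local Notation D := (Diff R P).
Local Notation lie := (@lieG R m P).
Local Notation U := (UPi R P).
Variables (X : 'I_d -> lie) (hX : is_basis X).

Definition lamU (xi : C) (u : U) : R := rep u xi 1%g.
Definition sepU : separating lamU := rep_separating hX.

Lemma sw_at (A B : lmodType R) (t : tensor A B) (b : A -> B -> C) g :
  sweedler t b g = sweedler t (fun x y => b x y g : R^o) :> R.
Proof. by rewrite !swE Csum. Qed.

Lemma efun_bilinear : bilinear_map (fun (T : OpG R P) (x : C) => T x).
Proof. by split=> [x a S T|T]; [|exact: Endo_linear]. Qed.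
Ltac lin_leaf ::= first [exact: rep_linear_at | exact: pull_linear | exact: Endo_linear
  | exact: rep_linear | exact: efun_bilinear].

Lemma rep_mul_bilinear (f g : C) : bilinear_map (fun x y : U => rep x f * rep y g).
Proof. lin. Qed.

(** The coproduct is read off from the Leibniz rule: primitive on derivations, and for a product of
    operators the rule is applied twice. *)
Lemma comulU_ex (u : U) : exists t : tensor U U, forall f g : C,
  rep u (f * g) = \sw_(x, y <- t) (rep x f * rep y g).
Proof.
have b f g := rep_mul_bilinear f g.
elim/UPi_ind: u => [Y|| a u v [t ht] [s hs]|u v [t ht] [s hs]].
- exists (ugen Y \ox 1 + 1 \ox ugen Y) => f g.
  rewrite (rlinD (sw_linear (b f g))) !(tpure_bilinear_eval _ _ (b f g)) rep1 rep_gen.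
  by have [dY _] := set_mem (valP Y); exact: dY.
- by exists (1 \ox 1) => f g; rewrite (tpure_bilinear_eval _ _ (b f g)) rep1.
- by exists (a *: t + s) => f g; rewrite (sw_linear (b f g)) rep_linear OpGD OpGZ ht hs.
- exists (\sw_(x, y <- s) \sw_(z, w <- t) ((z * x) \ox (w * y))) => f g.
  rewrite repM OpGM hs (sw_comp _ _ (Endo_linear (rep u))) (sw_comp _ _ (sw_linear (b f g))).
  apply: eq_sw => x y; rewrite (sw_comp _ _ (sw_linear (b f g))) ht.
  by apply: eq_sw => z w; rewrite (tpure_bilinear_eval _ _ (b f g)) !repM.
Qed.

Definition comulU (u : U) : tensor U U := sval (cid (comulU_ex u)).

Lemma comulU_rep (u : U) f g : rep u (f * g) = \sw_(x, y <- comulU u) (rep x f * rep y g).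
Proof. exact: (svalP (cid (comulU_ex u)) f g). Qed.

Lemma comulUE f g u : tev (lamU f) (lamU g) (comulU u) = lamU (f * g) u.
Proof.
by rewrite /lamU comulU_rep sw_at; exact: eq_swr.
Qed.

Lemma comulU_linear : linear comulU. Proof. exact: eval_comul_linear sepU comulUE. Qed.

Lemma comulU_gen (Y : lie) : comulU (ugen Y) = ugen Y \ox 1 + 1 \ox ugen Y.
Proof.
apply: (sep_eq (tensor_separating sepU sepU)) => -[f g] /=.
have lf := sepU.1 f; have lg := sepU.1 g.
rewrite comulUE (rlinD (tev_linear lf lg)) !tev_pure// /lamU rep1 rep_gen.
by have [dY _] := set_mem (valP Y); rewrite dY.
Qed.

Lemma comulU1 : comulU 1 = 1 \ox 1.
Proof.
apply: (sep_eq (tensor_separating sepU sepU)) => -[f g] /=.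
have lf := sepU.1 f; have lg := sepU.1 g.
by rewrite comulUE !tev_pure// /lamU rep1.
Qed.

Lemma comulUM x y : comulU (x * y) =
  \sw_(a, b <- comulU x) \sw_(c, e <- comulU y) ((a * c) \ox (b * e)).
Proof.
apply: (sep_eq (tensor_separating sepU sepU)) => -[f g] /=.
have ll := tev_linear (sepU.1 f) (sepU.1 g).
rewrite comulUE /lamU repM OpGM comulU_rep (sw_comp _ _ (Endo_linear (rep x))).
rewrite sw_at sw_swap (sw_comp _ _ ll).
apply: eq_swr => a b; rewrite (sw_comp _ _ ll) comulU_rep sw_at.
by apply: eq_swr => c e; rewrite (tev_pure _ _ (sepU.1 f) (sepU.1 g)) /lamU !repM.
Qed.

(** Functions commute, so the two orders of the Leibniz rule agree on all functionals. *)
Lemma comulU_cocomm u : \sw_(a, b <- comulU u) (b \ox a) = comulU u.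
Proof.
apply: (sep_eq (tensor_separating sepU sepU)) => -[f g] /=.
have lf := sepU.1 f; have lg := sepU.1 g.
rewrite (sw_comp _ _ (tev_linear lf lg)) comulUE mulrC -comulUE.
by apply: eq_swr => a b; rewrite tev_pure// mulrC.
Qed.

Definition counitU (u : U) : R := lamU 1 u.

Lemma rep_one u : rep u 1 = counitU u *: 1.
Proof.
rewrite /counitU /lamU; elim/UPi_ind: u => [Y|| a u v hu hv|u v hu hv].
- have z : rep (ugen Y) 1 = 0.
    rewrite rep_gen; apply: Cext => g; rewrite C0.
    exact: pd1 (lie_pd g (set_mem (valP Y))).
  by rewrite z C0 scale0r.
- by rewrite rep1 C1 scale1r.
- by rewrite rep_linear OpGD OpGZ hu hv CD !CZ C1 !mulr1 scalerDl scalerA.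
- by rewrite repM OpGM hv (rlinZ (Endo_linear (rep u))) hu CZ CZ C1 !mulr1 scalerA.
Qed.

Lemma counitUM u v : counitU (u * v) = counitU u * counitU v.
Proof.
rewrite {1}/counitU /lamU repM OpGM rep_one (rlinZ (Endo_linear (rep u))) rep_one.
by rewrite !CZ C1 mulr1 mulrC.
Qed.

Let negU_lie : lie_morphism (fun Y : lie => - ugen Y : opalg U).
Proof.
split=> [a x y z e|x y z e].
  have -> : ugen z = a *: ugen x + ugen y :> U by exact: ugen_lin.
  by rewrite opprD scalerN.
have -> : ugen z = ugen x * ugen y - ugen y * ugen x :> U by exact: ugen_bracket.
rewrite -[X in _ = X - _]/((- ugen y : U) * - ugen x) -[X in _ = _ - X]/((- ugen x : U) * - ugen y).
by rewrite !mulrNN opprB.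
Qed.

Definition antiU (u : U) : U := ulift (fun Y : lie => - ugen Y : opalg U) u.

Lemma antiU_linear : linear antiU. Proof. exact: ulift_linear negU_lie. Qed.
Lemma antiUM u v : antiU (u * v) = antiU v * antiU u. Proof. exact: (uliftM negU_lie u v). Qed.
Lemma antiU1 : antiU 1 = 1. Proof. exact: (ulift1 negU_lie). Qed.
Lemma antiU_gen (Y : lie) : antiU (ugen Y) = - ugen Y.
Proof. exact: (ulift_gen negU_lie Y). Qed.

Ltac lin_leaf ::= first [exact: rep_linear_at | exact: antiU_linear | exact: comulU_linear].

Lemma antiU_l u : \sw_(a, b <- comulU u) (antiU a * b) = counitU u *: 1.
Proof.
have hb : bilinear_map (fun a b : U => antiU a * b) by lin.
elim/UPi_ind: u => [Y|| a u v hu hv|u v hu hv].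
- rewrite comulU_gen (rlinD (sw_linear hb)) !(tpure_bilinear_eval _ _ hb).
  rewrite antiU1 antiU_gen mul1r mulr1 addNr /counitU /lamU rep_gen.
  by rewrite (pd1 (lie_pd 1%g (set_mem (valP Y)))) scale0r.
- by rewrite comulU1 (tpure_bilinear_eval _ _ hb) antiU1 mul1r /counitU /lamU rep1 C1 scale1r.
- by rewrite comulU_linear (sw_linear hb) hu hv /counitU (sepU.1 1) scalerDl scalerA.
- rewrite comulUM (sw_comp _ _ (sw_linear hb)) counitUM.
  transitivity (\sw_(a, b <- comulU u) (\sw_(c, e <- comulU v) (antiU c * (antiU a * b) * e))).
    apply: eq_sw => a b; rewrite (sw_comp _ _ (sw_linear hb)); apply: eq_sw => c e.
    by rewrite (tpure_bilinear_eval _ _ hb) antiUM !mulrA.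
  rewrite sw_swap mulrC -scalerA -hu.
  transitivity (\sw_(c, e <- comulU v) (counitU u *: (antiU c * e))); last first.
    by rewrite sw_scalef hv hu [in RHS]scalerA [in LHS]scalerA mulrC.
  apply: eq_sw => c e.
  have := sw_comp (f := fun z : U => antiU c * z * e) (comulU u) (fun a b => antiU a * b).
  rewrite hu => <-; last by move=> k p q; rewrite mulrDr mulrDl -scalerAr -scalerAl.
  by rewrite -scalerAr mulr1 scalerAl.
Qed.

Lemma antiU_r u : \sw_(a, b <- comulU u) (a * antiU b) = counitU u *: 1.
Proof.
have hb : bilinear_map (fun a b : U => a * antiU b) by lin.
elim/UPi_ind: u => [Y|| a u v hu hv|u v hu hv].
- rewrite comulU_gen (rlinD (sw_linear hb)) !(tpure_bilinear_eval _ _ hb).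
  rewrite antiU1 antiU_gen mul1r mulr1 subrr /counitU /lamU rep_gen.
  by rewrite (pd1 (lie_pd 1%g (set_mem (valP Y)))) scale0r.
- by rewrite comulU1 (tpure_bilinear_eval _ _ hb) antiU1 mul1r /counitU /lamU rep1 C1 scale1r.
- by rewrite comulU_linear (sw_linear hb) hu hv /counitU (sepU.1 1) scalerDl scalerA.
- rewrite comulUM (sw_comp _ _ (sw_linear hb)) counitUM.
  transitivity (\sw_(a, b <- comulU u) (counitU v *: (a * antiU b))).
    apply: eq_sw => a b; rewrite (sw_comp _ _ (sw_linear hb)).
    have := sw_comp (f := fun z : U => a * z * antiU b) (comulU v) (fun c e => c * antiU e).
    rewrite hv => h; transitivity (a * (counitU v *: 1) * antiU b); last first.
      by rewrite -scalerAr mulr1 scalerAl.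
    rewrite h; last by move=> k p q; rewrite mulrDr mulrDl -scalerAr -scalerAl.
    by apply: eq_sw => c e; rewrite (tpure_bilinear_eval _ _ hb) antiUM !mulrA.
  by rewrite sw_scalef hu scalerA mulrC.
Qed.

Definition hopfU : hopf_ops U :=
  {| hmul := *%R; hone := 1; hcomul := comulU; hcounit := counitU; hanti := antiU |}.

Lemma hopfU_is_hopf : is_hopf hopfU.
Proof.
have mA : associative ( *%R : C -> C -> C) by exact: mulrA.
split => //=.
- exact: mul_bilinear.
- exact: mulrA.
- exact: mul1r.
- exact: mulr1.
- exact: comulU_linear.
- exact: sepU.1 1.
- exact: antiU_linear.
- exact: (eval_comulA sepU mA comulUE).
- exact: (eval_counitl sepU (@mul1r C) comulUE).
- exact: (eval_counitr sepU (@mulr1 C) comulUE).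
- exact: comulUM.
- exact: comulU1.
- exact: counitUM.
- by rewrite /counitU /lamU rep1 C1.
- exact: antiU_l.
- exact: antiU_r.
Qed.

Lemma hopfU_spec : hopf_UPi hopfU.
Proof.
split=> [|Y]; first by split=> //; exact: hopfU_is_hopf.
split; [exact: comulU_gen| |exact: antiU_gen].
by rewrite /= /counitU /lamU rep_gen (pd1 (lie_pd 1%g (set_mem (valP Y)))).
Qed.

End HopfU.

(** * The Hopf algebra F and the coaction *)

Section HopfF.
Variables (R : realType) (m : nat) (P : primitive m) (d : nat).
Local Notation C := (Cinf R P).
Local Notation G := (GPi R P).
Local Notation N := (NPi R P).
Local Notation D := (Diff R P).
Local Notation lie := (@lieG R m P).
Local Notation U := (UPi R P).
Variables (X : 'I_d -> lie) (hX : is_basis X).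
Local Notation XX i := (val (X i) : OpG R P).
Local Notation F := (FPi X).
Local Notation ux k := (ugen (X k) : U).
Local Notation act := (act hX).

Definition gi i j : F := sval (cid (gi_ex hX i j)).

Lemma hat_gi phi i j : hat hX phi (gi i j) = pull phi (Gam X phi^-1%g i j).
Proof. exact: (svalP (cid (gi_ex hX i j)) phi). Qed.

(** The defining relation of Gam at [phi^-1], pulled back by [phi]. Its coefficients are of the form
    [hat], and this is what makes coproduct and coaction take values in F. *)
Lemma X_pull k phi (xi : C) :
  XX k (pull phi xi) = \sum_j hat hX phi (gi k j) * pull phi (XX j xi).
Proof.
have := congr1 (pull phi) (GamP hX phi^-1%g k xi); rewrite pullK invgK => ->.
rewrite (rlin_sum (pull_linear phi)); apply: eq_bigr => j _.
by rewrite pull_mul hat_gi.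
Qed.

Lemma hat_act_X phi k (f : F) : hat hX phi (act (ux k) f) = XX k (hat hX phi f).
Proof. by rewrite hat_act rep_gen. Qed.

Ltac lin_leaf ::= first [exact: hat_linear | exact: rep_linear_at | exact: pull_linear
  | exact: Endo_linear | exact: rep_linear | exact: efun_bilinear].

Lemma pull_hat_bilinear phi chi :
  bilinear_map (fun a b : F => pull chi (hat hX phi a) * hat hX chi b).
Proof. lin. Qed.

Lemma gam_ex i j : exists e : F, forall phi, hat hX phi e = Gam X phi i j.
Proof.
have [e ee] : exists e : F, galgv e = Defs.eta X i j [::].
  by apply: galg_gen; exists i, j, [::].
by exists e => phi; apply: Cext => g; rewrite hatE ee -GamX_eta.
Qed.

Definition gm i j : F := sval (cid (gam_ex i j)).

Lemma hat_gm phi i j : hat hX phi (gm i j) = Gam X phi i j.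
Proof. exact: (svalP (cid (gam_ex i j)) phi). Qed.

(** On entries of Gam this is the cocycle identity. For one further derivative, the derivation X k
    is applied to the product, and [X_pull] takes it through the pull-back. *)
Lemma comulF_ex (f : F) : exists t : tensor F F, forall phi chi : D,
  \sw_(a, b <- t) (pull chi (hat hX phi a) * hat hX chi b) = hat hX (phi * chi)%g f.
Proof.
have hb phi chi := pull_hat_bilinear phi chi.
move: f; apply: (F_ind (hX := hX)) => [|x y [t ht] [s hs]|a x [t ht]|x y [t ht] [s hs]|i j e he|k x y hy [t ht]].
- exists (1 \ox 1) => phi chi.
  by rewrite (tpure_bilinear_eval _ _ (hb phi chi)) !hat1 pull_one mulr1.
- exists (t + s) => phi chi.
  by rewrite (rlinD (sw_linear (hb phi chi))) ht hs (rlinD (hat_linear hX _)).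
- exists (a *: t) => phi chi.
  by rewrite (rlinZ (sw_linear (hb phi chi))) ht (rlinZ (hat_linear hX _)).
- exists (\sw_(a, b <- t) \sw_(c, e <- s) ((a * c) \ox (b * e))) => phi chi.
  rewrite (sw_comp _ _ (sw_linear (hb phi chi))) hatM -ht -hs sw_mulr.
  apply: eq_sw => a b; rewrite (sw_comp _ _ (sw_linear (hb phi chi))) sw_mull.
  apply: eq_sw => c e; rewrite (tpure_bilinear_eval _ _ (hb phi chi)) !hatM pull_mul.
  by rewrite mulrACA.
- exists (\sum_k gm i k \ox gm k j) => phi chi.
  rewrite (rlin_sum (sw_linear (hb phi chi))) he GamM//; apply: eq_bigr => k _.
  by rewrite (tpure_bilinear_eval _ _ (hb phi chi)) !hat_gm.
- exists (\sw_(a, b <- t) (\sum_j act (ux j) a \ox (gi k j * b) + a \ox act (ux k) b)) => phi chi.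
  have lb := sw_linear (hb phi chi).
  rewrite hy -ht (sw_comp _ _ (Endo_linear (XX k))) (sw_comp _ _ lb).
  apply: eq_sw => a b; have [dX _] := X_lie X k; rewrite dX X_pull.
  rewrite (rlinD lb) (rlin_sum lb) mulr_suml (tpure_bilinear_eval _ _ (hb phi chi)) hat_act_X.
  congr (_ + _); apply: eq_bigr => j _.
  rewrite (tpure_bilinear_eval _ _ (hb phi chi)) hat_act_X hatM.
  by rewrite mulrA; congr (_ * _); exact: mulrC.
Qed.

Definition comulF (f : F) : tensor F F := sval (cid (comulF_ex f)).

Lemma comulF_hat phi chi f :
  \sw_(a, b <- comulF f) (pull chi (hat hX phi a) * hat hX chi b) = hat hX (phi * chi)%g f.
Proof. exact: (svalP (cid (comulF_ex f)) phi chi). Qed.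

(** Entries of Gam go to those of the inverse matrix; a derivative X k, conjugated by [phi], becomes
    a combination of derivatives with coefficients in Gam. *)
Lemma antiF_ex (f : F) : exists h : F, forall phi, hat hX phi h = pull phi (hat hX phi^-1%g f).
Proof.
move: f; apply: (F_ind (hX := hX)) => [|x y [t ht] [s hs]|a x [t ht]|x y [t ht] [s hs]|i j e he|k x y hy [t ht]].
- by exists 1 => phi; rewrite !hat1 pull_one.
- exists (t + s) => phi.
  by rewrite !(rlinD (hat_linear hX _)) (rlinD (pull_linear phi)) ht hs.
- exists (a *: t) => phi.
  by rewrite !(rlinZ (hat_linear hX _)) (rlinZ (pull_linear phi)) ht.
- by exists (t * s) => phi; rewrite !hatM pull_mul ht hs.
- by exists (gi i j) => phi; rewrite hat_gi he.
- exists (\sum_j gm k j * act (ux j) t) => phi.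
  have e : hat hX phi^-1%g x = pull phi^-1%g (hat hX phi t) by rewrite ht pullVK.
  rewrite (rlin_sum (hat_linear hX phi)) hy e (GamP hX); apply: eq_bigr => j _.
  by rewrite hatM hat_gm hat_act_X.
Qed.

Definition antiF (f : F) : F := sval (cid (antiF_ex f)).

Lemma hat_antiF phi f : hat hX phi (antiF f) = pull phi (hat hX phi^-1%g f).
Proof. exact: (svalP (cid (antiF_ex f)) phi). Qed.

Definition evF (psi : N) (f : F) : R := galgv f psi.

Lemma sepF : separating evF.
Proof.
by split=> [psi a f g//|f h]; apply: val_inj; apply/funext => psi; exact: h.
Qed.

Lemma comulFE psi1 psi2 f : tev (evF psi1) (evF psi2) (comulF f) = evF (psi1 * psi2)%g f.
Proof.
rewrite /evF -(hat_unit hX) -[nval (psi1 * psi2)%g]/(nval psi1 * nval psi2)%g -comulF_hat.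
rewrite sw_at; apply: eq_swr => a b.
by rewrite CM pullE tilde_N1 !hat_unit.
Qed.

Lemma antiFE psi f : evF psi (antiF f) = evF psi^-1%g f.
Proof.
rewrite /evF -(hat_unit hX) hat_antiF pullE tilde_N1.
by rewrite -[(nval psi)^-1%g]/(nval psi^-1%g) hat_unit.
Qed.

Definition counitF (f : F) : R := evF 1%g f.

Definition hopfF : hopf_ops F :=
  {| hmul := *%R; hone := 1; hcomul := comulF; hcounit := counitF; hanti := antiF |}.

Lemma antiF_linear : linear antiF.
Proof.
by move=> a f g; apply: (sep_eq sepF) => psi; rewrite (sepF.1 psi) !antiFE (sepF.1 _).
Qed.

Lemma comulF_linear : linear comulF. Proof. exact: eval_comul_linear sepF comulFE. Qed.

Lemma evFM psi f g : evF psi (f * g) = evF psi f * evF psi g. Proof. by []. Qed.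
Lemma evF1 psi : evF psi 1 = 1. Proof. by []. Qed.

Lemma comulFM x y : comulF (x * y) =
  \sw_(a, b <- comulF x) \sw_(c, e <- comulF y) ((a * c) \ox (b * e)).
Proof.
apply: (sep_eq (tensor_separating sepF sepF)) => -[f g] /=.
have ll := tev_linear (sepF.1 f) (sepF.1 g).
rewrite comulFE evFM -!comulFE (sw_comp _ _ ll) [X in X * _]/tev -[_ * _]/(_ * _ : R^o) sw_mulr.
apply: eq_swr => a b; rewrite (sw_comp _ _ ll) [X in _ * X]/tev -[_ * _ in LHS]/(_ * _ : R^o) sw_mull.
apply: eq_swr => c e; rewrite (tev_pure _ _ (sepF.1 f) (sepF.1 g)) !evFM.
exact: mulrACA.
Qed.

Lemma comulF1 : comulF 1 = 1 \ox 1.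
Proof.
apply: (sep_eq (tensor_separating sepF sepF)) => -[f g] /=.
by rewrite comulFE (tev_pure _ _ (sepF.1 f) (sepF.1 g)) !evF1 mulr1.
Qed.

Lemma antiF_l f : \sw_(a, b <- comulF f) (antiF a * b) = counitF f *: 1.
Proof.
apply: (sep_eq sepF) => psi; rewrite (sw_comp _ _ (sepF.1 psi)).
transitivity (tev (evF psi^-1%g) (evF psi) (comulF f)).
  by apply: eq_swr => a b; rewrite evFM antiFE.
by rewrite comulFE mulVg; exact: esym (mulr1 _).
Qed.

Lemma antiF_r f : \sw_(a, b <- comulF f) (a * antiF b) = counitF f *: 1.
Proof.
apply: (sep_eq sepF) => psi; rewrite (sw_comp _ _ (sepF.1 psi)).
transitivity (tev (evF psi) (evF psi^-1%g) (comulF f)).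
  by apply: eq_swr => a b; rewrite evFM antiFE.
by rewrite comulFE mulgV; exact: esym (mulr1 _).
Qed.

Lemma hopfF_is_hopf : is_hopf hopfF.
Proof.
split => //=.
- exact: mul_bilinear.
- exact: mulrA.
- exact: mul1r.
- exact: mulr1.
- exact: comulF_linear.
- exact: antiF_linear.
- exact: (eval_comulA sepF (@mulgA N) comulFE).
- exact: (eval_counitl sepF (@mul1g N) comulFE).
- exact: (eval_counitr sepF (@mulg1 N) comulFE).
- exact: comulFM.
- exact: comulF1.
- exact: antiF_l.
- exact: antiF_r.
Qed.

Lemma hopfF_spec : hopf_FPi hopfF.
Proof.
split=> //; first by split=> //; exact: hopfF_is_hopf.
- by move=> f p1 p2; exact: (comulFE p1 p2 f).
- by move=> f psi; exact: antiFE.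
Qed.

(* rep u o pull phi = sum hat(u<1>) . pull phi o rep u<0> *)
Definition coact_eq (u : U) (t : tensor U F) : Prop := forall phi (xi : C),
  rep u (pull phi xi) = \sw_(x, b <- t) (hat hX phi b * pull phi (rep x xi)).

Lemma coact_bilinear phi (xi : C) :
  bilinear_map (fun (x : U) (b : F) => hat hX phi b * pull phi (rep x xi)).
Proof. lin. Qed.

(** X k is a derivation: on [hat b] it acts through [act], on the pull-back through [X_pull]. For v
    = 1 this gives the coaction of X k as the sum of X j (x) gi k j. *)
Lemma coact_gen (k : 'I_d) (v : U) t : coact_eq v t ->
  coact_eq (ux k * v) (\sw_(x, b <- t) (x \ox act (ux k) b + \sum_j (ux j * x) \ox (gi k j * b))).
Proof.
move=> ht phi xi; have hb := coact_bilinear phi xi; have lb := sw_linear hb.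
rewrite repM OpGM ht rep_gen (sw_comp _ _ (Endo_linear (XX k))) (sw_comp _ _ lb).
apply: eq_sw => x b; have [dX _] := X_lie X k; rewrite dX X_pull.
rewrite (rlinD lb) (rlin_sum lb) (tpure_bilinear_eval _ _ hb) hat_act_X mulr_sumr; congr (_ + _).
apply: eq_bigr => j _; rewrite (tpure_bilinear_eval _ _ hb) hatM repM OpGM rep_gen.
by rewrite mulrA; congr (_ * _); exact: mulrC.
Qed.

Lemma coact_ex (u : U) : exists t, coact_eq u t.
Proof.
suff h v : (exists t, coact_eq v t) -> exists t, coact_eq (u * v) t.
  rewrite -[u]mulr1; apply: h; exists (1 \ox 1) => phi xi.
  by rewrite (tpure_bilinear_eval _ _ (coact_bilinear phi xi)) hat1 mul1r !rep1.
elim/UPi_ind: u v => [Y|| a u1 u2 h1 h2|u1 u2 h1 h2] v hv.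
- have [c ->] := ugen_X_span hX Y; have [t ht] := hv.
  elim: (index_enum _) => [|k s [t' ht']].
    exists 0 => phi xi; rewrite big_nil mul0r (rlin0 (sw_linear (coact_bilinear phi xi))).
    by rewrite (rlin0 (rep_linear_at _)).
  eexists (c k *: _ + t') => phi xi.
  rewrite big_cons mulrDl -scalerAl (rep_linear_at (pull phi xi)) ht' (coact_gen k ht).
  by rewrite (sw_linear (coact_bilinear phi xi)).
- by rewrite mul1r.
- have [t1 e1] := h1 _ hv; have [t2 e2] := h2 _ hv; exists (a *: t1 + t2) => phi xi.
  rewrite mulrDl -scalerAl (rep_linear_at (pull phi xi)) e1 e2.
  by rewrite (sw_linear (coact_bilinear phi xi)).
- by rewrite -mulrA; exact/h1/h2.
Qed.

Definition coact (u : U) : tensor U F := sval (cid (coact_ex u)).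

Lemma coact_rep u phi (xi : C) :
  rep u (pull phi xi) = \sw_(x, b <- coact u) (hat hX phi b * pull phi (rep x xi)).
Proof. exact: (svalP (cid (coact_ex u)) phi xi). Qed.

Local Notation lamU := (@lamU R m P).
Local Notation sepU := (sepU hX).
Definition sepUF := tensor_separating sepU sepF.

Lemma coactE xi psi u : tev (lamU xi) (evF psi) (coact u) = lamU (pull (nval psi) xi) u.
Proof.
rewrite /lamU coact_rep sw_at; apply: eq_swr => x b.
by rewrite CM hat_unit pullE tilde_N1 mulrC.
Qed.

Lemma coact_linear : linear coact.
Proof.
move=> a u v; apply: (sep_eq sepUF) => -[xi psi] /=.
by rewrite (tev_linear (sepU.1 xi) (sepF.1 psi)) !coactE (sepU.1 _).
Qed.

End HopfF.

(** * The matched pair axioms *)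

Section MatchedPair.
Variables (R : realType) (m : nat) (P : primitive m) (d : nat).
Local Notation C := (Cinf R P).
Local Notation G := (GPi R P).
Local Notation N := (NPi R P).
Local Notation D := (Diff R P).
Local Notation lie := (@lieG R m P).
Local Notation U := (UPi R P).
Variables (X : 'I_d -> lie) (hX : is_basis X).
Local Notation XX i := (val (X i) : OpG R P).
Local Notation F := (FPi X).
Local Notation ux k := (ugen (X k) : U).
Local Notation act := (act hX).
Local Notation coact := (coact hX).
Local Notation hat := (hat hX).
Local Notation lamU := (@lamU R m P).
Local Notation sepU := (sepU hX).
Local Notation evF := (@evF R m P d X).
Local Notation sepF := (@sepF R m P d X).
Local Notation sepUF := (sepUF hX).
Local Notation comulU := (@comulU R m P).
Local Notation comulF := (comulF hX).
Local Notation hU := (hopfU R P).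
Local Notation hF := (hopfF hX).

Let lU xi : linear (lamU xi : U -> R^o). Proof. exact: sepU.1. Qed.
Let lF psi : linear (evF psi : F -> R^o). Proof. exact: sepF.1. Qed.
Let lUF xi psi := tev_linear (lU xi) (lF psi).

Lemma hat_inj (f h : F) : (forall phi, hat phi f = hat phi h) -> f = h.
Proof. by move=> e; apply: (hat_eq (hX := hX)) => psi; rewrite e. Qed.

Lemma actE psi u f : evF psi (act u f) = lamU (hat (nval psi) f) u.
Proof. by rewrite /evF -(hat_unit hX) hat_act. Qed.

Lemma act_bilinear : bilinear_map act.
Proof.
split=> [f a u v|u a f g]; apply: hat_inj => phi; rewrite hat_linear !hat_act.
  exact: rep_linear_at.
by rewrite hat_linear (Endo_linear (rep u)).
Qed.

Lemma module_algebra_act : module_algebra hU hF act.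
Proof.
split => /=.
- exact: act_bilinear.
- by move=> f; apply: hat_inj => phi; rewrite hat_act rep1.
- by move=> x y f; apply: hat_inj => phi; rewrite !hat_act repM.
- move=> x a b; apply: hat_inj => phi; rewrite hat_act hatM comulU_rep.
  rewrite (sw_comp _ _ (hat_linear hX phi)); apply: eq_sw => y z.
  by rewrite hatM !hat_act.
- move=> x; apply: hat_inj => phi.
  by rewrite hat_act (rlinZ (hat_linear hX phi)) !hat1 rep_one.
Qed.

Lemma comodule_coalgebra_coact : comodule_coalgebra hU hF coact.
Proof.
split => /=.
- exact: coact_linear.
- move=> x; apply: (sep_eq (tensor_separating sepUF sepF)) => -[[xi psi] chi] /=.
  have l3 := tev_linear (lUF xi psi) (lF chi).
  transitivity (lamU (pull (nval chi) (pull (nval psi) xi)) x).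
    rewrite (sw_comp _ _ l3) -(coactE hX) [RHS]/tev; apply: eq_swr => a b.
    by rewrite (tev_pure _ _ (lUF xi psi) (lF chi)) (coactE hX).
  rewrite -pullM -[(nval psi * _)%g]/(nval (psi * chi)%g) -(coactE hX) (sw_comp _ _ l3) [LHS]/tev.
  apply: eq_swr => a b; rewrite (sw_comp _ _ l3) -(comulFE hX) [X in _ * X]/tev -[_ * _ in LHS]/(_ * _ : R^o).
  rewrite sw_mull; apply: eq_swr => c e.
  by rewrite (tev_pure _ _ (lUF xi psi) (lF chi)) (tev_pure _ _ (lU xi) (lF psi)) mulrA.
- move=> x; apply: (sep_eq sepU) => xi; rewrite (sw_comp _ _ (lU xi)).
  transitivity (tev (lamU xi) (evF 1%g) (coact x)).
    by apply: eq_swr => a b; rewrite (rlinZ (lU xi)) mulrC.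
  by rewrite (coactE hX) -[nval 1%g]/(1%g : D) pull1.
- move=> x; apply: (sep_eq (tensor_separating (tensor_separating sepU sepU) sepF)) => -[[xi ze] psi] /=.
  have l2 := tev_linear (lU xi) (lU ze); have l3 := tev_linear l2 (lF psi).
  transitivity (lamU (pull (nval psi) (xi * ze)) x).
    rewrite (sw_comp _ _ l3) -(coactE hX) [RHS]/tev; apply: eq_swr => a b.
    by rewrite (tev_pure _ _ l2 (lF psi)) comulUE.
  rewrite pull_mul -comulUE (sw_comp _ _ l3) [LHS]/tev; apply: eq_swr => a b.
  rewrite -!(coactE hX) (sw_comp _ _ l3) [X in X * _]/tev -[_ * _ in LHS]/(_ * _ : R^o) sw_mulr.
  apply: eq_swr => a0 a1; rewrite (sw_comp _ _ l3) [X in _ * X]/tev -[_ * _ in LHS]/(_ * _ : R^o) sw_mull.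
  apply: eq_swr => b0 b1; rewrite (tev_pure _ _ l2 (lF psi)) (tev_pure _ _ (lU xi) (lU ze)).
  by rewrite evFM; exact: mulrACA.
- move=> x; apply: (sep_eq sepF) => psi; rewrite (sw_comp _ _ (lF psi)).
  transitivity (tev (lamU 1) (evF psi) (coact x)).
    by apply: eq_swr => a b; rewrite (rlinZ (lF psi)).
  by rewrite (coactE hX) pull_one (rlinZ (lF psi)); exact: esym (mulr1 _).
Qed.

Lemma matched_pair_act_coact : matched_pair hU hF act coact.
Proof.
split => /=.
- exact: (hopfU_is_hopf hX).
- exact: hopfF_is_hopf.
- exact: module_algebra_act.
- exact: comodule_coalgebra_coact.
- move=> x a; rewrite /counitF actE.
  (* At the identity diffeomorphism [hat] is constant, since the N-part of every g in G is
     trivial. *)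
  have -> : hat (nval 1%g) a = evF 1%g a *: 1.
    apply: Cext => g; rewrite hatE CZ C1 mulr1 -[nval 1%g]/(1%g : D) mul1g.
    by have := NpartE g (1%g : N); rewrite -[nval 1%g]/(1%g : D) mulg1 => ->.
  by rewrite /lamU (rlinZ (Endo_linear (rep x))) CZ mulrC.
- move=> x a; apply: (sep_eq (tensor_separating sepF sepF)) => -[psi chi] /=.
  have l2 := tev_linear (lF psi) (lF chi).
  rewrite (comulFE hX) actE -[nval (psi * chi)%g]/(nval psi * nval chi)%g -comulF_hat.
  (* The coproduct of F writes the function attached to psi chi as a sum of products; the Leibniz
     rule for x then splits each product and the coaction moves x1 through the pull-back. *)
  rewrite /lamU (sw_comp _ _ (Endo_linear (rep x))) sw_at.
  transitivity (\sw_(a1, a2 <- comulF a) \sw_(x1, x2 <- comulU x)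
     (lamU (pull (nval chi) (hat (nval psi) a1)) x1 * lamU (hat (nval chi) a2) x2 : R^o)).
    by apply: eq_swr => a1 a2; rewrite comulU_rep sw_at; apply: eq_swr.
  rewrite sw_swap (sw_comp _ _ l2); apply: eq_swr => x1 x2.
  rewrite (sw_comp _ _ l2).
  transitivity (\sw_(y0, y1 <- coact x1) \sw_(a1, a2 <- comulF a)
     (lamU (hat (nval psi) a1) y0 * evF chi y1 * lamU (hat (nval chi) a2) x2 : R^o)).
    rewrite sw_swap; apply: eq_swr => a1 a2; rewrite -(coactE hX) [X in X * _]/tev.
    by rewrite -[_ * _ in LHS]/(_ * _ : R^o) sw_mulr.
  apply: eq_swr => y0 y1; rewrite (sw_comp _ _ l2); apply: eq_swr => a1 a2.
  by rewrite (tev_pure _ _ (lF psi) (lF chi)) evFM !actE mulrA.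
- apply: (sep_eq sepUF) => -[xi psi] /=.
  rewrite (coactE hX) (tev_pure _ _ (lU xi) (lF psi)) /lamU !rep1 evF1 mulr1.
  by rewrite -[LHS]/(pull (nval psi) xi 1%g) pullE tilde_N1.
- move=> x y; apply: (sep_eq sepUF) => -[xi psi] /=.
  rewrite (coactE hX) /lamU repM OpGM (coact_rep hX) (sw_comp _ _ (Endo_linear (rep x))) sw_at.
  transitivity (\sw_(y0, y1 <- coact y) \sw_(x1, x2 <- comulU x)
     (lamU (pull (nval psi) (rep y0 xi)) x1 * lamU (hat (nval psi) y1) x2 : R^o)).
    by apply: eq_swr => y0 y1; rewrite mulrC comulU_rep sw_at; apply: eq_swr.
  rewrite sw_swap (sw_comp _ _ (lUF xi psi)); apply: eq_swr => x1 x2.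
  rewrite (sw_comp _ _ (lUF xi psi)).
  transitivity (\sw_(z0, z1 <- coact x1) \sw_(y0, y1 <- coact y)
     (lamU (rep y0 xi) z0 * evF psi z1 * lamU (hat (nval psi) y1) x2 : R^o)).
    rewrite sw_swap; apply: eq_swr => a1 a2; rewrite -(coactE hX) [X in X * _]/tev.
    by rewrite -[_ * _ in LHS]/(_ * _ : R^o) sw_mulr.
  apply: eq_swr => z0 z1; rewrite (sw_comp _ _ (lUF xi psi)); apply: eq_swr => y0 y1.
  by rewrite (tev_pure _ _ (lU xi) (lF psi)) evFM actE mulrA /lamU repM.
- move=> x a; apply: (sep_eq sepUF) => -[xi psi] /=.
  have E (x1 x2 : U) (k : R) : lamU (pull (nval psi) xi) x2 * k =
      \sw_(y0, y1 <- coact x2) (lamU xi y0 * evF psi y1 * k : R^o).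
    by rewrite -(coactE hX) [X in X * _]/tev -[_ * _ in LHS]/(_ * _ : R^o) sw_mulr.
  rewrite !(sw_comp _ _ (lUF xi psi)).
  (* Both sides expand the same product of functions by the Leibniz rule, with its factors in the
     two orders. *)
  transitivity (lamU (hat (nval psi) a * pull (nval psi) xi) x).
    rewrite -comulUE [RHS]/tev; apply: eq_swr => x1 x2.
    rewrite mulrC (E x1) (sw_comp _ _ (lUF xi psi)); apply: eq_swr => y0 y1.
    by rewrite (tev_pure _ _ (lU xi) (lF psi)) evFM actE mulrAC mulrA.
  rewrite mulrC -comulUE [LHS]/tev; apply: eq_swr => x1 x2.
  rewrite (E x2) (sw_comp _ _ (lUF xi psi)); apply: eq_swr => y0 y1.
  by rewrite (tev_pure _ _ (lU xi) (lF psi)) evFM actE mulrA.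
Qed.

End MatchedPair.

(** * Diagonal operators on the crossed product *)

Section DiagonalOperators.
Variables (R : realType) (m : nat) (P : primitive m).
Local Notation C := (Cinf R P).
Local Notation D := (Diff R P).
Local Notation OpG := (OpG R P).

Lemma diag_ext (T T' : D -> OpG) : (forall phi xi, T phi xi = T' phi xi) -> diag T = diag T'.
Proof.
by move=> h; apply: EndoE => a; apply: val_inj; apply/funext => phi /=; exact: h.
Qed.

Lemma diagM (T T' : D -> OpG) : diag T * diag T' = diag (fun phi => T phi * T' phi).
Proof. by apply: EndoE => a; apply: val_inj; apply/funext => phi. Qed.

Lemma diag_lin c (T T' : D -> OpG) : c *: diag T + diag T' = diag (fun phi => c *: T phi + T' phi).
Proof. by apply: EndoE => a; apply: val_inj; apply/funext => phi. Qed.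

Lemma diag1 : 1 = diag (fun=> 1 : OpG).
Proof. by apply: EndoE => a; apply: val_inj; apply/funext => phi. Qed.

Lemma diag_monom (T : D -> OpG) (xi : C) phi : diag T (monom xi phi) phi = T phi xi.
Proof. by rewrite /= eqxx. Qed.

Lemma multopM (h k : D -> C) : multop h * multop k = multop (fun phi => h phi * k phi).
Proof. by rewrite /multop diagM; apply: diag_ext => phi xi; exact: mulrA. Qed.

Lemma multop_lin c (h k : D -> C) : c *: multop h + multop k = multop (fun phi => c *: h phi + k phi).
Proof.
rewrite /multop diag_lin; apply: diag_ext => phi xi; rewrite OpGD OpGZ /=.
by rewrite mulrDl -scalerAl.
Qed.

Lemma multop1 : multop (fun=> 1 : C) = 1 :> OpA R P.
Proof. by rewrite diag1; apply: diag_ext => phi xi; exact: mul1r. Qed.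

Lemma multop_inj (h k : D -> C) : multop h = multop k -> forall phi, h phi = k phi.
Proof.
move=> e phi; have := congr1 (fun T : OpA R P => T (monom 1 phi) phi) e.
by rewrite !diag_monom /= !mulr1.
Qed.

Lemma vfield_lin c (S T : OpG) : c *: vfield S + vfield T = vfield (c *: S + T).
Proof. exact: diag_lin. Qed.

Lemma vfieldM (S T : OpG) : vfield S * vfield T = vfield (S * T).
Proof. exact: diagM. Qed.

End DiagonalOperators.

(** * The isomorphism with H as an algebra *)

Section Isomorphism.
Variables (R : realType) (m : nat) (P : primitive m) (d : nat).
Local Notation C := (Cinf R P).
Local Notation G := (GPi R P).
Local Notation N := (NPi R P).
Local Notation D := (Diff R P).
Local Notation lie := (@lieG R m P).
Local Notation U := (UPi R P).
Variables (X : 'I_d -> lie) (hX : is_basis X).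
Local Notation XX i := (val (X i) : OpG R P).
Local Notation F := (FPi X).
Local Notation H := (HPi X).
Local Notation ux k := (ugen (X k) : U).
Local Notation act := (act hX).
Local Notation coact := (coact hX).
Local Notation hat := (hat hX).
Local Notation gi := (gi hX).
Local Notation gm := (gm hX).
Local Notation gens := ([set T : OpA R P |
  (exists k, T = vfield (val (X k))) \/ (exists i j, T = Delta X i j)]).
Local Notation inH T := (galg_set gens T).
Local Notation mhat f := (multop (fun phi : D => hat phi f)).
Local Notation B := (tensor F U).
Local Notation hU := (hopfU R P).
Local Notation hF := (hopfF hX).

Lemma inH_lin c S T : inH S -> inH T -> inH (c *: S + T).
Proof.
move=> hS hT Q hQ SQ; have [_ hD hZ _] := hQ.
by apply: hD; [apply: hZ; exact: hS|exact: hT].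
Qed.
Lemma inHM S T : inH S -> inH T -> inH (S * T).
Proof.
by move=> hS hT Q hQ SQ; have [_ _ _ h] := hQ; apply: h; [exact: hS|exact: hT].
Qed.
Lemma inH1 : inH 1. Proof. by move=> Q []. Qed.
Lemma inH0 : inH 0.
Proof. by have := inH_lin (- 1) inH1 inH1; rewrite scaleN1r addNr. Qed.

Lemma Gaminv_hat phi i j : Gaminv X phi i j = hat phi (gi i j).
Proof.
pose M := \matrix_(i, j) hat phi (gi i j).
have h1 : Gam X phi *m M = 1%:M.
  apply/matrixP => a b; rewrite [LHS]mxE [RHS]mxE -(Gam_inv hX phi).
  by apply: eq_bigr => k _; rewrite [X in _ * X]mxE hat_gi.
have h2 : M *m Gam X phi = 1%:M := mulmx1C h1.
have hx : [set M : 'M[C]_d | M *m Gam X phi = 1%:M /\ Gam X phi *m M = 1%:M] (Gaminv X phi).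
  by apply: (xgetPex 0); exists M.
have -> : Gaminv X phi = M.
  by rewrite -[LHS]mulmx1 -h1 mulmxA hx.1 mul1mx.
by rewrite mxE.
Qed.

Lemma Delta_hat i j : Delta X i j = mhat (gi i j).
Proof. by apply: diag_ext => phi xi; rewrite /= Gaminv_hat. Qed.

Lemma mhat_lin c f g : c *: mhat f + mhat g = mhat (c *: f + g).
Proof. by rewrite multop_lin; apply: diag_ext => phi xi; rewrite /= (hat_linear hX). Qed.
Lemma mhatM f g : mhat f * mhat g = mhat (f * g).
Proof. by rewrite multopM; apply: diag_ext => phi xi; rewrite /= hatM. Qed.
Lemma mhat1 : mhat 1 = 1.
Proof. by rewrite -multop1; apply: diag_ext => phi xi; rewrite /= hat1. Qed.

(** A derivation commuted past a multiplication leaves multiplication by the derivative; hence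
    iterated commutators of the [Delta] amount to iterating [act]. *)
Lemma commutator_hat k f : vfield (XX k) * mhat f - mhat f * vfield (XX k) = mhat (act (ux k) f).
Proof.
rewrite /vfield /multop !diagM addrC -scaleN1r diag_lin; apply: diag_ext => phi xi.
rewrite OpGD OpGZ !OpGM /= hat_act_X; have [dX _] := X_lie X k.
by rewrite dX scaleN1r addrC addrK.
Qed.

Lemma mhat0 : mhat 0 = 0.
Proof.
have e : (0 : F) = (- 1) *: 1 + 1 by rewrite scaleN1r addNr.
by rewrite e -mhat_lin scaleN1r addNr.
Qed.

(** H is generated with the entries of the inverse of Gam. Those of Gam come back as a polynomial in
    them, the four-term geometric sum for the inverse of the unipotent matrix Gam(psi^-1)(e). *)
Lemma gm_inH i j : inH (mhat (gm i j)).
Proof.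
have gE (psi : N) a b : galgv (gi a b) psi = Gam_unit X psi^-1%g a b.
  by rewrite -(hat_unit hX) hat_gi pullE tilde_N1 mxE.
have giH a b : inH (mhat (gi a b)).
  by rewrite -Delta_hat => Q _; apply; right; exists a, b.
have QL c f g : inH (mhat f) -> inH (mhat g) -> inH (mhat (c *: f + g)).
  by move=> hf hg; rewrite -mhat_lin; exact: inH_lin.
have Q0 : inH (mhat 0) by rewrite mhat0; exact: inH0.
have Q1 : inH (mhat 1) by rewrite mhat1; exact: inH1.
have QM f g : inH (mhat f) -> inH (mhat g) -> inH (mhat (f * g)).
  by move=> hf hg; rewrite -mhatM; exact: inHM.
have QS (I : Type) (s : seq I) (f : I -> F) : (forall k, inH (mhat (f k))) ->
    inH (mhat (\sum_(k <- s) f k)).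
  move=> h; elim: s => [|k s IH]; first by rewrite big_nil.
  by rewrite big_cons -[f k]scale1r; apply: QL.
have pw n i' j' : exists b : F, inH (mhat b) /\
    forall psi : N, galgv b psi = ((1 - Gam_unit X psi^-1%g) ^+ n) i' j'.
  elim: n i' j' => [|n IH] i' j'.
    exists ((i' == j')%:R *: 1 + 0); split; first exact: QL.
    by move=> psi; rewrite addr0 expr0 [RHS]mxE; exact: mulr1.
  pose b k := sval (cid (IH i' k)).
  have bP k : inH (mhat (b k)) /\ forall psi : N, galgv (b k) psi = ((1 - Gam_unit X psi^-1%g) ^+ n) i' k.
    exact: (svalP (cid (IH i' k))).
  exists (\sum_k b k * ((- 1) *: gi k j' + ((k == j')%:R *: 1 + 0))); split.
    by apply: QS => k; apply: QM; [exact: (bP k).1|apply: (QL) => //; exact: (QL)].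
  move=> psi; rewrite exprSr [RHS]mxE -(hat_unit hX) (rlin_sum (hat_linear hX _)) Csum.
  apply: eq_bigr => k _; rewrite hatM CM hat_unit (bP k).2; congr (_ * _).
  rewrite !(hat_linear hX) (rlin0 (hat_linear hX _)) addr0 hat1 CD !CZ C1 mulr1 hat_unit gE.
  by rewrite [RHS]mxE [X in _ = X + _]mxE [X in _ = _ + X]mxE mulN1r addrC.
suff -> : gm i j = \sum_(n < 4) sval (cid (pw n i j)).
  by apply: QS => n; exact: (svalP (cid (pw n i j))).1.
apply: (hat_eq (hX := hX)) => psi; rewrite (rlin_sum (hat_linear hX _)) Csum.
pose Q := Gam_unit X psi^-1%g; pose Sg := \sum_(n < 4) (1 - Q) ^+ n.
have h2 : Q *m Sg = 1%:M.
  have := subrX1 (1 - Q) 4.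
  have -> : (1 - Q) ^+ 4 = 0 by rewrite -opprB exprNn (Gam_unit_unipotent hX) mulr0.
  by rewrite addrAC subrr !add0r mulNr => /oppr_inj e1; exact: esym e1.
have h1 : Gam_unit X psi *m Q = 1%:M.
  apply/matrixP => a b; rewrite [LHS]mxE [RHS]mxE.
  have := congr1 (fun x : C => x 1%g) (Gam_inv hX (nval psi) a b); rewrite Csum => h.
  have hd : ((a == b)%:R : C) 1%g = (a == b)%:R by case: (a == b).
  rewrite -hd -h; apply: eq_bigr => k _; rewrite CM pullE tilde_N1.
  by rewrite [X in X * _]mxE [X in _ * X]mxE.
have gmE : hat (nval psi) (gm i j) 1%g = Sg i j.
  rewrite hat_gm -[Sg]mul1mx -h1 -mulmxA h2 mulmx1; by rewrite mxE.
rewrite gmE summxE; apply: eq_bigr => n _.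
by rewrite hat_unit (svalP (cid (pw n i j))).2.
Qed.

Lemma mhat_inH f : inH (mhat f).
Proof.
move: f; apply: (F_ind (hX := hX)) => [|x y hx hy|a x hx|x y hx hy|i j e he|k x y hy hx].
- by rewrite mhat1; exact: inH1.
- by rewrite -[x]scale1r -mhat_lin; exact: inH_lin.
- by rewrite -[_ *: _]addr0 -mhat_lin mhat0; apply: inH_lin => //; exact: inH0.
- by rewrite -mhatM; exact: inHM.
- suff -> : e = gm i j by exact: gm_inH.
  by apply: (hat_inj (hX := hX)) => phi; rewrite he hat_gm.
- have -> : y = act (ux k) x by apply: (hat_inj (hX := hX)) => phi; rewrite hy hat_act_X.
  rewrite -commutator_hat; have vH : inH (vfield (XX k)) by move=> Q _; apply; left; exists k.
  by rewrite addrC -scaleN1r; apply: inH_lin; exact: inHM.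
Qed.

Lemma rep_inH (u : U) : inH (vfield (rep u)).
Proof.
elim/UPi_ind: u => [Y|| a u v hu hv|u v hu hv].
- have [c ->] := ugen_X_span hX Y; elim: (index_enum _) => [|k s IH].
    have -> : vfield (rep (\sum_(i <- [::]) c i *: ux i)) = 0.
      rewrite big_nil (rlin0 (@rep_linear R m P)) -(scale0r (0 : OpG R P)) -[_ *: _]addr0.
      by rewrite -vfield_lin scale0r add0r; apply: EndoE => a; apply: val_inj; apply/funext.
    exact: inH0.
  rewrite big_cons rep_linear -vfield_lin; apply: inH_lin => //.
  by rewrite rep_gen => Q _; apply; left; exists k.
- by rewrite rep1 /vfield -diag1; exact: inH1.
- by rewrite rep_linear -vfield_lin; exact: inH_lin.
- by rewrite repM -vfieldM; exact: inHM.
Qed.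

(* The operator of multiplication by [f] after the action of [u]. *)
Definition psiop (f : F) (u : U) : OpA R P := mhat f * vfield (rep u).

Lemma psiop_bilinear : bilinear_map psiop.
Proof.
split=> [u a f g|f a u v]; rewrite /psiop.
  by rewrite -mhat_lin mulrDl scalerAl.
by rewrite rep_linear -vfield_lin mulrDr scalerAr.
Qed.

Definition Psi (s : B) : OpA R P := sweedler s psiop.

Lemma Psi_linear : linear Psi. Proof. exact: sw_linear psiop_bilinear. Qed.
Lemma Psi_pure f u : Psi (f \ox u) = psiop f u.
Proof. exact: tpure_bilinear_eval psiop_bilinear. Qed.

Lemma Psi_monom s (xi : C) phi :
  Psi s (monom xi phi) phi = \sw_(f, u <- s) (hat phi f * rep u xi).
Proof.
rewrite /Psi (sw_comp (f := fun T : OpA R P => T (monom xi phi) phi))//.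
by apply: eq_sw => f u; rewrite /psiop /vfield /multop diagM diag_monom.
Qed.

Local Notation evF := (@evF R m P d X).
Local Notation lamU := (@lamU R m P).
Definition evB (i : N * C) (s : B) : R := tev (evF i.1) (lamU i.2) s.

Lemma sepB : separating evB.
Proof. exact: tensor_separating (@sepF R m P d X) (sepU hX). Qed.

Lemma evB_Psi psi xi s : evB (psi, xi) s = Psi s (monom xi (nval psi)) (nval psi) 1%g.
Proof.
rewrite Psi_monom sw_at; apply: eq_swr => f u.
by rewrite CM hat_unit.
Qed.

Lemma Psi_inj s t : Psi s = Psi t -> s = t.
Proof. by move=> e; apply: (sep_eq sepB) => -[psi xi]; rewrite !evB_Psi e. Qed.

Lemma Psi_inH s : inH (Psi s).
Proof.
move: s; apply: tensor_ind => [f u|s t hs ht].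
  by rewrite Psi_pure; apply: inHM; [exact: mhat_inH|exact: rep_inH].
by rewrite (rlinD Psi_linear) -[X in X + _]scale1r; exact: inH_lin.
Qed.

(** The Leibniz rule as an identity of operators: it is the straightening rule that defines the
    product of the bicrossed product. *)
Lemma vfield_mhat u f : vfield (rep u) * mhat f =
  \sw_(u1, u2 <- comulU u) (mhat (act u1 f) * vfield (rep u2)).
Proof.
rewrite diagM; apply: EndoE => a; apply: val_inj; apply/funext => phi /=.
have -> : (\sw_(u1, u2 <- comulU u) (mhat (act u1 f) * vfield (rep u2))) a phi =
   \sw_(u1, u2 <- comulU u) ((mhat (act u1 f) * vfield (rep u2)) a phi).
  exact: (sw_comp (f := fun T : OpA R P => T a phi)).
rewrite comulU_rep; apply: eq_sw => x y.
by rewrite diagM /= hat_act.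
Qed.

Lemma PsiM s t : Psi (bicrossed_mul hU hF act s t) = Psi s * Psi t.
Proof.
rewrite /bicrossed_mul (sw_comp _ _ Psi_linear) {2}/Psi sw_mulr; apply: eq_sw => f u.
rewrite (sw_comp _ _ Psi_linear) [in RHS]/Psi sw_mull; apply: eq_sw => g v.
rewrite (sw_comp _ _ Psi_linear) /psiop -mulrA [in RHS]mulrA -[in RHS]mulrA.
rewrite (mulrA (vfield (rep u))) vfield_mhat sw_mulr sw_mull /=; apply: eq_sw => x y.
by rewrite Psi_pure /psiop -mhatM repM -vfieldM !mulrA.
Qed.

Lemma Psi1 : Psi (1 \ox 1) = 1.
Proof. by rewrite Psi_pure /psiop mhat1 rep1 /vfield -diag1 mulr1. Qed.

Lemma galg_of s : `[< inH (Psi s) >]. 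
Proof. by apply/asboolP; exact: Psi_inH. Qed.

Definition Phi (s : B) : H := MkGalg (galg_of s).

Lemma Phi_linear : linear Phi. Proof. by move=> a s t; apply: val_inj; exact: Psi_linear. Qed.

Lemma PhiM s t : Phi (bicrossed_mul hU hF act s t) = Phi s * Phi t.
Proof. by apply: val_inj; exact: PsiM. Qed.

Lemma Phi1 : Phi (1 \ox 1) = 1. Proof. by apply: val_inj; exact: Psi1. Qed.

Lemma Phi_inj : injective Phi. Proof. by move=> s t /(congr1 val) /Psi_inj. Qed.

Lemma Phi_surj (h : H) : exists s, Phi s = h.
Proof.
move: h; apply: galg_ind => [|x y [s <-] [t <-]|a x [s <-]|x y [s <-] [t <-]|x [[k e]|[i [j e]]]].
- by exists (1 \ox 1); exact: Phi1.
- by exists (s + t); rewrite (rlinD Phi_linear).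
- by exists (a *: s); rewrite (rlinZ Phi_linear).
- by exists (bicrossed_mul hU hF act s t); exact: PhiM.
- exists (1 \ox ux k); apply: val_inj; rewrite [RHS]e.
  by rewrite -[LHS]/(Psi _) Psi_pure /psiop mhat1 mul1r rep_gen.
- exists (gi i j \ox 1); apply: val_inj; rewrite [RHS]e.
  by rewrite -[LHS]/(Psi _) Psi_pure /psiop rep1 /vfield -diag1 mulr1 Delta_hat.
Qed.

Lemma Phi_bij : bijective Phi.
Proof.
exists (fun h => sval (cid (Phi_surj h))) => [s|h].
  by apply: Phi_inj; exact: (svalP (cid (Phi_surj (Phi s)))).
exact: (svalP (cid (Phi_surj h))).
Qed.

Lemma Phi_canonical : canonical_map Phi.
Proof.
split=> [Y|h hh].
  by rewrite -[LHS]/(Psi _) Psi_pure /psiop mhat1 mul1r rep_gen.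
have [f e] : exists f, multop h = mhat f.
  (* Multiplications by functions [hat f] form a subalgebra containing the iterated commutators,
     hence the given operator. *)
  apply: (hh [set T | exists f, T = mhat f]) => [|T [i [j [ks ->]]]].
    split=> [|x y [f ->] [g ->]|a x [f ->]|x y [f ->] [g ->]].
    - by exists 1; rewrite mhat1.
    - by exists (1 *: f + g); rewrite -mhat_lin scale1r.
    - by exists (a *: f + 0); rewrite -mhat_lin mhat0 addr0.
    - by exists (f * g); rewrite mhatM.
  rewrite Delta_hat; elim: ks (gi i j) => [|k ks IH] f /=; first by exists f.
  by rewrite commutator_hat; exact: IH.
exists f; split=> [psi|]; first by rewrite (multop_inj e) hat_unit.
by rewrite -[LHS]/(Psi _) Psi_pure /psiop rep1 /vfield -diag1 mulr1 e.
Qed.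

End Isomorphism.

(** * Antipodes of a Hopf algebra and of its co-opposite *)

Section HopfTheory.
Variables (R : comNzRingType) (H : lmodType R) (h : hopf_ops H).
Hypothesis hh : is_hopf h.
Local Notation "x ** y" := (hmul h x y) (at level 40, left associativity).
Local Notation S := (hanti h).
Local Notation Dl := (hcomul h).
Local Notation ep := (hcounit h).

Lemma sw_flip (A B W : lmodType R) (t : tensor A B) (b : B -> A -> W) : bilinear_map b ->
  sweedler (\sw_(x, y <- t) (y \ox x)) b = \sw_(x, y <- t) b y x.
Proof.
by move=> hb; rewrite (sw_comp _ _ (sw_linear hb)); apply: eq_sw => x y;
  rewrite (tpure_bilinear_eval _ _ hb).
Qed.

Ltac lin_leaf ::= first [exact: (hopf_mul_bilinear hh) | exact: (hopf_comul_linear hh)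
  | exact: (hopf_counit_linear hh) | exact: (hopf_anti_linear hh)].

Lemma sw_coassoc (W : lmodType R) (g : H -> H -> H -> W) x :
  (forall b c, linear (fun a => g a b c)) -> (forall a c, linear (fun b => g a b c)) ->
  (forall a b, linear (fun c => g a b c)) ->
  \sw_(a, b <- Dl x) \sw_(a1, a2 <- Dl a) g a1 a2 b =
  \sw_(a, b <- Dl x) \sw_(b1, b2 <- Dl b) g a b1 b2.
Proof.
move=> g1 g2 g3.
have b2 c : bilinear_map (fun a b => g a b c) by split=> z; [exact: g1|exact: g2].
have b3 : bilinear_map (fun (p : tensor H H) c => sweedler p (fun a1 a2 => g a1 a2 c)).
  split=> [c|p]; first exact: sw_linear (b2 c).
  by apply: lin_swb => a b; exact: g3.
have := congr1 (fun t => sweedler t (fun p c => sweedler p (fun a1 a2 => g a1 a2 c)))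
  (hopf_comulA hh x).
rewrite !(sw_comp _ _ (sw_linear b3)) => e.
transitivity (\sw_(a, b <- Dl x)
    sweedler (Dl a \ox b) (fun p c => sweedler p (fun a1 a2 => g a1 a2 c))).
  by apply: eq_sw => a b; rewrite (tpure_bilinear_eval _ _ b3).
rewrite e; apply: eq_sw => a b; rewrite (sw_comp _ _ (sw_linear b3)).
by apply: eq_sw => c f; rewrite (tpure_bilinear_eval _ _ b3) (tpure_bilinear_eval _ _ (b2 f)).
Qed.

Let mZl a x y : (a *: x) ** y = a *: (x ** y).
Proof. exact: rlinZ ((hopf_mul_bilinear hh).1 y) a x. Qed.
Let mZr a x y : x ** (a *: y) = a *: (x ** y).
Proof. exact: rlinZ ((hopf_mul_bilinear hh).2 x) a y. Qed.
Let mA := hopf_mulA hh.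
Let m1l := hopf_mul1 hh.
Let m1r := hopf_mulr1 hh.
Let sml (A B : lmodType R) (t : tensor A B) (b : A -> B -> H) c :
  c ** sweedler t b = \sw_(x, y <- t) (c ** b x y).
Proof. exact: sw_comp ((hopf_mul_bilinear hh).2 c). Qed.
Let smr (A B : lmodType R) (t : tensor A B) (b : A -> B -> H) c :
  sweedler t b ** c = \sw_(x, y <- t) (b x y ** c).
Proof. exact: (sw_comp t b ((hopf_mul_bilinear hh).1 c)). Qed.

Lemma hopf_anti1 : S (hone h) = hone h.
Proof.
have hb : bilinear_map (fun a b => S a ** b) by lin.
have := hopf_antil hh (hone h).
by rewrite (hopf_comul1 hh) (tpure_bilinear_eval _ _ hb) (hopf_counit1 hh) scale1r m1r.
Qed.

(* Both sides are convolution inverses of the product H (x) H -> H. *)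
Lemma hopf_antiM x y : S (x ** y) = S y ** S x.
Proof.
pose g a b1 b2 c e1 e2 := S (a ** c) ** ((b1 ** e1) ** (S e2 ** S b2)).
transitivity (\sw_(a, b <- Dl x) \sw_(b1, b2 <- Dl b) \sw_(c, e <- Dl y)
    \sw_(e1, e2 <- Dl e) g a b1 b2 c e1 e2).
  transitivity (\sw_(a, b <- Dl x) \sw_(c, e <- Dl y) (ep b *: (ep e *: S (a ** c)))).
    rewrite -{1}(hopf_counitr hh x) -{1}(hopf_counitr hh y).
    have l1 z : linear (fun w => S (w ** z)) by lin.
    have l2 z : linear (fun w => S (z ** w)) by lin.
    rewrite (sw_comp _ _ (l1 _)); apply: eq_sw => a b.
    rewrite (rlinZ (l1 _)) (sw_comp _ _ (l2 _)) -sw_scalef; apply: eq_sw => c e.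
    by rewrite (rlinZ (l2 _)).
  apply: eq_sw => a b; rewrite sw_swap; apply: eq_sw => c e.
  transitivity (\sw_(b1, b2 <- Dl b) (ep e *: (S (a ** c) ** (b1 ** S b2)))).
    rewrite sw_scalef -sml (hopf_antir hh) mZr m1r scalerA mulrC -scalerA; congr (_ *: _).
  apply: eq_sw => b1 b2; rewrite -mZr -[ep e *: _]mZr -[in LHS](m1l (S b2)).
  rewrite -[ep e *: _]mZl -(hopf_antir hh) smr sml sml; apply: eq_sw => e1 e2.
  by rewrite /g !mA.
transitivity (\sw_(a, b <- Dl x) \sw_(a1, a2 <- Dl a) \sw_(c, e <- Dl y)
    \sw_(c1, c2 <- Dl c) g a1 a2 b c1 c2 e).
  rewrite -(sw_coassoc (g := fun a b1 b2 => \sw_(c, e <- Dl y) \sw_(e1, e2 <- Dl e) g a b1 b2 c e1 e2));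
    rewrite /g; try (by move=> *; lin).
  apply: eq_sw => a b; apply: eq_sw => a1 a2.
  rewrite -(sw_coassoc (g := fun c e1 e2 => g a1 a2 b c e1 e2)) //;
    by rewrite /g; move=> *; lin.
transitivity (\sw_(a, b <- Dl x) \sw_(c, e <- Dl y) (ep a *: (ep c *: (S e ** S b)))).
  apply: eq_sw => a b; rewrite sw_swap; apply: eq_sw => c e.
  have hb : bilinear_map (fun p q => S p ** q) by lin.
  have := hopf_antil hh (a ** c); rewrite (hopf_comulM hh) (hopf_counitM hh).
  rewrite (sw_comp _ _ (sw_linear hb)) => e1.
  rewrite scalerA -[in RHS](m1l (S e ** S b)) -mZl -e1 smr; apply: eq_sw => a1 a2.
  rewrite (sw_comp _ _ (sw_linear hb)) smr; apply: eq_sw => c1 c2.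
  by rewrite (tpure_bilinear_eval _ _ hb) /g !mA.
rewrite -[in RHS](hopf_counitl hh x) -[in RHS](hopf_counitl hh y).
have l1 z : linear (fun w => z ** S w) by lin.
have l2 z : linear (fun w => S w ** z) by lin.
rewrite (sw_comp _ _ (l1 _)); apply: eq_sw => a b.
rewrite (rlinZ (l1 _)) (sw_comp _ _ (l2 _)) -sw_scalef; apply: eq_sw => c e.
by rewrite (rlinZ (l2 _)).
Qed.

Section Cop.
Variable S' : H -> H.
Hypotheses (lS' : linear S')
  (copl : forall x, \sw_(a, b <- Dl x) (S' b ** a) = ep x *: hone h)
  (copr : forall x, \sw_(a, b <- Dl x) (b ** S' a) = ep x *: hone h).

(** Evaluate x1 S(x2) S(S'(x3)) in two ways. Contracting the first two factors gives S(S' x); by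
    antimultiplicativity the last two are S(S'(x3) x2), which contracts to a counit and gives x. *)
Lemma anti_cop x : S (S' x) = x.
Proof.
transitivity (\sw_(a, b <- Dl x) \sw_(a1, a2 <- Dl a) (a1 ** (S a2 ** S (S' b)))).
  rewrite -{1}(hopf_counitl hh x).
  have l1 : linear (fun w => S (S' w)) by lin.
  rewrite (sw_comp _ _ l1); apply: eq_sw => a b.
  rewrite (rlinZ l1) -[in LHS](m1l (S (S' b))) -mZl -(hopf_antir hh) smr.
  by apply: eq_sw => a1 a2; rewrite mA.
rewrite (sw_coassoc (g := fun a1 a2 b => a1 ** (S a2 ** S (S' b)))); try by move=> *; lin.
rewrite -[RHS](hopf_counitr hh x); apply: eq_sw => a b.
rewrite -sml -[in RHS](m1r a) -mZr; congr (_ ** _).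
transitivity (S (\sw_(b1, b2 <- Dl b) (S' b2 ** b1))).
  rewrite (sw_comp _ _ (hopf_anti_linear hh)); apply: eq_sw => b1 b2.
  by rewrite hopf_antiM.
by rewrite copl (rlinZ (hopf_anti_linear hh)) hopf_anti1.
Qed.

Definition cop_with : hopf_ops H :=
  {| hmul := hmul h; hone := hone h; hcomul := fun x => \sw_(a, b <- Dl x) (b \ox a);
     hcounit := ep; hanti := S' |}.

Lemma cop_with_is_hopf : is_hopf cop_with.
Proof.
have lf : linear (fun x => \sw_(a, b <- Dl x) (b \ox a)) by lin.
split => /=.
- exact: (hopf_mul_bilinear hh).
- exact: mA.
- exact: m1l.
- exact: m1r.
- exact: lf.
- exact: (hopf_counit_linear hh).
- exact: lS'.
- move=> x; rewrite !sw_flip; try by lin.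
  transitivity (\sw_(a, b <- Dl x) \sw_(b1, b2 <- Dl b) ((b2 \ox b1) \ox a)).
    apply: eq_sw => a b; rewrite (sw_comp _ _ ((@tpure_bilinear R (tensor H H) H).1 a)).
    by [].
  rewrite -(sw_coassoc (g := fun a b1 b2 => (b2 \ox b1) \ox a)); try by move=> *; lin.
  by apply: eq_sw => a b; rewrite sw_flip//; lin.
- by move=> x; rewrite sw_flip; [exact: (hopf_counitr hh)|lin].
- by move=> x; rewrite sw_flip; [exact: (hopf_counitl hh)|lin].
- move=> x y; rewrite (hopf_comulM hh) sw_flip; last by lin.
  have hb : bilinear_map (fun a b : H => b \ox a) by lin.
  rewrite (sw_comp _ _ (sw_linear hb)); apply: eq_sw => a b.
  rewrite (sw_comp _ _ (sw_linear hb)) sw_flip; last by lin.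
  by apply: eq_sw => c e; rewrite (tpure_bilinear_eval _ _ hb).
- have hb : bilinear_map (fun a b : H => b \ox a) by lin.
  by rewrite (hopf_comul1 hh) (tpure_bilinear_eval _ _ hb).
- exact: (hopf_counitM hh).
- exact: (hopf_counit1 hh).
- by move=> x; rewrite sw_flip; [exact: copl|lin].
- by move=> x; rewrite sw_flip; [exact: copr|lin].
Qed.

End Cop.
End HopfTheory.

(** This is [anti_cop] for the co-opposite Hopf algebra, whose antipode is S' and in which the
    original antipode takes the place of S'. *)
Lemma cop_anti (R : comNzRingType) (H : lmodType R) (h : hopf_ops H) (S' : H -> H) :
  is_hopf h -> linear S' ->
  (forall x, \sw_(a, b <- hcomul h x) hmul h (S' b) a = hcounit h x *: hone h) ->
  (forall x, \sw_(a, b <- hcomul h x) hmul h b (S' a) = hcounit h x *: hone h) ->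
  forall x, S' (hanti h x) = x.
Proof.
move=> hh lS cl cr x; have hc := cop_with_is_hopf hh lS cl cr.
have mb := hopf_mul_bilinear hh; have sl := hopf_anti_linear hh.
apply: (anti_cop hc (S' := hanti h)) => //= y.
by rewrite sw_flip; [exact: (hopf_antil hh)|lin].
Qed.

(** * Transport of a Hopf structure along an isomorphism *)

Section Transport.
Variables (R : comNzRingType) (H K : lmodType R) (h : hopf_ops H) (k : hopf_ops K) (f : H -> K).
Hypotheses (hh : is_hopf h) (fi : hopf_iso h k f).
Let lf := hiso_linear fi.
Let fM := hiso_mul fi.
Let f1 := hiso_one fi.
Let fD := hiso_comul fi.
Let fe := hiso_counit fi.
Let fS := hiso_anti fi.

Ltac lin_leaf ::= first [exact: lf | exact: (hopf_mul_bilinear hh) | exact: (hopf_comul_linear hh)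
  | exact: (hopf_counit_linear hh) | exact: (hopf_anti_linear hh)].

Lemma transport_is_hopf : is_hopf k.
Proof.
have [g gf fg] := hiso_bij fi.
have sf x : exists y, f y = x by exists (g x).
have lin_k (W : lmodType R) (q : K -> W) : linear (fun y => q (f y)) -> linear q.
  by move=> l a x y; have [x' <-] := sf x; have [y' <-] := sf y; rewrite -lf l.
have lD : linear (hcomul k) by apply: lin_k => a x y; rewrite !fD (hopf_comul_linear hh) sw_linear//; lin.
have le : linear (hcounit k : K -> R^o) by apply: lin_k => a x y; rewrite !fe (hopf_counit_linear hh).
have lS : linear (hanti k) by apply: lin_k => a x y; rewrite -!fS (hopf_anti_linear hh) lf.
have mb : bilinear_map (hmul k).
  split=> y; apply: lin_k => a u v; have [y' <-] := sf y; rewrite -!fM -lf; congr f.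
    exact: (hopf_mul_bilinear hh).1.
  exact: (hopf_mul_bilinear hh).2.
have swD (W : lmodType R) (b : K -> K -> W) x : bilinear_map b ->
    sweedler (hcomul k (f x)) b = \sw_(c, e <- hcomul h x) b (f c) (f e).
  by move=> hb; rewrite fD (sw_comp _ _ (sw_linear hb)); apply: eq_sw => c e;
    rewrite (tpure_bilinear_eval _ _ hb).
have tf : bilinear_map (fun a b : H => f a \ox f b) by lin.
split.
- exact: mb.
- by move=> x y z; have [x' <-] := sf x; have [y' <-] := sf y; have [z' <-] := sf z;
    rewrite -!fM (hopf_mulA hh).
- by move=> x; have [x' <-] := sf x; rewrite -f1 -fM (hopf_mul1 hh).
- by move=> x; have [x' <-] := sf x; rewrite -f1 -fM (hopf_mulr1 hh).
- exact: lD.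
- exact: le.
- exact: lS.
- move=> x0; have [x <-] := sf x0; rewrite !swD; try by lin.
  have b3 : bilinear_map (fun (p : tensor H H) b => sweedler p (fun a1 a2 => f a1 \ox f a2) \ox f b) by lin.
  have := congr1 (fun t => sweedler t (fun p b => sweedler p (fun a1 a2 => f a1 \ox f a2) \ox f b))
    (hopf_comulA hh x).
  rewrite !(sw_comp _ _ (sw_linear b3)) => e.
  transitivity (\sw_(a, b <- hcomul h x) sweedler (hcomul h a \ox b)
      (fun p b => sweedler p (fun a1 a2 => f a1 \ox f a2) \ox f b)).
    by apply: eq_sw => a b; rewrite (tpure_bilinear_eval _ _ b3) fD.
  rewrite e; apply: eq_sw => a b; rewrite (sw_comp _ _ (sw_linear b3)) swD; last by lin.
  by apply: eq_sw => c i; rewrite (tpure_bilinear_eval _ _ b3) (tpure_bilinear_eval _ _ tf).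
- move=> x0; have [x <-] := sf x0; rewrite swD; last by lin.
  rewrite -[in RHS](hopf_counitl hh x) (sw_comp _ _ lf); apply: eq_sw => a b.
  by rewrite fe (rlinZ lf).
- move=> x0; have [x <-] := sf x0; rewrite swD; last by lin.
  rewrite -[in RHS](hopf_counitr hh x) (sw_comp _ _ lf); apply: eq_sw => a b.
  by rewrite fe (rlinZ lf).
- move=> x0 y0; have [x <-] := sf x0; have [y <-] := sf y0; rewrite -fM fD (hopf_comulM hh).
  rewrite (sw_comp _ _ (sw_linear tf)) swD; last by lin.
  apply: eq_sw => a b; rewrite (sw_comp _ _ (sw_linear tf)) swD; last by lin.
  by apply: eq_sw => c e; rewrite (tpure_bilinear_eval _ _ tf) !fM.
- by rewrite -f1 fD (hopf_comul1 hh) (tpure_bilinear_eval _ _ tf).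
- by move=> x0 y0; have [x <-] := sf x0; have [y <-] := sf y0; rewrite -fM !fe (hopf_counitM hh).
- by rewrite -f1 fe (hopf_counit1 hh).
- move=> x0; have [x <-] := sf x0; rewrite swD; last by lin.
  rewrite fe -f1 -(rlinZ lf) -(hopf_antil hh) (sw_comp _ _ lf); apply: eq_sw => a b.
  by rewrite fM fS.
- move=> x0; have [x <-] := sf x0; rewrite swD; last by lin.
  rewrite fe -f1 -(rlinZ lf) -(hopf_antir hh) (sw_comp _ _ lf); apply: eq_sw => a b.
  by rewrite fM fS.
Qed.

End Transport.

(** * The bicrossed product is a Hopf algebra *)

Section BicrossedHopf.
Variables (R : realType) (m : nat) (P : primitive m) (d : nat).
Local Notation C := (Cinf R P).
Local Notation G := (GPi R P).
Local Notation N := (NPi R P).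
Local Notation D := (Diff R P).
Local Notation lie := (@lieG R m P).
Local Notation U := (UPi R P).
Variables (X : 'I_d -> lie) (hX : is_basis X).
Local Notation F := (FPi X).
Local Notation H := (HPi X).
Local Notation act := (act hX).
Local Notation coact := (coact hX).
Local Notation hat := (hat hX).
Local Notation B := (tensor F U).
Local Notation hU := (hopfU R P).
Local Notation hF := (hopfF hX).
Local Notation hB := (bicrossed hU hF act coact).
Local Notation bmul := (bicrossed_mul hU hF act).
Local Notation evF := (@evF R m P d X).
Local Notation lamU := (@lamU R m P).
Local Notation evB := (@evB R m P d X).
Local Notation sepB := (sepB hX).
Local Notation Psi := (Psi hX).
Local Notation antiF := (antiF hX).
Local Notation antiU := (@antiU R m P).
Local Notation comulU := (@comulU R m P).
Local Notation comulF := (comulF hX).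
Let hhF := hopfF_is_hopf hX.
Let hhU := hopfU_is_hopf hX.
Let cc := comodule_coalgebra_coact hX.

Definition mh (f : F) : OpA R P := multop (fun phi : D => hat phi f).
Definition io (u : U) : OpA R P := vfield (rep u).

Lemma mh_linear : linear mh.
Proof. by move=> a f g; rewrite /mh mhat_lin. Qed.
Lemma io_linear : linear io.
Proof. by move=> a u v; rewrite /io vfield_lin rep_linear. Qed.
Lemma mhM f g : mh f * mh g = mh (f * g). Proof. exact: mhatM. Qed.
Lemma mh1 : mh 1 = 1. Proof. exact: mhat1. Qed.
Lemma ioM u v : io u * io v = io (u * v). Proof. by rewrite /io vfieldM repM. Qed.
Lemma io1 : io 1 = 1. Proof. by rewrite /io rep1 diag1. Qed.
Lemma PsiE f u : Psi (f \ox u) = mh f * io u. Proof. exact: Psi_pure. Qed.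

Ltac lin_leaf ::= first [exact: hat_linear | exact: mh_linear | exact: io_linear
  | exact: rep_linear_at | exact: pull_linear
  | exact: Endo_linear | exact: rep_linear | exact: Psi_linear
  | exact: coact_linear | exact: (hopf_anti_linear hhF) | exact: (hopf_anti_linear hhU)
  | exact: comulF_linear | exact: comulU_linear | exact: mul_bilinear
  | exact: (hopf_counit_linear hhF) | exact: (hopf_counit_linear hhU)].

(** The component at [phi] of the operator [Psi s], as an operator on functions. *)
Definition pev (s : B) (phi : D) (xi : C) : C := \sw_(f, u <- s) (hat phi f * rep u xi).

Lemma pev_bilinear phi (xi : C) : bilinear_map (fun (f : F) (u : U) => hat phi f * rep u xi).
Proof. lin. Qed.

Lemma pev_linear phi (xi : C) : linear (fun s : B => pev s phi xi).
Proof. exact: sw_linear (pev_bilinear phi xi). Qed.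

Lemma pev_pure f u phi (xi : C) : pev (f \ox u) phi xi = hat phi f * rep u xi.
Proof. exact: tpure_bilinear_eval (pev_bilinear phi xi). Qed.

Lemma pevx_linear s phi : linear (pev s phi).
Proof. by apply: lin_swb => f u; lin. Qed.

Lemma evB_pev psi (xi : C) s : evB (psi, xi) s = pev s (nval psi) xi 1%g.
Proof. by rewrite (evB_Psi hX) Psi_monom. Qed.

Lemma pevM s t phi (xi : C) : pev (bmul s t) phi xi = pev s phi (pev t phi xi).
Proof.
rewrite /bicrossed_mul (sw_comp _ _ (pev_linear phi xi)) [RHS]/pev; apply: eq_sw => f u.
rewrite (sw_comp _ _ (pev_linear phi xi)) [in RHS]/pev (sw_comp _ _ (Endo_linear (rep u))) sw_mull.
apply: eq_sw => g v; rewrite (sw_comp _ _ (pev_linear phi xi)) comulU_rep sw_mull /=.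
by apply: eq_sw => x y; rewrite pev_pure hatM hat_act repM mulrA.
Qed.

(** The Leibniz rule for [Psi s] on a product of two monomials. Three rules combine: the coproduct
    of F for phi chi, the Leibniz rule of u on the product, and the coaction for u1 acting on a
    pull-back. *)
Lemma pev_comul s phi chi (xi eta : C) :
  \sw_(a, b <- hcomul hB s) (pull chi (pev a phi eta) * pev b chi xi) =
  pev s (phi * chi)%g (pull chi eta * xi).
Proof.
have hb : bilinear_map (fun a b : B => pull chi (pev a phi eta) * pev b chi xi).
  by split=> y; [apply: lin_mull|apply: lin_mulr]; [apply: (lin_comp (pull_linear chi))|];
    exact: pev_linear.
have lb := sw_linear hb.
rewrite /= (sw_comp _ _ lb) [RHS]/pev; apply: eq_sw => f u.
rewrite (sw_comp _ _ lb) -(comulF_hat hX) sw_mulr; apply: eq_sw => f1 f2.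
rewrite (sw_comp _ _ lb) comulU_rep sw_mull; apply: eq_sw => u1 u2.
rewrite (sw_comp _ _ lb) (coact_rep hX) sw_mulr sw_mull; apply: eq_sw => y0 y1.
rewrite (tpure_bilinear_eval _ _ hb) !pev_pure pull_mul /= hatM -!mulrA; congr (_ * _).
by rewrite mulrCA; congr (_ * _); rewrite mulrCA.
Qed.

(** The product of j.2 U^*_(j.1) and i.2 U^*_(i.1) in the crossed product, that is with the factors
    in reversed order: this reversal is why the co-opposite of H appears. *)
Definition opB (i j : N * C) : N * C := ((i.1 * j.1)%g, pull (nval j.1) i.2 * j.2).

Lemma comulBE i j s : tev (evB i) (evB j) (hcomul hB s) = evB (opB i j) s.
Proof.
case: i j => [phi eta] [chi xi].
rewrite evB_pev -[nval _]/(nval phi * nval chi)%g -pev_comul sw_at; apply: eq_swr => a b.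
by rewrite CM pullE tilde_N1 !evB_pev.
Qed.

Let opBA : associative opB.
Proof.
move=> [p x] [q y] [r z]; rewrite /opB; congr pair; first exact: mulgA.
transitivity (pull (nval r) (pull (nval q) x) * (pull (nval r) y * z)).
  by congr (_ * _); exact: pullM.
by rewrite mulrA -pull_mul.
Qed.
Let opB1 : left_id (1%g, 1) opB.
Proof. by move=> [p x]; rewrite /opB /= mul1g pull_one mul1r. Qed.
Let opB1r : right_id (1%g, 1) opB.
Proof.
move=> [p x]; rewrite /opB; congr pair; first exact: mulg1.
by transitivity (pull 1%g x); [exact: mulr1|exact: pull1].
Qed.

Lemma pev_one s : pev s (nval 1%g) 1 = hcounit hB s *: 1.
Proof.
have hat1c (a : F) : hat (nval 1%g) a = evF 1%g a *: 1.
  apply: Cext => g; rewrite hatE CZ C1 mulr1 -[nval 1%g]/(1%g : D) mul1g.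
  by have := NpartE g (1%g : N); rewrite -[nval 1%g]/(1%g : D) mulg1 => ->.
apply: Cext => g; rewrite /pev sw_at CZ C1 mulr1; apply: eq_swr => f u.
by rewrite hat1c rep_one CM !CZ C1 !mulr1.
Qed.

Lemma bicrossed_comulM x y : hcomul hB (bmul x y) =
  \sw_(a, b <- hcomul hB x) \sw_(c, e <- hcomul hB y) (bmul a c \ox bmul b e).
Proof.
apply: (sep_eq (tensor_separating sepB sepB)) => -[[phi eta] [chi xi]]; rewrite [fst _]/= [snd _]/=.
have ll := tev_linear (sepB.1 (phi, eta)) (sepB.1 (chi, xi)).
rewrite comulBE evB_pev pevM -[nval _]/(nval phi * nval chi)%g.
rewrite -(pev_comul y) (sw_comp _ _ (pevx_linear x _)) sw_at.
transitivity (\sw_(c, e <- hcomul hB y) \sw_(a, b <- hcomul hB x)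
    (pev a (nval phi) (pev c (nval phi) eta) 1%g * pev b (nval chi) (pev e (nval chi) xi) 1%g : R^o)).
  apply: eq_swr => c e; rewrite -pev_comul sw_at; apply: eq_swr => a b.
  by rewrite CM pullE tilde_N1.
rewrite sw_swap (sw_comp _ _ ll); apply: eq_swr => a b; rewrite (sw_comp _ _ ll); apply: eq_swr => c e.
by rewrite (tev_pure _ _ (sepB.1 _) (sepB.1 _)) !evB_pev !pevM.
Qed.

Lemma bmul_bilinear : bilinear_map bmul.
Proof.
by split=> [t|s] a u v; apply: (Psi_inj (hX := hX)); rewrite (Psi_linear hX) !PsiM (Psi_linear hX);
  [rewrite mulrDl scalerAl|rewrite mulrDr scalerAr].
Qed.

Lemma Fcomm (f g : F) : f * g = g * f.
Proof. by apply: (sep_eq (@sepF R m P d X)) => psi; rewrite !evFM mulrC. Qed.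

Lemma antiFM f g : antiF (f * g) = antiF f * antiF g.
Proof. by apply: (sep_eq (@sepF R m P d X)) => psi; rewrite evFM !(antiFE hX) evFM. Qed.

Lemma sw_cc (W : lmodType R) (g : U -> F -> F -> W) x :
  (forall b c, linear (fun a => g a b c)) -> (forall a c, linear (fun b => g a b c)) ->
  (forall a b, linear (fun c => g a b c)) ->
  \sw_(x0, x1 <- coact x) \sw_(z0, z1 <- coact x0) g z0 z1 x1 =
  \sw_(x0, x1 <- coact x) \sw_(a, b <- comulF x1) g x0 a b.
Proof.
move=> g1 g2 g3.
have b2 c : bilinear_map (fun a b => g a b c) by split=> z; [exact: g1|exact: g2].
have b3 : bilinear_map (fun (p : tensor U F) c => sweedler p (fun a1 a2 => g a1 a2 c)).
  split=> [c|p]; first exact: sw_linear (b2 c).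
  by apply: lin_swb => a b; exact: g3.
have := congr1 (fun t => sweedler t (fun p c => sweedler p (fun a1 a2 => g a1 a2 c)))
  (cc_coassoc cc x).
rewrite !(sw_comp _ _ (sw_linear b3)) => e.
transitivity (\sw_(a, b <- coact x)
    sweedler (coact a \ox b) (fun p c => sweedler p (fun a1 a2 => g a1 a2 c))).
  by apply: eq_sw => a b; rewrite (tpure_bilinear_eval _ _ b3).
rewrite e; apply: eq_sw => a b; rewrite (sw_comp _ _ (sw_linear b3)).
by apply: eq_sw => c f; rewrite (tpure_bilinear_eval _ _ b3) (tpure_bilinear_eval _ _ (b2 f)).
Qed.

Lemma sw_cc_comul (W : lmodType R) (g : U -> U -> F -> W) x :
  (forall b c, linear (fun a => g a b c)) -> (forall a c, linear (fun b => g a b c)) ->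
  (forall a b, linear (fun c => g a b c)) ->
  \sw_(x0, x1 <- coact x) \sw_(a, b <- comulU x0) g a b x1 =
  \sw_(x1, x2 <- comulU x) \sw_(a0, a1 <- coact x1) \sw_(b0, b1 <- coact x2) g a0 b0 (a1 * b1).
Proof.
move=> g1 g2 g3.
have b2 c : bilinear_map (fun a b => g a b c) by split=> z; [exact: g1|exact: g2].
have b3 : bilinear_map (fun (p : tensor U U) c => sweedler p (fun a1 a2 => g a1 a2 c)).
  split=> [c|p]; first exact: sw_linear (b2 c).
  by apply: lin_swb => a b; exact: g3.
have := congr1 (fun t => sweedler t (fun p c => sweedler p (fun a1 a2 => g a1 a2 c)))
  (cc_comul cc x).
rewrite !(sw_comp _ _ (sw_linear b3)) => e.
transitivity (\sw_(a, b <- coact x)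
    sweedler (comulU a \ox b) (fun p c => sweedler p (fun a1 a2 => g a1 a2 c))).
  by apply: eq_sw => a b; rewrite (tpure_bilinear_eval _ _ b3).
rewrite e; apply: eq_sw => x1 x2; rewrite (sw_comp _ _ (sw_linear b3)).
apply: eq_sw => a0 a1; rewrite (sw_comp _ _ (sw_linear b3)); apply: eq_sw => b0 b1.
by rewrite (tpure_bilinear_eval _ _ b3) (tpure_bilinear_eval _ _ (b2 _)).
Qed.

Ltac lin_opleaf := lazymatch goal with
  | |- GRing.linear_for _ mh => exact: mh_linear
  | |- GRing.linear_for _ io => exact: io_linear
  | |- GRing.linear_for _ antiF => exact: (hopf_anti_linear hhF)
  | |- GRing.linear_for _ antiU => exact: (hopf_anti_linear hhU)
  | |- GRing.linear_for _ coact => exact: coact_linear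
  | |- _ => first [exact: lin_id | move=> ? ? ?; reflexivity]
  end.

(* The same as [lin], with a purely syntactic selection of the leaves. *)
Ltac lin_op :=
  cbv beta;
  lazymatch goal with
  | |- bilinear_map _ => split; intros ?; lin_op
  | |- GRing.linear_for _ (fun x => x) => first [exact: lin_id | move=> ? ? ?; reflexivity]
  | |- GRing.linear_for ?s (fun x => ?g x) =>
      first [change (GRing.linear_for s g); lin_opleaf | lin_opstep]
  | |- GRing.linear_for _ (fun x => _) => lin_opstep
  | |- _ => lin_opleaf
  end
with lin_opstep :=
  match goal with
  | |- GRing.linear_for _ (fun x => sweedler ?t (@?b x)) =>
      apply: lin_swb; intros ? ?; lin_op
  | |- GRing.linear_for _ (fun x => sweedler (@?t x) ?b) =>
      apply: (lin_swt (t := t) (b := b)); [lin_op | lin_op]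
  | |- GRing.linear_for _ (fun x => @?f x * ?c) => apply: lin_mull; lin_op
  | |- GRing.linear_for _ (fun x => ?c * @?f x) => apply: lin_mulr; lin_op
  | |- GRing.linear_for _ (fun x => tpure ?c (@?f x)) =>
      apply: (lin_bilr (f := f) c (@tpure_bilinear _ _ _)); lin_op
  | |- GRing.linear_for _ (fun x => tpure (@?f x) ?c) =>
      apply: (lin_bill (f := f) c (@tpure_bilinear _ _ _)); lin_op
  | |- GRing.linear_for _ (fun x => bmul ?c (@?f x)) =>
      apply: (lin_bilr (f := f) c bmul_bilinear); lin_op
  | |- GRing.linear_for _ (fun x => bmul (@?f x) ?c) =>
      apply: (lin_bill (f := f) c bmul_bilinear); lin_op
  | |- GRing.linear_for _ (fun x => ?g (@?f x)) =>
      apply: (lin_comp (g := g) (f := f)); [lin_opleaf | lin_op]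
  end.

Local Opaque mh io.

Definition antiK (f : F) (u : U) : OpA R P :=
  \sw_(x0, x1 <- coact u) (io (antiU x0) * mh (antiF (f * x1))).

Lemma antiB_bilinear : bilinear_map (fun (a : F) (x : U) => \sw_(x0, x1 <- coact x)
  bmul (1 \ox antiU x0) (antiF (a * x1) \ox 1)).
Proof. have hm := bmul_bilinear; lin. Qed.

Lemma antiB_linear : linear (hanti hB).
Proof. exact: sw_linear antiB_bilinear. Qed.

Lemma Psi_antiB f u : Psi (hanti hB (f \ox u)) = antiK f u.
Proof.
rewrite /hanti /= (tpure_bilinear_eval _ _ antiB_bilinear) (sw_comp _ _ (Psi_linear hX)).
by apply: eq_sw => x0 x1; rewrite PsiM !PsiE mh1 mul1r io1 mulr1.
Qed.

Lemma Psi_counit s : Psi (hcounit hB s *: (1 \ox 1)) =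
  \sw_(f, u <- s) ((counitF f * counitU u) *: 1).
Proof.
rewrite (rlinZ (Psi_linear hX)) Psi1.
exact: (sw_comp (f := fun k : R^o => k *: (1 : OpA R P)) _ _ (lin_scalel _ (@lin_id _ _))).
Qed.

(** Three contractions of operators follow one another: coassociativity of the coaction brings two
    F-factors together for the antipode of F, then the antipode of F acts on the parts of f, and
    that of U on the parts of u. *)
Lemma bicrossed_antil s :
  \sw_(a, b <- hcomul hB s) bmul (hanti hB a) b = hcounit hB s *: (1 \ox 1).
Proof.
apply: (Psi_inj (hX := hX)); rewrite Psi_counit (sw_comp _ _ (Psi_linear hX)).
have lA := antiB_linear.
have hb : bilinear_map (fun p q : B => Psi (hanti hB p) * Psi q).
  split=> y; [apply: lin_mull|apply: lin_mulr]; [apply: (lin_comp (Psi_linear hX)); exact: lA|].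
  exact: Psi_linear.
have lb := sw_linear hb.
transitivity (\sw_(a, b <- hcomul hB s) (Psi (hanti hB a) * Psi b)).
  by apply: eq_sw => a b; rewrite PsiM.
rewrite [hcomul hB s]/= (sw_comp _ _ lb); apply: eq_sw => f u.
rewrite (sw_comp _ _ lb).
transitivity (\sw_(f1, f2 <- comulF f) \sw_(u1, u2 <- comulU u)
    (io (antiU u1) * (mh (antiF f1 * f2) * io u2))).
  apply: eq_sw => f1 f2; rewrite (sw_comp _ _ lb); apply: eq_sw => u1 u2.
  rewrite (sw_comp _ _ lb).
  pose g (z0 : U) (z1 y1 : F) : OpA R P := io (antiU z0) * (mh (antiF f1 * f2 * (antiF z1 * y1)) * io u2).
  transitivity (\sw_(y0, y1 <- coact u1) \sw_(z0, z1 <- coact y0) g z0 z1 y1).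
    apply: eq_sw => y0 y1; rewrite (tpure_bilinear_eval _ _ hb) Psi_antiB PsiE sw_mulr.
    apply: eq_sw => z0 z1; rewrite /g antiFM -[LHS]mulrA; congr (_ * _).
    have e : antiF f1 * antiF z1 * (f2 * y1) = antiF f1 * f2 * (antiF z1 * y1).
      by apply: (sep_eq (@sepF R m P d X)) => psi; rewrite !evFM; ring.
    by rewrite [LHS]mulrA mhM e.
  have g1 b c : linear (fun a => g a b c) by rewrite /g; lin_op.
  have g2 a c : linear (fun b => g a b c) by rewrite /g; lin_op.
  have g3 a b : linear (fun c => g a b c).
    move=> k p q; rewrite /g.
    have -> : antiF f1 * f2 * (antiF b * (k *: p + q)) =
        k *: (antiF f1 * f2 * (antiF b * p)) + antiF f1 * f2 * (antiF b * q).
      by rewrite !mulrDr -!scalerAr.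
    by rewrite mh_linear mulrDl mulrDr -scalerAl -scalerAr.
  rewrite (sw_cc _ g1 g2 g3).
  rewrite -[in RHS](cc_counit cc u1).
  have l1 : linear (fun w => io (antiU w) * (mh (antiF f1 * f2) * io u2)) by lin_op.
  rewrite (sw_comp _ _ l1); apply: eq_sw => x0 x1; rewrite (rlinZ l1) /g.
  have l2 : linear (fun w => io (antiU x0) * (mh (antiF f1 * f2 * w) * io u2)) by lin_op.
  rewrite -(sw_comp _ _ l2) (hopf_antil hhF) (rlinZ l2) /=.
  by rewrite mulr1.
rewrite sw_swap.
transitivity (\sw_(u1, u2 <- comulU u) (counitF f *: io (antiU u1 * u2))).
  apply: eq_sw => u1 u2.
  have l2 : linear (fun w => io (antiU u1) * (mh w * io u2)) by lin_op.
  rewrite -(sw_comp _ _ l2) (hopf_antil hhF) (rlinZ l2) /= mh1 mul1r.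
  by rewrite ioM.
transitivity (counitF f *: \sw_(u1, u2 <- comulU u) io (antiU u1 * u2)).
  exact: (sw_scalef _ _ (fun u1 u2 => io (antiU u1 * u2))).
rewrite -(sw_comp _ _ io_linear) (hopf_antil hhU) (rlinZ io_linear) io1.
by rewrite scalerA.
Qed.

(** Compatibility of the coaction with the coproduct of U merges the two coactions, so that the
    antipode of U contracts first; the coaction then contributes only a counit, and the antipode of
    F finishes. *)
Lemma bicrossed_antir s :
  \sw_(a, b <- hcomul hB s) bmul a (hanti hB b) = hcounit hB s *: (1 \ox 1).
Proof.
apply: (Psi_inj (hX := hX)); rewrite Psi_counit (sw_comp _ _ (Psi_linear hX)).
have lA := antiB_linear.
have hb : bilinear_map (fun p q : B => Psi p * Psi (hanti hB q)).
  split=> y; [apply: lin_mull|apply: lin_mulr]; [exact: Psi_linear|].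
  by apply: (lin_comp (Psi_linear hX)); exact: lA.
have lb := sw_linear hb.
transitivity (\sw_(a, b <- hcomul hB s) (Psi a * Psi (hanti hB b))).
  by apply: eq_sw => a b; rewrite PsiM.
rewrite [hcomul hB s]/= (sw_comp _ _ lb); apply: eq_sw => f u.
rewrite (sw_comp _ _ lb).
transitivity (\sw_(f1, f2 <- comulF f) (counitU u *: mh (f1 * antiF f2))).
  apply: eq_sw => f1 f2; rewrite (sw_comp _ _ lb).
  pose g (c e : U) (x1 : F) : OpA R P := mh f1 * io (c * antiU e) * mh (antiF (f2 * x1)).
  transitivity (\sw_(u1, u2 <- comulU u) \sw_(y0, y1 <- coact u1) \sw_(z0, z1 <- coact u2)
      g y0 z0 (y1 * z1)).
    apply: eq_sw => u1 u2; rewrite (sw_comp _ _ lb); apply: eq_sw => y0 y1.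
    rewrite (tpure_bilinear_eval _ _ hb) Psi_antiB PsiE sw_mull; apply: eq_sw => z0 z1.
    by rewrite /g -ioM !mulrA.
  rewrite -sw_cc_comul; try by rewrite /g; move=> *; lin_op.
  transitivity (\sw_(x0, x1 <- coact u) (counitU x0 *: (mh f1 * mh (antiF (f2 * x1))))).
    apply: eq_sw => x0 x1; rewrite /g.
    have l1 : linear (fun w => mh f1 * io w * mh (antiF (f2 * x1))) by lin_op.
    rewrite -(sw_comp _ _ l1) (hopf_antir hhU) (rlinZ l1) io1.
    by rewrite mulr1.
  have l1 : linear (fun w => mh f1 * mh (antiF (f2 * w))).
    apply: lin_mulr; apply: (lin_comp mh_linear); apply: (lin_comp (hopf_anti_linear hhF)).
    by apply: lin_mulr; exact: lin_id.
  transitivity (mh f1 * mh (antiF (f2 * \sw_(x0, x1 <- coact u) (counitU x0 *: x1)))).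
    have e := sw_comp (coact u) (fun (x0 : U) (x1 : F) => counitU x0 *: x1) l1.
    apply: esym; apply: etrans e _; apply: eq_sw => x0 x1; exact: rlinZ l1 _ _.
  by rewrite (cc_coun cc) (rlinZ l1) /= mulr1 mhM.
transitivity (counitU u *: \sw_(f1, f2 <- comulF f) mh (f1 * antiF f2)).
  exact: (sw_scalef _ _ (fun f1 f2 => mh (f1 * antiF f2))).
rewrite -(sw_comp _ _ mh_linear) (hopf_antir hhF) (rlinZ mh_linear) mh1.
by rewrite scalerA mulrC.
Qed.

Lemma bicrossed_is_hopf : is_hopf hB.
Proof.
split.
- exact: bmul_bilinear.
- by move=> x y z; apply: (Psi_inj (hX := hX)); rewrite !PsiM mulrA.
- by move=> x; apply: (Psi_inj (hX := hX)); rewrite PsiM Psi1 mul1r.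
- by move=> x; apply: (Psi_inj (hX := hX)); rewrite PsiM Psi1 mulr1.
- exact: (eval_comul_linear sepB comulBE).
- exact: (sepB.1 (1%g, 1)).
- exact: antiB_linear.
- exact: (eval_comulA sepB opBA comulBE).
- exact: (eval_counitl sepB opB1 comulBE).
- exact: (eval_counitr sepB opB1r comulBE).
- exact: bicrossed_comulM.
- apply: (sep_eq (tensor_separating sepB sepB)) => -[[phi eta] [chi xi]]; rewrite [fst _]/= [snd _]/=.
  rewrite comulBE (tev_pure _ _ (sepB.1 _) (sepB.1 _)) !evB_pev !pev_pure !rep1 !hat1 !mul1r.
  by rewrite -[LHS]/((pull (nval chi) eta * xi) 1%g) CM pullE tilde_N1.
- move=> x y.
  transitivity (evB (1%g, 1) (bmul x y)); first by [].
  rewrite evB_pev pevM pev_one (rlinZ (pevx_linear x _)) pev_one !CZ C1 mulr1 mulrC.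
  by [].
- transitivity (evB (1%g, 1) (1 \ox 1)); first by [].
  by rewrite evB_pev pev_pure hat1 rep1 mul1r C1.
- exact: bicrossed_antil.
- exact: bicrossed_antir.
Qed.

Local Transparent mh io.

End BicrossedHopf.

(** * The antipode of the co-opposite structure *)

Section CoAntipode.
Variables (R : realType) (m : nat) (P : primitive m) (d : nat).
Local Notation C := (Cinf R P).
Local Notation G := (GPi R P).
Local Notation N := (NPi R P).
Local Notation D := (Diff R P).
Local Notation lie := (@lieG R m P).
Local Notation U := (UPi R P).
Variables (X : 'I_d -> lie) (hX : is_basis X).
Local Notation F := (FPi X).
Local Notation H := (HPi X).
Local Notation act := (act hX).
Local Notation coact := (coact hX).
Local Notation hat := (hat hX).
Local Notation B := (tensor F U).
Local Notation hU := (hopfU R P).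
Local Notation hF := (hopfF hX).
Local Notation hB := (bicrossed hU hF act coact).
Local Notation bmul := (bicrossed_mul hU hF act).
Local Notation evF := (@evF R m P d X).
Local Notation lamU := (@lamU R m P).
Local Notation evB := (@evB R m P d X).
Local Notation sepB := (sepB hX).
Local Notation Psi := (Psi hX).
Local Notation antiF := (antiF hX).
Local Notation antiU := (@antiU R m P).
Local Notation comulU := (@comulU R m P).
Local Notation comulF := (comulF hX).
Let hhF := hopfF_is_hopf hX.
Let hhU := hopfU_is_hopf hX.
Let cc := comodule_coalgebra_coact hX.

Local Notation mhX := (mh hX).
Local Notation ioX := (@io R m P).
Let bmul_bilinear := bmul_bilinear hX.
Let mh_linear := mh_linear hX.
Let io_linear := @io_linear R m P.

Definition Theta (v : U) : OpA R P := \sw_(x0, x1 <- coact v) (mhX (antiF x1) * ioX x0).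

Lemma Theta_def v : Theta v = \sw_(x0, x1 <- coact v) (mhX (antiF x1) * ioX x0).
Proof. by []. Qed.

Lemma Theta_linear : linear Theta.
Proof.
apply: lin_swt; first exact: coact_linear.
split=> y; first by apply: lin_mulr; exact: io_linear.
by apply: lin_mull; apply: (lin_comp mh_linear); exact: (hopf_anti_linear hhF).
Qed.

(* Conjugation of [rep v] by the action of Diff. *)
Lemma ThetaE v : Theta v =
  diag (fun phi => MkEndo (introT (asboolP _)
    (lin_comp (pull_linear phi) (lin_comp (Endo_linear (rep v)) (pull_linear phi^-1%g))))).
Proof.
apply: EndoE => a; apply: val_inj; apply/funext => phi /=.
rewrite (coact_rep hX) (sw_comp _ _ (pull_linear phi)).
transitivity (\sw_(x0, x1 <- coact v) ((mhX (antiF x1) * ioX x0) a phi)).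
  exact: (sw_comp (f := fun T : OpA R P => T a phi)).
apply: eq_sw => x b.
by rewrite pull_mul pullK -[LHS]/(hat phi (antiF b) * rep x (a phi)) (hat_antiF hX).
Qed.

Lemma ThetaM u v : Theta (u * v) = Theta u * Theta v.
Proof.
rewrite !ThetaE diagM; apply: diag_ext => phi xi; rewrite OpGM /= repM OpGM.
by rewrite pullVK.
Qed.

Lemma Theta1 : Theta 1 = 1.
Proof. by rewrite ThetaE diag1; apply: diag_ext => phi xi; rewrite /= rep1 pullK. Qed.

(** The coaction formula read backwards: a function is the pull-back by phi of its pull-back by the
    inverse, which turns the U-factor into a conjugate. *)
Lemma iot_Theta v : ioX v = \sw_(x0, x1 <- coact v) (mhX x1 * Theta x0).
Proof.
apply: EndoE => a; apply: val_inj; apply/funext => phi /=.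
transitivity (\sw_(x0, x1 <- coact v) ((mhX x1 * Theta x0) a phi)); last first.
  by apply: esym; exact: (sw_comp (f := fun T : OpA R P => T a phi)).
rewrite -[in LHS](pullK phi (a phi)) (coact_rep hX); apply: eq_sw => x b.
by rewrite ThetaE.
Qed.

Ltac lin_opleaf := lazymatch goal with
  | |- GRing.linear_for _ mhX => exact: mh_linear
  | |- GRing.linear_for _ ioX => exact: io_linear
  | |- GRing.linear_for _ Theta => exact: Theta_linear
  | |- GRing.linear_for _ antiF => exact: (hopf_anti_linear hhF)
  | |- GRing.linear_for _ antiU => exact: (hopf_anti_linear hhU)
  | |- GRing.linear_for _ coact => exact: coact_linear
  | |- _ => first [exact: lin_id | move=> ? ? ?; reflexivity]
  end.

Ltac lin_op :=
  cbv beta;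
  lazymatch goal with
  | |- bilinear_map _ => split; intros ?; lin_op
  | |- GRing.linear_for _ (fun x => x) => first [exact: lin_id | move=> ? ? ?; reflexivity]
  | |- GRing.linear_for ?s (fun x => ?g x) =>
      first [change (GRing.linear_for s g); lin_opleaf | lin_opstep]
  | |- GRing.linear_for _ (fun x => _) => lin_opstep
  | |- _ => lin_opleaf
  end
with lin_opstep :=
  match goal with
  | |- GRing.linear_for _ (fun x => sweedler ?t (@?b x)) =>
      apply: lin_swb; intros ? ?; lin_op
  | |- GRing.linear_for _ (fun x => sweedler (@?t x) ?b) =>
      apply: (lin_swt (t := t) (b := b)); [lin_op | lin_op]
  | |- GRing.linear_for _ (fun x => @?f x * ?c) => apply: lin_mull; lin_op
  | |- GRing.linear_for _ (fun x => ?c * @?f x) => apply: lin_mulr; lin_op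
  | |- GRing.linear_for _ (fun x => tpure ?c (@?f x)) =>
      apply: (lin_bilr (f := f) c (@tpure_bilinear _ _ _)); lin_op
  | |- GRing.linear_for _ (fun x => tpure (@?f x) ?c) =>
      apply: (lin_bill (f := f) c (@tpure_bilinear _ _ _)); lin_op
  | |- GRing.linear_for _ (fun x => bmul ?c (@?f x)) =>
      apply: (lin_bilr (f := f) c bmul_bilinear); lin_op
  | |- GRing.linear_for _ (fun x => bmul (@?f x) ?c) =>
      apply: (lin_bill (f := f) c bmul_bilinear); lin_op
  | |- GRing.linear_for _ (fun x => ?g (@?f x)) =>
      apply: (lin_comp (g := g) (f := f)); [lin_opleaf | lin_op]
  end.

Local Opaque mh io Theta.

Ltac lin_leaf ::= first [exact: coact_linear | exact: (hopf_anti_linear hhF)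
  | exact: (hopf_anti_linear hhU) | exact: mul_bilinear].

Definition antiB' (s : B) : B := \sw_(f, u <- s)
  bmul (\sw_(x0, x1 <- coact (antiU u)) (antiF x1 \ox x0)) (antiF f \ox 1).

Lemma antiB'_bilinear : bilinear_map (fun (f : F) (u : U) =>
  bmul (\sw_(x0, x1 <- coact (antiU u)) (antiF x1 \ox x0)) (antiF f \ox 1)).
Proof. have hm := bmul_bilinear; lin. Qed.

Lemma antiB'_linear : linear antiB'. Proof. exact: sw_linear antiB'_bilinear. Qed.

Lemma Psi_antiB' f u : Psi (antiB' (f \ox u)) = Theta (antiU u) * mhX (antiF f).
Proof.
rewrite /antiB' (tpure_bilinear_eval _ _ antiB'_bilinear) PsiM (sw_comp _ _ (Psi_linear hX)).
rewrite [in X in _ * X](PsiE hX) io1 mulr1; congr (_ * _).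
by apply: eq_sw => x0 x1; rewrite PsiE.
Qed.

Lemma sw_cocomm (W : lmodType R) (g : U -> U -> W) u : bilinear_map g ->
  \sw_(a, b <- comulU u) g b a = \sw_(a, b <- comulU u) g a b.
Proof. by move=> hg; rewrite -[in RHS](comulU_cocomm hX) sw_flip. Qed.

(** The coaction of u1 reassembles into [Theta u1]. Multiplicativity of [Theta] then joins the
    factors in the order S(u2) u1, which cocommutativity of U turns into the antipode identity. *)
Lemma bicrossed_copl s :
  \sw_(a, b <- hcomul hB s) bmul (antiB' b) a = hcounit hB s *: (1 \ox 1).
Proof.
apply: (Psi_inj (hX := hX)); rewrite Psi_counit (sw_comp _ _ (Psi_linear hX)).
have lA := antiB'_linear.
have hb : bilinear_map (fun p q : B => Psi (antiB' q) * Psi p).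
  split=> y; [apply: lin_mulr|apply: lin_mull]; [exact: Psi_linear|].
  by apply: (lin_comp (Psi_linear hX)); exact: lA.
have lb := sw_linear hb.
transitivity (\sw_(a, b <- hcomul hB s) (Psi (antiB' b) * Psi a)).
  by apply: eq_sw => a b; rewrite PsiM.
rewrite [hcomul hB s]/= (sw_comp _ _ lb); apply: eq_sw => f u.
rewrite (sw_comp _ _ lb).
transitivity (\sw_(f1, f2 <- comulF f) \sw_(u1, u2 <- comulU u) \sw_(y0, y1 <- coact u1)
    (Theta (antiU u2) * (mhX (f1 * antiF f2 * antiF y1) * ioX y0))).
  apply: eq_sw => f1 f2; rewrite (sw_comp _ _ lb); apply: eq_sw => u1 u2.
  rewrite (sw_comp _ _ lb); apply: eq_sw => y0 y1.
  rewrite (tpure_bilinear_eval _ _ hb) Psi_antiB' PsiE -[LHS]mulrA; congr (_ * _).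
  have e : antiF f2 * antiF y1 * f1 = f1 * antiF f2 * antiF y1.
    by apply: (sep_eq (@sepF R m P d X)) => psi; rewrite !evFM; ring.
  by rewrite [LHS]mulrA mhM antiFM e.
rewrite sw_swap.
transitivity (\sw_(u1, u2 <- comulU u) (counitF f *: Theta (antiU u2 * u1))).
  apply: eq_sw => u1 u2; rewrite sw_swap ThetaM (Theta_def u1) sw_mull.
  apply: esym; apply: etrans (esym (sw_scalef _ _ _)) _; apply: esym; apply: eq_sw => y0 y1.
  have l1 : linear (fun w => Theta (antiU u2) * (mhX (w * antiF y1) * ioX y0)).
    by apply: lin_mulr; apply: lin_mull; apply: (lin_comp mh_linear); apply: lin_mull; exact: lin_id.
  by rewrite -(sw_comp _ _ l1) (hopf_antir hhF) (rlinZ l1) /= mul1r.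
transitivity (counitF f *: \sw_(u1, u2 <- comulU u) Theta (antiU u2 * u1)).
  exact: (sw_scalef _ _ (fun u1 u2 => Theta (antiU u2 * u1))).
rewrite -(sw_comp _ _ Theta_linear) (sw_cocomm (g := fun a b => antiU a * b)); last by lin_op.
by rewrite (hopf_antil hhU) (rlinZ Theta_linear) Theta1 scalerA.
Qed.

(** Expressing u2 through conjugates lets [sw_cc_comul] merge two coactions. Cocommutativity of U
    then contracts the conjugates, and commutativity of F orders the remaining product. *)
Lemma bicrossed_copr s :
  \sw_(a, b <- hcomul hB s) bmul b (antiB' a) = hcounit hB s *: (1 \ox 1).
Proof.
apply: (Psi_inj (hX := hX)); rewrite Psi_counit (sw_comp _ _ (Psi_linear hX)).
have lA := antiB'_linear.
have hb : bilinear_map (fun p q : B => Psi q * Psi (antiB' p)).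
  split=> y; [apply: lin_mulr|apply: lin_mull]; [|exact: Psi_linear].
  by apply: (lin_comp (Psi_linear hX)); exact: lA.
have lb := sw_linear hb.
transitivity (\sw_(a, b <- hcomul hB s) (Psi b * Psi (antiB' a))).
  by apply: eq_sw => a b; rewrite PsiM.
rewrite [hcomul hB s]/= (sw_comp _ _ lb); apply: eq_sw => f u.
rewrite (sw_comp _ _ lb).
transitivity (\sw_(f1, f2 <- comulF f) (counitU u *: mhX (f2 * antiF f1))).
  apply: eq_sw => f1 f2; rewrite (sw_comp _ _ lb).
  pose g (c e : U) (x1 : F) : OpA R P := mhX (f2 * x1) * Theta (e * antiU c) * mhX (antiF f1).
  have ml : linear (fun w => mhX (f2 * w)) by apply: (lin_comp mh_linear); apply: lin_mulr; exact: lin_id.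
  transitivity (\sw_(u1, u2 <- comulU u) \sw_(y0, y1 <- coact u1) \sw_(z0, z1 <- coact u2)
      g y0 z0 (y1 * z1)).
    apply: eq_sw => u1 u2; rewrite (sw_comp _ _ lb); apply: eq_sw => y0 y1.
    rewrite (tpure_bilinear_eval _ _ hb) Psi_antiB' PsiE (iot_Theta u2).
    rewrite sw_mull sw_mulr; apply: eq_sw => z0 z1.
    have e : f2 * y1 * z1 = f2 * (y1 * z1) by rewrite mulrA.
    by rewrite /g ThetaM !mulrA mhM e !mulrA.
  rewrite -(sw_cc_comul hX); first last.
  - by move=> a b; rewrite /g; do 2 apply: lin_mull; exact: ml.
  - by rewrite /g; move=> *; lin_op.
  - by rewrite /g; move=> *; lin_op.
  transitivity (\sw_(x0, x1 <- coact u) (counitU x0 *: (mhX (f2 * x1) * mhX (antiF f1)))).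
    apply: eq_sw => x0 x1.
    have l1 : linear (fun w => mhX (f2 * x1) * Theta w * mhX (antiF f1)) by lin_op.
    rewrite (sw_cocomm (g := fun a b => g b a x1)); last by rewrite /g; lin_op.
    by rewrite /g -(sw_comp _ _ l1) (hopf_antir hhU) (rlinZ l1) Theta1 mulr1.
  have l1 : linear (fun w => mhX (f2 * w) * mhX (antiF f1)) by apply: lin_mull.
  transitivity (mhX (f2 * \sw_(x0, x1 <- coact u) (counitU x0 *: x1)) * mhX (antiF f1)).
    have e := sw_comp (coact u) (fun (x0 : U) (x1 : F) => counitU x0 *: x1) l1.
    apply: esym; apply: etrans e _; apply: eq_sw => x0 x1; exact: rlinZ l1 _ _.
  by rewrite (cc_coun cc) (rlinZ l1) /= mulr1 mhM.
transitivity (counitU u *: \sw_(f1, f2 <- comulF f) mhX (antiF f1 * f2)).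
  apply: etrans (sw_scalef _ _ (fun f1 f2 => mhX (f2 * antiF f1))) _.
  congr (_ *: _); apply: eq_sw => f1 f2; congr mhX.
  by rewrite Fcomm.
rewrite -(sw_comp _ _ mh_linear) (hopf_antil hhF) (rlinZ mh_linear) mh1.
by rewrite scalerA mulrC.
Qed.

End CoAntipode.

(** * The Hopf algebra H and the conclusion *)

Section Conclusion.
Variables (R : realType) (m : nat) (P : primitive m) (d : nat).
Local Notation C := (Cinf R P).
Local Notation G := (GPi R P).
Local Notation N := (NPi R P).
Local Notation D := (Diff R P).
Local Notation lie := (@lieG R m P).
Local Notation U := (UPi R P).
Variables (X : 'I_d -> lie) (hX : is_basis X).
Local Notation F := (FPi X).
Local Notation H := (HPi X).
Local Notation B := (tensor F U).
Local Notation hU := (hopfU R P).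
Local Notation hF := (hopfF hX).
Local Notation act := (act hX).
Local Notation coact := (coact hX).
Local Notation hB := (bicrossed hU hF act coact).
Local Notation Phi := (Phi hX).
Local Notation antiB' := (antiB' hX).

Definition Phi_inv (h : H) : B := sval (cid (Phi_surj hX h)).

Lemma Phi_invK h : Phi (Phi_inv h) = h.
Proof. exact: (svalP (cid (Phi_surj hX h))). Qed.

Lemma PhiK s : Phi_inv (Phi s) = s.
Proof. by apply: (Phi_inj (hX := hX)); rewrite Phi_invK. Qed.

(** The coproduct is transported with its factors exchanged, so that [hopf_cop] gives back the
    bicrossed one; the antipode is accordingly that of the co-opposite structure, [antiB']. *)
Definition hopfH : hopf_ops H :=
  {| hmul := *%R; hone := 1;
     hcomul := fun h => \sw_(a, b <- hcomul hB (Phi_inv h)) (Phi b \ox Phi a);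
     hcounit := fun h => hcounit hB (Phi_inv h);
     hanti := fun h => Phi (antiB' (Phi_inv h)) |}.

Let hhB := bicrossed_is_hopf hX.
Let lS' := antiB'_linear hX.
Let cl := bicrossed_copl hX.
Let cr := bicrossed_copr hX.

Lemma PhiPhi_bilinear : bilinear_map (fun a b : B => Phi a \ox Phi b).
Proof.
split=> y; [apply: (lin_bill _ (@tpure_bilinear _ _ _))|apply: (lin_bilr _ (@tpure_bilinear _ _ _))];
  exact: Phi_linear.
Qed.

Lemma cop_iso : hopf_iso (cop_with hB antiB') hopfH Phi.
Proof.
split.
- exact: Phi_linear.
- exact: Phi_bij.
- exact: PhiM.
- exact: Phi1.
- by move=> s; rewrite [LHS]/= PhiK [in RHS]/hcomul [in RHS]/cop_with (sw_flip _ PhiPhi_bilinear).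
- by move=> s; rewrite /= PhiK.
- by move=> s; rewrite [RHS]/= PhiK.
Qed.

Lemma hopfH_is_hopf : is_hopf hopfH.
Proof. exact: transport_is_hopf (cop_with_is_hopf hhB lS' cl cr) cop_iso. Qed.

Lemma bicrossed_iso : hopf_iso hB (hopf_cop hopfH) Phi.
Proof.
split.
- exact: Phi_linear.
- exact: Phi_bij.
- exact: PhiM.
- exact: Phi1.
- move=> s; rewrite [LHS]/= PhiK.
  have hb : bilinear_map (fun a b : H => b \ox a).
    by split=> y; [exact: (tpure_bilinear H H).2|exact: (tpure_bilinear H H).1].
  rewrite (sw_comp _ _ (sw_linear hb)); apply: eq_sw => a b.
  by rewrite (tpure_bilinear_eval _ _ hb).
- by move=> s; rewrite /= PhiK.
- move=> s; rewrite [RHS]/hanti [hopf_cop _]/hopf_cop.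
  have e : hanti hopfH (Phi (hanti hB s)) = Phi s.
    rewrite /hanti /= PhiK; congr (Phi _); exact: (cop_anti hhB lS' cl cr).
  (* [hopf_cop] picks a preimage under the antipode of H; one exists by [e], and applying the
     antipode of the bicrossed product to its defining equation identifies it. *)
  have := xgetPex 0 (P := [set y | hanti hopfH y = Phi s]) (ex_intro _ _ e).
  set y := xget _ _; rewrite /= => /(Phi_inj (hX := hX)) ey.
  rewrite -[in RHS](Phi_invK y); congr (Phi _).
  by rewrite -ey; exact: (anti_cop hhB lS' cl _).
Qed.

Lemma Phi_at s (a : crossed R P) phi : galgv (Phi s) a phi = pev hX s phi (a phi).
Proof.
have e : galgv (Phi s) = sweedler s (psiop hX) by [].
rewrite e (sw_comp (f := fun T : OpA R P => T a phi))//; exact: eq_sw.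
Qed.

(** One list of indices serves for every [a'] supported inside the support of [a]. Elements of H do
    not enlarge supports, so products become sums over a fixed list, bilinear in the operators. *)
Lemma cmul_sum (a : crossed R P) : exists t : seq D, forall (a' b : crossed R P) chi,
  (forall phi, a phi = 0 -> a' phi = 0) ->
  cmul a' b chi = \sum_(phi <- t) a' phi * pull phi (b (chi * phi^-1)%g).
Proof.
exists (finmap.enum_fset (fset_set [set phi | a phi != 0])) => a' b chi h.
rewrite -(fsbig_finite _ (fun phi => a' phi * pull phi (b (chi * phi^-1)%g))) /=; last exact: crossed_finite.
rewrite [RHS](fsbig_widen _ [set: D])//.
move=> phi [_ /= /negP]; rewrite negbK => /eqP /h ->; exact: mul0r.
Qed.

Definition evH (c : crossed R P) (phi : D) (h : H) : C := galgv h c phi.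

Lemma evH_linear c phi : linear (evH c phi).
Proof.
move=> k x y; have [s <-] := Phi_surj hX x; have [s' <-] := Phi_surj hX y.
by rewrite /evH -Phi_linear !Phi_at; exact: pev_linear.
Qed.

Local Opaque evH.

Lemma evH_bilinear (t : seq D) a b chi : bilinear_map (fun h1 h2 : H =>
  \sum_(phi <- t) evH a phi h1 * pull phi (evH b (chi * phi^-1)%g h2)).
Proof.
split=> y k u v; rewrite scaler_sumr -big_split; apply: eq_bigr => phi _.
  exact: (lin_mull _ (evH_linear a phi)).
exact: (lin_mulr _ (lin_comp (pull_linear phi) (evH_linear b _))).
Qed.

Local Transparent evH.

Lemma hopfH_spec : hopf_HPi hopfH.
Proof.
split=> [|h a b]; first by split=> //; exact: hopfH_is_hopf.
have [t ht] := cmul_sum a.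
have supp h' phi : a phi = 0 -> galgv (h' : H) a phi = 0.
  by move=> a0; have [s <-] := Phi_surj hX h'; rewrite Phi_at a0 (rlin0 (pevx_linear hX s phi)).
apply: val_inj; apply/funext => chi.
pose K (h1 h2 : H) : C := \sum_(phi <- t) evH a phi h1 * pull phi (evH b (chi * phi^-1)%g h2).
have hK : bilinear_map K := evH_bilinear t a b chi.
transitivity (\sw_(h1, h2 <- hcomul hopfH h) K h1 h2); last first.
  apply: esym.
  apply: etrans (sw_comp (f := fun c : crossed R P => c chi) _ _ (fun _ _ _ => erefl)) _.
  by apply: eq_sw => h1 h2; apply: ht => phi; exact: supp.
rewrite [hcomul _ _]/= (sw_comp _ _ (sw_linear hK)).
rewrite -{1}(Phi_invK h) -[LHS]/(galgv (Phi (Phi_inv h)) (cmul a b) chi) Phi_at ht//.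
rewrite (rlin_sum (pevx_linear hX _ chi)).
(* The coefficient at chi of a product collects the pairs (chi phi^-1, phi), and [pev_comul] applies
   to each of them. *)
transitivity (\sum_(phi <- t) \sw_(p, q <- hcomul hB (Phi_inv h))
    (pull phi (pev hX p (chi * phi^-1)%g (b (chi * phi^-1)%g)) * pev hX q phi (a phi))).
  apply: eq_bigr => phi _; have := pev_comul hX (Phi_inv h) (chi * phi^-1)%g phi (a phi) (b (chi * phi^-1)%g).
  by rewrite -mulgA mulVg mulg1 => ->; rewrite mulrC.
rewrite [RHS]swE.
under eq_bigr do rewrite swE.
rewrite exchange_big; apply: eq_bigr => p _ /=.
rewrite (tpure_bilinear_eval _ _ hK) /K; apply: eq_bigr => phi _.
by rewrite /evH !Phi_at mulrC.
Qed.

(** psi <| exp(tY) is the N-part of psi exp(tY), so the curve is the function [hat] of psi along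
    exp(tY), starting at the unit. *)
Lemma act_spec : action_spec act.
Proof.
move=> Y f psi; have [_ hd] := expG_spec (set_mem (valP Y)).
have -> : galgv (act (ugen Y) f) psi = val Y (hat hX (nval psi) f) 1%g.
  by rewrite -(hat_unit hX) hat_act rep_gen.
have -> : (fun t : R => galgv f (lact psi (expG (val Y) t)) : R) =
    (fun t => hat hX (nval psi) f (1 * expG (val Y) t)%g).
  by apply/funext => t; rewrite hatE mul1g.
exact: hd.
Qed.

Lemma tensor_pbw (t : tensor U F) : exists (s : seq {ffun 'I_d -> nat}) (b : {ffun 'I_d -> nat} -> F),
  uniq s /\ t = \sum_(J <- s) pbw X J \ox b J.
Proof.
have tb := @tpure_bilinear R U F.
move: t; apply: tensor_ind => [u f|t1 t2 [s1 [b1 [u1 e1]]] [s2 [b2 [u2 e2]]]].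
  have [s [c [us eu]]] := pbw_span hX u.
  exists s, (fun J => c J *: f); split => //.
  rewrite eu (rlin_sum (tb.1 f)); apply: eq_bigr => J _.
  by rewrite (rlinZ (tb.1 f)) (rlinZ (tb.2 _)).
(* Both expansions are extended to the union of the two lists, with coefficient zero outside their
   own. *)
exists (undup (s1 ++ s2)), (fun J => (J \in s1)%:R *: b1 J + (J \in s2)%:R *: b2 J).
split; first exact: undup_uniq.
have ext (s : seq {ffun 'I_d -> nat}) (b : {ffun 'I_d -> nat} -> F) : uniq s -> {subset s <= s1 ++ s2} ->
    \sum_(J <- s) pbw X J \ox b J = \sum_(J <- undup (s1 ++ s2)) (pbw X J \ox ((J \in s)%:R *: b J)).
  move=> us ss; rewrite [RHS](bigID (mem s)) /= [X in _ + X]big1 ?addr0; last first.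
    by move=> J /negbTE ->; rewrite scale0r (rlin0 (tb.2 _)).
  transitivity (\sum_(J <- s) pbw X J \ox ((J \in s)%:R *: b J)).
    by rewrite !big_seq; apply: eq_bigr => J Js; rewrite Js scale1r.
  rewrite -[RHS]big_filter; apply: perm_big; apply: uniq_perm => //.
    by rewrite filter_uniq ?undup_uniq.
  by move=> J; rewrite mem_filter mem_undup; case Js : (J \in s) => //=; rewrite ss.
rewrite e1 e2 (ext s1 b1 u1) => [|J Js]; last by rewrite mem_cat Js.
rewrite (ext s2 b2 u2) => [|J Js]; last by rewrite mem_cat Js orbT.
by rewrite -big_split; apply: eq_bigr => J _; rewrite /= (rlinD (tb.2 _)).
Qed.

Lemma coact_spec : coaction_spec coact.
Proof.
move=> I; have [s [b [us e]]] := tensor_pbw (coact (pbw X I)).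
(* beta_I^J(psi) is [hat] of [b J] at psi, transported back by psi^-1; as N fixes the unit, its
   value there is that of [b J]. *)
exists s, (fun J psi => pull (nval psi)^-1%g (hat hX (nval psi) (b J))), b; split => // [psi xi|J psi].
  rewrite -(rep_pbw X I) (coact_rep hX) e (rlin_sum (sw_linear (coact_bilinear hX (nval psi) xi))).
  rewrite (rlin_sum (pull_linear _)); apply: eq_bigr => J _.
  by rewrite (tpure_bilinear_eval _ _ (coact_bilinear hX (nval psi) xi)) pull_mul pullVK rep_pbw.
by rewrite pullE -[(nval psi)^-1%g]/(nval psi^-1%g) tilde_N1 hat_unit.
Qed.

End Conclusion.

Theorem theorem0p2 (R : realType) (m : nat) (P : primitive m) (d : nat)
    (X : 'I_d -> @lieG R m P) (hX : is_basis X) :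
  exists (hU : hopf_ops (UPi R P)) (hF : hopf_ops (FPi X)) (hH : hopf_ops (HPi X))
         (act : UPi R P -> FPi X -> FPi X)
         (coact : UPi R P -> tensor (UPi R P) (FPi X)),
    [/\ hopf_UPi hU, hopf_FPi hF, hopf_HPi hH,
        action_spec act & coaction_spec coact] /\
    [/\ matched_pair hU hF act coact,
        is_hopf (bicrossed hU hF act coact),
        is_hopf (hopf_cop hH)
      & exists Phi : tensor (FPi X) (UPi R P) -> HPi X,
          hopf_iso (bicrossed hU hF act coact) (hopf_cop hH) Phi /\
          canonical_map Phi].
Proof.
exists (hopfU R P), (hopfF hX), (hopfH hX), (act hX), (coact hX); split.
  split; [exact: (hopfU_spec hX)|exact: hopfF_spec|exact: hopfH_spec|exact: act_spec|exact: coact_spec].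
split; [exact: matched_pair_act_coact|exact: bicrossed_is_hopf| |].
  exact: transport_is_hopf (bicrossed_is_hopf hX) (bicrossed_iso hX).
by exists (Phi hX); split; [exact: bicrossed_iso|exact: Phi_canonical].
Qed.
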